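(* Let $(R,W,\overline V)$ be a strong solution of the augmented NSLK system on $[0,T[\times\mathbb T^d$ and assume $\lambda'=\lambda-\frac{\mu\nu}2>0$. Then any weak solution $(\rho,w,\overline v)$ of the augmented NSLK system satisfies, writing $\mathcal E_{NSLK}(t)=\mathcal E_{NSLK}(\rho,w,\overline v|R,W,\overline V)(t)$, $$\mathcal E_{NSLK}(t)-\mathcal E_{NSLK}(0)\le C\Big(1+\frac{\nu}{\hbar_\nu}\Big)\int_0^t\mathcal E_{NSLK}(s)\,ds,$$ where $C=C(R,W,\overline V)$ denotes a constant independent of $\lambda$, $\mu$, $\nu$ and $\hbar$.
   Context: Setting: $\mathbb T^d$ is the $d$-dimensional torus, $1\le d\le3$, $T>0$, $\lambda,\mu,\hbar>0$, $0<\nu<\hbar$, $\hbar_\nu=\sqrt{\hbar^2-\nu^2}$, $\lambda'=\lambda-\frac{\mu\nu}{2}$. Conventions: $(\nabla u)_{ij}=\partial_{x_j}u_i$, $(u\otimes v)_{ij}=u_iv_j$, $(\mathrm{div}\,\sigma)_i=\sum_j\partial_{x_j}\sigma_{ij}$, $\sigma:\tau=\sum_{i,j}\sigma_{ij}\tau_{ij}$, $|\sigma|^2=\sigma:\sigma$; $H(\rho)=\rho\log\rho-\rho$, $H(\rho|R)=H(\rho)-H(R)-H'(R)(\rho-R)$. The augmented Navier-Stokes-Langevin-Korteweg (NSLK) system, with $v=\nabla\log\rho$, $w=u+\frac\nu2v$, $\overline v=\frac{\hbar_\nu}{2}v$, is $$\partial_t\rho+\mathrm{div}(\rho u)=0,$$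 $$\partial_t(\rho w)+\mathrm{div}(\rho w\otimes u)+\lambda'\nabla\rho+\mu\rho w=\tfrac{\hbar_\nu}{2}\mathrm{div}(\rho\nabla\overline v)+\tfrac\nu2\mathrm{div}(\rho\nabla w),$$ $$\partial_t(\rho v)+\mathrm{div}(\rho v\otimes u)+\mathrm{div}(\rho\nabla u^\top)=0.$$ For a vector field $z\in\{u,w,\overline v\}$, $\mathbb T_N(z)$ (a substitute for $\sqrt\rho\nabla z$) is defined through $\sqrt\rho\,\mathbb T_N(z)=\nabla(\sqrt\rho\,\sqrt\rho z)-2\sqrt\rho z\otimes\nabla\sqrt\rho$. On vacuum, $\sqrt\rho\,v$ means $2\nabla\sqrt\rho$, $\sqrt\rho\,\overline v$ means $\hbar_\nu\nabla\sqrt\rho$ and $\sqrt\rho\,w$ means $\sqrt\rho u+\nu\nabla\sqrt\rho$. Energy and dissipation of the augmented system: $$\mathcal E_{NSLK}(\rho,w,\overline v)=\int_{\mathbb T^d}\Big(\tfrac12\rho|w|^2+\tfrac12\rho|\overline v|^2+\lambda'H(\rho)\Big),\quad \mathcal D_{NSLK}(\rho,w,\overline v)=\frac\nu2\int_{\mathbb T^d}\Big(\rho|\nabla w|^2+\rho|\nabla\overline v|^2+\frac{4\lambda'}{\hbar_\nu^2}\rho|\overline v|^2\Big)+\mu\int_{\mathbb T^d}\rho|w|^2,$$ with $\sqrt\rho\nabla w$, $\sqrt\rho\nabla\overline v$ understood as $\mathbb T_N(w)$, $\mathbb T_N(\overline v)$. Weak solution of the augmented NSLK system with initial data $(\rho_0,w_0,\overline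 v_0)$, $\overline v_0=\frac{\hbar_\nu}{2}\nabla\log\rho_0=\frac{\hbar_\nu}2v_0$, of finite energy $\mathcal E_{NSLK}(\rho_0,w_0,\overline v_0)<\infty$: there exist locally integrable functions $\sqrt\rho,\sqrt\rho u$ such that, with $\rho=\sqrt\rho^{\,2}$, $\rho u=\sqrt\rho\,\sqrt\rho u$, $v=\nabla\log\rho$, $w=u+\frac\nu2v$ and $\overline v=\frac{\hbar_\nu}{2}v$, (i) $\sqrt\rho\in L^\infty([0,T[;H^1(\mathbb T^d))$, $\sqrt\rho u\in L^\infty([0,T[;L^2(\mathbb T^d))$, $\sqrt\rho\ge0$ a.e., $\sqrt\rho u=0$ a.e. on $\{\rho=0\}$; (ii) for all $\eta\in\mathcal C_0^\infty([0,T[\times\mathbb T^d)$ and $\zeta,\xi\in\mathcal C_0^\infty([0,T[\times\mathbb T^d;\mathbb R^d)$, $$\int_0^T\!\!\int_{\mathbb T^d}(\rho\partial_t\eta+\rho u\cdot\nabla\eta)+\int_{\mathbb T^d}\rho_0\eta(0)=0,$$ $$\int_0^T\!\!\int_{\mathbb T^d}\Big(\rho w\cdot\partial_t\zeta+\sqrt\rho w\otimes\sqrt\rho u:\nabla\zeta+\lambda'\rho\,\mathrm{div}\,\zeta-\mu\rho w\cdot\zeta-\tfrac{\hbar_\nu}{2}\sqrt\rho\,\mathbb T_N(\overline v):\nabla\zeta-\tfrac\nu2\sqrt\rho\,\mathbb T_N(w):\nabla\zeta\Big)+\int_{\mathbb T^d}\rho_0w_0\cdot\zeta(0)=0,$$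 $$\int_0^T\!\!\int_{\mathbb T^d}\Big(\rho v\cdot\partial_t\xi+\sqrt\rho v\otimes\sqrt\rho u:\nabla\xi+\sqrt\rho\,\mathbb T_N(u)^\top:\nabla\xi\Big)+\int_{\mathbb T^d}\rho_0v_0\cdot\xi(0)=0;$$ (iii) for every $\xi\in\mathcal C_0^\infty(\mathbb T^d)$, $\int\rho(t)\xi\to\int\rho_0\xi$ and $\int\rho u(t)\xi\to\int\rho_0u_0\xi$ as $t\to0$, where $\rho_0w_0=\rho_0u_0+\frac{\nu}{2}\nabla\rho_0$. Weak solutions are understood to satisfy the energy estimate of the augmented system: for a.e. $t$, $\mathcal E_{NSLK}(\rho,w,\overline v)(t)+\int_0^t\mathcal D_{NSLK}(\rho,w,\overline v)(s)\,ds\le\mathcal E_{NSLK}(\rho_0,w_0,\overline v_0)$. Strong solution of the augmented NSLK system with initial data $(R_0,W_0,\overline V_0=\frac{\hbar_\nu}{2}\nabla\log R_0)$, $\mathcal E_{NSLK}(R_0,W_0,\overline V_0)<\infty$: a triple $(R,W,\overline V)$ with $0<\inf_{]0,T[\times\mathbb T^d}R\le R\le\sup_{]0,T[\times\mathbb T^d}R<\infty$; $\nabla R\in L^2([0,T[;L^\infty(\mathbb T^d))\cap L^1([0,T[;W^{1,\infty}(\mathbb T^d))$; $W,\overline V\in L^\infty([0,T[;W^{2,\infty}(\mathbb T^d))\cap W^{1,\infty}([0,T[;L^\infty(\mathbb T^d))$; $\partial_tH'(R),\nabla H'(R)\in L^1([0,T[;L^\infty(\mathbb T^d))$; and, for a.a.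 $(t,x)$, $$\partial_tR+\mathrm{div}(RU)=0,$$ $$R(\partial_tW+\nabla W\,U)+\lambda'\nabla R+\mu RW=\tfrac{\hbar_\nu}{2}\mathrm{div}(R\nabla\overline V)+\tfrac\nu2\mathrm{div}(R\nabla W),$$ $$R(\partial_t\overline V+\nabla\overline V\,U)+\tfrac{\hbar_\nu}{2}\mathrm{div}(R\nabla U^\top)=0,$$ where $U=W-\frac\nu2V$ and $\overline V=\frac{\hbar_\nu}{2}V$, with $V=\nabla\log R$. Relative entropy: $$\begin{aligned}\mathcal E_{NSLK}(\rho,w,\overline v|R,W,\overline V)(t)={}&\frac12\int_{\mathbb T^d}\rho\big(|\overline v-\overline V|^2+|w-W|^2\big)+\lambda'\int_{\mathbb T^d}H(\rho|R)\\&+\frac\nu2\int_0^t\int_{\mathbb T^d}\rho\Big(\Big|\frac{\mathbb T_N(\overline v)}{\sqrt\rho}-\nabla\overline V\Big|^2+\Big|\frac{\mathbb T_N(w)}{\sqrt\rho}-\nabla W\Big|^2\Big)+\mu\int_0^t\int_{\mathbb T^d}\rho|w-W|^2,\end{aligned}$$ the first two integrals being taken at time $t$ (initial data when $t=0$). The inequality is meant for a.e. $t\in[0,T[$. *)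

(* Defs.v *)
From HB Require Import structures.
From mathcomp Require Import all_boot all_order all_algebra.
From mathcomp Require Import all_classical all_reals all_analysis ess_sup_inf.

Set Implicit Arguments.
Unset Strict Implicit.
Unset Printing Implicit Defensive.

Import Order.TTheory GRing.Theory Num.Theory.
Import numFieldNormedType.Exports.

Local Open Scope classical_set_scope.
Local Open Scope ring_scope.

(* The product (Borel) sigma-algebra on R^n. *)
Section measurable_rV.
Context {K : realType} {n : nat}.

Let coors : 'I_n -> 'rV[K]_n -> K := fun i x => x 0 i.

Let rV_set0 : g_sigma_preimage coors set0.
Proof. exact: sigma_algebra0. Qed.

Let rV_setC A : g_sigma_preimage coors A -> g_sigma_preimage coors (~` A).
Proof. exact: sigma_algebraC. Qed.

Let rV_bigcup (F : (set 'rV[K]_n)^nat) : (forall i, g_sigma_preimage coors (F i)) ->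
  g_sigma_preimage coors (\bigcup_i (F i)).
Proof. exact: sigma_algebra_bigcup. Qed.

HB.instance Definition _ := @isMeasurable.Build default_measure_display
  'rV[K]_n (g_sigma_preimage coors) rV_set0 rV_setC rV_bigcup.

Lemma measurable_coord (i : 'I_n) :
  measurable_fun [set: 'rV[K]_n] (fun x : 'rV[K]_n => x 0 i).
Proof.
move=> _ Y mY; rewrite setTI; apply: sub_sigma_algebra => /=.
rewrite -bigcup_seq/=; exists i => /=; first by rewrite mem_index_enum.
by exists Y => //; rewrite setTI.
Qed.

Lemma measurable_fun_rVP d (T : measurableType d) (f : T -> 'rV[K]_n) :
  measurable_fun [set: T] f <->
  forall i, measurable_fun [set: T] (fun x => f x 0 i).
Proof.
split=> [mf i|mf].
  by apply: (measurableT_comp (measurable_coord i)).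
suff : g_sigma_preimage (fun i => coors i \o f) `<=` measurable.
  rewrite g_sigma_preimage_comp => + _ A mA; apply.
  by exists A.
apply: smallest_sub; first exact: sigma_algebra_measurable.
apply: (big_ind (fun S : set (set T) => S `<=` measurable)).
- by [].
- by move=> A B hA hB X [/hA|/hB].
- by move=> i _ A [B mB <-]; exact: mf.
Qed.

End measurable_rV.

Section torus_measure.
Context {K : realType}.

Definition consrV n (p : measurableTypeR K * 'rV[K]_n) : 'rV[K]_n.+1 :=
  row_mx (p.1)%:M p.2.

Lemma measurable_consrV n : measurable_fun setT (@consrV n).
Proof.
apply/measurable_fun_rVP => i; rewrite /consrV.
case: (@split_ordP 1 n i) => j ->.
  rewrite (_ : (fun x => _) = fst) //.
  by apply/funext => x; rewrite (row_mxEl x.1%:M x.2 0 j) mxE !ord1 eqxx.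
rewrite (_ : (fun x => _) = (fun y : 'rV[K]_n => y 0 j) \o snd).
  by apply: measurableT_comp => //; exact: measurable_coord.
by apply/funext => x; rewrite (row_mxEr x.1%:M x.2 0 j).
Qed.

HB.instance Definition _ n :=
  @isMeasurableFun.Build _ _ _ _ (@consrV n) (@measurable_consrV n).

(* The torus T^d is (R/Z)^d: [torus d] is Lebesgue measure on the fundamental
   domain [0,1]^d, seen as a measure on R^d. A function on T^d is represented by
   any function on R^d, up to [torus d]-null sets, so only its values on the
   cube matter; periodicity is imposed on the test functions. *)
Fixpoint torus n : probability 'rV[K]_n K :=
  if n is m.+1 then
    distribution (uniform_prob (@ltr01 K) \x torus m)%E (@consrV m)
  else \d_(0 : 'rV[K]_0).

End torus_measure.

Section fields.
Variables (K : realType) (d : nat).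

Local Notation pt := 'rV[K]_d.
Local Notation spacetime := (K * 'rV[K]_d)%type.
Local Notation field := (spacetime -> K).

Definition inner m n (A B : 'M[K]_(m, n)) : K := \sum_i \sum_j A i j * B i j.
Definition normsq m n (A : 'M[K]_(m, n)) : K := inner A A.
Definition outer (u v : 'rV[K]_d) : 'M[K]_d := u^T *m v.
Definition comp (z : spacetime -> 'rV[K]_d) (i : 'I_d) : field :=
  fun p => z p 0 i.
Definition slice X (f : spacetime -> X) (t : K) : pt -> X := fun x => f (t, x).

(* [None] is the time direction, [Some i] the i-th space direction. *)
Definition dirv (k : option 'I_d) : spacetime :=
  if k is Some i then (0, delta_mx 0 i) else (1, 0).

Definition pd (k : option 'I_d) (f : field) : field := fun p => 'D_(dirv k) f p.

Section differential_operators.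
(* [D] is either the classical derivative [pd] or the weak derivative [wD]. *)
Variable D : option 'I_d -> field -> field.

Definition dtv (z : spacetime -> 'rV[K]_d) (p : spacetime) : 'rV[K]_d :=
  \row_i D None (comp z i) p.
Definition grad (f : field) (p : spacetime) : 'rV[K]_d :=
  \row_j D (Some j) f p.
Definition gradv (z : spacetime -> 'rV[K]_d) (p : spacetime) : 'M[K]_d :=
  \matrix_(i, j) D (Some j) (comp z i) p.
Definition divv (z : spacetime -> 'rV[K]_d) (p : spacetime) : K :=
  \sum_j D (Some j) (comp z j) p.
Definition divm (S : spacetime -> 'M[K]_d) (p : spacetime) : 'rV[K]_d :=
  \row_i \sum_j D (Some j) (fun q => S q i j) p.

End differential_operators.

Definition smooth (f : field) := forall s : seq (option 'I_d),
  continuous (foldr pd f s) /\ forall k p, derivable (foldr pd f s) p (dirv k).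

(* C^oo(T^d): smooth functions on R^d that are 1-periodic in each variable. *)
Definition test_torus (xi : pt -> K) :=
  smooth (fun p => xi p.2) /\ forall x i, xi (x + delta_mx 0 i) = xi x.

(* C_0^oo([0,T[ x T^d); smoothness up to t = 0 is expressed by an extension to
   negative times. *)
Definition test0 (T : K) (f : field) :=
  [/\ smooth f, forall t x i, f (t, x + delta_mx 0 i) = f (t, x) &
      exists2 T', T' < T & forall t x, T' <= t -> f (t, x) = 0].

(* C_0^oo(]0,T[ x T^d) *)
Definition test (T : K) (f : field) :=
  test0 T f /\ exists2 t0, 0 < t0 & forall t x, t <= t0 -> f (t, x) = 0.

Definition time (T : K) := mrestr (@lebesgue_measure K) (measurable_itv `]0, T[).
HB.instance Definition _ T := Measure.on (time T).

Lemma time_fin T : fin_num_fun (time T).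
Proof.
apply: lty_fin_num_fun.
change (lebesgue_measure ([set: K] `&` [set` `]0%R, T[%R]) < +oo)%E.
rewrite setTI lebesgue_measure_itv /=.
by case: ifP => // _; rewrite -EFinD ltry.
Qed.
HB.instance Definition _ T := Measure_isFinite.Build _ _ _ (time T) (time_fin T).

(* The measure dt dx on ]0,T[ x T^d. *)
Definition stm (T : K) : {measure set (measurableTypeR K * pt) -> \bar K} :=
  (time T \x torus d)%E.

(* [g] is the distributional derivative of [f] in direction [k] on
   ]0,T[ x T^d. *)
Definition is_wderiv (T : K) k (f g : field) :=
  [/\ (stm T).-integrable setT (EFin \o f),
      (stm T).-integrable setT (EFin \o g) &
      forall phi, test T phi ->
        \int[stm T]_p (f p * pd k phi p) = - \int[stm T]_p (g p * phi p)].

Definition wderivable (T : K) k (f : field) := exists g, is_wderiv T k f g.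

(* The weak derivative: unique up to a null set when it exists, 0 otherwise. *)
Definition wD (T : K) k (f : field) : field :=
  xget (fun=> 0) [set g | is_wderiv T k f g].

(* Weak derivatives on T^d, for functions of [x] only. *)
Definition is_sderiv (i : 'I_d) (f g : pt -> K) :=
  [/\ (torus d).-integrable setT (EFin \o f),
      (torus d).-integrable setT (EFin \o g) &
      forall xi, test_torus xi ->
        \int[torus d]_x (f x * 'D_(delta_mx 0 i) xi x) =
        - \int[torus d]_x (g x * xi x)].

Definition sderivable (i : 'I_d) (f : pt -> K) := exists g, is_sderiv i f g.

Definition sD (i : 'I_d) (f : pt -> K) : pt -> K :=
  xget (fun=> 0) [set g | is_sderiv i f g].

Definition sgrad (f : pt -> K) (x : pt) : 'rV[K]_d := \row_i sD i f x.

(* f belongs to L^p(0,T; L^q(T^d)) *)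
Definition LpLq (T : K) (p q : \bar K) (f : field) :=
  measurable_fun [set: measurableTypeR K * pt] f /\
  ('N[time T]_p[(fun t => 'N[torus d]_q[EFin \o slice f t])] < +oo)%E.

(* f belongs to L^p(0,T; W^{m,q}(T^d)) *)
Fixpoint LpWq (T : K) (m : nat) (p q : \bar K) (f : field) : Prop :=
  LpLq T p q f /\
  (if m is m'.+1 then
     forall i, wderivable T (Some i) f /\ LpWq T m' p q (wD T (Some i) f)
   else True).

(* f(t) tends to l as t -> 0+, for an f that is only defined almost everywhere *)
Definition ess_cvg0 (f : K -> K) (l : K) :=
  forall e, 0 < e -> exists2 delta, 0 < delta &
    {ae (@lebesgue_measure K), forall t, 0 < t < delta -> `|f t - l| < e}.

(* Distributional convergence on T^d as t -> 0+ *)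
Definition initial (f : field) (f0 : pt -> K) :=
  forall xi, test_torus xi ->
    ess_cvg0 (fun t => \int[torus d]_x (f (t, x) * xi x))
             (\int[torus d]_x (f0 x * xi x)).

End fields.

Section entropy.
Variable K : realType.

Definition H (x : K) : K := x * ln x - x.
Definition relH (x y : K) : K := H x - H y - derive1 H y * (x - y).

End entropy.

Section NSLK.
Variables (K : realType) (d : nat) (T lambda mu nu hbar : K).

Local Notation pt := 'rV[K]_d.
Local Notation spacetime := (K * 'rV[K]_d)%type.
Local Notation field := (spacetime -> K).
Local Notation vfield := (spacetime -> 'rV[K]_d).
Local Notation tfield := (spacetime -> 'M[K]_d).
Local Notation wD := (wD T).
Local Notation stm := (stm d T).

Definition hbar_nu : K := Num.sqrt (hbar ^+ 2 - nu ^+ 2).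
Definition lambda' : K := lambda - mu * nu / 2.

(* In the next three definitions the arguments [r], [rw], [rvb] stand for
   sqrt(rho), sqrt(rho) w, sqrt(rho) vbar at a fixed time, and [Tw], [Tvb] for
   T_N(w), T_N(vbar). *)
Definition energy (r : pt -> K) (rw rvb : pt -> 'rV[K]_d) : \bar K :=
  (\int[torus d]_x (2^-1 * normsq (rw x) + 2^-1 * normsq (rvb x)
                    + lambda' * H (r x ^+ 2))%:E)%E.

Definition dissipation (rw rvb : pt -> 'rV[K]_d) (Tw Tvb : pt -> 'M[K]_d) : \bar K :=
  ((nu / 2)%:E * (\int[torus d]_x (normsq (Tw x) + normsq (Tvb x)
                    + 4 * lambda' / hbar_nu ^+ 2 * normsq (rvb x))%:E)
   + mu%:E * \int[torus d]_x (normsq (rw x))%:E)%E.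

(* The time-integral-free part of the relative entropy. *)
Definition rel_energy (r : pt -> K) (rw rvb : pt -> 'rV[K]_d)
    (R : pt -> K) (W Vb : pt -> 'rV[K]_d) : \bar K :=
  ((2^-1)%:E * (\int[torus d]_x (normsq (rvb x - r x *: Vb x)
                                 + normsq (rw x - r x *: W x))%:E)
   + lambda'%:E * \int[torus d]_x (relH (r x ^+ 2) (R x))%:E)%E.

Section weak.
(* Initial data: [r0] is sqrt(rho_0), [w0] is w_0; vbar_0 is determined by
   rho_0, with the same reading of sqrt(rho_0) vbar_0 on vacuum as below. *)
Variables (r0 : pt -> K) (w0 : pt -> 'rV[K]_d).

Definition rw0 (x : pt) : 'rV[K]_d := r0 x *: w0 x.
Definition rv0 (x : pt) : 'rV[K]_d := 2 *: sgrad r0 x.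
Definition rvb0 (x : pt) : 'rV[K]_d := hbar_nu *: sgrad r0 x.
(* From rho_0 w_0 = rho_0 u_0 + (nu/2) grad rho_0 *)
Definition ru0 (x : pt) : 'rV[K]_d := rw0 x - nu *: sgrad r0 x.

(* [r] is sqrt(rho), [ru] is sqrt(rho) u. Then sqrt(rho) v, sqrt(rho) vbar and
   sqrt(rho) w are read as 2 grad r, hbar_nu grad r and ru + nu grad r, which
   makes sense on vacuum. *)
Variables (r : field) (ru : vfield).

Definition rho (p : spacetime) : K := r p ^+ 2.
Definition rv (p : spacetime) : 'rV[K]_d := 2 *: grad wD r p.
Definition rvb (p : spacetime) : 'rV[K]_d := hbar_nu *: grad wD r p.
Definition rw (p : spacetime) : 'rV[K]_d := ru p + nu *: grad wD r p.

(* [Tz] is T_N(z), where [rz] is sqrt(rho) z: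
   sqrt(rho) T_N(z) + 2 sqrt(rho) z (x) grad sqrt(rho)
     = grad (sqrt(rho) sqrt(rho) z).
   This determines [Tz] off the vacuum only; its values on vacuum are left free,
   and count in the dissipation, hence in the energy estimate. *)
Definition is_TN (rz : vfield) (Tz : tfield) := forall i j,
  [/\ measurable_fun [set: measurableTypeR K * pt] (fun p => Tz p i j),
      stm.-integrable setT (fun p => (r p * Tz p i j)%:E) &
      is_wderiv T (Some j) (fun p => r p * rz p 0 i)
        (fun p => r p * Tz p i j + 2 * outer (rz p) (grad wD r p) i j)].

Variables (Tu Tw Tvb : tfield).

Definition weak_continuity := forall eta : field, test0 T eta ->
  \int[stm]_p (rho p * pd None eta p + inner (r p *: ru p) (grad (@pd K d) eta p))
  + \int[torus d]_x (r0 x ^+ 2 * eta (0, x)) = 0.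

Definition weak_momentum := forall zeta : vfield,
  (forall i, test0 T (comp zeta i)) ->
  \int[stm]_p (inner (r p *: rw p) (dtv (@pd K d) zeta p)
    + inner (outer (rw p) (ru p)) (gradv (@pd K d) zeta p)
    + lambda' * rho p * divv (@pd K d) zeta p
    - mu * inner (r p *: rw p) (zeta p)
    - hbar_nu / 2 * inner (r p *: Tvb p) (gradv (@pd K d) zeta p)
    - nu / 2 * inner (r p *: Tw p) (gradv (@pd K d) zeta p))
  + \int[torus d]_x inner (r0 x *: rw0 x) (zeta (0, x)) = 0.

Definition weak_drift := forall xi : vfield,
  (forall i, test0 T (comp xi i)) ->
  \int[stm]_p (inner (r p *: rv p) (dtv (@pd K d) xi p)
    + inner (outer (rv p) (ru p)) (gradv (@pd K d) xi p)
    + inner (r p *: (Tu p)^T) (gradv (@pd K d) xi p))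
  + \int[torus d]_x inner (r0 x *: rv0 x) (xi (0, x)) = 0.

Record weak_solution : Prop := WeakSolution {
  weak_r0_ge0 : {ae (torus d), forall x, 0 <= r0 x};
  weak_r0_diff : forall i, sderivable i r0;
  weak_w0_meas : forall i, measurable_fun setT (fun x => w0 x 0 i);
  weak_energy0 : (energy r0 rw0 rvb0 < +oo)%E;
  weak_r_reg : LpWq T 1 +oo 2%:E r;
  weak_ru_reg : forall i, LpLq T +oo 2%:E (comp ru i);
  weak_r_ge0 : {ae stm, forall p, 0 <= r p};
  weak_vacuum : {ae stm, forall p, rho p = 0 -> ru p = 0};
  weak_TN_u : is_TN ru Tu;
  weak_TN_w : is_TN rw Tw;
  weak_TN_vb : is_TN rvb Tvb;
  weak_eq_rho : weak_continuity;
  weak_eq_w : weak_momentum;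
  weak_eq_v : weak_drift;
  weak_init_rho : initial rho (fun x => r0 x ^+ 2);
  weak_init_rhou : forall i,
    initial (fun p => (r p *: ru p) 0 i) (fun x => (r0 x *: ru0 x) 0 i);
  weak_energy : {ae time T, forall t,
    (energy (slice r t) (slice rw t) (slice rvb t)
     + \int[lebesgue_measure]_(s in `]0%R, t[)
         dissipation (slice rw s) (slice rvb s) (slice Tw s) (slice Tvb s)
     <= energy r0 rw0 rvb0)%E}
}.

End weak.

Section strong.
Variables (R0 : pt -> K) (W0 : pt -> 'rV[K]_d).

Definition Vb0 (x : pt) : 'rV[K]_d := (hbar_nu / 2) *: sgrad (fun y => ln (R0 y)) x.

Variables (R : field) (W Vb : vfield).

Definition V (p : spacetime) : 'rV[K]_d := grad wD (fun q => ln (R q)) p.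
Definition U (p : spacetime) : 'rV[K]_d := W p - (nu / 2) *: V p.

Definition H'R : field := fun p => derive1 (@H K) (R p).

Record strong_solution : Prop := StrongSolution {
  strong_R_inf : (0 < ess_inf stm (EFin \o R))%E;
  strong_R_sup : (ess_sup stm (EFin \o R) < +oo)%E;
  strong_gradR : forall i,
    [/\ wderivable T (Some i) R, LpLq T 2%:E +oo (wD (Some i) R) &
        LpWq T 1 1%:E +oo (wD (Some i) R)];
  strong_W_reg : forall i,
    [/\ LpWq T 2 +oo +oo (comp W i), wderivable T None (comp W i) &
        LpLq T +oo +oo (wD None (comp W i))];
  strong_Vb_reg : forall i,
    [/\ LpWq T 2 +oo +oo (comp Vb i), wderivable T None (comp Vb i) &
        LpLq T +oo +oo (wD None (comp Vb i))];
  strong_H'R_reg : forall k, wderivable T k H'R /\ LpLq T 1%:E +oo (wD k H'R);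
  strong_Vb : {ae stm, forall p, Vb p = (hbar_nu / 2) *: V p};
  (* The next four fields: the weak derivatives in the equations exist. *)
  strong_dtR : wderivable T None R;
  strong_diff1 : forall j, wderivable T (Some j) (fun p => R p * U p 0 j);
  strong_diff2 : forall i j, wderivable T (Some i) (comp U j);
  strong_diff3 : forall i j,
    [/\ wderivable T (Some j) (fun p => R p * gradv wD Vb p i j),
        wderivable T (Some j) (fun p => R p * gradv wD W p i j) &
        wderivable T (Some j) (fun p => R p * gradv wD U p j i)];
  strong_eq_R : {ae stm, forall p,
    wD None R p + divv wD (fun q => R q *: U q) p = 0};
  strong_eq_W : {ae stm, forall p,
    R p *: (dtv wD W p + U p *m (gradv wD W p)^T)
    + lambda' *: grad wD R p + (mu * R p) *: W p
    = (hbar_nu / 2) *: divm wD (fun q => R q *: gradv wD Vb q) p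
      + (nu / 2) *: divm wD (fun q => R q *: gradv wD W q) p};
  strong_eq_Vb : {ae stm, forall p,
    R p *: (dtv wD Vb p + U p *m (gradv wD Vb p)^T)
    + (hbar_nu / 2) *: divm wD (fun q => R q *: (gradv wD U q)^T) p = 0};
  strong_R0_int : (torus d).-integrable setT (EFin \o R0);
  strong_W0_int : forall i, (torus d).-integrable setT (fun x => (W0 x 0 i)%:E);
  strong_lnR0_diff : forall i, sderivable i (fun x => ln (R0 x));
  strong_energy0 : (energy (fun x => Num.sqrt (R0 x))
    (fun x => Num.sqrt (R0 x) *: W0 x) (fun x => Num.sqrt (R0 x) *: Vb0 x) < +oo)%E;
  strong_init_R : initial R R0;
  strong_init_W : forall i, initial (comp W i) (fun x => W0 x 0 i);
  strong_init_Vb : forall i, initial (comp Vb i) (fun x => Vb0 x 0 i)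
}.

End strong.

Section relative_entropy.
Variables (r0 : pt -> K) (w0 : pt -> 'rV[K]_d).
Variables (r : field) (ru : vfield) (Tw Tvb : tfield).
Variables (R0 : pt -> K) (W0 : pt -> 'rV[K]_d) (R : field) (W Vb : vfield).

(* rho |T_N(z)/sqrt(rho) - grad Z|^2 is written |T_N(z) - sqrt(rho) grad Z|^2 and
   rho |z - Z|^2 is written |sqrt(rho) z - sqrt(rho) Z|^2. *)
Definition rel_dissipation (s : K) : \bar K :=
  ((nu / 2)%:E * (\int[torus d]_x
      (normsq (Tvb (s, x) - r (s, x) *: gradv wD Vb (s, x))
       + normsq (Tw (s, x) - r (s, x) *: gradv wD W (s, x)))%:E)
   + mu%:E * \int[torus d]_x (normsq (rw r ru (s, x) - r (s, x) *: W (s, x)))%:E)%E.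

Definition rel_entropy (t : K) : \bar K :=
  if t == 0 then rel_energy r0 (rw0 r0 w0) (rvb0 r0) R0 W0 (Vb0 R0)
  else (rel_energy (slice r t) (slice (rw r ru) t) (slice (rvb r) t)
          (slice R t) (slice W t) (slice Vb t)
        + \int[lebesgue_measure]_(s in `]0%R, t[) rel_dissipation s)%E.

End relative_entropy.

End NSLK.

(* Main.v *)
Require Import Defs.
From mathcomp Require Import all_boot all_order all_algebra.
From mathcomp Require Import all_classical all_reals all_analysis.
From mathcomp Require Import measurable_realfun.
From mathcomp Require Import ring lra.

(* Testing the weak momentum and drift equations with W and Vb, and the weak
   continuity equation with |W|^2/2 + |Vb|^2/2 - lambda' log R, and adding the energy
   inequality, bounds E(t) - E(0) by the time integral of a space integral. Once the
   time derivatives of the strong solution are replaced by its equations and the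
   terms of higher order are integrated by parts, what is left is quadratic in
   sqrt(rho) (w - W) and sqrt(rho) (vbar - Vb) with coefficients grad W and grad Vb,
   plus the nonpositive term - (2 lambda' nu / hbar_nu^2) rho |vbar - Vb|^2; hence the
   bound by C (1 + nu / hbar_nu) times the integral of E, with C determined by a
   bound on grad W and grad Vb.

   The fields W, Vb and log R are only Lipschitz, whereas the weak equations hold
   for smooth test functions. Tested with chi(t) e(x), for chi a bump function and e
   a trigonometric polynomial, they become ordinary differential equations for the
   moments of the unknowns. The trigonometric kernel prod_i c_N cos(pi (x_i - y_i))^(2N)
   is a finite sum of products e(x) e'(y), an approximate identity, and depends on
   x - y only, so multiplying these moments by those of a Lipschitz field, summing,
   and letting N tend to infinity yields the tested equations for that field. The
   same kernel gives the calculus of weak derivatives on the torus (product and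
   exponential rules, symmetry of second derivatives). *)

Set Implicit Arguments.
Unset Strict Implicit.
Unset Printing Implicit Defensive.

Import Order.TTheory GRing.Theory Num.Theory.
Import numFieldNormedType.Exports.

Local Open Scope classical_set_scope.
Local Open Scope ring_scope.

(** * Integrable functions *)

(** The tests are dictated by expanding the relative energy. Since H(rho|R) = H(rho) + R - rho log
    R, it is the energy of the weak solution, minus the integrals of rho w . W and rho vbar . Vb,
    plus that of rho (|W|^2/2 + |Vb|^2/2 - lambda' log R), plus lambda' times the mass of R, which
    is constant. The middle terms are linear in quantities governed by a conservation law. Nothing
    is divided by rho: the tested identities involve only sqrt(rho), sqrt(rho) w, sqrt(rho) vbar and
    sqrt(rho) T_N, and the symmetry of T_N(vbar) is used after multiplication by sqrt(rho). The
    quotient nu / hbar_nu comes from u = w - (nu / hbar_nu) vbar and its analogue for U. The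
    constant is 8 d M, with M a bound on grad W and grad Vb selected before the parameters are
    introduced. Null sets of times are a recurrent obstacle: an identity holds at almost every time
    for each single test, so the tests are drawn from a countable family of trigonometric monomials,
    and all further spatial calculus is done at fixed time. *)

Section L1.
Context d (X : measurableType d) (K : realType) (mu : {measure set X -> \bar K}).
Implicit Types f g : X -> K.

Definition L1 f : Prop := mu.-integrable setT (EFin \o f).

Lemma L1_meas f : L1 f -> measurable_fun setT f.
Proof. by move=> /measurable_int/measurable_EFinP. Qed.

Lemma eq_L1 f g : f =1 g -> L1 f -> L1 g.
Proof. by move=> /funext ->. Qed.

Lemma L1_le_ae f g : measurable_fun setT f ->
  {ae mu, forall x, `|f x| <= g x} -> L1 g -> L1 f.
Proof.
move=> mf fg /integrableP[mg gi]; apply/integrableP; split.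
  exact/measurable_EFinP.
apply: le_lt_trans gi; apply: ae_ge0_le_integral => //=.
- by apply/measurable_EFinP; exact: measurableT_comp.
- apply/measurable_EFinP; apply: measurableT_comp => //.
  exact/measurable_EFinP.
- by apply: filterS fg => x fg _; rewrite lee_fin (le_trans fg)// ler_norm.
Qed.

Lemma L1_le f g : measurable_fun setT f ->
  (forall x, `|f x| <= g x) -> L1 g -> L1 f.
Proof. by move=> mf fg; apply: L1_le_ae => //; apply: aeW => x; exact: fg. Qed.

Lemma L1_ae f g : measurable_fun setT g ->
  {ae mu, forall x, f x = g x} -> L1 f -> L1 g.
Proof.
move=> mg fg lf; apply: (@L1_le_ae _ (fun x => `|f x|)) => //.
  by apply: filterS fg => x ->.
exact: integrable_norm.
Qed.

Lemma L1D f g : L1 f -> L1 g -> L1 (fun x => f x + g x).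
Proof. by move=> lf lg; exact: (integrableD measurableT lf lg). Qed.

Lemma L1Z (c : K) f : L1 f -> L1 (fun x => c * f x).
Proof. by move=> lf; exact: (integrableZl measurableT c lf). Qed.

Lemma L1N f : L1 f -> L1 (fun x => - f x).
Proof. by move=> /(L1Z (-1)); apply: eq_L1 => x; rewrite mulN1r. Qed.

Lemma L1B f g : L1 f -> L1 g -> L1 (fun x => f x - g x).
Proof. by move=> lf lg; exact: (L1D lf (L1N lg)). Qed.

Lemma L1Zr (c : K) f : L1 f -> L1 (fun x => f x * c).
Proof. by move=> lf; apply: eq_L1 (L1Z c lf) => x; rewrite mulrC. Qed.

Lemma L1_0 : L1 (fun=> 0).
Proof. exact: integrable0. Qed.

Lemma L1_sum (I : Type) (s : seq I) (P : pred I) (F : I -> X -> K) :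
  (forall i, P i -> L1 (F i)) -> L1 (fun x => \sum_(i <- s | P i) F i x).
Proof.
move=> lF; elim: s => [|i s ih].
  by apply: eq_L1 L1_0 => x; rewrite big_nil.
case Pi : (P i).
  by apply: eq_L1 (L1D (lF i Pi) ih) => x; rewrite big_cons Pi.
by apply: eq_L1 ih => x; rewrite big_cons Pi.
Qed.

Lemma L1_norm f : L1 f -> L1 (fun x => `|f x|).
Proof. exact: integrable_norm. Qed.

Lemma L1_mul_bounded M f g : L1 f -> measurable_fun setT g ->
  {ae mu, forall x, `|g x| <= M} -> L1 (fun x => f x * g x).
Proof.
move=> lf mg gM; apply: (@L1_le_ae _ (fun x => `|f x| * M)).
- by apply: measurable_funM => //; exact: L1_meas.
- by apply: filterS gM => x gM; rewrite normrM ler_wpM2l.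
- exact/L1Zr/L1_norm.
Qed.

Lemma RD f g : L1 f -> L1 g ->
  \int[mu]_x (f x + g x) = \int[mu]_x f x + \int[mu]_x g x.
Proof. exact: RintegralD. Qed.

Lemma RB f g : L1 f -> L1 g ->
  \int[mu]_x (f x - g x) = \int[mu]_x f x - \int[mu]_x g x.
Proof. exact: RintegralB. Qed.

Lemma RZ (c : K) f : L1 f -> \int[mu]_x (c * f x) = c * \int[mu]_x f x.
Proof. exact: RintegralZl. Qed.

Lemma RZr (c : K) f : L1 f -> \int[mu]_x (f x * c) = (\int[mu]_x f x) * c.
Proof. exact: RintegralZr. Qed.

Lemma RN f : L1 f -> \int[mu]_x (- f x) = - \int[mu]_x f x.
Proof.
move=> lf; rewrite -mulN1r -RZ//; apply: eq_Rintegral => x _.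
by rewrite mulN1r.
Qed.

Lemma eqR f g : f =1 g -> \int[mu]_x f x = \int[mu]_x g x.
Proof. by move=> fg; apply: eq_Rintegral => x _; exact: fg. Qed.

Lemma R0 : \int[mu]_x 0 = 0 :> K.
Proof. by rewrite /Rintegral integral0. Qed.

Lemma Rsum (I : Type) (s : seq I) (P : pred I) (F : I -> X -> K) :
  (forall i, P i -> L1 (F i)) ->
  \int[mu]_x (\sum_(i <- s | P i) F i x) = \sum_(i <- s | P i) \int[mu]_x F i x.
Proof.
move=> lF; elim: s => [|i s ih].
  by rewrite big_nil -[RHS]R0; apply: eqR => x; rewrite big_nil.
rewrite big_cons; case Pi : (P i); last first.
  by rewrite -ih; apply: eqR => x; rewrite big_cons Pi.
rewrite -ih -RD//; [|exact: lF|exact: L1_sum].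
by apply: eqR => x; rewrite big_cons Pi.
Qed.

Lemma R_ae f g : measurable_fun setT f -> measurable_fun setT g ->
  {ae mu, forall x, f x = g x} -> \int[mu]_x f x = \int[mu]_x g x.
Proof.
move=> mf mg fg; congr fine; apply: ae_eq_integral => //.
- exact/measurable_EFinP.
- exact/measurable_EFinP.
- by apply: filterS fg => x -> _.
Qed.

(** Reduction to a pointwise comparison: [g] is replaced by [max f g], which equals [g] almost
    everywhere and dominates [f] everywhere. *)
Lemma R_le_ae f g : L1 f -> L1 g -> {ae mu, forall x, f x <= g x} ->
  \int[mu]_x f x <= \int[mu]_x g x.
Proof.
move=> lf lg fg.
have mm : measurable_fun setT (fun x => Num.max (f x) (g x)).
  by apply: measurable_maxr; exact: L1_meas.
have ae : {ae mu, forall x, g x = Num.max (f x) (g x)}.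
  by apply: filterS fg => x /max_idPr ->.
rewrite (R_ae (L1_meas lg) mm ae); apply: le_Rintegral => //.
  exact: L1_ae ae lg.
by move=> x _; rewrite le_max lexx.
Qed.

Lemma R_ge0_ae f : L1 f -> {ae mu, forall x, 0 <= f x} -> 0 <= \int[mu]_x f x.
Proof. by move=> lf f0; rewrite -[leLHS]R0; apply: R_le_ae => //; exact: L1_0. Qed.

Lemma R_norm f : L1 f -> `|\int[mu]_x f x| <= \int[mu]_x `|f x|.
Proof. exact: le_normr_Rintegral. Qed.

Lemma EFinR f : L1 f -> (\int[mu]_x f x)%:E = (\int[mu]_x (f x)%:E)%E.
Proof. by move=> lf; rewrite /Rintegral fineK//; exact: integrable_fin_num. Qed.

(** Indices are coded by natural numbers through [pickle]; codes of no index impose nothing, and a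
    countable union of null sets is null. *)
Lemma ae_foralli (J : countType) (P : J -> X -> Prop) :
  (forall j, {ae mu, forall x, P j x}) -> {ae mu, forall x j, P j x}.
Proof.
move=> h; pose Q n x := if unpickle n is Some j then P j x else True.
have : {ae mu, forall x, forall n, Q n x}.
  apply: ae_foralln => n; rewrite /Q; case: unpickle => [j|]; first exact: h.
  exact: aeW.
by apply: filterS => x Qx j; have := Qx (pickle j); rewrite /Q pickleK.
Qed.

Lemma L1_cst (c : K) : (mu setT < +oo)%E -> L1 (fun=> c).
Proof.
move=> fm; apply/integrableP; split; first exact/measurable_EFinP.
rewrite (_ : (fun x => _) = cst (`|c|%:E)%E)//= integral_cst//.
by rewrite lte_mul_pinfty// lee_fin.
Qed.

Lemma R_dct (f_ : nat -> X -> K) f g :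
  (forall n, measurable_fun setT (f_ n)) -> measurable_fun setT f ->
  {ae mu, forall x, f_ ^~ x @ \oo --> f x} -> L1 g ->
  {ae mu, forall x n, `|f_ n x| <= g x} ->
  \int[mu]_x `|f_ n x - f x| @[n --> \oo] --> (0 : K) /\
  \int[mu]_x f_ n x @[n --> \oo] --> \int[mu]_x f x.
Proof.
move=> mf_ mf cf lg bf.
have lfn n : L1 (f_ n) by apply: L1_le_ae lg => //; apply: filterS bf.
have [] := @dominated_convergence _ _ _ mu setT measurableT
  (fun n => EFin \o f_ n) (EFin \o f) (EFin \o g).
- by move=> n; exact/measurable_EFinP.
- exact/measurable_EFinP.
- by apply: filterS cf => x cx _; apply: cvg_EFin => //; apply: nearW => n.
- exact: lg.
- by apply: filterS bf => x bx n _; rewrite /= lee_fin.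
move=> lf c1 c2; split.
  by move: c1 => /fine_cvgP[_].
by move: c2; rewrite -EFinR// => /fine_cvgP[_].
Qed.

(** A function class for L^infinity: measurability is exact, the bound holds only almost everywhere,
    as for the fields of the strong solution. *)
Definition essbdd f : Prop :=
  measurable_fun setT f /\ exists M : K, {ae mu, forall x, `|f x| <= M}.

Lemma bddM f g : essbdd f -> essbdd g -> essbdd (fun x => f x * g x).
Proof.
move=> [mf [M fM]] [mg [N gN]]; split; first exact: measurable_funM.
by exists (M * N); apply: filterS2 fM gN => x fM gN; rewrite normrM ler_pM.
Qed.

Lemma bddD f g : essbdd f -> essbdd g -> essbdd (fun x => f x + g x).
Proof.
move=> [mf [M fM]] [mg [N gN]]; split; first exact: measurable_funD.
exists (M + N); apply: filterS2 fM gN => x fM gN.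
by apply: le_trans (ler_normD _ _) _; exact: lerD.
Qed.

Lemma bdd_cst (c : K) : essbdd (fun=> c).
Proof. by split => //; exists `|c|; exact: aeW. Qed.

Lemma bddZ (c : K) f : essbdd f -> essbdd (fun x => c * f x).
Proof. exact/bddM/bdd_cst. Qed.

Lemma bddB f g : essbdd f -> essbdd g -> essbdd (fun x => f x - g x).
Proof.
move=> bf bg; rewrite (_ : (fun _ => _) = fun x => f x + -1 * g x).
  by apply: bddD => //; exact: bddZ.
by apply/funext => x; rewrite mulN1r.
Qed.

Lemma bdd_sum (I : Type) (s : seq I) (F : I -> X -> K) :
  (forall a, essbdd (F a)) -> essbdd (fun x => \sum_(a <- s) F a x).
Proof.
move=> bF; elim: s => [|a s ih].
  rewrite (_ : (fun _ => _) = (fun=> 0)); first exact: bdd_cst.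
  by apply/funext => x; rewrite big_nil.
rewrite (_ : (fun _ => _) = (fun x => F a x + \sum_(b <- s) F b x)).
  exact: bddD.
by apply/funext => x; rewrite big_cons.
Qed.

Lemma bdd_ae f g : measurable_fun setT g -> {ae mu, forall x, f x = g x} ->
  essbdd f -> essbdd g.
Proof.
move=> mg fg [mf [M fM]]; split => //; exists M.
by apply: filterS2 fM fg => x h <-.
Qed.

Lemma L1_mul_bdd f g : L1 f -> essbdd g -> L1 (fun x => f x * g x).
Proof. by move=> lf [mg [M gM]]; exact: L1_mul_bounded gM. Qed.

Lemma essbdd_L1 f : (mu setT < +oo)%E -> essbdd f -> L1 f.
Proof. by move=> fin [mf [M fM]]; apply: L1_le_ae fM _ => //; exact: L1_cst. Qed.

Definition sqint f : Prop := measurable_fun setT f /\ L1 (fun x => f x ^+ 2).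

(** Dominated by f^2 + g^2, from the square of [|f| - |g|] being nonnegative. *)
Lemma L2_mul f g : sqint f -> sqint g -> L1 (fun x => f x * g x).
Proof.
move=> [mf lf] [mg lg].
apply: (@L1_le _ (fun x => f x ^+ 2 + g x ^+ 2)); last exact: L1D.
  exact: measurable_funM.
move=> x; rewrite normrM.
have := sqr_ge0 (`|f x| - `|g x|); rewrite -(real_normK (num_real (f x))) -(real_normK (num_real (g x))).
have := normr_ge0 (f x); have := normr_ge0 (g x); nra.
Qed.

Lemma sqint_L1 f : L1 (fun=> 1) -> sqint f -> L1 f.
Proof.
move=> l1 hf; have h1 : sqint (fun=> 1) by split => //; apply: eq_L1 l1 => x; rewrite expr1n.
by apply: eq_L1 (L2_mul hf h1) => x; rewrite mulr1.
Qed.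

Lemma L2_mul_bdd f g : sqint f -> essbdd g -> sqint (fun x => f x * g x).
Proof.
move=> [mf lf] bg; split; first by apply: measurable_funM => //; have [] := bg.
apply: eq_L1 (L1_mul_bdd lf (bddM bg bg)) => x; rewrite exprMn; congr (_ * _).
Qed.

Lemma L2Z (c : K) f : sqint f -> sqint (fun x => c * f x).
Proof.
move=> hf; rewrite (_ : (fun _ => _) = fun x => f x * c); last by apply/funext => x; rewrite mulrC.
by apply: L2_mul_bdd => //; exact: bdd_cst.
Qed.

Lemma L2D f g : sqint f -> sqint g -> sqint (fun x => f x + g x).
Proof.
move=> hf hg; have [mf lf] := hf; have [mg lg] := hg.
split; first exact: measurable_funD.
apply: eq_L1 (L1D lf (L1D (L1Z 2 (L2_mul hf hg)) lg)) => x; ring.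
Qed.

Lemma L2B f g : sqint f -> sqint g -> sqint (fun x => f x - g x).
Proof.
move=> hf hg; rewrite (_ : (fun _ => _) = fun x => f x + -1 * g x).
  by apply: L2D => //; exact: L2Z.
by apply/funext => x; rewrite mulN1r.
Qed.

Lemma R_norm_eq0 f : L1 f -> \int[mu]_x `|f x| = 0 -> {ae mu, forall x, f x = 0}.
Proof.
move=> lf f0; have : (\int[mu]_x `|(f x)%:E|)%E = 0%E.
  by rewrite -[LHS]/(\int[mu]_x (`|f x|)%:E)%E -EFinR ?f0//; exact: L1_norm.
move=> /ae_eq_integral_abs => /(_ measurableT (measurable_int _ lf)).
by apply: filterS => x /(_ I) [].
Qed.

End L1.

(** * Slicing, Fubini and almost-everywhere statements on a product *)

Section fubini.
Context d1 d2 (X : measurableType d1) (Y : measurableType d2) (K : realType).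
Variables (m1 : {sigma_finite_measure set X -> \bar K})
          (m2 : {sigma_finite_measure set Y -> \bar K}).
Local Notation P := (m1 \x m2)%E.
Implicit Types f : X * Y -> K.

Lemma meas_slice1 f (x : X) : measurable_fun setT f ->
  measurable_fun setT (fun y => f (x, y)).
Proof. by move=> mf; exact: measurableT_comp (pair1_measurable x). Qed.

Lemma meas_slice2 f (y : Y) : measurable_fun setT f ->
  measurable_fun setT (fun x => f (x, y)).
Proof. by move=> mf; exact: measurableT_comp (pair2_measurable y). Qed.

(** The inner integral is the difference of those of the positive and negative parts, each
    measurable by Tonelli. Infinite inner integrals are allowed. *)
Lemma meas_eint1 f : measurable_fun setT f ->
  measurable_fun setT (fun x => \int[m2]_y (f (x, y))%:E)%E.
Proof.
move=> /measurable_EFinP mf.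
rewrite (_ : (fun _ => _) = fubini_F m2 ((EFin \o f)^\+)%E \-
                            fubini_F m2 ((EFin \o f)^\-)%E)%E.
  apply: emeasurable_funB; apply: measurable_fun_fubini_tonelli_F => //.
    exact: measurable_funepos.
  exact: measurable_funeneg.
apply/funext=> x; rewrite [LHS]integralE; congr (_ - _)%E.
  by apply: eq_integral => y _; rewrite !funeposE.
by apply: eq_integral => y _; rewrite !funenegE.
Qed.

Lemma meas_eint2 f : measurable_fun setT f ->
  measurable_fun setT (fun y => \int[m1]_x (f (x, y))%:E)%E.
Proof.
move=> /measurable_EFinP mf.
rewrite (_ : (fun _ => _) = fubini_G m1 ((EFin \o f)^\+)%E \-
                            fubini_G m1 ((EFin \o f)^\-)%E)%E.
  apply: emeasurable_funB; apply: measurable_fun_fubini_tonelli_G => //.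
    exact: measurable_funepos.
  exact: measurable_funeneg.
apply/funext=> y; rewrite [LHS]integralE; congr (_ - _)%E.
  by apply: eq_integral => x _; rewrite !funeposE.
by apply: eq_integral => x _; rewrite !funenegE.
Qed.

Lemma meas_int1 f : measurable_fun setT f ->
  measurable_fun setT (fun x => \int[m2]_y f (x, y)).
Proof.
by move=> mf; apply: (measurableT_comp (fine_measurable measurableT)); exact: meas_eint1.
Qed.

Lemma meas_int2 f : measurable_fun setT f ->
  measurable_fun setT (fun y => \int[m1]_x f (x, y)).
Proof.
by move=> mf; apply: (measurableT_comp (fine_measurable measurableT)); exact: meas_eint2.
Qed.

Lemma L1_slice1 f : L1 P f -> {ae m1, forall x, L1 m2 (fun y => f (x, y))}.
Proof. exact: ae_integrable1. Qed.

Lemma L1_slice2 f : L1 P f -> {ae m2, forall y, L1 m1 (fun x => f (x, y))}.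
Proof. exact: ae_integrable2. Qed.

(** [fine] sends infinite values to 0, so the real-valued inner integral is dominated by the
    extended one. *)
Let abse_fine (x : \bar K) : (`|(fine x)%:E| <= `|x|)%E.
Proof. by case: x => [r| |] /=; rewrite ?lexx ?leey. Qed.

Lemma L1_int1 f : L1 P f -> L1 m1 (fun x => \int[m2]_y f (x, y)).
Proof.
move=> lf; apply: (le_integrable measurableT _ _ (integrable_fubini_F lf)).
  by apply/measurable_EFinP; apply: meas_int1; exact: L1_meas lf.
by move=> x _; exact: abse_fine.
Qed.

Lemma L1_int2 f : L1 P f -> L1 m2 (fun y => \int[m1]_x f (x, y)).
Proof.
move=> lf; have mf := L1_meas lf; have mG := meas_int2 mf.
apply/integrableP; split; first exact/measurable_EFinP.
have /integrable21ltyP := lf; move=> /(_ (measurable_int _ lf)); apply: le_lt_trans.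
apply: ge0_le_integral => //=.
- by apply/measurable_EFinP; exact: measurableT_comp.
- apply: (@measurable_fun_fubini_tonelli_G _ _ _ _ _ m1 (abse \o (EFin \o f))).
    by apply: measurableT_comp => //; exact/measurable_EFinP.
  by move=> z /=; rewrite lee_fin.
move=> y _; apply: le_trans (abse_fine _) _; apply: le_abse_integral => //.
by apply/measurable_EFinP; exact: meas_slice2.
Qed.

Lemma R_fubini1 f : L1 P f -> \int[P]_p f p = \int[m1]_x \int[m2]_y f (x, y).
Proof.
move=> lf; rewrite /Rintegral -(integral12_prod_meas1 lf); congr fine.
apply: ae_eq_integral => //.
- exact: meas_eint1 (L1_meas lf).
- by apply/measurable_EFinP; apply: meas_int1; exact: L1_meas lf.
- by apply: filterS (L1_slice1 lf) => x lx _; rewrite EFinR.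
Qed.

Lemma R_fubini2 f : L1 P f -> \int[P]_p f p = \int[m2]_y \int[m1]_x f (x, y).
Proof.
move=> lf; rewrite /Rintegral -(integral21_prod_meas1 lf); congr fine.
apply: ae_eq_integral => //.
- exact: meas_eint2 (L1_meas lf).
- by apply/measurable_EFinP; apply: meas_int2; exact: L1_meas lf.
- by apply: filterS (L1_slice2 lf) => x lx _; rewrite EFinR.
Qed.

Lemma R_swap f : L1 P f ->
  \int[m1]_x \int[m2]_y f (x, y) = \int[m2]_y \int[m1]_x f (x, y).
Proof. by move=> lf; rewrite -R_fubini1// R_fubini2. Qed.

(** The measure of the exceptional set is the integral of the measures of its sections, so almost
    every section is null. *)
Lemma ae_slice1 (Q : X * Y -> Prop) : {ae P, forall p, Q p} ->
  {ae m1, forall x, {ae m2, forall y, Q (x, y)}}.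
Proof.
move=> [N [mN N0 QN]].
have h : {ae m1, forall x, m2 (xsection N x) = 0%E}.
  have : ae_eq m1 setT (m2 \o xsection N) (cst 0%E).
    apply/ae_eq_integral_abs => //; first exact: measurable_fun_xsection.
    under eq_integral do rewrite gee0_abs//.
    exact: N0.
  by apply: filterS => x; apply.
apply: filterS h => x x0; exists (xsection N x); split=> //.
  exact: measurable_xsection.
by move=> y /= nQ; rewrite /xsection/= mem_set//; exact: QN.
Qed.

Lemma ae_slice2 (Q : X * Y -> Prop) : {ae P, forall p, Q p} ->
  {ae m2, forall y, {ae m1, forall x, Q (x, y)}}.
Proof.
move=> [N [mN N0 QN]].
have h : {ae m2, forall y, m1 (ysection N y) = 0%E}.
  have : ae_eq m2 setT (m1 \o ysection N) (cst 0%E).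
    apply/ae_eq_integral_abs => //; first exact: measurable_fun_ysection.
    under eq_integral do rewrite gee0_abs//.
    (* The product measure integrates the sections at fixed [x]; for the other family of sections it
       is identified, by uniqueness, with the measure built in the opposite order. *)
    rewrite -[LHS]/((m1 \x^ m2)%E N) -N0; symmetry.
    by apply: product_measure_unique => //= A B mA mB; rewrite product_measure2E.
  by apply: filterS => x; apply.
apply: filterS h => y y0; exists (ysection N y); split=> //.
  exact: measurable_ysection.
by move=> x /= nQ; rewrite /ysection/= mem_set//; exact: QN.
Qed.

(** Measurability of [A] allows the measure of its complement to be computed by integrating the
    sections, which are almost all null. *)
Lemma ae_prod1 (A : set (X * Y)) : measurable A ->
  {ae m1, forall x, {ae m2, forall y, A (x, y)}} -> {ae P, forall p, A p}.
Proof.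
move=> mA h; exists (~` A); split => //; first exact: measurableC.
rewrite -[LHS]/(\int[m1]_x (m2 \o xsection (~` A)) x)%E.
rewrite (@ae_eq_integral _ _ _ _ setT (cst 0%E))//.
- by rewrite integral_cst// mul0e.
- by apply: measurable_fun_xsection; exact: measurableC.
apply: filterS h => x hx _ /=; apply/eqP; rewrite -measure_le0; apply/eqP.
have [N [mN N0 NA]] := hx.
apply/eqP; rewrite -N0; apply: le_measure; rewrite ?inE//.
  by apply: measurable_xsection; exact: measurableC.
by move=> y; rewrite /xsection/= inE => ?; exact: NA.
Qed.

Lemma ae_prod2 (A : set (X * Y)) : measurable A ->
  {ae m2, forall y, {ae m1, forall x, A (x, y)}} -> {ae P, forall p, A p}.
Proof.
move=> mA h; exists (~` A); split => //; first exact: measurableC.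
have -> : (m1 \x m2)%E (~` A) = (m1 \x^ m2)%E (~` A).
  apply: product_measure_unique => //; last exact: measurableC.
  by move=> B C mB mC /=; rewrite product_measure2E.
rewrite -[LHS]/(\int[m2]_y (m1 \o ysection (~` A)) y)%E.
rewrite (@ae_eq_integral _ _ _ _ setT (cst 0%E))//.
- by rewrite integral_cst// mul0e.
- by apply: measurable_fun_ysection; exact: measurableC.
apply: filterS h => x hx _ /=; apply/eqP; rewrite -measure_le0; apply/eqP.
have [N [mN N0 NA]] := hx.
apply/eqP; rewrite -N0; apply: le_measure; rewrite ?inE//.
  by apply: measurable_ysection; exact: measurableC.
by move=> y; rewrite /ysection/= inE => ?; exact: NA.
Qed.

Lemma L1_tonelli f : measurable_fun setT f ->
  {ae m1, forall x, L1 m2 (fun y => f (x, y))} ->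
  L1 m1 (fun x => \int[m2]_y `|f (x, y)|) -> L1 P f.
Proof.
move=> mf lf lF; apply/integrable12ltyP; first exact/measurable_EFinP.
move: lF => /integrableP[_]; apply: le_lt_trans.
apply: ae_ge0_le_integral => //.
- by move=> x _; exact: integral_ge0.
- apply: (@measurable_fun_fubini_tonelli_F _ _ _ _ _ m2 (abse \o (EFin \o f))).
    by apply: measurableT_comp => //; exact/measurable_EFinP.
  by move=> z /=; rewrite lee_fin.
- apply: measurableT_comp => //; apply/measurable_EFinP.
  by apply: (@meas_int1 (fun p => `|f p|)); exact: measurableT_comp.
apply: filterS lf => x lx _; rewrite gee0_abs.
  by rewrite /= EFinR//; exact: L1_norm.
by rewrite /= lee_fin; exact: Rintegral_ge0.
Qed.

Lemma L1_prodM (f : X -> K) (g : Y -> K) : L1 m1 f -> L1 m2 g ->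
  L1 P (fun p => f p.1 * g p.2).
Proof.
move=> lf lg; apply: L1_tonelli.
- apply: measurable_funM.
    exact: measurableT_comp (L1_meas lf) measurable_fst.
  exact: measurableT_comp (L1_meas lg) measurable_snd.
- by apply: aeW => x; exact: (L1Z (f x) lg).
- apply: eq_L1 (L1Zr (\int[m2]_y `|g y|) (L1_norm lf)) => x.
  rewrite -RZ; last exact: L1_norm.
  by apply: eqR => y; rewrite normrM.
Qed.

End fubini.

(** * Null sets and integrals of a restricted measure *)

Section restriction.
Context d (X : measurableType d) (K : realType) (mu : {measure set X -> \bar K}).
Variables (D : set X) (mD : measurable D).

(** The exceptional set is enlarged by the complement of [D], which the restricted measure does not
    see. *)
Lemma ae_mrestr (P : X -> Prop) :
  {ae mu, forall x, D x -> P x} -> {ae mrestr mu mD, forall x, P x}.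
Proof.
move=> [N [mN N0 DN]]; exists (N `|` ~` D); split.
- by apply: measurableU => //; exact: measurableC.
- apply/eqP; rewrite -measure_le0 -N0 /mrestr; apply: le_measure; rewrite ?inE//.
    by apply: measurableI => //; apply: measurableU => //; exact: measurableC.
  by move=> x [[]].
- move=> x /= nP; have [Dx|] := pselect (D x); last by right.
  by left; apply: DN => /= /(_ Dx).
Qed.

Lemma mrestr_ae (P : X -> Prop) :
  {ae mrestr mu mD, forall x, P x} -> {ae mu, forall x, D x -> P x}.
Proof.
move=> [N [mN N0 PN]]; exists (N `&` D); split => //; first exact: measurableI.
by move=> x /= /not_implyP[Dx nP]; split => //; exact: PN.
Qed.

(** The measure is the sum of its restrictions to [D] and to the complement. The extension of [f] by
    zero agrees with [f] for the first and vanishes for the second. *)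
Lemma ge0_integral_mrestr (f : X -> \bar K) : measurable_fun setT f ->
  (forall x, 0 <= f x)%E ->
  (\int[mrestr mu mD]_x f x = \int[mu]_(x in D) f x)%E.
Proof.
move=> mf f0; have mDc := measurableC mD.
pose g := f \_ D.
have mg : measurable_fun setT g.
  by apply/(measurable_restrictT _ mD); exact: measurable_funTS.
have g0 x : (0 <= g x)%E by rewrite /g patchE; case: ifP.
rewrite [RHS]integral_mkcond -/g.
rewrite (eq_measure_integral (measure_add (mrestr mu mD) (mrestr mu mDc))); last first.
  move=> A mA _; transitivity (mrestr mu mD A + mrestr mu mDc A)%E; last first.
    by rewrite /measure_add/= /msum 2!big_ord_recl/= big_ord0 adde0.
  rewrite /mrestr -measureU//.
  - by rewrite -setIUr setUv setIT.
  - exact: measurableI.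
  - exact: measurableI.
  - by rewrite setIACA setICr setI0.
rewrite ge0_integral_measure_add//.
rewrite [X in (_ + X)%E](_ : _ = 0%E) ?adde0.
  apply: ae_eq_integral => //.
  apply: (@ae_mrestr (fun x => setT x -> f x = g x)); apply: aeW => x Dx _.
  by rewrite /g patchE mem_set.
rewrite (@ae_eq_integral _ _ _ _ setT (cst 0%E))//; first by rewrite integral0.
have [N [mN N0 DN]] : {ae mrestr mu mDc, forall x, setT x -> g x = 0%E}; last by exists N.
exists D; split => //; first by rewrite /mrestr setICr measure0.
move=> x /= nx; apply: contrapT => Dx; apply: nx => _.
by rewrite /g patchE memNset.
Qed.

Lemma L1_mrestr (f : X -> K) : measurable_fun setT f ->
  L1 (mrestr mu mD) f -> L1 mu (f \_ D).
Proof.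
move=> mf /integrableP[_ fi]; apply/integrableP; split.
  apply/measurable_EFinP.
  by apply/(measurable_restrictT _ mD); exact: measurable_funTS.
move: fi; rewrite ge0_integral_mrestr//; last first.
  by apply: measurableT_comp => //; exact/measurable_EFinP.
rewrite [X in (X < _)%E -> _]integral_mkcond; congr (_ < _)%E.
by apply: eq_integral => x _; rewrite !patchE/= patchE; case: ifP => //; rewrite normr0.
Qed.

Lemma R_mrestr (f : X -> K) : measurable_fun setT f ->
  \int[mrestr mu mD]_x f x = \int[mu]_(x in D) f x.
Proof.
move=> mf; congr fine; rewrite integralE [RHS]integralE.
by congr (_ - _)%E; rewrite ge0_integral_mrestr//; [apply: measurable_funepos|
  apply: measurable_funeneg]; exact/measurable_EFinP.
Qed.

End restriction.

(** * Bump functions and primitives in time *)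

Section time.
Variables (K : realType) (T : K).
Local Notation mT := (measurableTypeR K).
Local Notation tm := (time T).
Local Notation mu := (@lebesgue_measure K).
Implicit Types h a b : mT -> K.

Lemma ae_time (P : mT -> Prop) :
  {ae tm, forall t, P t} <-> {ae mu, forall t, 0 < t < T -> P t}.
Proof.
have fF := ae_filter_ringOfSetsType mu.
split=> [/mrestr_ae|h].
  by apply: filterS => t Pt t0T; apply: Pt; rewrite /= in_itv.
apply: ae_mrestr; apply: filterS h => t Pt /=; rewrite in_itv/=; exact: Pt.
Qed.

Lemma ae_time_itv : {ae tm, forall t : mT, 0 < t < T}.
Proof. by apply/ae_time; apply: aeW. Qed.

Lemma L1_time_patch h : measurable_fun setT h ->
  L1 tm h -> L1 mu (h \_ `]0, T[).
Proof. exact: L1_mrestr. Qed.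

Lemma R_time h : measurable_fun setT h ->
  \int[tm]_t h t = \int[mu]_(t in `]0, T[) h t.
Proof. exact: R_mrestr. Qed.

Lemma ge0_time (f : mT -> \bar K) : measurable_fun setT f ->
  (forall x, 0 <= f x)%E ->
  (\int[tm]_t f t = \int[mu]_(t in `]0%R, T[) f t)%E.
Proof. exact: ge0_integral_mrestr. Qed.

(** The primitive vanishing at 0, written with an indicator under the fixed measure instead of a
    variable domain, so that linearity, Fubini and dominated convergence apply directly. *)
Definition prim h (t : K) : K := \int[tm]_s (((s : K) < t)%R%:R * h s).

Lemma meas_lt (t : mT) : measurable_fun setT (fun s : mT => (s < t)%R%:R : K).
Proof.
rewrite (_ : (fun _ => _) = \1_`]-oo, t[); first exact: measurable_indic.
by apply/funext => s; rewrite indicE mem_setE in_itv.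
Qed.

Lemma norm_lt_le (P : bool) (x : K) : `|P%:R * x| <= `|x|.
Proof. by case: P; rewrite ?mul1r// mul0r normr0. Qed.

Lemma L1_lt h (t : K) : L1 tm h -> L1 tm (fun s => (s < t)%R%:R * h s).
Proof.
move=> lh; apply: (@L1_le _ _ _ _ _ (fun s => `|h s|)).
- by apply: measurable_funM; [exact: meas_lt|exact: L1_meas lh].
- by move=> s; exact: norm_lt_le.
- exact: L1_norm.
Qed.

Lemma primD a b t : L1 tm a -> L1 tm b ->
  prim (fun s => a s + b s) t = prim a t + prim b t.
Proof.
move=> la lb; rewrite /prim -RD; [|exact: L1_lt|exact: L1_lt].
by apply: eqR => s; rewrite mulrDr.
Qed.

Lemma primZ (c : K) a t : L1 tm a -> prim (fun s => c * a s) t = c * prim a t.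
Proof.
move=> la; rewrite /prim -RZ; last exact: L1_lt.
by apply: eqR => s; rewrite mulrCA.
Qed.

Lemma primB a b t : L1 tm a -> L1 tm b ->
  prim (fun s => a s - b s) t = prim a t - prim b t.
Proof.
move=> la lb; rewrite -[in RHS](mulN1r (prim b t)) -primZ// -primD//; last exact: L1Z.
by congr prim; apply/funext => s; rewrite mulN1r.
Qed.

Lemma prim_sum (I : Type) (s : seq I) (F : I -> mT -> K) t :
  (forall i, L1 tm (F i)) ->
  prim (fun u => \sum_(i <- s) F i u) t = \sum_(i <- s) prim (F i) t.
Proof.
move=> lF; rewrite /prim -Rsum; last by move=> i _; exact: L1_lt.
by apply: eqR => u; rewrite mulr_sumr.
Qed.

Lemma eq_prim_ae a b t : measurable_fun setT a -> measurable_fun setT b ->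
  {ae tm, forall s, a s = b s} -> prim a t = prim b t.
Proof.
move=> ma mb ab; apply: R_ae.
- by apply: measurable_funM => //; exact: meas_lt.
- by apply: measurable_funM => //; exact: meas_lt.
- by apply: filterS ab => s ->.
Qed.

Lemma le_prim_ae a b t : L1 tm a -> L1 tm b ->
  {ae tm, forall s, a s <= b s} -> prim a t <= prim b t.
Proof.
move=> la lb ab; apply: R_le_ae; [exact: L1_lt|exact: L1_lt|].
by apply: filterS ab => s ab; apply: ler_wpM2l.
Qed.

Lemma norm_prim_le a t : L1 tm a -> `|prim a t| <= \int[tm]_s `|a s|.
Proof.
move=> la; apply: le_trans (R_norm (L1_lt t la)) _.
apply: R_le_ae; [exact/L1_norm/L1_lt|exact: L1_norm|].
by apply: aeW => s; exact: norm_lt_le.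
Qed.

Lemma meas_lt2 : measurable_fun setT (fun p : mT * mT => (p.1 < p.2)%R%:R : K).
Proof.
rewrite (_ : (fun _ => _) = \1_[set p : mT * mT | p.1 < p.2]).
  apply: measurable_indic; rewrite -[X in measurable X]setTI.
  rewrite (_ : [set p | _] = (fun p : mT * mT => p.1 < p.2) @^-1` [set true]).
    by apply: measurable_fun_ltr.
  by apply/funext => p /=; apply/propext; split; case: (_ < _).
apply/funext => p; rewrite indicE; congr (_%:R).
by case E : (p.1 < p.2); [rewrite mem_set|rewrite memNset//= E].
Qed.

Lemma meas_prim h : measurable_fun setT h -> measurable_fun setT (prim h : mT -> K).
Proof.
move=> mh; apply: (@meas_int2 _ _ _ _ _ tm (fun p => (p.1 < p.2)%R%:R * h p.1)).
apply: measurable_funM; first exact: meas_lt2.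
exact: measurableT_comp mh measurable_fst.
Qed.

Lemma L1_tcst (c : K) : L1 tm (fun=> c).
Proof. by apply: L1_cst; rewrite ltey_eq fin_num_measure. Qed.

Lemma L1_mul_prim a b : L1 tm a -> L1 tm b -> L1 tm (fun s => a s * prim b s).
Proof.
move=> la lb; apply: (@L1_mul_bounded _ _ _ _ (\int[tm]_s `|b s|)) => //.
  exact: meas_prim (L1_meas lb).
by apply: aeW => t; exact: norm_prim_le.
Qed.

Lemma ae_neq (t : mT) : {ae tm, forall s : mT, s != t}.
Proof.
apply/ae_time; exists [set t]; split => //; first exact: lebesgue_measure_set1.
move=> s /= h; apply: contrapT => st; apply: h => _; exact/eqP.
Qed.

(** Integration by parts without differentiating: the product is a double integral over a square,
    cut along the diagonal, which is null. Fubini in the two orders gives the two terms. *)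
Lemma prim_mul a b t : L1 tm a -> L1 tm b ->
  prim a t * prim b t = prim (fun s => a s * prim b s + prim a s * b s) t.
Proof.
move=> la lb.
pose F (p : mT * mT) := ((p.1 < t)%R%:R * a p.1) * ((p.2 < t)%R%:R * b p.2).
have lF : L1 (tm \x tm)%E F by exact: (L1_prodM (L1_lt t la) (L1_lt t lb)).
have mlt2 : measurable_fun setT (fun p : mT * mT => (p.2 < p.1)%R%:R : K).
  have sw : measurable_fun setT (fun p : mT * mT => (p.2, p.1)).
    by apply: measurable_fun_pair; [exact: measurable_snd|exact: measurable_fst].
  exact: (measurableT_comp meas_lt2 sw).
have lF1 : L1 (tm \x tm)%E (fun p => (p.2 < p.1)%R%:R * F p).
  apply: (@L1_le _ _ _ _ _ (fun s => `|F s|)); last exact: L1_norm.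
    by apply: measurable_funM => //; exact: L1_meas lF.
  by move=> p; exact: norm_lt_le.
have lF2 : L1 (tm \x tm)%E (fun p => (p.1 < p.2)%R%:R * F p).
  apply: (@L1_le _ _ _ _ _ (fun s => `|F s|)); last exact: L1_norm.
    by apply: measurable_funM; [exact: meas_lt2|exact: L1_meas lF].
  by move=> p; exact: norm_lt_le.
have -> : prim a t * prim b t = \int[(tm \x tm)%E]_p F p.
  rewrite R_fubini1// /prim -RZr; last exact: L1_lt.
  by apply: eqR => s; rewrite -RZ//; exact: L1_lt.
transitivity (\int[(tm \x tm)%E]_p ((p.2 < p.1)%R%:R * F p + (p.1 < p.2)%R%:R * F p)).
  apply: R_ae; [exact: L1_meas lF|exact: (L1_meas (L1D lF1 lF2))|].
  apply: (@ae_prod1 _ _ _ _ _ _ _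
    [set p | F p = (p.2 < p.1)%R%:R * F p + (p.1 < p.2)%R%:R * F p]).
    rewrite -[X in measurable X]setTI.
    rewrite (_ : [set p | _] = (fun p => F p == ((p.2 < p.1)%R%:R * F p + (p.1 < p.2)%R%:R * F p)) @^-1` [set true]).
      by apply: measurable_fun_eqr => //; [exact: L1_meas lF|exact: (L1_meas (L1D lF1 lF2))].
    by apply/funext => p /=; apply/propext; split=> /eqP.
  apply: aeW => s; apply: filterS (ae_neq s) => u us /=.
  case: (ltgtP u s) us => //= _ _; rewrite ?mul1r ?mul0r ?addr0 ?add0r//.
rewrite RD// R_fubini1// R_fubini2//= primD; last 2 first.
- exact: L1_mul_prim.
- by apply: eq_L1 (L1_mul_prim lb la) => s; rewrite mulrC.
congr (_ + _).
- apply: eqR => s; rewrite /F/= mulrA -[in RHS]/(prim b s) /prim -RZ; last exact: L1_lt.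
  apply: eqR => u; case: (ltP u s) => us; rewrite ?mul0r ?mulr0 ?mul1r//.
  by case: (ltP s t) => st; rewrite ?mul0r// (lt_trans us st) !mul1r.
- apply: eqR => u; rewrite /F/= mulrCA [in RHS]mulrC.
  rewrite /prim -RZ; last exact: L1_lt.
  apply: eqR => s; case: (ltP s u) => su; rewrite ?mul0r ?mulr0 ?mul1r//.
  case: (ltP u t) => ut; rewrite ?mul0r ?mulr0//.
  by rewrite (lt_trans su ut) !mul1r mulrC.
Qed.

(** The product rule for functions given as an initial value plus a primitive. It is what later
    allows moments of the weak solution to be multiplied by moments of a Lipschitz field. *)
Lemma prim_mulD (A B : K) a b t : L1 tm a -> L1 tm b ->
  (A + prim a t) * (B + prim b t) =
  A * B + prim (fun s => a s * (B + prim b s) + (A + prim a s) * b s) t.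
Proof.
move=> la lb.
have l1 := L1_mul_prim la lb.
have l2 : L1 tm (fun s => prim a s * b s).
  by apply: eq_L1 (L1_mul_prim lb la) => s; rewrite mulrC.
rewrite mulrDl !mulrDr prim_mul// (_ : prim (fun s => a s * (B + _) + _) t =
   prim (fun s => (B * a s + A * b s) + (a s * prim b s + prim a s * b s)) t).
  rewrite !primD ?primZ//; last 4 first.
  - exact: L1Z.
  - exact: L1Z.
  - by apply: L1D; exact: L1Z.
  - exact: L1D.
  ring.
by congr prim; apply/funext => s; ring.
Qed.

End time.

(** * Compactly supported smooth functions of time *)

Section tbump.
Variable K : realType.
Implicit Types (k : nat) (x : K).

(** The functions x^(-k) exp(-1/x) extended by 0. The family is closed under differentiation up to
    linear combinations, which gives smoothness at 0 by induction. *)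
Definition flat k x : K := if 0 < x then x^-1 ^+ k * expR (- x^-1) else 0.

Lemma flat_ge0 k x : 0 <= flat k x.
Proof.
rewrite /flat; case: ltP => // x0.
by rewrite mulr_ge0 ?expR_ge0// exprn_ge0// invr_ge0 ltW.
Qed.

(** With y = 1/x, the bound exp(y) >= y^(k+1)/(k+1)! makes y^k exp(-y) at most (k+1)!/y. *)
Lemma flat_le k x : 0 < x -> flat k x <= (k.+1)`!%:R * x.
Proof.
move=> x0; rewrite /flat x0; set y := x^-1.
have y0 : 0 < y by rewrite invr_gt0.
have := expR_ge1Dxn k (ltW y0); set f := (k.+1)`!%:R.
have f0 : 0 < f :> K by rewrite ltr0n fact_gt0.
move=> h; rewrite expRN -[x]invrK -/y ler_pdivrMr ?expR_gt0//.
rewrite mulrAC ler_pdivlMr//.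
have {}h : y ^+ k.+1 / f <= expR y by apply: le_trans h; rewrite lerDr.
by rewrite ler_pdivrMr// in h; rewrite -exprSr mulrC.
Qed.

Lemma flatS k x : flat k x = flat k.+1 x * x.
Proof.
rewrite /flat; case: ltP => x0; last by rewrite mul0r.
rewrite exprSr -!mulrA; congr (_ * _).
by rewrite mulrCA mulVf ?gt_eqF// mulr1.
Qed.

Lemma is_derive_flat k x :
  is_derive x 1 (flat k) (flat k.+2 x - k%:R * flat k.+1 x).
Proof.
case: (ltgtP x 0) => [x0|x0|->].
- have -> : flat k.+2 x - k%:R * flat k.+1 x = 0.
    by rewrite /flat ltNge (ltW x0)/= mulr0 subr0.
  have dc : is_derive x 1 (cst (0 : K)) 0 by exact: is_derive_cst.
  apply: near_eq_is_derive dc.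
  near=> y; have : y < 0 by near: y; exact: lt_nbhsl.
  by rewrite /cst/flat/= => y0; rewrite ltNge (ltW y0).
- have dV : is_derive x 1 (fun y : K => y^-1) (- x^-1 ^+ 2).
    have xn0 : x != 0 by rewrite gt_eqF.
    apply: DeriveDef; first exact: derivableV.
    by rewrite deriveV// derive_id /GRing.scale/= mulr1 exprVn.
  have dE : is_derive x 1 (fun y : K => expR (- y^-1)) (x^-1 ^+ 2 * expR (- x^-1)).
    have h := @is_derive1_comp _ expR (fun y : K => - y^-1) x _ _
      (is_derive_expR _) (is_deriveN dV).
    by apply: (is_derive_eq h); rewrite opprK mulrC.
  have h := is_deriveM (is_deriveX k dV) dE.
  have {}h : is_derive x 1 (fun y : K => y^-1 ^+ k * expR (- y^-1))
                       (flat k.+2 x - k%:R * flat k.+1 x).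
    rewrite (_ : (fun y => _) = GRing.inv ^+ k * (fun y : K => expR (- y^-1))); last first.
      by apply/funext => y; rewrite !fctE.
    apply: (is_derive_eq h); rewrite !fctE /flat x0 /GRing.scale/=.
    case: k {h} => [|k]; first by rewrite !expr0; ring.
    by rewrite !exprS /=; ring.
  apply: near_eq_is_derive h.
  near=> y; have : 0 < y by near: y; exact: lt_nbhsr.
  by rewrite /flat => ->.
- have -> : flat k.+2 0 - k%:R * flat k.+1 0 = 0.
    by rewrite /flat ltxx mulr0 subr0.
  suff c : h^-1 *: (flat k (h *: 1 + 0) - flat k 0) @[h --> 0^'] --> (0 : K).
    apply: DeriveDef; first by apply/cvg_ex; exists 0.
    exact/cvg_lim.
  have -> : flat k 0 = 0 by rewrite /flat ltxx.
  have h0 : (k.+2)`!%:R * `|h| @[h --> (0:K)^'] --> (0 : K).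
    rewrite -[X in _ --> X](mulr0 (k.+2)`!%:R); apply: cvgMr.
    rewrite -[X in _ --> X](@normr0 _ K); apply: cvg_norm.
    exact: nbhs_dnbhs.
  apply: norm_cvg0; apply: (@squeeze_cvgr _ _ _ _ (cst 0)); last 2 first.
  - exact: cvg_cst.
  - exact: h0.
  near=> h; have hn0 : h != 0 by near: h; exact: nbhs_dnbhs_neq.
  rewrite normr_ge0/= addr0 subr0 /GRing.scale/= mulr1 normrM (ger0_norm (flat_ge0 _ _)).
  case: (leP h 0) => hle; first by rewrite /flat ltNge hle/= mulr0 mulr_ge0.
  (* For h > 0 the difference quotient at 0 equals [flat k.+1 h], hence is at most (k+2)! h. *)
  rewrite (gtr0_norm hle) normfV gtr0_norm// flatS mulrCA mulVf ?mulr1//.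
  exact: flat_le.
Unshelve. all: by end_near. Qed.

Definition smooth1 (f : K -> K) := forall n t, derivable (derive1n n f) t 1.

(** A syntax closed under the symbolic derivative [tder], so that one first-order lemma gives
    smoothness of every order. *)
Inductive texpr := TCst of K | TFlat of nat & K & K
  | TAdd of texpr & texpr | TMul of texpr & texpr.

Fixpoint teval (e : texpr) (t : K) : K := match e with
  | TCst c => c
  | TFlat k a b => flat k (a * t + b)
  | TAdd e1 e2 => teval e1 t + teval e2 t
  | TMul e1 e2 => teval e1 t * teval e2 t
  end.

Fixpoint tder (e : texpr) : texpr := match e with
  | TCst c => TCst 0
  | TFlat k a b => TMul (TCst a)
      (TAdd (TFlat k.+2 a b) (TMul (TCst (- k%:R)) (TFlat k.+1 a b)))
  | TAdd e1 e2 => TAdd (tder e1) (tder e2)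
  | TMul e1 e2 => TAdd (TMul e1 (tder e2)) (TMul (tder e1) e2)
  end.

Lemma is_derive_teval e (t : K) : is_derive t 1 (teval e) (teval (tder e) t).
Proof.
elim: e => [c|k a b|e1 h1 e2 h2|e1 h1 e2 h2] /=.
- exact: is_derive_cst.
- have hl : is_derive t 1 (fun t : K => a * t + b) a.
    have h := is_deriveD (is_deriveZ a (is_derive_id t (1 : K))) (is_derive_cst b t (1 : K)).
    by apply: (is_derive_eq h); rewrite addr0 /GRing.scale/= mulr1.
  have h := @is_derive1_comp _ (flat k) _ t _ _ (is_derive_flat k (a * t + b)) hl.
  by apply: (is_derive_eq h); rewrite mulrC mulNr.
- have h := is_deriveD h1 h2; exact: (is_derive_eq h).
- have h := is_deriveM h1 h2; apply: (is_derive_eq h).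
  by rewrite /GRing.scale/= [X in _ + X]mulrC.
Qed.

Lemma derive1_teval e : derive1 (teval e) = teval (tder e).
Proof.
by apply/funext => t; rewrite derive1E; have [_ ->] := is_derive_teval e t.
Qed.

Lemma smooth1_teval e : smooth1 (teval e).
Proof.
suff h n : exists e', derive1n n (teval e) = teval e'.
  by move=> n t; have [e' ->] := h n; have [] := is_derive_teval e' t.
elim: n => [|n [e' h]]; first by exists e.
by exists (tder e'); rewrite derive1nS h derive1_teval.
Qed.

Lemma smooth1_prim (F f : K -> K) :
  (forall t : K, is_derive t 1 F (f t)) -> smooth1 f -> smooth1 F.
Proof.
move=> dF sf [|n] t; first by rewrite derive1n0; have [] := dF t.
rewrite derive1Sn (_ : derive1 F = f) //.
by apply/funext => s; rewrite derive1E; have [_ ->] := dF s.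
Qed.

Lemma smooth1_continuous f : smooth1 f -> continuous f.
Proof.
move=> sf t; apply: differentiable_continuous; apply/derivable1_diffP.
exact: sf 0 t.
Qed.

(** With m = n+1, this is exp(-1/(m(t-a))) exp(-1/(m(b-t))) on ]a, b[ and 0 elsewhere. It tends to
    the indicator of ]a, b[ as [n] grows. *)
Definition tbump (a b : K) (n : nat) : texpr :=
  TMul (TFlat 0 n.+1%:R (- (n.+1%:R * a))) (TFlat 0 (- n.+1%:R) (n.+1%:R * b)).

Lemma bumpE a b n t : teval (tbump a b n) t =
  flat 0 (n.+1%:R * (t - a)) * flat 0 (n.+1%:R * (b - t)).
Proof. by rewrite /=; congr (flat _ _ * flat _ _); ring. Qed.

Lemma flat0_le1 x : flat 0 x <= 1.
Proof.
rewrite /flat; case: ltP => // x0; rewrite expr0 mul1r expRN invf_le1 ?expR_gt0//.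
by rewrite -expR0 ler_expR invr_ge0 ltW.
Qed.

Lemma flat0_le0 k x : x <= 0 -> flat k x = 0.
Proof. by rewrite /flat ltNge => ->. Qed.

Lemma bump_ge0 a b n t : 0 <= teval (tbump a b n) t.
Proof. by rewrite bumpE mulr_ge0 ?flat_ge0. Qed.

Lemma bump_le1 a b n t : teval (tbump a b n) t <= 1.
Proof. by rewrite bumpE mulr_ile1 ?flat_ge0 ?flat0_le1. Qed.

Lemma bump_out a b n t : ~~ (a < t < b) -> teval (tbump a b n) t = 0.
Proof.
rewrite bumpE negb_and -!leNgt => /orP[ta|bt].
  by rewrite (@flat0_le0 0 (_ * (t - a))) ?mul0r// mulr_ge0_le0// subr_le0.
by rewrite (@flat0_le0 0 (_ * (b - t))) ?mulr0// mulr_ge0_le0// subr_le0.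
Qed.

Lemma bump_gt0 a b n t : a < t < b -> 0 < teval (tbump a b n) t.
Proof.
move=> /andP[at_ tb]; rewrite bumpE /flat !expr0 !mul1r.
by rewrite !mulr_gt0 ?subr_gt0 ?ltr0n// expR_gt0.
Qed.

Lemma flat0_cvg x : 0 < x -> flat 0 (n.+1%:R * x) @[n --> \oo] --> (1 : K).
Proof.
move=> x0; have -> : (fun n => flat 0 (n.+1%:R * x)) =
    (fun n => expR (- (n.+1%:R^-1 * x^-1))).
  by apply/funext => n; rewrite /flat mulr_gt0 ?ltr0n// expr0 mul1r invfM.
rewrite -[X in _ --> X](@expR0 K); apply: continuous_cvg; first exact: continuous_expR.
rewrite -[X in _ --> X]oppr0; apply: cvgN.
rewrite -[X in _ --> X](mul0r x^-1); apply: cvgMl.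
exact: (@cvg_harmonic K).
Qed.

Lemma bump_cvg a b t :
  teval (tbump a b n) t @[n --> \oo] --> ((a < t < b)%R%:R : K).
Proof.
case: (boolP (a < t < b)) => [/andP[at_ tb]|tab]; last first.
  by under eq_fun do rewrite bump_out//; exact: cvg_cst.
rewrite (_ : (fun n => _) = (fun n => flat 0 (n.+1%:R * (t - a)) *
  flat 0 (n.+1%:R * (b - t)))); last by apply/funext => n; rewrite bumpE.
rewrite (_ : true%:R = 1 * 1 :> K); last by rewrite mulr1.
by apply: cvgM; apply: flat0_cvg; rewrite subr_gt0.
Qed.

End tbump.

(** * Primitives against test functions of time *)

Section time_calculus.
Variables (K : realType) (T : K).
Local Notation mT := (measurableTypeR K).
Local Notation tm := (time T).
Local Notation mu := (@lebesgue_measure K).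
Implicit Types h a b : mT -> K.

(** The integral over a half-line is the form to which the Lebesgue differentiation theorem applies
    in [prim_derive]. *)
Lemma prim_leb h (t : K) : L1 tm h ->
  prim T h t = \int[mu]_(s in `]-oo, t]) ((h \_ `]0, T[) s).
Proof.
move=> lh; have lp := L1_time_patch (L1_meas lh) lh.
rewrite -Rintegral_itv_bndo_bndc; last first.
  exact: (integrableS measurableT _ _ lp).
rewrite /prim R_time; last first.
  by apply: measurable_funM; [exact: meas_lt|exact: L1_meas lh].
rewrite Rintegral_mkcond [RHS]Rintegral_mkcond; apply: eq_Rintegral => s _.
rewrite !patchE !mem_setE/= !in_itv/=.
by case: ifP => //; case: ifP; rewrite ?mul1r// mul0r.
Qed.

Lemma prim_derive h : L1 tm h ->
  {ae tm, forall t : mT, is_derive (t : K) (1 : K) (prim T h) (h t)}.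
Proof.
move=> lh; have lp := L1_time_patch (L1_meas lh) lh.
have fF := ae_filter_ringOfSetsType mu.
apply/ae_time.
have := @FTC1Ny K (h \_ `]0, T[).
have int1 y : mu.-integrable `]-oo, y] (EFin \o (h \_ `]0, T[)).
  exact: (integrableS measurableT _ _ lp).
move=> /(_ int1 (open_integrable_locally openT lp)).
apply: filterS => t /= [dt et] t0T.
rewrite (_ : prim T h = (fun x => \int[mu]_(s in `]-oo, x]) ((h \_ `]0, T[) s))).
  by apply: DeriveDef => //; rewrite -derive1E et patchE mem_set.
by apply/funext => x; exact: prim_leb.
Qed.

Lemma prim_const_eq0 h (c : K) : L1 tm h ->
  (forall t : K, 0 < t < T -> prim T h t = c) -> {ae tm, forall t, h t = 0}.
Proof.
move=> lh hc; apply: filterS2 (prim_derive lh) (ae_time_itv T) => t [dt <-] t0T.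
have -> : 'D_1 (prim T h) t = 'D_1 (cst c) t.
  apply: near_eq_derive; move: t0T => /andP[t0 tT].
  by near=> s; apply: hc; apply/andP; split; near: s;
    [exact: lt_nbhsr|exact: lt_nbhsl].
exact: derive_cst.
Unshelve. all: by end_near. Qed.

Lemma primT h : L1 tm h -> prim T h T = \int[tm]_t h t.
Proof.
move=> lh; apply: R_ae; [exact: L1_meas (L1_lt T lh)|exact: L1_meas lh|].
by apply: filterS (ae_time_itv T) => t /andP[_ tT]; rewrite tT mul1r.
Qed.

Lemma L1_cont_mul h (g : K -> K) (M : K) : L1 tm h -> continuous g ->
  (forall t, `|g t| <= M) -> L1 tm (fun t => h t * g t).
Proof.
move=> lh cg gM; apply: (@L1_mul_bounded _ _ _ _ M) => //.
  exact: continuous_measurable_fun.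
by apply: aeW.
Qed.

Lemma L1_cont (g : K -> K) (M : K) : continuous g ->
  (forall t, `|g t| <= M) -> L1 tm g.
Proof.
move=> cg gM; apply: eq_L1 (L1_cont_mul (L1_tcst T 1) cg gM) => t.
by rewrite mul1r.
Qed.

(** The bumps tend boundedly to indicators of intervals, so the primitive of [h] is constant on ]0,
    T[; its derivative is [h] almost everywhere. *)
Lemma bump_ae0 h : L1 tm h ->
  (forall (a b : K) n, 0 < a -> a < b -> b < T ->
     \int[tm]_t (h t * teval (tbump a b n) t) = 0) ->
  {ae tm, forall t, h t = 0}.
Proof.
move=> lh h0.
have mb (a b : K) n : measurable_fun setT (teval (tbump a b n) : mT -> K).
  by apply: continuous_measurable_fun; exact/smooth1_continuous/smooth1_teval.
have mi (a b : K) : measurable_fun setT (fun t : mT => (a < t < b)%R%:R : K).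
  rewrite (_ : (fun _ => _) = \1_`]a, b[); first exact: measurable_indic.
  by apply/funext => s; rewrite indicE mem_setE in_itv.
have h1 (a b : K) : 0 < a -> a < b -> b < T -> \int[tm]_t (h t * (a < t < b)%R%:R) = 0.
  move=> a0 ab bT.
  have [] := @R_dct _ _ _ tm (fun n t => h t * teval (tbump a b n) t)
     (fun t => h t * (a < t < b)%R%:R) (fun t => `|h t|).
  - by move=> n; apply: measurable_funM => //; exact: L1_meas lh.
  - by apply: measurable_funM => //; exact: L1_meas lh.
  - by apply: aeW => t; apply: cvgM; [exact: cvg_cst|exact: bump_cvg].
  - exact: L1_norm.
  - apply: aeW => t n; rewrite normrM ler_piMr// ger0_norm ?bump_ge0//.
    exact: bump_le1.
  move=> _; under eq_fun do rewrite h0//.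
  by move/cvg_lim => /(_ (@Rhausdorff K)) <-; rewrite lim_cst.
have pc (a b : K) : 0 < a -> a < b -> b < T -> prim T h a = prim T h b.
  move=> a0 ab bT; apply/eqP; rewrite eq_sym -subr_eq0; apply/eqP.
  rewrite /prim -RB; [|exact: L1_lt|exact: L1_lt].
  rewrite -(h1 a b)//; apply: R_ae.
  - by apply: L1_meas (L1B (L1_lt b lh) (L1_lt a lh)).
  - by apply: measurable_funM => //; exact: L1_meas lh.
  apply: filterS (ae_neq T a) => s sa.
  rewrite -mulrBl mulrC; congr (_ * _).
  case: (ltgtP s a) sa => //= [sa|sa] _; last by rewrite subr0.
  by rewrite (lt_trans sa ab) subrr.
apply: (prim_const_eq0 lh (c := prim T h (T / 2))) => t /andP[t0 tT].
have T0 : 0 < T by exact: lt_trans t0 tT.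
case: (ltgtP t (T / 2)) => [tT2|tT2|-> //].
- by apply: pc => //; rewrite ltr_pdivrMr// ltr_pMr// ltr1n.
- by symmetry; apply: pc => //; rewrite divr_gt0.
Qed.

Definition ttest (chi : K -> K) :=
  [/\ smooth1 chi, (exists2 T', T' < T & forall t, T' <= t -> chi t = 0) &
      exists2 t0, 0 < t0 & forall t, t <= t0 -> chi t = 0].

Lemma ttest_bump (a b : K) n : 0 < a -> b < T -> ttest (teval (tbump a b n)).
Proof.
move=> a0 bT; split; first exact: smooth1_teval.
- by exists b => // t bt; apply: bump_out; rewrite negb_and -!leNgt bt orbT.
- by exists a => // t ta; apply: bump_out; rewrite negb_and -!leNgt ta.
Qed.

Lemma fundamental_time h : L1 tm h ->
  (forall chi, ttest chi -> \int[tm]_t (h t * chi t) = 0) ->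
  {ae tm, forall t, h t = 0}.
Proof.
move=> lh h0; apply: bump_ae0 => // a b n a0 ab bT.
by apply: h0; exact: ttest_bump.
Qed.

Lemma is_derive_prim (g : K -> K) (a b : K) : 0 < a -> b < T -> continuous g ->
  (forall t, ~~ (a < t < b) -> g t = 0) ->
  forall t : K, is_derive t 1 (prim T g) (g t).
Proof.
move=> a0 bT cg g0 t.
have mg : measurable_fun setT (g : mT -> K) by exact: continuous_measurable_fun.
have gi (x : K) : mu.-integrable `[-1, x] (EFin \o g).
  apply: continuous_compact_integrable; first exact: segment_compact.
  exact: continuous_subspaceT.
(* Any base point left of the support gives the same integral; [-1] leaves room for the fundamental
   theorem at every t > 0, the case t <= 0 being treated apart. *)
have pE (x : K) : prim T g x = \int[mu]_(s in `[-1, x]) g s.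
  rewrite -Rintegral_itv_bndo_bndc; last first.
    apply: (integrableS _ _ _ (gi x)) => //.
    by apply: subset_itvl; rewrite bnd_simp.
  rewrite /prim R_time; last by apply: measurable_funM => //; exact: meas_lt.
  rewrite Rintegral_mkcond [RHS]Rintegral_mkcond; apply: eq_Rintegral => s _.
  rewrite !patchE !mem_setE/= !in_itv/=.
  have [/andP[as_ sb]|/g0 ->] := boolP (a < s < b); last by rewrite mulr0 !if_same.
  rewrite (lt_trans a0 as_) (lt_trans sb bT) (le_trans _ (ltW as_))/=; last first.
    by rewrite (le_trans _ (ltW a0))// lerN10.
  by case: ifP => _; rewrite ?mul1r ?mul0r.
have [tN|tN] := leP t 0.
  rewrite g0; last by rewrite negb_and -!leNgt (le_trans tN (ltW a0)).
  have dc : is_derive t 1 (cst (0 : K)) 0 by exact: is_derive_cst.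
  apply: near_eq_is_derive dc.
  near=> y; have ya : y < a by near: y; apply: lt_nbhsl; exact: le_lt_trans a0.
  rewrite /cst/= pE -[LHS](@Rintegral_set0 _ _ _ mu g).
  rewrite Rintegral_mkcond [RHS]Rintegral_mkcond; apply: eq_Rintegral => s _.
  rewrite !patchE mem_setE in_set0/= in_itv/=; case: ifP => // /andP[_ sy].
  by rewrite g0// negb_and -!leNgt (le_trans sy (ltW ya)).
have t1 : t < t + 1 by rewrite ltrDl.
have [] := @continuous_FTC1_closed K g (-1) t (t + 1) t1 (gi _) _ (cg t).
  by apply: lt_trans tN; rewrite ltrN10.
move=> dt et; rewrite (_ : prim T g = (fun x => \int[mu]_(s in `[-1, x]) g s)).
  by apply: DeriveDef; [exact: dt|rewrite -derive1E; exact: et].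
by apply/funext.
Unshelve. all: by end_near. Qed.

(** A bump corrected by a multiple of the fixed bump [th0] has zero integral, so its primitive is an
    admissible test. Such tests show that [f - prim T h] minus its average against [th0] is
    orthogonal to every bump. *)
Lemma dubois_reymond f h : 0 < T -> L1 tm f -> L1 tm h ->
  (forall chi, ttest chi ->
     \int[tm]_t (f t * derive1 chi t + h t * chi t) = 0) ->
  exists c : K, {ae tm, forall t, f t = c + prim T h t}.
Proof.
move=> T0 lf lh H.
pose th0 := tbump (T / 3) (2 * T / 3) 0.
have cb (a b : K) n : continuous (teval (tbump a b n) : K -> K).
  exact/smooth1_continuous/smooth1_teval.
have nb (a b : K) n t : `|teval (tbump a b n) t| <= 1.
  by rewrite ger0_norm; [exact: bump_le1|exact: bump_ge0].
have lb (a b : K) n : L1 tm (teval (tbump a b n)) by exact: L1_cont (cb _ _ _) (nb _ _ _).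
have T30 : 0 < T / 3 by rewrite divr_gt0.
have T3T : 2 * T / 3 < T by lra.
pose m0 := \int[tm]_t teval th0 t.
have m0_gt0 : 0 < m0.
  have m00 : 0 <= m0 by apply: Rintegral_ge0 => t _; exact: bump_ge0.
  rewrite lt_neqAle m00 andbT; apply/eqP => m0E.
  (* If the mass of [th0] were 0, its primitive would vanish identically, while its derivative at
     [T / 2] is a positive value of the bump. *)
  have p0 : prim T (teval th0) = cst 0.
    apply/funext => t; apply/eqP; rewrite eq_le; apply/andP; split.
      apply: (@le_trans _ _ m0); last by rewrite -m0E.
      apply: R_le_ae; [exact: L1_lt (lb _ _ _)|exact: lb|].
      apply: aeW => s; case: (_ < _); rewrite ?mul1r// mul0r; exact: bump_ge0.
    by apply: Rintegral_ge0 => s _; rewrite mulr_ge0// bump_ge0.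
  have := @is_derive_prim _ _ _ T30 T3T (cb _ _ 0) (fun t => @bump_out _ _ _ 0 t) (T / 2).
  rewrite p0 => -[_]; rewrite derive_cst => /esym/eqP.
  by rewrite gt_eqF// bump_gt0//; apply/andP; split; lra.
pose F t := f t - prim T h t.
have lp : L1 tm (prim T h).
  by apply: eq_L1 (L1_mul_prim (L1_tcst T 1) lh) => t; rewrite mul1r.
have lF : L1 tm F by exact: L1B.
pose c := (\int[tm]_t (F t * teval th0 t)) / m0.
exists c; suff: {ae tm, forall t, F t - c = 0}.
  by apply: filterS => t /eqP; rewrite subr_eq0 => /eqP <-; rewrite subrK.
apply: bump_ae0; first exact: L1B lF (L1_tcst T c).
move=> a b n a0 ab bT; set th := tbump a b n.
(* The multiple of [th0] that makes the integral of [e] vanish. *)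
pose m := (\int[tm]_t teval th t) / m0.
pose e := TAdd th (TMul (TCst (- m)) th0).
pose a' := Num.min a (T / 3); pose b' := Num.max b (2 * T / 3).
have a'0 : 0 < a' by rewrite lt_min a0 T30.
have b'T : b' < T by rewrite gt_max bT T3T.
have eE t : teval e t = teval th t + (- m) * teval th0 t by [].
have e_out t : ~~ (a' < t < b') -> teval e t = 0.
  move=> nt; rewrite eE.
  have ha : ~~ (a < t < b).
    apply: contra nt => /andP[at_ tb]; rewrite /a' /b' gt_min at_/=.
    by rewrite lt_max tb.
  have hT : ~~ (T / 3 < t < 2 * T / 3).
    apply: contra nt => /andP[at_ tb]; rewrite /a' /b' gt_min at_ orbT/=.
    by rewrite lt_max tb orbT.
  by rewrite (bump_out n ha) (bump_out 0 hT) mulr0 addr0.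
have ce : continuous (teval e) by exact/smooth1_continuous/smooth1_teval.
have le : L1 tm (teval e) by apply: L1D; [exact: lb|apply: L1Z; exact: lb].
have dchi := is_derive_prim a'0 b'T ce e_out.
have d1 : derive1 (prim T (teval e)) = teval e.
  by apply/funext => t; rewrite derive1E; have [_ ->] := dchi t.
have e0 : \int[tm]_t teval e t = 0.
  under eqR do rewrite eE.
  rewrite RD; [|exact: lb|apply: L1Z; exact: lb].
  rewrite RZ; last exact: lb.
  by rewrite mulNr -/m0 /m divfK ?gt_eqF// subrr.
have tchi : ttest (prim T (teval e)).
  split; first by apply: smooth1_prim dchi _; exact: smooth1_teval.
    exists b' => // t bt; rewrite -[RHS]e0 -primT//.
    rewrite /prim; apply: eqR => s.
    have [/andP[_ sb]|/e_out ->] := boolP (a' < s < b'); last by rewrite !mulr0.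
    by rewrite (lt_le_trans sb bt) (lt_trans sb b'T).
  exists a' => // t ta; rewrite -[RHS](@R0 _ _ K tm); apply: eqR => s.
  have [/andP[as_ _]|/e_out ->] := boolP (a' < s < b'); last by rewrite mulr0.
  by rewrite ltNge (le_trans ta (ltW as_)) mul0r.
have M t : `|teval e t| <= 1 + `|m|.
  rewrite eE; apply: le_trans (ler_normD _ _) _; apply: lerD; first exact: nb.
  by rewrite normrM normrN ler_piMr//; exact: nb.
have := H _ tchi; rewrite d1.
have lfe : L1 tm (fun t => f t * teval e t) by exact: L1_cont_mul lf ce M.
have lpe : L1 tm (fun t => prim T h t * teval e t) by exact: L1_cont_mul lp ce M.
rewrite RD//; last exact: L1_mul_prim.
(* At [T] the primitive of [e] vanishes, so the integral of [h] against it is minus the integral of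
   [prim T h] against [e]. *)
have := prim_mul T lh le; rewrite (primT le) e0 mulr0.
rewrite primT; last by apply: L1D; [exact: L1_mul_prim|].
rewrite RD//; last exact: L1_mul_prim.
move=> /esym/eqP; rewrite addr_eq0 => /eqP ->.
rewrite -RB// => H0.
have {}H0 : \int[tm]_t (F t * teval e t) = 0.
  by rewrite -H0; apply: eqR => t; rewrite /F mulrBl.
have lFb (a1 b1 : K) n1 : L1 tm (fun t => F t * teval (tbump a1 b1 n1) t).
  exact: L1_cont_mul lF (cb _ _ _) (nb _ _ _).
transitivity (\int[tm]_t (F t * teval th t - c * teval th t)).
  by apply: eqR => t; rewrite mulrBl.
rewrite RB//; [|exact: lFb|apply: L1Z; exact: lb].
rewrite RZ; last exact: lb.
move: H0; rewrite (_ : (fun t => F t * _) =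
    (fun t => F t * teval th t - m * (F t * teval th0 t))); last first.
  by apply/funext => t; rewrite eE; ring.
rewrite RB//; [|exact: lFb|apply: L1Z; exact: lFb].
rewrite RZ; last exact: lFb.
by move=> <-; congr (_ - _); rewrite /c /m; field; rewrite gt_eqF.
Qed.

End time_calculus.

(** * Trigonometric polynomials and smoothing kernels *)

Section trig.
Variables (K : realType) (d : nat).
Local Notation pt := 'rV[K]_d.
Local Notation dirv := (@dirv K d).

(** Trigonometric polynomials as syntax: periodicity, boundedness and all derivatives come by
    structural induction, and the symbolic derivatives commute. *)
Inductive xexpr := XCst of K | XCos of 'I_d | XSin of 'I_d
  | XAdd of xexpr & xexpr | XMul of xexpr & xexpr.

Fixpoint xeval (e : xexpr) (x : pt) : K := match e with
  | XCst c => c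
  | XCos i => cos (2 * pi * x 0 i)
  | XSin i => sin (2 * pi * x 0 i)
  | XAdd e1 e2 => xeval e1 x + xeval e2 x
  | XMul e1 e2 => xeval e1 x * xeval e2 x
  end.

Fixpoint xder (j : 'I_d) (e : xexpr) : xexpr := match e with
  | XCst c => XCst 0
  | XCos i => XMul (XCst (- (2 * pi) *+ (i == j))) (XSin i)
  | XSin i => XMul (XCst ((2 * pi) *+ (i == j))) (XCos i)
  | XAdd e1 e2 => XAdd (xder j e1) (xder j e2)
  | XMul e1 e2 => XAdd (XMul e1 (xder j e2)) (XMul (xder j e1) e2)
  end.

Lemma xderC i j e x : xeval (xder i (xder j e)) x = xeval (xder j (xder i e)) x.
Proof.
elim: e => [c|k|k|e1 h1 e2 h2|e1 h1 e2 h2] //=.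
- by case: (k == i); case: (k == j) => //=; rewrite ?mulr0n ?mulr1n; ring.
- by case: (k == i); case: (k == j) => //=; rewrite ?mulr0n ?mulr1n; ring.
- by rewrite h1 h2.
- by rewrite h1 h2; ring.
Qed.

Lemma meas_xeval e : measurable_fun [set: pt] (xeval e).
Proof.
have mc : measurable_fun [set: K] (@cos K).
  by apply: continuous_measurable_fun; exact: continuous_cos.
have ms : measurable_fun [set: K] (@sin K).
  by apply: continuous_measurable_fun; exact: continuous_sin.
have ml k : measurable_fun [set: pt] (fun x : pt => 2 * pi * x 0 k).
  by apply: measurable_funM => //; exact: measurable_coord.
elim: e => [c|k|k|e1 h1 e2 h2|e1 h1 e2 h2] /=.
- exact: measurable_cst.
- exact: (measurableT_comp mc (ml k)).
- exact: (measurableT_comp ms (ml k)).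
- exact: measurable_funD.
- exact: measurable_funM.
Qed.

Lemma xeval_bounded e : exists M, forall x, `|xeval e x| <= M.
Proof.
elim: e => [c|k|k|e1 [M1 h1] e2 [M2 h2]|e1 [M1 h1] e2 [M2 h2]] /=.
- by exists `|c|.
- by exists 1 => x; rewrite ler_norml cos_le1 cos_geN1.
- by exists 1 => x; rewrite ler_norml sin_le1 sin_geN1.
- exists (M1 + M2) => x; apply: le_trans (ler_normD _ _) _; exact: lerD.
- by exists (M1 * M2) => x; rewrite normrM; apply: ler_pM.
Qed.

Lemma xeval_periodic e x i : xeval e (x + delta_mx 0 i) = xeval e x.
Proof.
have h k : cos (2 * pi * (x + delta_mx 0 i) 0 k) = cos (2 * pi * x 0 k) /\
           sin (2 * pi * (x + delta_mx 0 i) 0 k) = sin (2 * pi * x 0 k).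
  rewrite !mxE eqxx/= mulrDr; case: (k == i) => /=; last by rewrite mulr0 addr0.
  by rewrite mulr1 mulr_natl cosD2pi sinD2pi.
elim: e => [c|k|k|e1 h1 e2 h2|e1 h1 e2 h2] //=.
- by have [] := h k.
- by have [] := h k.
- by rewrite h1 h2.
- by rewrite h1 h2.
Qed.

Lemma continuous_xeval e : continuous (fun p : K * pt => xeval e p.2).
Proof.
have cc i : continuous (fun p : K * pt => 2 * pi * p.2 0 i).
  move=> p; apply: cvgM; first exact: cvg_cst.
  apply: (@cvg_comp _ _ _ (fun p : K * pt => p.2) (fun x : pt => x 0 i)).
    exact: cvg_snd.
  exact: coord_continuous.
elim: e => [c|k|k|e1 h1 e2 h2|e1 h1 e2 h2] /= p.
- exact: cvg_cst.
- by apply: continuous_comp; [exact: cc|exact: continuous_cos].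
- by apply: continuous_comp; [exact: cc|exact: continuous_sin].
- by apply: cvgD; [exact: h1|exact: h2].
- by apply: cvgM; [exact: h1|exact: h2].
Qed.

Section coordinate.
Variables (V : normedModType K) (c : V -> K) (phi : K -> K) (p v : V) (a : K).

(** Along [v] the scalar [c] is constant here and moves with unit speed in the next lemma, so the
    difference quotient is zero or literally that of [phi]. *)
Lemma is_derive_coord0 : (forall h : K, c (h *: v + p) = c p) ->
  is_derive p v (phi \o c) 0.
Proof.
move=> hc.
have h0 : h^-1 *: ((phi \o c \o shift p) (h *: v) - (phi \o c) p) @[h --> 0^'] --> (0 : K).
  rewrite (_ : (fun h : K => _) = cst 0); first exact: cvg_cst.
  by apply/funext => h /=; rewrite hc subrr scaler0.
by apply: DeriveDef; [apply/cvg_ex; exists 0|exact/cvg_lim].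
Qed.

Lemma is_derive_coord1 : (forall h : K, c (h *: v + p) = h + c p) ->
  is_derive (c p) 1 phi a -> is_derive p v (phi \o c) a.
Proof.
move=> hc [da ea].
have h0 : h^-1 *: ((phi \o c \o shift p) (h *: v) - (phi \o c) p) @[h --> 0^'] --> (a : K).
  rewrite (_ : (fun h : K => _) =
      fun h => h^-1 *: ((phi \o shift (c p)) (h *: 1) - phi (c p))).
    by rewrite -ea; exact: da.
  by apply/funext => h /=; rewrite hc; congr (_ *: (phi _ - _)); rewrite /GRing.scale/= mulr1.
by apply: DeriveDef; [apply/cvg_ex; exists a|exact/cvg_lim].
Qed.

End coordinate.

Lemma is_derive_xeval_space e (p : K * pt) j :
  is_derive p (dirv (Some j)) (fun p : K * pt => xeval e p.2) (xeval (xder j e) p.2).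
Proof.
have cs (phi : K -> K) (a : K -> K) (i : 'I_d) : (forall t : K, is_derive t 1 phi (a t)) ->
    is_derive p (dirv (Some j)) (fun p : K * pt => phi (p.2 0 i)) (a (p.2 0 i) *+ (i == j)).
  move=> ha; have [<-|ij] := eqVneq i j; rewrite ?mulr1n ?mulr0n.
    apply: (@is_derive_coord1 _ (fun p : K * pt => p.2 0 i) phi _ _ _ _ (ha _)).
    by move=> h /=; rewrite !mxE eqxx/= eqxx/= mulr1.
  apply: (@is_derive_coord0 _ (fun p : K * pt => p.2 0 i) phi).
  by move=> h /=; rewrite !mxE eqxx/= (negbTE ij) mulr0 add0r.
have lin (t : K) : is_derive t 1 (fun t : K => 2 * pi * t) (2 * pi).
  have h := is_deriveZ (2 * pi : K) (is_derive_id t (1 : K)).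
  by apply: (is_derive_eq h); rewrite /GRing.scale/= mulr1.
elim: e => [c|i|i|e1 h1 e2 h2|e1 h1 e2 h2] /=.
- exact: is_derive_cst.
- have h0 := cs (fun t => cos (2 * pi * t)) (fun t => - (2 * pi) * sin (2 * pi * t)) i.
  suff h1 : forall t : K, is_derive t 1 (fun t => cos (2 * pi * t)) (- (2 * pi) * sin (2 * pi * t)).
    by apply: (is_derive_eq (h0 h1)); case: (i == j); rewrite ?mulr1n ?mulr0n ?mul0r.
  move=> t.
  have h := @is_derive1_comp _ (@cos K) _ t _ _ (is_derive_cos _) (lin t).
  by apply: (is_derive_eq h); rewrite mulrC mulrN mulNr.
- have h0 := cs (fun t => sin (2 * pi * t)) (fun t => (2 * pi) * cos (2 * pi * t)) i.
  suff h1 : forall t : K, is_derive t 1 (fun t => sin (2 * pi * t)) ((2 * pi) * cos (2 * pi * t)).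
    by apply: (is_derive_eq (h0 h1)); case: (i == j); rewrite ?mulr1n ?mulr0n ?mul0r.
  move=> t.
  have h := @is_derive1_comp _ (@sin K) _ t _ _ (is_derive_sin _) (lin t).
  by apply: (is_derive_eq h); rewrite mulrC.
- have h := is_deriveD h1 h2; exact: (is_derive_eq h).
- have h := is_deriveM h1 h2; apply: (is_derive_eq h).
  by rewrite /GRing.scale/= [X in _ + X]mulrC.
Qed.

Lemma is_derive_time (phi : K -> K) (p : K * pt) : derivable phi p.1 1 ->
  is_derive p (dirv None) (fun p : K * pt => phi p.1) (derive1 phi p.1).
Proof.
move=> dphi; apply: (@is_derive_coord1 _ (fun p : K * pt => p.1) phi).
  by move=> h /=; rewrite /GRing.scale/= mulr1.
by apply: DeriveDef => //; rewrite derive1E.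
Qed.

Definition tprod (chi : K -> K) (e : xexpr) : K * pt -> K :=
  fun p => chi p.1 * xeval e p.2.

Lemma is_derive_tprod_time (chi : K -> K) e (p : K * pt) : derivable chi p.1 1 ->
  is_derive p (dirv None) (tprod chi e) (tprod (derive1 chi) e p).
Proof.
move=> dchi; have h1 := is_derive_time dchi.
have h2 : is_derive p (dirv None) (fun p : K * pt => xeval e p.2) 0.
  by apply: (@is_derive_coord0 _ (fun p : K * pt => xeval e p.2) id) => h /=; rewrite scaler0 add0r.
have h := is_deriveM h1 h2; apply: (is_derive_eq h).
by rewrite scaler0 add0r /GRing.scale/= mulrC.
Qed.

Lemma is_derive_tprod_space (chi : K -> K) e (p : K * pt) j :
  is_derive p (dirv (Some j)) (tprod chi e) (tprod chi (xder j e) p).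
Proof.
have h1 : is_derive p (dirv (Some j)) (fun p : K * pt => chi p.1) 0.
  apply: (@is_derive_coord0 _ (fun p : K * pt => p.1) chi) => h /=.
  by rewrite /GRing.scale/= mulr0 add0r.
have h := is_deriveM h1 (is_derive_xeval_space e p j); apply: (is_derive_eq h).
by rewrite scaler0 addr0.
Qed.

Lemma pd_tprod_time chi e : smooth1 chi ->
  pd None (tprod chi e) = tprod (derive1 chi) e.
Proof.
move=> sc; apply/funext => p; rewrite /pd.
by have [_ ->] := is_derive_tprod_time e (sc 0 p.1).
Qed.

Lemma pd_tprod_space chi e j : pd (Some j) (tprod chi e) = tprod chi (xder j e).
Proof.
by apply/funext => p; rewrite /pd; have [_ ->] := is_derive_tprod_space chi e p j.
Qed.

Lemma smooth1_derive1n n (chi : K -> K) : smooth1 chi -> smooth1 (derive1n n chi).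
Proof. by move=> sc m t; rewrite /derive1n -iterD; exact: sc (m + n)%N t. Qed.

(** Every iterated partial derivative is again the product of a derivative of [chi] and a
    trigonometric polynomial. *)
Lemma smooth_tprod chi e : smooth1 chi -> smooth (tprod chi e).
Proof.
move=> sc s.
have [n [e' ->]] : exists n e', foldr (@pd K d) (tprod chi e) s = tprod (derive1n n chi) e'.
  elim: s => [|[j|] s [n [e' h]]] /=; first by exists 0, e.
    by exists n, (xder j e'); rewrite h pd_tprod_space.
  exists n.+1, e'; rewrite h pd_tprod_time ?derive1nS//.
  exact: smooth1_derive1n.
have sn := smooth1_derive1n (n := n) sc; split.
  move=> p; apply: cvgM; last exact: continuous_xeval.
  apply: (@cvg_comp _ _ _ (fun p : K * pt => p.1) (derive1n n chi)).
    exact: cvg_fst.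
  exact: smooth1_continuous.
move=> [j|] p; first by have [] := is_derive_tprod_space (derive1n n chi) e' p j.
by have [] := is_derive_tprod_time e' (sn 0 p.1).
Qed.

Lemma test_torus_xeval e : test_torus (xeval e).
Proof.
split; last by move=> x i; exact: xeval_periodic.
rewrite (_ : (fun p => _) = tprod (cst 1) e).
  apply: smooth_tprod => n t; rewrite (_ : cst 1 = teval (TCst (1 : K))) //.
  exact: smooth1_teval.
by apply/funext => p; rewrite /tprod mul1r.
Qed.

Lemma test_tprod T chi e : ttest T chi -> test T (tprod chi e).
Proof.
move=> [sc [T' T'T h'] [t0 t00 h0]]; split.
  split; first exact: smooth_tprod.
    by move=> t x i; rewrite /tprod/= xeval_periodic.
  by exists T' => // t x T't; rewrite /tprod/= h'// mul0r.
by exists t0 => // t x tt0; rewrite /tprod/= h0// mul0r.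
Qed.

End trig.

(** * Symmetric kernels and approximate identities *)

Section kernel.
Context d (X : measurableType d) (K : realType) (P : probability X K).
Implicit Types (k : X -> X -> K) (h : X -> K).

(** Bounded symmetric probability kernels: boundedness gives integrability on the product, while
    symmetry and unit mass make smearing a contraction both of L^1 and of L^infinity. *)
Record kern k : Prop := Kern {
  kern_meas : measurable_fun setT (fun p : X * X => k p.1 p.2);
  kern_ge0 : forall x y, 0 <= k x y;
  kern_sym : forall x y, k x y = k y x;
  kern_bd : exists M, forall x y, k x y <= M;
  kern_mass : forall x, \int[P]_y k x y = 1 }.

Definition smear k h (x : X) : K := \int[P]_y (k x y * h y).

Lemma L1_pcst (c : K) : L1 P (fun=> c).
Proof. by apply: L1_cst; rewrite ltey_eq fin_num_measure. Qed.

Lemma Rcst (c : K) : \int[P]_x c = c.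
Proof.
have := Rintegral_cst P measurableT c.
move=> ->; rewrite (_ : fine _ = 1) ?mulr1//.
exact: (congr1 fine (@probability_setT _ _ _ P)).
Qed.

Section fixed_kernel.
Variables (k : X -> X -> K) (kk : kern k).

Lemma kern_meas1 x : measurable_fun setT (k x).
Proof. exact: (meas_slice1 x (kern_meas kk)). Qed.

Lemma kern_L1_1 x h : L1 P h -> L1 P (fun y => k x y * h y).
Proof.
move=> lh; have [M kM] := kern_bd kk.
apply: (@L1_le _ _ _ _ _ (fun y => M * `|h y|)).
- by apply: measurable_funM; [exact: kern_meas1|exact: L1_meas lh].
- by move=> y; rewrite normrM ger0_norm ?(kern_ge0 kk)// ler_wpM2r.
- exact/L1Z/L1_norm.
Qed.

Lemma kern_L1 h : L1 P h -> L1 (P \x P)%E (fun p => k p.1 p.2 * h p.2).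
Proof.
move=> lh; have [M kM] := kern_bd kk.
apply: (@L1_le _ _ _ _ _ (fun p => M * `|h p.2|)).
- apply: measurable_funM; first exact: kern_meas kk.
  exact: measurableT_comp (L1_meas lh) measurable_snd.
- by move=> y; rewrite normrM ger0_norm ?(kern_ge0 kk)// ler_wpM2r.
- apply: L1Z; apply: eq_L1 (L1_prodM (L1_pcst 1) (L1_norm lh)) => p.
  by rewrite mul1r.
Qed.

Lemma smear_L1 h : L1 P h -> L1 P (smear k h).
Proof. by move=> lh; exact: (L1_int1 (kern_L1 lh)). Qed.

Lemma smearB h1 h2 x : L1 P h1 -> L1 P h2 ->
  smear k (fun y => h1 y - h2 y) x = smear k h1 x - smear k h2 x.
Proof.
move=> l1 l2; rewrite /smear -RB; [|exact: kern_L1_1|exact: kern_L1_1].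
by apply: eqR => y; rewrite mulrBr.
Qed.

(** The absolute value goes under the kernel; after exchanging the integrals, symmetry turns the
    inner one into the unit mass. *)
Lemma smear_contr h : L1 P h ->
  \int[P]_x `|smear k h x| <= \int[P]_x `|h x|.
Proof.
move=> lh; have lk := kern_L1 (L1_norm lh).
apply: (@le_trans _ _ (\int[P]_x \int[P]_y (k x y * `|h y|))).
  apply: R_le_ae; [exact/L1_norm/smear_L1|exact: (L1_int1 lk)|].
  apply: aeW => x; apply: le_trans (R_norm (kern_L1_1 x lh)) _.
  rewrite le_eqVlt; apply/orP; left; apply/eqP/eqR => y.
  by rewrite normrM ger0_norm// (kern_ge0 kk).
rewrite (R_swap lk) le_eqVlt; apply/orP; left; apply/eqP/eqR => y /=.
rewrite RZr; last first.
  by apply: eq_L1 (kern_L1_1 y (L1_pcst 1)) => x; rewrite mulr1 (kern_sym kk).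
rewrite -[RHS]mul1r -(kern_mass kk y); congr (_ * _).
by apply: eqR => x; rewrite (kern_sym kk).
Qed.

(** Smearing is self-adjoint by Fubini and the symmetry of the kernel, the bound on [g] making the
    double integrand integrable. *)
Lemma smear_sym M (f g : X -> K) : L1 P f -> measurable_fun setT g ->
  {ae P, forall x, `|g x| <= M} ->
  \int[P]_x (smear k f x * g x) = \int[P]_x (f x * smear k g x).
Proof.
move=> lf mg gM.
have lg : L1 P g by apply: L1_le_ae gM _ => //; exact: L1_pcst.
have lk : L1 (P \x P)%E (fun p => k p.1 p.2 * f p.2 * g p.1).
  apply: (@L1_mul_bounded _ _ _ _ M); first exact: kern_L1 lf.
    exact: measurableT_comp mg measurable_fst.
  apply: (@ae_prod1 _ _ _ _ _ _ _ [set p | `|g p.1| <= M]).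
    rewrite -[X in measurable X]setTI.
    rewrite (_ : [set p | _] = (fun p : X * X => `|g p.1| <= M) @^-1` [set true]) //.
    apply: (@measurable_fun_ler _ _ _ _ (fun p : X * X => `|g p.1|) (cst M)) => //.
    by apply: measurableT_comp => //; exact: measurableT_comp mg measurable_fst.
  by apply: filterS gM => x gM; exact: aeW.
transitivity (\int[P]_x \int[P]_y (k x y * f y * g x)).
  by apply: eqR => x; rewrite RZr//; exact: kern_L1_1.
rewrite (R_swap lk); apply: eqR => y /=; rewrite /smear -RZ; last exact: kern_L1_1.
by apply: eqR => x; rewrite (kern_sym kk); ring.
Qed.

Lemma smear_bound M h x : measurable_fun setT h -> {ae P, forall x, `|h x| <= M} ->
  `|smear k h x| <= M.
Proof.
move=> mh hM.
have lh : L1 P h by apply: L1_le_ae hM _ => //; exact: L1_pcst.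
have l1 : L1 P (k x) by apply: eq_L1 (kern_L1_1 x (L1_pcst 1)) => y; rewrite mulr1.
apply: le_trans (R_norm (kern_L1_1 x lh)) _.
rewrite -[leRHS]mul1r -(kern_mass kk x) -RZr//.
apply: R_le_ae; [exact/L1_norm/kern_L1_1|exact: L1Zr|].
apply: filterS hM => y hM.
by rewrite normrM ger0_norm ?(kern_ge0 kk)// ler_wpM2l// (kern_ge0 kk).
Qed.

End fixed_kernel.

Definition approx_id (k : nat -> X -> X -> K) : Prop :=
  (forall n, kern (k n)) /\
  forall h, L1 P h -> \int[P]_x `|smear (k n) h x - h x| @[n --> \oo] --> (0 : K).

End kernel.

Section product.
Context d1 d2 (X : measurableType d1) (Y : measurableType d2) (K : realType).
Variables (P : probability X K) (Q : probability Y K).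
Variables (k : nat -> X -> X -> K) (l : nat -> Y -> Y -> K).
Hypotheses (ak : approx_id P k) (al : approx_id Q l).

Definition kprod n (p q : X * Y) : K := k n p.1 q.1 * l n p.2 q.2.

Let kk n : kern P (k n) := ak.1 n.
Let kl n : kern Q (l n) := al.1 n.

Lemma kern_prod n : kern (P \x Q)%E (kprod n).
Proof.
split.
- apply: measurable_funM.
    have m : measurable_fun setT (fun p : (X * Y) * (X * Y) => (p.1.1, p.2.1)).
      by apply: measurable_fun_pair; apply: measurableT_comp => //; exact: measurable_fst.
    exact: (measurableT_comp (kern_meas (kk n)) m).
  have m : measurable_fun setT (fun p : (X * Y) * (X * Y) => (p.1.2, p.2.2)).
    by apply: measurable_fun_pair; apply: measurableT_comp => //; exact: measurable_snd.
  exact: (measurableT_comp (kern_meas (kl n)) m).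
- by move=> p q; rewrite mulr_ge0 ?(kern_ge0 (kk n)) ?(kern_ge0 (kl n)).
- by move=> p q; rewrite /kprod (kern_sym (kk n)) (kern_sym (kl n)).
- have [M1 h1] := kern_bd (kk n); have [M2 h2] := kern_bd (kl n).
  exists (M1 * M2) => p q; apply: ler_pM => //.
    exact: kern_ge0 (kk n) _ _.
  exact: kern_ge0 (kl n) _ _.
- move=> p.
  have l1 : L1 P (k n p.1).
    by apply: eq_L1 (kern_L1_1 (kk n) p.1 (L1_pcst P 1)) => y; rewrite mulr1.
  have l2 : L1 Q (l n p.2).
    by apply: eq_L1 (kern_L1_1 (kl n) p.2 (L1_pcst Q 1)) => y; rewrite mulr1.
  rewrite (R_fubini1 (L1_prodM l1 l2)) /=.
  under eqR do rewrite RZ//.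
  by rewrite RZr// (kern_mass (kk n)) (kern_mass (kl n)) mulr1.
Qed.

Variable h : X * Y -> K.
Hypothesis lh : L1 (P \x Q)%E h.

Let mh : measurable_fun setT h := L1_meas lh.

(** Smearing in the second variable only; the product kernel then factors through it. *)
Let S n (p : X * Y) := smear Q (l n) (fun y => h (p.1, y)) p.2.

Let mS n : measurable_fun setT (S n).
Proof.
apply: (@meas_int1 _ _ _ _ _ Q (fun q : (X * Y) * Y => l n q.1.2 q.2 * h (q.1.1, q.2))).
apply: measurable_funM.
  have m : measurable_fun setT (fun q : (X * Y) * Y => (q.1.2, q.2)).
    apply: measurable_fun_pair; last exact: measurable_snd.
    by apply: measurableT_comp => //; exact: measurable_snd.
  exact: (measurableT_comp (kern_meas (kl n)) m).
have m : measurable_fun setT (fun q : (X * Y) * Y => (q.1.1, q.2)).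
  apply: measurable_fun_pair; last exact: measurable_snd.
  by apply: measurableT_comp => //; exact: measurable_fst.
exact: (measurableT_comp mh m).
Qed.

Let lS n : L1 (P \x Q)%E (S n).
Proof.
apply: L1_tonelli => //.
  by apply: filterS (L1_slice1 lh) => x lx; exact: (smear_L1 (kl n) lx).
apply: (@L1_le_ae _ _ _ _ _ (fun x => \int[Q]_y `|h (x, y)|)).
- by apply: (@meas_int1 _ _ _ _ _ Q (fun p => `|S n p|)); exact: measurableT_comp.
- apply: filterS (L1_slice1 lh) => x lx.
  rewrite ger0_norm; last by apply: Rintegral_ge0.
  exact: (smear_contr (kl n) lx).
- exact: (L1_int1 (L1_norm lh)).
Qed.

Let smear_prod n y x :
  smear (P \x Q)%E (kprod n) h (x, y) = smear P (k n) (fun x' => S n (x', y)) x.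
Proof.
rewrite /smear.
have l0 : L1 (P \x Q)%E (fun q => kprod n (x, y) q * h q).
  exact: (kern_L1_1 (kern_prod n) (x, y) lh).
rewrite (R_fubini1 l0); apply: R_ae.
- exact: L1_meas (L1_int1 l0).
- apply: measurable_funM; first exact: (kern_meas1 (kk n)).
  exact: (meas_slice2 y (mS n)).
apply: filterS (L1_slice1 lh) => x' lx'.
rewrite /S /smear -RZ; last exact: (kern_L1_1 (kl n)).
by apply: eqR => y'; rewrite /kprod/= mulrA.
Qed.

Let a n (x : X) := \int[Q]_y `|S n (x, y) - h (x, y)|.
Let b n (y : Y) := \int[P]_x `|smear P (k n) (fun x => h (x, y)) x - h (x, y)|.

Let mB n : measurable_fun setT (fun p : X * Y => smear P (k n) (fun x => h (x, p.2)) p.1).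
Proof.
apply: (@meas_int1 _ _ _ _ _ P (fun q : (X * Y) * X => k n q.1.1 q.2 * h (q.2, q.1.2))).
apply: measurable_funM.
  have m : measurable_fun setT (fun q : (X * Y) * X => (q.1.1, q.2)).
    apply: measurable_fun_pair; last exact: measurable_snd.
    by apply: measurableT_comp => //; exact: measurable_fst.
  exact: (measurableT_comp (kern_meas (kk n)) m).
have m : measurable_fun setT (fun q : (X * Y) * X => (q.2, q.1.2)).
  apply: measurable_fun_pair; first exact: measurable_snd.
  by apply: measurableT_comp => //; exact: measurable_snd.
exact: (measurableT_comp mh m).
Qed.

(** On almost every section the error tends to 0, and contraction bounds it by twice the L^1 norm of
    the section, which is integrable in the other variable. *)
Let a_cvg : \int[P]_x a n x @[n --> \oo] --> (0 : K).
Proof.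
have [] := @R_dct _ _ _ P a (cst 0) (fun x => 2 * \int[Q]_y `|h (x, y)|).
- move=> n; apply: (@meas_int1 _ _ _ _ _ Q (fun p => `|S n p - h p|)).
  by apply: measurableT_comp => //; exact: measurable_funB.
- exact: measurable_cst.
- by apply: filterS (L1_slice1 lh) => x lx; exact: (al.2 _ lx).
- exact: L1Z (L1_int1 (L1_norm lh)).
- apply: filterS (L1_slice1 lh) => x lx n.
  have ls : L1 Q (fun y => S n (x, y)) by exact: (smear_L1 (kl n) lx).
  rewrite ger0_norm; last by apply: Rintegral_ge0.
  apply: (@le_trans _ _ (\int[Q]_y (`|S n (x, y)| + `|h (x, y)|))).
    apply: R_le_ae; [exact: (L1_norm (L1B ls lx))|exact: (L1D (L1_norm ls) (L1_norm lx))|].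
    by apply: aeW => y; exact: ler_normB.
  rewrite (RD (L1_norm ls) (L1_norm lx)).
  by rewrite mulr_natl mulr2n lerD2r; exact: (smear_contr (kl n) lx).
by move=> _; rewrite R0.
Qed.

Let b_le n y : L1 P (fun x => h (x, y)) -> `|b n y| <= 2 * \int[P]_x `|h (x, y)|.
Proof.
move=> ly; have ls := smear_L1 (kk n) ly.
rewrite ger0_norm; last by apply: Rintegral_ge0.
apply: (@le_trans _ _ (\int[P]_x (`|smear P (k n) (fun x => h (x, y)) x| + `|h (x, y)|))).
  apply: R_le_ae; [exact: (L1_norm (L1B ls ly))|exact: (L1D (L1_norm ls) (L1_norm ly))|].
  by apply: aeW => x; exact: ler_normB.
rewrite (RD (L1_norm ls) (L1_norm ly)).
by rewrite mulr_natl mulr2n lerD2r; exact: (smear_contr (kk n) ly).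
Qed.

Let b_cvg : \int[Q]_y b n y @[n --> \oo] --> (0 : K).
Proof.
have [] := @R_dct _ _ _ Q b (cst 0) (fun y => 2 * \int[P]_x `|h (x, y)|).
- move=> n; apply: (@meas_int2 _ _ _ _ _ P
    (fun p => `|smear P (k n) (fun x => h (x, p.2)) p.1 - h p|)).
  by apply: measurableT_comp => //; exact: measurable_funB.
- exact: measurable_cst.
- by apply: filterS (L1_slice2 lh) => x lx; exact: (ak.2 _ lx).
- exact: L1Z (L1_int2 (L1_norm lh)).
- by apply: filterS (L1_slice2 lh) => y ly n; exact: b_le.
by move=> _; rewrite R0.
Qed.

(** The error splits as the [x]-smearing of the [y]-error, controlled by contraction, plus the
    [x]-error of [h] itself. Both integrals tend to 0 by dominated convergence. *)
Lemma approx_id_prod_cvg :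
  \int[(P \x Q)%E]_p `|smear (P \x Q)%E (kprod n) h p - h p| @[n --> \oo] --> (0 : K).
Proof.
have l1 n : L1 (P \x Q)%E (fun p => `|smear (P \x Q)%E (kprod n) h p - h p|).
  by apply: L1_norm; apply: L1B => //; exact: (smear_L1 (kern_prod n)).
have l2 n : L1 (P \x Q)%E (fun p => `|S n p - h p|) by exact/L1_norm/L1B.
have B1 n (y : Y) x : L1 P (fun x => h (x, y)) -> L1 P (fun x => S n (x, y)) ->
    `|smear (P \x Q)%E (kprod n) h (x, y) - h (x, y)| <=
    `|smear P (k n) (fun x => S n (x, y) - h (x, y)) x| +
    `|smear P (k n) (fun x => h (x, y)) x - h (x, y)|.
  move=> l1' l2'; rewrite (smearB (kk n))//; apply: le_trans (ler_normD _ _).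
  by rewrite smear_prod addrA subrK.
have le n : \int[(P \x Q)%E]_p `|smear (P \x Q)%E (kprod n) h p - h p| <=
    \int[P]_x a n x + \int[Q]_y b n y.
  rewrite (R_fubini2 (l1 n)) -(R_fubini1 (l2 n)) (R_fubini2 (l2 n)).
  have lb : L1 Q (b n).
    apply: (@L1_le_ae _ _ _ _ _ (fun y => 2 * \int[P]_x `|h (x, y)|)).
    - apply: (@meas_int2 _ _ _ _ _ P
        (fun p => `|smear P (k n) (fun x => h (x, p.2)) p.1 - h p|)).
      by apply: measurableT_comp => //; exact: measurable_funB.
    - by apply: filterS (L1_slice2 lh) => y ly; exact: b_le.
    - exact: L1Z (L1_int2 (L1_norm lh)).
  rewrite -RD//; last exact: (L1_int2 (l2 n)).
  apply: R_le_ae; [exact: (L1_int2 (l1 n))|by apply: L1D lb; exact: (L1_int2 (l2 n))|].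
  apply: filterS2 (L1_slice2 lh) (L1_slice2 (lS n)) => y ly lSy.
  have lSh : L1 P (fun x => S n (x, y) - h (x, y)) by exact: L1B.
  have m1 : L1 P (fun x => `|smear P (k n) (fun x => S n (x, y) - h (x, y)) x|).
    by apply: L1_norm; exact: (smear_L1 (kk n)).
  have m2 : L1 P (fun x => `|smear P (k n) (fun x => h (x, y)) x - h (x, y)|).
    by apply/L1_norm/L1B => //; exact: (smear_L1 (kk n)).
  apply: (@le_trans _ _ (\int[P]_x
    (`|smear P (k n) (fun x => S n (x, y) - h (x, y)) x| +
     `|smear P (k n) (fun x => h (x, y)) x - h (x, y)|))).
    apply: R_le_ae; [|exact: L1D|by apply: aeW => x; exact: B1].
    apply: (@L1_le _ _ _ _ _ (fun x =>
      `|smear P (k n) (fun x => S n (x, y) - h (x, y)) x| +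
      `|smear P (k n) (fun x => h (x, y)) x - h (x, y)|)); last exact: L1D.
      exact: (meas_slice2 y (L1_meas (l1 n))).
    by move=> x; rewrite normr_id; exact: B1.
  rewrite RD// lerD2r; exact: (smear_contr (kk n)).
apply: (@squeeze_cvgr _ _ _ _ (cst 0) (fun n => \int[P]_x a n x + \int[Q]_y b n y)).
- by apply: nearW => n; rewrite le andbT; apply: Rintegral_ge0.
- exact: cvg_cst.
- by rewrite -[X in _ --> X](addr0 (0 : K)); apply: cvgD; [exact: a_cvg|exact: b_cvg].
Qed.

End product.

Lemma approx_id_prod d1 d2 (X : measurableType d1) (Y : measurableType d2)
  (K : realType) (P : probability X K) (Q : probability Y K) k l :
  approx_id P k -> approx_id Q l -> approx_id (P \x Q)%E (kprod k l).
Proof.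
by move=> ak al; split=> [n|h lh]; [exact: kern_prod|exact: approx_id_prod_cvg].
Qed.

(** * The cosine-power kernel on the circle *)

Section circle.
Variable K : realType.
Local Notation mT := (measurableTypeR K).
Local Notation mu := (@lebesgue_measure K).
Local Notation UU := (uniform_prob (@ltr01 K)).

Lemma ge0_unif (f : mT -> \bar K) : measurable_fun setT f -> (forall x, 0 <= f x)%E ->
  (\int[UU]_x f x = \int[mu]_(x in `[0%R, 1%R]) f x)%E.
Proof. by move=> mf f0; rewrite integral_uniform// subr0 invr1 mul1e. Qed.

Lemma L1_unif (f : mT -> K) : measurable_fun setT f ->
  L1 UU f <-> mu.-integrable `[0, 1] (EFin \o f).
Proof.
move=> mf; have h : (\int[UU]_x `|(f x)%:E| = \int[mu]_(x in `[0%R, 1%R]) `|(f x)%:E|)%E.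
  rewrite ge0_unif//; apply: measurableT_comp => //; exact/measurable_EFinP.
split=> /integrableP[_ i]; apply/integrableP; split.
- by apply/measurable_EFinP; exact: measurable_funTS.
- by rewrite -h.
- exact/measurable_EFinP.
- by rewrite h.
Qed.

Lemma R_unif (f : mT -> K) : measurable_fun setT f ->
  \int[UU]_x f x = \int[mu]_(x in `[0, 1]) f x.
Proof.
move=> mf; congr fine; rewrite integralE [RHS]integralE.
by congr (_ - _)%E; rewrite ge0_unif//; [apply: measurable_funepos|
  apply: measurable_funeneg]; exact/measurable_EFinP.
Qed.

Lemma ae_unif_itv : {ae UU, forall x : mT, 0 < x < 1}.
Proof.
exists (~` `]0, 1[); split => //.
- exact: measurableC.
- have mA : measurable (~` `]0, 1[ : set mT) by exact: measurableC.
  rewrite -[LHS]mul1e -integral_cst// integral_mkcond.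
  rewrite ge0_unif; last 2 first.
  + by apply/(measurable_restrictT _ mA).
  + by move=> x; rewrite patchE; case: ifP => // _; rewrite lee01.
  rewrite -integral_mkcondr integral_cst ?mul1e; last exact: measurableI.
  apply/eqP; rewrite -measure_le0.
  have <- : mu [set (0 : K); 1] = 0%E.
    by apply: countable_lebesgue_measure0; apply: finite_set_countable; exact: finite_set2.
  apply: le_measure; rewrite ?inE//; first exact: measurableI.
    exact: measurableU.
  move=> x /= []; rewrite !in_itv/= => /andP[x0 x1] /negP; rewrite negb_and -!leNgt.
  by case/orP => h; [left|right]; apply/eqP; rewrite eq_le ?x0 ?x1 h.
Qed.

Section shift.
Variable g : K -> K.
Hypotheses (cg : continuous g) (pg : forall t, g (t + 1) = g t)
  (eg : forall t, g (- t) = g t).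

Let mg : measurable_fun setT (g : mT -> K).
Proof. exact: continuous_measurable_fun. Qed.

Let cgs x : continuous (fun y => g (x - y)).
Proof.
move=> y; apply: continuous_comp; last exact: cg.
by apply: cvgB; [exact: cvg_cst|exact: cvg_id].
Qed.

(** With [G] a primitive of [g], the left side is G(x) - G(x-1). Its derivative in x vanishes by
    periodicity, and its value at x = 0 is the right side by evenness. *)
Lemma periodic_shift x : \int[UU]_y g (x - y) = \int[UU]_y g y.
Proof.
(* A base point strictly left of both x - 1 and -1, so that [G] is differentiable wherever it is
   used. *)
pose a := Num.min x 0 - 2.
have ax : a < x - 1.
  have m : Num.min x 0 <= x by rewrite ge_min lexx.
  by rewrite /a; lra.
have a0 : a < -1.
  have m : Num.min x 0 <= 0 by rewrite ge_min lexx orbT.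
  by rewrite /a; lra.
have gi (t : K) : mu.-integrable `[a, t] (EFin \o g).
  apply: continuous_compact_integrable; first exact: segment_compact.
  exact: continuous_subspaceT.
pose G t := \int[mu]_(s in `[a, t]) g s.
have dG t : a < t -> is_derive t 1 G (g t).
  move=> at_; have t1 : t < t + 1 by rewrite ltrDl.
  have [d1 e1] := @continuous_FTC1_closed K g a t (t + 1) t1 (gi _) at_ (@cg t).
  by apply: DeriveDef; [exact: d1|rewrite -derive1E; exact: e1].
have key (z : K) : a < z - 1 -> \int[UU]_y g (z - y) = G z - G (z - 1).
  move=> az; rewrite R_unif; last by apply: continuous_measurable_fun; exact: cgs.
  pose F y := - G (z - y).
  have dF y : y < z - a -> is_derive y 1 F (g (z - y)).
    move=> yz; have azy : a < z - y by lra.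
    have dl : is_derive y 1 (fun y => z - y) (- 1).
      have h := is_deriveB (is_derive_cst z y (1 : K)) (is_derive_id y (1 : K)).
      by apply: (is_derive_eq h); rewrite sub0r.
    have h := is_deriveN (@is_derive1_comp _ G _ y _ _ (dG _ azy) dl).
    by apply: (is_derive_eq h); rewrite mulrN1 opprK.
  have cF y : y < z - a -> {for y, continuous F}.
    move=> /dF dFy; apply: differentiable_continuous; apply/derivable1_diffP.
    by case: dFy.
  have := @continuous_FTC2 K (fun y => g (z - y)) F 0 1 ltr01.
  move=> H; rewrite /Rintegral H/=; first by rewrite /F subr0 opprK addrC.
  - by apply: continuous_subspaceT; exact: cgs.
  - split.
    + move=> y; rewrite in_itv/= => /andP[y0 y1].
      have yza : y < z - a by lra.
      by case: (dF _ yza).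
    + apply: cvg_at_right_filter; apply: cF; lra.
    + apply: cvg_at_left_filter; apply: cF; lra.
  - move=> y; rewrite in_itv/= => /andP[y0 y1].
    have yza : y < z - a by lra.
    by rewrite derive1E; case: (dF _ yza).
transitivity (\int[UU]_y g (0 - y)); last by apply: eqR => y; rewrite sub0r eg.
rewrite key// key ?sub0r//.
pose D t := G t - G (t - 1).
have dD t : a < t - 1 -> is_derive t 1 D 0.
  move=> at_; have at2 : a < t by lra.
  have dl : is_derive t 1 (fun y => y - 1) 1.
    have h := is_deriveB (is_derive_id t (1 : K)) (is_derive_cst (1 : K) t (1 : K)).
    by apply: (is_derive_eq h); rewrite subr0.
  have h := is_deriveB (dG _ at2) (@is_derive1_comp _ G _ t _ _ (dG _ at_) dl).
  by apply: (is_derive_eq h); rewrite mulr1 -{1}(subrK 1 t) pg subrr.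
have cD t : a < t - 1 -> {for t, continuous D}.
  move=> /dD dDy; apply: differentiable_continuous; apply/derivable1_diffP.
  by case: dDy.
have Dle u v : a < u - 1 -> u <= v -> D v = D u.
  move=> au uv; apply/eqP; rewrite -subr_eq0.
  have [||c _ ->] := @MVT_segment K D (cst 0) u v uv.
  - move=> y; rewrite in_itv/= => /andP[uy yv]; apply: dD; lra.
  - apply: continuous_in_subspaceT => y; rewrite inE/= in_itv/= => /andP[uy yv].
    apply: cD; lra.
  by rewrite mul0r.
have h0 : a < 0 - 1 by rewrite sub0r.
rewrite -/(D x).
have -> : G 0 - G (-1) = D 0 by rewrite /D sub0r.
have [x0|x0] := leP x 0; first by rewrite (Dle x 0).
by rewrite (Dle 0 x)// ltW.
Qed.

End shift.

(** This is 2^n cos(pi t)^(2n); the form with a single cosine makes the separation of variables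
    immediate. *)
Definition cpow n (t : K) : K := (1 + cos (2 * pi * t)) ^+ n.

Lemma cpow_ge0 n t : 0 <= cpow n t.
Proof. by rewrite exprn_ge0// -lerBlDl sub0r cos_geN1. Qed.

Lemma cpow_le n t : cpow n t <= 2 ^+ n.
Proof.
have h1 : 0 <= 1 + cos (2 * pi * t) by rewrite -lerBlDl sub0r cos_geN1.
have h2 : 1 + cos (2 * pi * t) <= 2 by rewrite -[leRHS]/(1 + 1) lerD2l cos_le1.
by rewrite lerXn2r ?nnegrE.
Qed.

Lemma continuous_cpow n : continuous (cpow n).
Proof.
move=> t; apply: (@continuous_comp _ _ _ (fun t => 1 + cos (2 * pi * t)) (fun x : K => x ^+ n)); last exact: exprn_continuous.
apply: cvgD; first exact: cvg_cst.
apply: continuous_comp; last exact: continuous_cos.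
by apply: cvgM; [exact: cvg_cst|exact: cvg_id].
Qed.

Lemma cpow_periodic n t : cpow n (t + 1) = cpow n t.
Proof. by rewrite /cpow mulrDr mulr1 mulr_natl cosD2pi. Qed.

Lemma cpow_even n t : cpow n (- t) = cpow n t.
Proof. by rewrite /cpow mulrN cosN. Qed.

Lemma meas_cpow n : measurable_fun setT (cpow n : mT -> K).
Proof. by apply: continuous_measurable_fun; exact: continuous_cpow. Qed.

Lemma cpow_L1 n : L1 UU (cpow n).
Proof.
apply: (@L1_le _ _ _ _ _ (fun=> 2 ^+ n)); [exact: meas_cpow| |exact: L1_pcst].
by move=> t; rewrite ger0_norm ?cpow_ge0// cpow_le.
Qed.

Definition cmass n : K := \int[UU]_t cpow n t.

(** The reflection s -> 1 - s reduces to s <= 1/2, where the cosine decreases. *)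
Lemma cos_2pi_le (a s : K) : 0 <= a -> a <= 2^-1 -> a <= s -> s <= 1 - a ->
  cos (2 * pi * s) <= cos (2 * pi * a).
Proof.
have p0 := pi_gt0 K.
move=> a0 a12.
wlog s12 : s / s <= 2^-1.
  move=> H as_ s1; have [/H|sh] := leP s 2^-1; first exact.
  have -> : cos (2 * pi * s) = cos (2 * pi * (1 - s)).
    by rewrite mulrBr mulr1 addrC [X in _ + X]mulr_natl cosD2pi cosN.
  by apply: H; lra.
move=> as_ _; rewrite leNgt ltr_cos ?in_itv/=.
- by rewrite -leNgt ler_pM2l// mulr_gt0.
- by apply/andP; split; nra.
- by apply/andP; split; nra.
Qed.

(** On [0, e] the integrand is at least its value at [e]. *)
Lemma cmass_ge n (e : K) : 0 < e -> e <= 2^-1 ->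
  e * (1 + cos (2 * pi * e)) ^+ n <= cmass n.
Proof.
move=> e0 e12; have p0 := pi_gt0 K.
have mi : measurable_fun setT (\1_`[0, e] : mT -> K) by exact: measurable_indic.
have li : L1 UU (\1_`[0, e] : mT -> K).
  apply: (@L1_le _ _ _ _ _ (fun=> 1)) => //; last exact: L1_pcst.
  by move=> t; rewrite indicE; case: (_ \in _); rewrite ?normr1 ?normr0.
have ie : \int[UU]_t (\1_`[0, e] : mT -> K) t = e.
  rewrite R_unif// /Rintegral integral_indic//.
  rewrite setIidl; last by apply: subset_itvl; rewrite bnd_simp; lra.
  have E : lebesgue_measure (`[0, e]%classic : set K) = e%:E.
    by rewrite lebesgue_measure_itv/= lte_fin e0 -EFinB subr0.
  exact: (congr1 fine E).
rewrite -[X in X * _]ie -RZr//; apply: R_le_ae; [exact: L1Zr|exact: cpow_L1|].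
apply: aeW => t; rewrite indicE; case: (boolP (t \in _)); last first.
  by rewrite mul0r cpow_ge0.
rewrite inE/= in_itv/= => /andP[t0 te]; rewrite mul1r.
have h1 (u : K) : 0 <= 1 + cos (2 * pi * u) by rewrite -lerBlDl sub0r cos_geN1.
rewrite lerXn2r ?nnegrE// lerD2l.
by apply: cos_2pi_le; lra.
Qed.

Lemma cmass_gt0 n : 0 < cmass n.
Proof.
(* At 1/4 the cosine vanishes, so the lower bound for the mass is 1/4 whatever [n] is. *)
have e : (0 : K) < 4^-1 by [].
apply: lt_le_trans (cmass_ge n e _); last by lra.
rewrite mulr_gt0// exprn_gt0//.
have -> : 2 * pi * 4^-1 = pi / 2 :> K by lra.
by rewrite cos_pihalf addr0.
Qed.

Definition ckern n (x y : K) : K := cpow n (x - y) / cmass n.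

Lemma kern_ckern n : kern UU (ckern n : mT -> mT -> K).
Proof.
have m0 := cmass_gt0 n.
split.
- apply: measurable_funM => //.
  have m : measurable_fun setT (fun p : mT * mT => p.1 - p.2).
    by apply: measurable_funB; [exact: measurable_fst|exact: measurable_snd].
  exact: (measurableT_comp (@meas_cpow n) m).
- by move=> x y; rewrite divr_ge0 ?cpow_ge0// ltW.
- by move=> x y; rewrite /ckern -cpow_even opprB.
- exists (2 ^+ n / cmass n) => x y.
  by rewrite ler_pM2r ?invr_gt0// cpow_le.
- move=> x.
  have h := periodic_shift (@continuous_cpow n) (cpow_periodic n) (cpow_even n) x.
  rewrite RZr; first by rewrite h divff// gt_eqF.
  apply: (@L1_le _ _ _ _ _ (fun=> 2 ^+ n)); last exact: L1_pcst.
    have m : measurable_fun setT (fun y : mT => x - y) by exact: measurable_funB.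
    exact: (measurableT_comp (@meas_cpow n) m).
  by move=> t; rewrite ger0_norm ?cpow_ge0// cpow_le.
Qed.

End circle.

Section circle_cvg.
Variable K : realType.
Local Notation mT := (measurableTypeR K).
Local Notation mu := (@lebesgue_measure K).
Local Notation UU := (uniform_prob (@ltr01 K)).

(** The mass is at least (e/2) B^n, where B is the base of the power at e/2, so the quotient is at
    most (2/e) (A/B)^n with A < B: geometric decay away from the diagonal. *)
Lemma ckern_tail (e : K) : 0 < e -> e <= 4^-1 ->
  (1 + cos (2 * pi * e)) ^+ n / cmass K n @[n --> \oo] --> (0 : K).
Proof.
move=> e0 e4; have p0 := pi_gt0 K.
set A := 1 + cos (2 * pi * e); set B := 1 + cos (2 * pi * (e / 2)).
have A0 : 0 <= A by rewrite /A -lerBlDl sub0r cos_geN1.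
have AB : A < B.
  rewrite ltrD2l ltr_cos ?in_itv/=.
  - by rewrite ltr_pM2l; [lra|rewrite mulr_gt0].
  - by apply/andP; split; nra.
  - by apply/andP; split; nra.
have B0 : 0 < B by exact: le_lt_trans AB.
have e20 : 0 < e / 2 by rewrite divr_gt0.
have c : (e / 2)^-1 * (A / B) ^+ n @[n --> \oo] --> (0 : K).
  apply: cvg_geometric; rewrite ger0_norm ?divr_ge0 ?(ltW B0)//.
  by rewrite ltr_pdivrMr// mul1r.
apply: (@squeeze_cvgr _ _ _ _ (cst 0) (fun n => (e / 2)^-1 * (A / B) ^+ n)).
- apply: nearW => n; have m0 := cmass_gt0 K n.
  rewrite divr_ge0 ?exprn_ge0 ?(ltW m0)//=.
  rewrite ler_pdivrMr//.
  have h : e / 2 * B ^+ n <= cmass K n by apply: cmass_ge; lra.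
  rewrite exprMn exprVn.
  rewrite [leLHS](_ : _ = (e / 2)^-1 * (A ^+ n * (B ^+ n)^-1) * (e / 2 * B ^+ n)); last first.
    have Bn : B ^+ n != 0 by rewrite expf_neq0// gt_eqF.
    by field; rewrite Bn gt_eqF.
  by apply: ler_wpM2l => //; rewrite !mulr_ge0 ?invr_ge0 ?exprn_ge0 ?(ltW B0) ?(ltW e20).
- exact: cvg_cst.
- exact: c.
Qed.

(** Near [x] continuity of [g] is used with the unit mass of the kernel; far from [x] the kernel is
    uniformly small by [ckern_tail]. *)
Lemma smear_ckern_cvg (g : K -> K) (M x : K) : continuous g ->
  (forall y, 0 < y < 1 -> `|g y| <= M) -> 0 < x < 1 ->
  smear UU (ckern n : mT -> mT -> K) g x @[n --> \oo] --> g x.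
Proof.
move=> cg gM /andP[x0 x1].
have M0 : 0 <= M by apply: le_trans (gM x _); rewrite ?x0.
have mg : measurable_fun setT (g : mT -> K) by exact: continuous_measurable_fun.
have lg : L1 UU (g : mT -> K).
  apply: (@L1_le_ae _ _ _ _ _ (fun=> M)) => //; last exact: L1_pcst.
  by apply: filterS (ae_unif_itv K) => y; exact: gM.
apply/cvgrPdist_le => /= eps eps0.
have e20 : 0 < eps / 2 by rewrite divr_gt0.
have [del /= del0 hdel] : exists2 del : K, 0 < del & forall y, `|x - y| < del -> `|g x - g y| <= eps / 2.
  have /cvgrPdist_le /(_ _ e20) := cg x.
  by move=> /nbhs_ballP[del del0 h]; exists del => // y xy; exact: h.
(* The conditions e <= x and e <= 1 - x force |x - y| <= 1 - e for y in ]0, 1[, which keeps far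
   points away from the periodic copies of the peak. *)
pose e := Num.min (del / 2) (Num.min (4^-1) (Num.min x (1 - x))).
have e0 : 0 < e by rewrite !lt_min divr_gt0//= x0 subr_gt0 x1 invr_gt0 ltr0n.
have ed : e < del.
  have : e <= del / 2 by rewrite ge_min lexx.
  lra.
have e4 : e <= 4^-1 by rewrite !ge_min lexx orbT.
have ex : e <= x by rewrite !ge_min lexx !orbT.
have ex1 : e <= 1 - x by rewrite !ge_min lexx !orbT.
have M20 : 0 < 2 * M + 1 by lra.
have /cvgrPdist_le /(_ (eps / 2 / (2 * M + 1)) (divr_gt0 e20 M20)) := ckern_tail e0 e4.
apply: filterS => n; rewrite sub0r normrN => hn.
set tau := _ / cmass K n in hn.
have m0 := cmass_gt0 K n.
have tau0 : 0 <= tau.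
  by rewrite divr_ge0 ?(ltW m0)// exprn_ge0// -lerBlDl sub0r cos_geN1.
rewrite ger0_norm// in hn.
have kk := @kern_ckern K n.
have lk : L1 UU (ckern n x : mT -> K).
  by apply: eq_L1 (kern_L1_1 kk x (L1_pcst _ 1)) => y; rewrite mulr1.
have -> : g x = \int[UU]_y (ckern n x y * g x).
  by rewrite RZr// (kern_mass kk) mul1r.
rewrite /smear -RB; last 2 first.
- exact: L1Zr.
- exact: (kern_L1_1 kk).
apply: le_trans (R_norm _) _; first by apply: L1B; [exact: L1Zr|exact: (kern_L1_1 kk)].
apply: (@le_trans _ _ (\int[UU]_y (ckern n x y * (eps / 2) + tau * (2 * M)))).
  apply: R_le_ae.
  - by apply/L1_norm/L1B; [exact: L1Zr|exact: (kern_L1_1 kk)].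
  - by apply: L1D; [exact: L1Zr|exact: L1_pcst].
  apply: filterS (ae_unif_itv K) => y /andP[y0 y1].
  rewrite -mulrBr normrM (ger0_norm (kern_ge0 kk _ _)).
  have [xy|xy] := ltP `|x - y| e.
    have h := hdel y (lt_trans xy ed).
    apply: (@le_trans _ _ (ckern n x y * (eps / 2))).
      by rewrite ler_wpM2l// (kern_ge0 kk).
    by rewrite lerDl mulr_ge0// mulr_ge0.
  apply: (@le_trans _ _ (tau * (2 * M))); last first.
    by rewrite lerDr mulr_ge0 ?(kern_ge0 kk)// ltW.
  apply: ler_pM => //; first exact: (kern_ge0 kk).
    rewrite ler_pM2r ?invr_gt0//.
    have -> : cpow n (x - y) = cpow n `|x - y|.
      by case: (ger0P (x - y)) => // _; rewrite cpow_even.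
    have h1 (u : K) : 0 <= 1 + cos (2 * pi * u) by rewrite -lerBlDl sub0r cos_geN1.
    rewrite lerXn2r ?nnegrE// lerD2l.
    apply: cos_2pi_le => //; [lra|lra|].
    by rewrite ler_norml; apply/andP; split; lra.
  apply: le_trans (ler_normB _ _) _; rewrite mulr_natl mulr2n.
  by apply: lerD; apply: gM; [rewrite x0|rewrite y0].
rewrite RD; [|exact: L1Zr|exact: L1_pcst].
rewrite Rcst RZr// (kern_mass kk) mul1r.
have h : tau * (2 * M + 1) <= eps / 2 by rewrite -ler_pdivlMr.
nra.
Qed.

(** Continuous functions are dense in L^1 and smearing is a contraction, so convergence for them
    passes to integrable functions by an eps/3 argument. *)
Lemma approx_id_circle : approx_id UU (@ckern K : nat -> mT -> mT -> K).
Proof.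
split=> [n|f lf]; first exact: kern_ckern.
have mf := L1_meas lf.
have [_ /(_ mf) ] := conj I (@L1_unif K f).
move=> [/(_ lf) fi _].
have m01 : (lebesgue_measure (`[0%R, 1%R]%classic : set K) < +oo)%E.
  by rewrite lebesgue_measure_itv/= lte_fin ltr01 ltry.
have [g_ [cg _ gf]] := approximation_continuous_integrable (measurable_itv _) m01 fi.
have mg k : measurable_fun setT (g_ k : mT -> K) by exact: continuous_measurable_fun.
have bg k : exists M, forall y, 0 < y < 1 -> `|g_ k y| <= M.
  have cI : {within `[0, 1], continuous (g_ k)} by exact: continuous_subspaceT.
  have := continuous_compact cI (segment_compact (a := 0) (b := 1)).
  move=> /compact_bounded[M [_ hM]]; exists (M + 1) => y /andP[y0 y1].
  apply: (hM (M + 1)); first by rewrite ltrDl.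
  by exists y => //=; rewrite in_itv/= !ltW.
have lg k : L1 UU (g_ k : mT -> K).
  have [M gM] := bg k.
  apply: (@L1_le_ae _ _ _ _ _ (fun=> M)) => //; last exact: L1_pcst.
  by apply: filterS (ae_unif_itv K) => y; exact: gM.
have cvgk k : \int[UU]_x `|smear UU (ckern n : mT -> mT -> K) (g_ k) x - g_ k x|
    @[n --> \oo] --> (0 : K).
  have [M gM] := bg k.
  have [] := @R_dct _ _ _ UU (fun n => smear UU (ckern n : mT -> mT -> K) (g_ k)) (g_ k) (fun=> M) => //.
  - by move=> n; exact: L1_meas (smear_L1 (@kern_ckern K n) (lg k)).
  - by apply: filterS (ae_unif_itv K) => x; exact: smear_ckern_cvg gM.
  - exact: L1_pcst.
  - apply: aeW => x n; apply: (smear_bound (@kern_ckern K n)) => //.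
    by apply: filterS (ae_unif_itv K) => y; exact: gM.
have gf' : \int[UU]_x `|f x - g_ k x| @[k --> \oo] --> (0 : K).
  have e k : (\int[UU]_x `|f x - g_ k x|)%:E = (\int[mu]_(z in `[0%R, 1%R]) `|(f z - g_ k z)%:E|)%E.
    rewrite EFinR; last exact/L1_norm/L1B.
    rewrite ge0_unif//.
    by apply/measurable_EFinP; apply: measurableT_comp => //; exact: measurable_funB.
  have /fine_cvgP[_] := gf.
  by apply: cvg_trans; apply: near_eq_cvg; apply: nearW => k /=; rewrite -e.
apply/cvgrPdist_le => /= eps eps0.
have e30 : 0 < eps / 3 by rewrite divr_gt0.
have /cvgrPdist_le /(_ _ e30) [k _ /(_ k (leqnn k)) /=] := gf'.
rewrite sub0r normrN ger0_norm ?Rintegral_ge0// => hk.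
have /cvgrPdist_le /(_ _ e30) := cvgk k.
apply: filterS => n; rewrite !sub0r !normrN !ger0_norm ?Rintegral_ge0// => hn.
have kk := @kern_ckern K n.
have lfg : L1 UU (fun x => f x - g_ k x) by exact: L1B.
have ls := L1_norm (smear_L1 kk lfg).
have lsg := L1_norm (L1B (smear_L1 kk (lg k)) (lg k)).
have l3 := L1_norm lfg.
apply: (@le_trans _ _ (\int[UU]_x
  ((`|smear UU (ckern n : mT -> mT -> K) (fun x => f x - g_ k x) x| +
   `|smear UU (ckern n : mT -> mT -> K) (g_ k) x - g_ k x|) + `|f x - g_ k x|))).
  apply: R_le_ae.
  - by apply/L1_norm/L1B => //; exact: (smear_L1 kk).
  - exact: (L1D (L1D ls lsg) l3).
  apply: aeW => x; rewrite (smearB kk)//.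
  set a := smear _ _ f x; set b := smear _ _ _ x.
  have -> : a - f x = ((a - b) + (b - g_ k x)) - (f x - g_ k x) by ring.
  apply: le_trans (ler_normB _ _) _; rewrite lerD2r; exact: ler_normD.
rewrite (RD (L1D ls lsg) l3) (RD ls lsg).
have hc := smear_contr kk lfg.
have -> : eps = eps / 3 + eps / 3 + eps / 3 by field.
by apply: lerD => //; apply: lerD => //; exact: le_trans hk.
Qed.

End circle_cvg.

Section pushforward.
Context d1 d2 (X : measurableType d1) (Y : measurableType d2) (K : realType).
Variables (P : probability X K) (phi : {RV P >-> Y}).
Local Notation Q := (distribution P phi).

Let mphi : measurable_fun setT phi := measurable_funPT phi.

Lemma L1_distribution (f : Y -> K) : measurable_fun setT f ->
  L1 Q f <-> L1 P (f \o phi).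
Proof.
move=> mf; have h : (\int[Q]_x `|(f x)%:E| = \int[P]_x `|(f (phi x))%:E|)%E.
  rewrite ge0_integral_distribution//.
  by apply: measurableT_comp => //; exact/measurable_EFinP.
split=> /integrableP[_ i]; apply/integrableP; split.
- by apply/measurable_EFinP; exact: measurableT_comp.
- by rewrite -h.
- exact/measurable_EFinP.
- by rewrite h.
Qed.

Lemma R_distribution (f : Y -> K) : measurable_fun setT f ->
  \int[Q]_x f x = \int[P]_x f (phi x).
Proof.
move=> mf; congr fine; rewrite integralE [RHS]integralE.
by congr (_ - _)%E; rewrite ge0_integral_distribution//;
  (try by apply: eq_integral => x _; rewrite /= ?funeposE ?funenegE);
  [apply: measurable_funepos|apply: measurable_funeneg]; exact/measurable_EFinP.
Qed.

Variable k : nat -> Y -> Y -> K.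
Hypothesis surj : forall y, exists x, phi x = y.
Hypothesis mk : forall n, measurable_fun setT (fun p : Y * Y => k n p.1 p.2).
Hypothesis ak : approx_id P (fun n x x' => k n (phi x) (phi x')).

(** Surjectivity turns the pointwise properties of the kernel, known on the image of [phi], into
    properties on all of [Y]; the integrals are transported by change of variables. *)
Lemma approx_id_distribution : approx_id Q k.
Proof.
have kk n : kern P (fun x x' => k n (phi x) (phi x')) := ak.1 n.
have kQ n : kern Q (k n).
  split => //.
  - move=> x y; have [x' <-] := surj x; have [y' <-] := surj y.
    exact: (kern_ge0 (kk n)).
  - move=> x y; have [x' <-] := surj x; have [y' <-] := surj y.
    exact: (kern_sym (kk n)).
  - have [M hM] := kern_bd (kk n); exists M => x y.
    by have [x' <-] := surj x; have [y' <-] := surj y.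
  - move=> x; have [x' <-] := surj x; rewrite R_distribution.
      exact: (kern_mass (kk n)).
    exact: (meas_slice1 _ (mk n)).
split=> // h lh; have mh := L1_meas lh.
have lh' : L1 P (h \o phi) by apply/L1_distribution.
have e n : \int[Q]_x `|smear Q (k n) h x - h x| =
    \int[P]_x `|smear P (fun x x' => k n (phi x) (phi x')) (h \o phi) x - (h \o phi) x|.
  rewrite R_distribution; last first.
    apply: measurableT_comp => //; apply: measurable_funB => //.
    exact: L1_meas (smear_L1 (kQ n) lh).
  apply: eqR => x; congr (`|_ - _|); rewrite /smear R_distribution//.
  by apply: measurable_funM => //; exact: (meas_slice1 _ (mk n)).
under eq_fun do rewrite e.
exact: ak.2 lh'.
Qed.

End pushforward.

(** * The kernel on the torus and its finite expansion *)

Section torus_kernel.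
Variable K : realType.

Definition tkern n N (x y : 'rV[K]_n) : K := \prod_i ckern N (x 0 i) (y 0 i).

Lemma meas_tkern n N :
  measurable_fun setT (fun p : 'rV[K]_n * 'rV[K]_n => tkern N p.1 p.2).
Proof.
apply: measurable_prod => i _.
apply: measurable_funM => //.
have mi : measurable_fun setT (fun p : 'rV[K]_n * 'rV[K]_n => p.1 0 i - p.2 0 i).
  apply: measurable_funB.
    exact: (measurableT_comp (measurable_coord i) measurable_fst).
  exact: (measurableT_comp (measurable_coord i) measurable_snd).
exact: (measurableT_comp (@meas_cpow K N) mi).
Qed.

Lemma tkern_cons n N (p q : measurableTypeR K * 'rV[K]_n) :
  tkern N (consrV p) (consrV q) = ckern N p.1 q.1 * tkern N p.2 q.2.
Proof.
rewrite /tkern /consrV (@big_split_ord _ _ _ 1 n)/= big_ord1; congr (_ * _).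
  by rewrite (row_mxEl p.1%:M p.2 0 ord0) (row_mxEl q.1%:M q.2 0 ord0) !mxE eqxx !mulr1n.
apply: eq_bigr => i _.
by rewrite (row_mxEr p.1%:M p.2 0 i) (row_mxEr q.1%:M q.2 0 i).
Qed.

Lemma consrV_surj n (y : 'rV[K]_n.+1) :
  exists p : measurableTypeR K * 'rV[K]_n, consrV p = y.
Proof.
exists ((y : 'rV_(1 + n)) 0 (lshift n 0), rsubmx (y : 'rV_(1 + n))).
rewrite /consrV/=; apply/rowP => i; case: (@split_ordP 1 n i) => j ->.
  by rewrite (row_mxEl _ _ 0 j) mxE !ord1 eqxx mulr1n.
by rewrite (row_mxEr ((y : 'rV_(1 + n)) 0 (lshift n 0))%:M (rsubmx (y : 'rV_(1 + n))) 0 j) mxE.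
Qed.

(** Induction along the recursive definition of the measure: a point mass with kernel 1 in dimension
    0, then the product with the circle, transported by [consrV]. *)
Lemma approx_id_torus n : approx_id (torus n) (@tkern n).
Proof.
elim: n => [|n ih].
  have z (x : 'rV[K]_0) : x = 0 by apply/rowP => -[].
  have k1 N (x y : 'rV[K]_0) : tkern N x y = 1 by rewrite /tkern big_ord0.
  have rd (f : 'rV[K]_0 -> K) : measurable_fun setT f -> \int[torus 0]_x f x = f 0.
    move=> mf; rewrite /Rintegral integral_dirac//; last exact/measurable_EFinP.
    by rewrite diracT mul1e.
  split=> [N|h lh].
    split.
    - exact: meas_tkern.
    - by move=> x y; rewrite k1.
    - by move=> x y; rewrite !k1.
    - by exists 1 => x y; rewrite k1.
    - by move=> x; under eqR do rewrite k1; rewrite Rcst.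
  have mh := L1_meas lh.
  have e N : \int[torus 0]_x `|smear (torus 0) (@tkern 0 N) h x - h x| = 0.
    rewrite -[RHS](R0 (torus 0)); apply: eqR => x.
    rewrite /smear; under eqR do rewrite k1 mul1r.
    by rewrite rd// (z x) subrr normr0.
  by under eq_fun do rewrite e; exact: cvg_cst.
have := approx_id_prod (approx_id_circle K) ih.
move=> h; apply: approx_id_distribution.
- exact: consrV_surj.
- by move=> N; exact: meas_tkern.
- rewrite (_ : (fun _ _ _ => _) = kprod (@ckern K) (@tkern n)) //.
  by apply/funext => N; apply/funext => p; apply/funext => q; exact: tkern_cons.
Qed.

End torus_kernel.

Section separable.
Variables (K : realType) (d : nat).
Local Notation pt := 'rV[K]_d.
Local Notation xexpr := (@xexpr K d).

Definition sepval (s : seq (xexpr * xexpr)) (x y : pt) : K :=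
  \sum_(e <- s) xeval e.1 x * xeval e.2 y.

(* The kernel depends on [x - y] only: its two gradients are opposite. *)
Definition translational (s : seq (xexpr * xexpr)) : Prop := forall j x y,
  \sum_(e <- s) xeval (xder j e.1) x * xeval e.2 y =
  - \sum_(e <- s) xeval e.1 x * xeval (xder j e.2) y.

Definition separable (k : pt -> pt -> K) : Prop :=
  exists2 s, k = sepval s & translational s.

Lemma separable_cst c : separable (fun _ _ => c).
Proof.
exists [:: (XCst d c, XCst d 1)].
  by apply/funext => x; apply/funext => y; rewrite /sepval big_seq1/= mulr1.
by move=> j x y; rewrite !big_seq1/= mul0r mulr0 oppr0.
Qed.

(** The addition formula for the cosine is the whole source of separation of variables. *)
Lemma separable_cos i : separable (fun x y => cos (2 * pi * (x 0 i - y 0 i))).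
Proof.
exists [:: (XCos K i, XCos K i); (XSin K i, XSin K i)].
  apply/funext => x; apply/funext => y; rewrite /sepval big_cons big_seq1/=.
  by rewrite mulrBr cosB.
move=> j x y; rewrite !big_cons !big_nil/=.
by case: (i == j); rewrite ?mulr1n ?mulr0n; ring.
Qed.

Lemma separableD k l : separable k -> separable l ->
  separable (fun x y => k x y + l x y).
Proof.
move=> [s -> hs] [t -> ht]; exists (s ++ t).
  by apply/funext => x; apply/funext => y; rewrite /sepval big_cat.
by move=> j x y; rewrite !big_cat/= hs ht opprD.
Qed.

(** Opposite gradients survive products: by the product rule, each term of one gradient is minus the
    corresponding term of the other. *)
Lemma separableM k l : separable k -> separable l ->
  separable (fun x y => k x y * l x y).
Proof.
move=> [s -> hs] [t -> ht].
exists [seq (XMul e.1 f.1, XMul e.2 f.2) | e <- s, f <- t].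
  apply/funext => x; apply/funext => y; rewrite /sepval big_allpairs_dep/=.
  rewrite big_distrl/=; apply: eq_bigr => e _; rewrite big_distrr/=.
  by apply: eq_bigr => f _; ring.
move=> j x y; rewrite !big_allpairs_dep/=.
have P (F1 F2 G1 G2 : xexpr -> K) :
   \sum_(e <- s) \sum_(f <- t) (F1 e.1 * F2 e.2 * (G1 f.1 * G2 f.2)) =
   (\sum_(e <- s) F1 e.1 * F2 e.2) * (\sum_(f <- t) G1 f.1 * G2 f.2).
  rewrite big_distrl/=; apply: eq_bigr => e _; rewrite big_distrr/=.
  by apply: eq_bigr => f _.
transitivity ((\sum_(e <- s) xeval e.1 x * xeval e.2 y) *
    (\sum_(f <- t) xeval (xder j f.1) x * xeval f.2 y) +
    (\sum_(e <- s) xeval (xder j e.1) x * xeval e.2 y) *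
    (\sum_(f <- t) xeval f.1 x * xeval f.2 y)).
  rewrite -(P (fun e => xeval e x) (fun e => xeval e y)
    (fun e => xeval (xder j e) x) (fun e => xeval e y)).
  rewrite -(P (fun e => xeval (xder j e) x) (fun e => xeval e y)
    (fun e => xeval e x) (fun e => xeval e y)).
  rewrite -big_split/=; apply: eq_bigr => e _; rewrite -big_split/=.
  by apply: eq_bigr => f _; ring.
rewrite hs ht mulrN mulNr -opprD; congr (- _).
rewrite -(P (fun e => xeval e x) (fun e => xeval e y)
  (fun e => xeval e x) (fun e => xeval (xder j e) y)).
rewrite -(P (fun e => xeval e x) (fun e => xeval (xder j e) y)
  (fun e => xeval e x) (fun e => xeval e y)).
rewrite -big_split/=; apply: eq_bigr => e _; rewrite -big_split/=.
by apply: eq_bigr => f _; ring.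
Qed.

Lemma separable_prod (I : Type) (s : seq I) (k : I -> pt -> pt -> K) :
  (forall i, separable (k i)) -> separable (fun x y => \prod_(i <- s) k i x y).
Proof.
move=> h; elim: s => [|i s ih].
  rewrite (_ : (fun _ _ => _) = (fun _ _ => 1)); first exact: separable_cst.
  by apply/funext => x; apply/funext => y; rewrite big_nil.
rewrite (_ : (fun _ _ => _) = (fun x y => k i x y * \prod_(i <- s) k i x y)).
  exact: separableM.
by apply/funext => x; apply/funext => y; rewrite big_cons.
Qed.

Lemma separable_tkern N : separable (@tkern K d N).
Proof.
apply: separable_prod => i; rewrite /ckern /cpow.
apply: separableM; last exact: separable_cst.
elim: N => [|N ih].
  by rewrite (_ : (fun _ _ => _) = (fun _ _ => 1)); [exact: separable_cst|].
under eq_fun do under eq_fun do rewrite exprS.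
apply: separableM => //; apply: separableD; first exact: separable_cst.
exact: separable_cos.
Qed.

End separable.

Section integral_derivative.
Variable K : realType.

(** Freezes the first coordinate at [s], so that an induction on the dimension can reach the
    remaining ones. *)
Fixpoint xsub n (s : K) (e : @xexpr K n.+1) : @xexpr K n := match e with
  | XCst c => XCst n c
  | XCos i => match @fintype.split 1 n i with inl _ => XCst n (cos (2 * pi * s)) | inr j => XCos K j end
  | XSin i => match @fintype.split 1 n i with inl _ => XCst n (sin (2 * pi * s)) | inr j => XSin K j end
  | XAdd e1 e2 => XAdd (xsub s e1) (xsub s e2)
  | XMul e1 e2 => XMul (xsub s e1) (xsub s e2)
  end.

Lemma consrV_l n (p : measurableTypeR K * 'rV[K]_n) (i : 'I_1) :
  consrV p 0 (lshift n i) = p.1.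
Proof. by rewrite /consrV (row_mxEl p.1%:M p.2 0 i) mxE !ord1 eqxx mulr1n. Qed.

Lemma consrV_r n (p : measurableTypeR K * 'rV[K]_n) (j : 'I_n) :
  consrV p 0 (rshift 1 j) = p.2 0 j.
Proof. by rewrite /consrV (row_mxEr p.1%:M p.2 0 j). Qed.

Lemma xsubE n s (e : @xexpr K n.+1) (x : 'rV[K]_n) :
  xeval (xsub s e) x = xeval e (consrV (s : measurableTypeR K, x)).
Proof.
elim: e => [c|i|i|e1 h1 e2 h2|e1 h1 e2 h2] //=; rewrite ?h1 ?h2//.
- by case: (@split_ordP 1 n i) => j ->; rewrite ?consrV_l ?consrV_r.
- by case: (@split_ordP 1 n i) => j ->; rewrite ?consrV_l ?consrV_r.
Qed.

Lemma xder_xsub n s (e : @xexpr K n.+1) (j : 'I_n) (x : 'rV[K]_n) :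
  xeval (xder j (xsub s e)) x = xeval (xder (rshift 1 j) e) (consrV (s : measurableTypeR K, x)).
Proof.
elim: e => [c|i|i|e1 h1 e2 h2|e1 h1 e2 h2] //=; rewrite ?h1 ?h2// ?xsubE//.
- case: (@split_ordP 1 n i) => k ->; rewrite /= ?consrV_l ?consrV_r.
    by rewrite (eq_lrshift k j) mulr0n mul0r.
  by rewrite (inj_eq (@rshift_inj 1 n)).
- case: (@split_ordP 1 n i) => k ->; rewrite /= ?consrV_l ?consrV_r.
    by rewrite (eq_lrshift k j) mulr0n mul0r.
  by rewrite (inj_eq (@rshift_inj 1 n)).
Qed.

Lemma is_derive_cons n (e : @xexpr K n.+1) (x : 'rV[K]_n) (s : K) :
  is_derive s (1 : K) (fun s => xeval e (consrV (s : measurableTypeR K, x)))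
    (xeval (xder (lshift n (0 : 'I_1)) e) (consrV (s : measurableTypeR K, x))).
Proof.
have lin (t : K) : is_derive t 1 (fun t : K => 2 * pi * t) (2 * pi).
  have h := is_deriveZ (2 * pi : K) (is_derive_id t (1 : K)).
  by apply: (is_derive_eq h); rewrite /GRing.scale/= mulr1.
elim: e => [c|i|i|e1 h1 e2 h2|e1 h1 e2 h2] /=.
- exact: is_derive_cst.
- case: (@split_ordP 1 n i) => k ->.
    rewrite ord1 eqxx mulr1n; under eq_fun do rewrite consrV_l/=.
    rewrite consrV_l/=.
    have h := @is_derive1_comp _ (@cos K) _ s _ _ (is_derive_cos _) (lin s).
    by apply: (is_derive_eq h); rewrite mulrC mulrN mulNr.
  rewrite (eq_rlshift k 0) mulr0n mul0r; under eq_fun do rewrite consrV_r/=.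
  exact: is_derive_cst.
- case: (@split_ordP 1 n i) => k ->.
    rewrite ord1 eqxx mulr1n; under eq_fun do rewrite consrV_l/=.
    rewrite consrV_l/=.
    have h := @is_derive1_comp _ (@sin K) _ s _ _ (is_derive_sin _) (lin s).
    by apply: (is_derive_eq h); rewrite mulrC.
  rewrite (eq_rlshift k 0) mulr0n mul0r; under eq_fun do rewrite consrV_r/=.
  exact: is_derive_cst.
- have h := is_deriveD h1 h2; exact: (is_derive_eq h).
- have h := is_deriveM h1 h2; apply: (is_derive_eq h).
  by rewrite /GRing.scale/= [X in _ + X]mulrC.
Qed.

Lemma xeval_cons1 n (e : @xexpr K n.+1) (x : 'rV[K]_n) :
  xeval e (consrV (1 : measurableTypeR K, x)) = xeval e (consrV (0 : measurableTypeR K, x)).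
Proof.
rewrite -[RHS](xeval_periodic e _ (lshift n (0 : 'I_1))); congr xeval.
apply/rowP => i; rewrite [RHS]mxE [X in _ + X]mxE eqxx/=.
case: (@split_ordP 1 n i) => k ->; rewrite ?consrV_l ?consrV_r/=.
  by rewrite ord1 eqxx add0r.
by rewrite addr0.
Qed.

(** In the first coordinate this is the fundamental theorem and periodicity; the others follow by
    induction after freezing the first. *)
Lemma integral_xder n (i : 'I_n) (e : @xexpr K n) :
  \int[torus n]_x xeval (xder i e) x = 0.
Proof.
elim: n i e => [[]//|n ih] i e.
rewrite R_distribution; last exact: meas_xeval.
have lx (e' : @xexpr K n.+1) : L1 (uniform_prob (@ltr01 K) \x torus n)%E
    (fun p => xeval e' (consrV p)).
  have [M eM] := xeval_bounded e'.
  apply: (@L1_le _ _ _ _ _ (fun=> M)) => //; last exact: L1_pcst.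
  exact: (measurableT_comp (meas_xeval e') (@measurable_consrV K n)).
case: (@split_ordP 1 n i) => k ->.
  rewrite ord1 (R_fubini2 (lx _)) -[RHS](@R0 _ _ K (torus n)); apply: eqR => x.
  rewrite R_unif; last first.
    apply: (measurableT_comp (meas_xeval _)).
    exact: (measurableT_comp (@measurable_consrV K n) (pair2_measurable x)).
  have dF (s : K) := is_derive_cons e x s.
  have cF e' : continuous (fun s : K => xeval e' (consrV (s : measurableTypeR K, x))).
    move=> s; apply: differentiable_continuous; apply/derivable1_diffP.
    by case: (is_derive_cons e' x s).
  have := @continuous_FTC2 K _ _ 0 1 ltr01 (continuous_subspaceT (cF (xder (lshift n (0 : 'I_1)) e))).
  move=> /(_ (fun s : K => xeval e (consrV (s : measurableTypeR K, x)))) H.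
  rewrite /Rintegral H/= ?xeval_cons1 ?subrr//.
    split; [|exact: cvg_at_right_filter (cF _ _)|exact: cvg_at_left_filter (cF _ _)].
    by move=> s _; case: (dF s).
  by move=> s _; rewrite derive1E; case: (dF s).
rewrite (R_fubini1 (lx _)) -[RHS](R0 (uniform_prob (@ltr01 K))); apply: eqR => s.
by rewrite -[RHS](ih k (xsub s e)); apply: eqR => x; rewrite xder_xsub.
Qed.

End integral_derivative.

(** * Weak derivatives on the torus *)

Section torus_calculus.
Variables (K : realType) (d : nat).
Local Notation pt := 'rV[K]_d.
Local Notation P := (@torus K d).
Local Notation xexpr := (@xexpr K d).
Local Notation tk := (@tkern K d).
Implicit Types (f g h : pt -> K) (e : xexpr) (i j : 'I_d).

Let kk N : kern P (tk N) := (approx_id_torus K d).1 N.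

Local Notation bdd := (essbdd P).

Lemma bdd_L1 f : bdd f -> L1 P f.
Proof. by move=> bf; apply: essbdd_L1 => //; rewrite ltey_eq fin_num_measure. Qed.

Lemma bdd_xeval e : bdd (xeval e).
Proof.
split; first exact: meas_xeval.
by have [M eM] := xeval_bounded e; exists M; exact: aeW.
Qed.

Lemma L1_mul_xeval f e : L1 P f -> L1 P (fun x => f x * xeval e x).
Proof. by move=> lf; apply: L1_mul_bdd => //; exact: bdd_xeval. Qed.

(** Weak differentiation tested with trigonometric polynomials only. They separate integrable
    functions, and smeared functions are among them, which is what the calculus rests on. *)
Definition twd i f g : Prop := [/\ L1 P f, L1 P g &
  forall e, \int[P]_x (f x * xeval (xder i e) x) = - \int[P]_x (g x * xeval e x)].

(** Smearing is a finite combination of moments because the kernel is a finite sum of products. As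
    its two gradients are opposite, differentiating the smeared [f] in [x] moves a derivative onto
    the test, and so smears the weak derivative. *)
Lemma smear_expand N : exists s : seq (xexpr * xexpr),
  (forall f, L1 P f -> forall x,
    smear P (tk N) f x = \sum_(a <- s) xeval a.1 x * \int[P]_y (f y * xeval a.2 y)) /\
  (forall j f g, twd j f g -> forall x,
    smear P (tk N) g x = \sum_(a <- s) xeval (xder j a.1) x * \int[P]_y (f y * xeval a.2 y)).
Proof.
have [s ks ts] := separable_tkern K d N.
have sumI (F G : xexpr -> xexpr) h (x : pt) : L1 P h ->
    \sum_(a <- s) xeval (F a.1) x * (\int[P]_y (h y * xeval (G a.2) y)) =
    \int[P]_y ((\sum_(a <- s) xeval (F a.1) x * xeval (G a.2) y) * h y).
  move=> lh; transitivity (\int[P]_y (\sum_(a <- s) xeval (F a.1) x * (h y * xeval (G a.2) y))).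
    rewrite Rsum; last by move=> a _; apply: L1Z; exact: L1_mul_xeval.
    by apply: eq_bigr => a _; rewrite RZ//; exact: L1_mul_xeval.
  by apply: eqR => y; rewrite big_distrl/=; apply: eq_bigr => a _; ring.
exists s; split=> [f lf x|j f g [lf lg fg] x].
  by rewrite (sumI id id)// /smear ks.
rewrite (sumI (xder j) id)//.
transitivity (\int[P]_y (- ((\sum_(a <- s) xeval a.1 x * xeval (xder j a.2) y) * f y))); last first.
  by apply: eqR => y; rewrite ts mulNr.
rewrite RN; last first.
  rewrite (_ : (fun _ => _) = fun y => \sum_(a <- s) xeval a.1 x * (f y * xeval (xder j a.2) y)).
    by apply: L1_sum => a _; apply: L1Z; exact: L1_mul_xeval.
  by apply/funext => y; rewrite big_distrl/=; apply: eq_bigr => a _; ring.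
rewrite -(sumI id (xder j))// -sumrN /smear ks -(sumI id id)//.
by apply: eq_bigr => a _; rewrite fg mulrN opprK.
Qed.

(** The smeared function is a genuine trigonometric polynomial, hence an admissible test, and its
    derivatives are the smeared derivatives. *)
Lemma smear_xeval N f : L1 P f -> exists e,
  (forall x, smear P (tk N) f x = xeval e x) /\
  forall j g, twd j f g -> forall x, xeval (xder j e) x = smear P (tk N) g x.
Proof.
move=> lf; have [s [sf sg]] := smear_expand N.
pose c (e : xexpr) := \int[P]_y (f y * xeval e y).
pose E := foldr (fun a acc => XAdd (XMul a.1 (XCst d (c a.2))) acc) (XCst d 0) s.
have EE (x : pt) : xeval E x = \sum_(a <- s) xeval a.1 x * c a.2.
  rewrite /E; elim: (s) => [|a s' ih] /=; first by rewrite big_nil.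
  by rewrite ih big_cons.
have EdE j (x : pt) : xeval (xder j E) x = \sum_(a <- s) xeval (xder j a.1) x * c a.2.
  rewrite /E; elim: (s) => [|a s' ih] /=; first by rewrite big_nil.
  by rewrite ih big_cons mulr0 add0r.
by exists E; split=> [x|j g fg x]; [rewrite EE sf|rewrite EdE -(sg j f g)].
Qed.

Lemma smear_cvg f g : L1 P f -> bdd g ->
  \int[P]_x (smear P (tk N) f x * g x) @[N --> \oo] --> \int[P]_x (f x * g x).
Proof.
move=> lf bg; have [mg [M gM]] := bg.
have M1 : {ae P, forall x, `|g x| <= `|M|}.
  by apply: filterS gM => x h; exact: le_trans h (ler_norm _).
apply/cvgrPdist_le => /= eps eps0.
have M0 : 0 < `|M| + 1 by rewrite ltr_wpDl.
have := (approx_id_torus K d).2 f lf.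
move=> /cvgrPdist_le /(_ _ (divr_gt0 eps0 M0)).
apply: filterS => N; rewrite sub0r normrN ger0_norm ?Rintegral_ge0// => h.
have ls := smear_L1 (kk N) lf; have lsf := L1B ls lf.
rewrite -RB; [|exact: L1_mul_bdd|exact: L1_mul_bdd].
have l1 : L1 P (fun x => f x * g x - smear P (tk N) f x * g x).
  by apply: L1B; exact: L1_mul_bdd.
apply: le_trans (R_norm l1) _.
apply: (@le_trans _ _ (\int[P]_x (`|smear P (tk N) f x - f x| * (`|M| + 1)))).
  apply: R_le_ae; [exact: L1_norm|exact: L1Zr (L1_norm lsf)|].
  apply: filterS M1 => x gx; rewrite -mulrBl normrM distrC ler_wpM2l//.
  by apply: le_trans gx _; rewrite lerDl.
rewrite RZr; last exact: L1_norm.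
by rewrite -ler_pdivlMr.
Qed.

(** If all moments vanish then so does every smearing of [h], and these tend to [h] in L^1. *)
Lemma twd_separate h : L1 P h -> (forall e, \int[P]_x (h x * xeval e x) = 0) ->
  {ae P, forall x, h x = 0}.
Proof.
move=> lh h0.
have s0 N x : smear P (tk N) h x = 0.
  have [s ks _] := separable_tkern K d N.
  rewrite /smear ks /sepval.
  transitivity (\int[P]_y (\sum_(a <- s) xeval a.1 x * (h y * xeval a.2 y))).
    by apply: eqR => y; rewrite big_distrl/=; apply: eq_bigr => a _; ring.
  rewrite Rsum; last by move=> a _; apply: L1Z; exact: L1_mul_xeval.
  rewrite big1// => a _; rewrite RZ ?h0 ?mulr0//; exact: L1_mul_xeval.
have := (approx_id_torus K d).2 h lh.
under eq_fun do under eqR do rewrite s0 sub0r normrN.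
move=> /cvg_lim => /(_ (@Rhausdorff K)); rewrite lim_cst// => i0.
by apply: R_norm_eq0.
Qed.

Lemma twd_uniq i f g g' : twd i f g -> twd i f g' -> {ae P, forall x, g x = g' x}.
Proof.
move=> [_ lg fg] [_ lg' fg'].
have : {ae P, forall x, g x - g' x = 0}.
  apply: twd_separate; first exact: L1B.
  move=> e; rewrite (_ : (fun x => _) = fun x => g x * xeval e x - g' x * xeval e x).
    rewrite RB; [|exact: L1_mul_xeval|exact: L1_mul_xeval].
    by have := fg e; rewrite fg' => /oppr_inj ->; rewrite subrr.
  by apply/funext => x; rewrite mulrBl.
by apply: filterS => x /eqP; rewrite subr_eq0 => /eqP.
Qed.

Lemma twd_ae i f g f' g' : twd i f g -> measurable_fun setT f' -> measurable_fun setT g' ->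
  {ae P, forall x, f x = f' x} -> {ae P, forall x, g x = g' x} -> twd i f' g'.
Proof.
move=> [lf lg fg] mf' mg' ff' gg'.
have lf' : L1 P f' by exact: L1_ae ff' lf.
have lg' : L1 P g' by exact: L1_ae gg' lg.
split=> // e.
rewrite -(R_ae (L1_meas (L1_mul_xeval (xder i e) lf)) (L1_meas (L1_mul_xeval (xder i e) lf'))).
  rewrite -(R_ae (L1_meas (L1_mul_xeval e lg)) (L1_meas (L1_mul_xeval e lg')))//.
  by apply: filterS gg' => x ->.
by apply: filterS ff' => x ->.
Qed.

Lemma twd_eq i f g f' g' : twd i f g -> f =1 f' -> g =1 g' -> twd i f' g'.
Proof. by move=> h /funext <- /funext <-. Qed.

Lemma twdD i f g f' g' : twd i f f' -> twd i g g' ->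
  twd i (fun x => f x + g x) (fun x => f' x + g' x).
Proof.
move=> [lf lf' ff'] [lg lg' gg']; split; [exact: L1D|exact: L1D|move=> e].
under eqR do rewrite mulrDl; under [in RHS]eqR do rewrite mulrDl.
by rewrite !RD ?ff' ?gg' ?opprD//; exact: L1_mul_xeval.
Qed.

Lemma twdZ i (c : K) f f' : twd i f f' ->
  twd i (fun x => c * f x) (fun x => c * f' x).
Proof.
move=> [lf lf' ff']; split; [exact: L1Z|exact: L1Z|move=> e].
under eqR do rewrite -mulrA; under [in RHS]eqR do rewrite -mulrA.
by rewrite !RZ ?ff' ?mulrN//; exact: L1_mul_xeval.
Qed.

Lemma twdB i f g f' g' : twd i f f' -> twd i g g' ->
  twd i (fun x => f x - g x) (fun x => f' x - g' x).
Proof.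
move=> h1 /(twdZ (-1)) h2; have := twdD h1 h2.
rewrite (_ : (fun x => f x + _) = fun x => f x - g x).
  rewrite (_ : (fun x => f' x + _) = fun x => f' x - g' x)//.
  by apply/funext => x; rewrite mulN1r.
by apply/funext => x; rewrite mulN1r.
Qed.

Lemma twd_int0 i f g : twd i f g -> \int[P]_x g x = 0.
Proof.
move=> [lf lg /(_ (XCst d 1))] /=.
under eqR do rewrite mulr0; under [in RHS]eqR do rewrite mulr1.
by rewrite R0 => /eqP; rewrite eq_sym oppr_eq0 => /eqP.
Qed.

(** The second derivatives have the same moments, since the symbolic derivatives of the test
    commute. *)
Lemma twd_schwarz i j f fi fj fij fji : twd i f fi -> twd j f fj ->
  twd j fi fij -> twd i fj fji -> {ae P, forall x, fij x = fji x}.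
Proof.
move=> [lf lfi hi] [_ lfj hj] [_ lfij hij] [_ lfji hji].
have : {ae P, forall x, fij x - fji x = 0}.
  apply: twd_separate; first exact: L1B.
  move=> e; rewrite (_ : (fun x => _) = fun x => fij x * xeval e x - fji x * xeval e x).
    rewrite RB; [|exact: L1_mul_xeval|exact: L1_mul_xeval].
    have -> : \int[P]_x (fij x * xeval e x) = \int[P]_x (f x * xeval (xder i (xder j e)) x).
      by rewrite hi hij opprK.
    have -> : \int[P]_x (fji x * xeval e x) = \int[P]_x (f x * xeval (xder j (xder i e)) x).
      by rewrite hj hji opprK.
    by apply/eqP; rewrite subr_eq0; apply/eqP/eqR => x; rewrite xderC.
  by apply/funext => x; rewrite mulrBl.
by apply: filterS => x /eqP; rewrite subr_eq0 => /eqP.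
Qed.

Lemma twd_mul_xeval i g g' e : twd i g g' ->
  twd i (fun x => g x * xeval e x) (fun x => g' x * xeval e x + g x * xeval (xder i e) x).
Proof.
move=> [lg lg' gg'].
have l1 := L1_mul_xeval e lg; have l2 := L1_mul_xeval e lg'.
have l3 := L1_mul_xeval (xder i e) lg.
split=> //; first exact: L1D.
move=> e2; have := gg' (XMul e e2); rewrite /=.
rewrite (_ : (fun x => g x * _) = (fun x => g x * xeval e x * xeval (xder i e2) x
    + g x * xeval (xder i e) x * xeval e2 x)); last by apply/funext => x; ring.
rewrite RD; [|exact: L1_mul_xeval|exact: L1_mul_xeval] => /eqP.
rewrite -subr_eq0 opprK => /eqP h.
under [in RHS]eqR do rewrite mulrDl.
rewrite RD; [|exact: L1_mul_xeval|exact: L1_mul_xeval].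
apply/eqP; rewrite -subr_eq0 opprK -h; apply/eqP.
under [X in _ = _ + X]eqR do rewrite mulrA.
by ring.
Qed.


(* Smoothing [f] into a trigonometric polynomial reduces this to the definition. *)
Lemma twd_ibp i f f' g g' : twd i f f' -> twd i g g' -> bdd g -> bdd g' ->
  \int[P]_x (f x * g' x) = - \int[P]_x (f' x * g x).
Proof.
move=> hf hg bg bg'; have [lf lf' _] := hf; have [_ _ gg'] := hg.
have e N : \int[P]_x (smear P (tk N) f x * g' x) = - \int[P]_x (smear P (tk N) f' x * g x).
  have [e [fe de]] := smear_xeval N lf.
  rewrite -[LHS]opprK; congr (- _).
  transitivity (\int[P]_x (g x * xeval (xder i e) x)).
    by rewrite gg'; congr (- _); apply: eqR => x; rewrite fe mulrC.
  by apply: eqR => x; rewrite (de i f')// mulrC.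
have c1 := smear_cvg lf bg'; have c2 := cvgN (smear_cvg lf' bg).
have c3 : \int[P]_x (smear P (tk N) f x * g' x) @[N --> \oo] --> - \int[P]_x (f' x * g x).
  by under eq_fun do rewrite e; exact: c2.
exact: (cvg_unique _ c1 c3).
Qed.

(** Testing the product with [e] amounts to integrating [f] by parts against [g] times [e], which
    [twd_ibp] allows. *)
Lemma twdM i f f' g g' : twd i f f' -> twd i g g' -> bdd g -> bdd g' ->
  twd i (fun x => f x * g x) (fun x => f' x * g x + f x * g' x).
Proof.
move=> hf hg bg bg'; have [lf lf' _] := hf.
have l1 := L1_mul_bdd lf bg; have l2 := L1_mul_bdd lf' bg; have l3 := L1_mul_bdd lf bg'.
split=> //; first exact: L1D.
move=> e; have hge := twd_mul_xeval e hg.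
have b1 : bdd (fun x => g x * xeval e x) by apply: bddM => //; exact: bdd_xeval.
have b2 : bdd (fun x => g' x * xeval e x + g x * xeval (xder i e) x).
  by apply: bddD; apply: bddM => //; exact: bdd_xeval.
have := twd_ibp hf hge b1 b2.
under eqR do rewrite mulrDr !mulrA.
rewrite RD; [|exact: L1_mul_xeval|exact: L1_mul_xeval] => h.
under [in RHS]eqR do rewrite mulrDl.
rewrite RD; [|exact: L1_mul_xeval|exact: L1_mul_xeval].
under [in X in _ = - (X + _)]eqR do rewrite -mulrA.
by rewrite opprD -h; ring.
Qed.

Lemma twd_cst i (c : K) : twd i (fun=> c) (fun=> 0).
Proof.
split; [exact: L1_pcst|exact: L1_pcst|move=> e].
under [in RHS]eqR do rewrite mul0r.
rewrite R0 oppr0 RZ ?integral_xder ?mulr0//.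
exact: bdd_L1 (bdd_xeval _).
Qed.

Lemma twd_sum (I : Type) (s : seq I) i (F G : I -> pt -> K) :
  (forall a, twd i (F a) (G a)) ->
  twd i (fun x => \sum_(a <- s) F a x) (fun x => \sum_(a <- s) G a x).
Proof.
move=> h; elim: s => [|a s ih].
  under eq_fun do rewrite big_nil; under [X in twd _ _ X]eq_fun do rewrite big_nil.
  exact: twd_cst.
under eq_fun do rewrite big_cons; under [X in twd _ _ X]eq_fun do rewrite big_cons.
exact: twdD.
Qed.

(** The derivative of the partial sum of order n+1 of the exponential series is the partial sum of
    order n times [f']. Both sides pass to the limit by domination with exp(M), [M] an essential
    bound of [f]. *)
Lemma twd_exp i f f' : twd i f f' -> bdd f -> bdd f' ->
  twd i (fun x => expR (f x)) (fun x => expR (f x) * f' x).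
Proof.
move=> hf bf bf'; have [mf [M fM]] := bf; have [mf' [M' fM']] := bf'.
have bX n : bdd (fun x => f x ^+ n).
  elim: n => [|n ih]; first exact: (bdd_cst _ 1).
  by under eq_fun do rewrite exprS; exact: bddM.
have hX n : twd i (fun x => f x ^+ n) (fun x => n%:R * f x ^+ n.-1 * f' x).
  elim: n => [|n ih].
    rewrite (_ : (fun x => 0%:R * _ * _) = fun=> 0); first exact: (twd_cst i 1).
    by apply/funext => x; rewrite !mul0r.
  have := twdM ih hf bf bf'.
  rewrite (_ : (fun x => f x ^+ n * f x) = fun x => f x ^+ n.+1); last first.
    by apply/funext => x; rewrite exprSr.
  rewrite (_ : (fun x => _ * f' x * f x + _) = fun x => n.+1%:R * f x ^+ n.+1.-1 * f' x)//.
  apply/funext => x /=; rewrite -natr1; case: (n) => [|m]; first by rewrite !expr0; ring.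
  by rewrite /= exprS; ring.
pose S n x := series (exp_coeff (f x)) n.
have hS n : twd i (S n.+1) (fun x => S n x * f' x).
  rewrite (_ : S n.+1 = fun x => \sum_(0 <= k < n.+1) (k`!%:R)^-1 * f x ^+ k); last first.
    by apply/funext => x; apply: eq_bigr => k _; rewrite /exp_coeff/= mulrC.
  rewrite (_ : (fun x => S n x * f' x) =
      fun x => \sum_(0 <= k < n.+1) (k`!%:R)^-1 * (k%:R * f x ^+ k.-1 * f' x)).
    by apply: twd_sum => k; exact: twdZ.
  apply/funext => x; rewrite big_nat_recl// !mul0r mulr0 add0r /S /series/= big_distrl/=.
  apply: eq_big_nat => k _; rewrite /exp_coeff/= factS natrM invfM.
  have k0 : k.+1%:R != 0 :> K by rewrite pnatr_eq0.
  have kf : k`!%:R != 0 :> K by rewrite pnatr_eq0 -lt0n fact_gt0.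
  by move: (k.+1%:R : K) (k`!%:R : K) k0 kf => a b a0 b0; field; rewrite ?a0 ?b0.
have Scvg x : S n x @[n --> \oo] --> expR (f x) by exact: is_cvg_series_exp_coeff.
have SM x n : `|S n x| <= expR `|f x|.
  apply: (@le_trans _ _ (series (exp_coeff `|f x|) n)).
    apply: le_trans (ler_norm_sum _ _ _) _; apply: ler_sum => k _.
    by rewrite /exp_coeff/= normrM normrX normfV normr_nat.
  apply: nondecreasing_cvgn_le; last exact: is_cvg_series_exp_coeff.
  apply/nondecreasing_seqP => m; rewrite /series/= big_nat_recr//= lerDl.
  by rewrite /exp_coeff/= mulr_ge0 ?exprn_ge0 ?invr_ge0.
have SM' : {ae P, forall x n, `|S n x| <= expR M}.
  by apply: filterS fM => x fM n; apply: le_trans (SM x n) _; rewrite ler_expR.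
have mS n : measurable_fun setT (S n).
  case: n => [|n]; last by have [/L1_meas] := hS n.
  rewrite (_ : S 0%N = fun=> 0) //; apply/funext => x.
  by rewrite /S /series/= big_geq.
have me : measurable_fun setT (fun x => expR (f x)).
  by apply: measurableT_comp => //; exact: measurable_expR.
have be : bdd (fun x => expR (f x)).
  split => //; exists (expR M); apply: filterS fM => x fM.
  by rewrite ger0_norm ?expR_ge0// ler_expR (le_trans (ler_norm _)).
have bef : bdd (fun x => expR (f x) * f' x) by exact: bddM.
split; [exact: bdd_L1|exact: bdd_L1|move=> e].
have lim (G : nat -> pt -> K) (g : pt -> K) e2 (B : K) :
    (forall n, measurable_fun setT (G n)) -> measurable_fun setT g ->
    (forall x, G n x @[n --> \oo] --> g x) -> {ae P, forall x n, `|G n x| <= B} ->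
    \int[P]_x (G n x * xeval e2 x) @[n --> \oo] --> \int[P]_x (g x * xeval e2 x).
  move=> mG mg cG GB; have [N eN] := xeval_bounded e2.
  have [] := @R_dct _ _ _ P (fun n x => G n x * xeval e2 x)
    (fun x => g x * xeval e2 x) (fun=> B * N).
  - by move=> n; apply: measurable_funM => //; exact: meas_xeval.
  - by apply: measurable_funM => //; exact: meas_xeval.
  - by apply: aeW => x; apply: cvgM; [exact: cG|exact: cvg_cst].
  - exact: L1_pcst.
  - by apply: filterS GB => x GB n; rewrite normrM ler_pM.
  by [].
have c1 := lim (fun n => S n.+1) (fun x => expR (f x)) (xder i e) (expR M)
  (fun n => mS n.+1) me.
have {}c1 : \int[P]_x (S n.+1 x * xeval (xder i e) x) @[n --> \oo] -->
    \int[P]_x (expR (f x) * xeval (xder i e) x).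
  apply: c1; first by move=> x; rewrite (cvg_shiftS (S ^~ x)).
  by apply: filterS SM' => x h n.
have c2 : \int[P]_x (S n x * f' x * xeval e x) @[n --> \oo] -->
    \int[P]_x (expR (f x) * f' x * xeval e x).
  apply: (lim _ _ _ (expR M * M')).
  - by move=> n; exact: measurable_funM.
  - exact: measurable_funM.
  - by move=> x; apply: cvgM; [exact: Scvg|exact: cvg_cst].
  - by apply: filterS2 SM' fM' => x h1 h2 n; rewrite normrM ler_pM.
apply: (cvg_unique (@Rhausdorff K) c1).
have -> : (fun n => \int[P]_x (S n.+1 x * xeval (xder i e) x)) =
    (fun n => - \int[P]_x (S n x * f' x * xeval e x)).
  by apply/funext => n; have [_ _ ->] := hS n.
exact: cvgN.
Qed.

Local Notation L2 := (sqint P).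

Lemma L2_L1 f : L2 f -> L1 P f.
Proof. exact/sqint_L1/L1_pcst. Qed.

Lemma young (A a b : K) : 0 < A -> `|a * b| <= A * a ^+ 2 + A^-1 * b ^+ 2.
Proof.
move=> A0; rewrite normrM -(real_normK (num_real a)) -(real_normK (num_real b)).
set u := `|a|; set v := `|b|; have u0 : 0 <= u := normr_ge0 a; have v0 : 0 <= v := normr_ge0 b.
have h : 0 <= A^-1 * (A * u - v) ^+ 2 by rewrite mulr_ge0 ?sqr_ge0// invr_ge0 ltW.
have e : A^-1 * (A * u - v) ^+ 2 = A * u ^+ 2 - 2 * (u * v) + A^-1 * v ^+ 2.
  by field; rewrite gt_eqF.
have uv : 0 <= u * v by exact: mulr_ge0.
by rewrite e in h; lra.
Qed.

(** The weighted Young inequality is applied under the kernel and integrated with the unit mass in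
    each variable. The free weight [A] makes one term small, after which the other is made small by
    the choice of [g]. *)
Lemma smear_young N (A : K) f g : 0 < A -> L2 f -> L2 g ->
  L1 P (fun x => smear P (tk N) f x * g x) /\
  `|\int[P]_x (smear P (tk N) f x * g x)| <=
    A * \int[P]_x (f x ^+ 2) + A^-1 * \int[P]_x (g x ^+ 2).
Proof.
move=> A0 hf hg; have [mf lf2] := hf; have [mg lg2] := hg.
have lf := L2_L1 hf; have lg := L2_L1 hg.
have [M kM] := kern_bd (kk N).
pose F (p : pt * pt) := tk N p.1 p.2 * f p.2 * g p.1.
have mk := kern_meas (kk N).
have mF : measurable_fun setT F.
  apply: measurable_funM; last exact: (measurableT_comp mg measurable_fst).
  apply: measurable_funM => //; exact: (measurableT_comp mf measurable_snd).
have lF : L1 (P \x P)%E F.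
  apply: (@L1_le _ _ _ _ _ (fun p => M * (`|g p.1| * `|f p.2|))) => //.
    move=> p; rewrite /F !normrM ger0_norm ?(kern_ge0 (kk N))// -mulrA [X in _ * X]mulrC.
    by rewrite ler_wpM2r// mulr_ge0.
  by apply: L1Z; exact: L1_prodM (L1_norm lg) (L1_norm lf).
have e : \int[P]_x (smear P (tk N) f x * g x) = \int[(P \x P)%E]_p F p.
  rewrite R_fubini1//; apply: eqR => x; rewrite /smear -RZr//.
  exact: (kern_L1_1 (kk N)).
have l1 := kern_L1 (kk N) lf2; have l2 := kern_L1 (kk N) lg2.
have l2' : L1 (P \x P)%E (fun p => tk N p.1 p.2 * g p.1 ^+ 2).
  apply: (@L1_le _ _ _ _ _ (fun p => M * (g p.1 ^+ 2 * 1))).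
  - apply: measurable_funM => //; apply: measurable_funX.
    exact: (measurableT_comp mg measurable_fst).
  - move=> p; rewrite mulr1 normrM ger0_norm ?(kern_ge0 (kk N))//.
    by rewrite ger0_norm ?sqr_ge0// ler_wpM2r ?sqr_ge0.
  - by apply: L1Z; exact: L1_prodM lg2 (L1_pcst _ 1).
split.
  have h := L1_int1 lF; apply: eq_L1 h => x; rewrite /F/= /smear -RZr//.
  exact: (kern_L1_1 (kk N)).
rewrite e; apply: le_trans (R_norm lF) _.
apply: (@le_trans _ _ (\int[(P \x P)%E]_p
   (A * (tk N p.1 p.2 * f p.2 ^+ 2) + A^-1 * (tk N p.1 p.2 * g p.1 ^+ 2)))).
  apply: R_le_ae; [exact: L1_norm|by apply: L1D; exact: L1Z|].
  apply: aeW => p; rewrite /F -mulrA normrM ger0_norm ?(kern_ge0 (kk N))//.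
  rewrite mulrCA [X in _ + X]mulrCA -mulrDr; apply: ler_wpM2l; first exact: (kern_ge0 (kk N)).
  exact: young.
rewrite RD; [|exact: L1Z|exact: L1Z]; rewrite !RZ//.
have -> : \int[(P \x P)%E]_p (tk N p.1 p.2 * f p.2 ^+ 2) = \int[P]_x (f x ^+ 2).
  rewrite R_fubini2//; apply: eqR => y /=; rewrite RZr.
    rewrite -[RHS]mul1r -(kern_mass (kk N) y); congr (_ * _).
    by apply: eqR => x; rewrite (kern_sym (kk N)).
  by apply: eq_L1 (kern_L1_1 (kk N) y (L1_pcst _ 1)) => x; rewrite mulr1 (kern_sym (kk N)).
have -> : \int[(P \x P)%E]_p (tk N p.1 p.2 * g p.1 ^+ 2) = \int[P]_x (g x ^+ 2).
  rewrite R_fubini1//; apply: eqR => x /=; rewrite RZr.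
    by rewrite (kern_mass (kk N)) mul1r.
  by apply: eq_L1 (kern_L1_1 (kk N) x (L1_pcst _ 1)) => y; rewrite mulr1.
by [].
Qed.

(** [g] is truncated at height [n]. The bounded part is [smear_cvg]; the remainder is controlled
    uniformly in [N] by [smear_young]. *)
Lemma smear_cvg_L2 f g : L2 f -> L2 g ->
  \int[P]_x (smear P (tk N) f x * g x) @[N --> \oo] --> \int[P]_x (f x * g x).
Proof.
move=> hf hg; have [mf lf2] := hf; have [mg lg2] := hg.
pose T n x : K := g x * (`|g x| <= n%:R)%R%:R.
have mT n : measurable_fun setT (T n).
  apply: measurable_funM => //.
  rewrite (_ : (fun x => _) = \1_[set x | `|g x| <= n%:R]).
    apply: measurable_indic; rewrite -[X in measurable X]setTI.
    rewrite (_ : [set x | _] = (fun x => `|g x| <= n%:R) @^-1` [set true]) //.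
    apply: (@measurable_fun_ler _ _ _ _ (fun x => `|g x|) (cst n%:R)) => //.
    exact: measurableT_comp.
  apply/funext => x; rewrite indicE.
  by case E : (`|g x| <= n%:R); [rewrite mem_set|rewrite memNset//= E].
have bT n : bdd (T n).
  split => //; exists n%:R; apply: aeW => x; rewrite /T.
  by case: (leP `|g x| n%:R) => h'; rewrite ?mulr1 ?mulr0 ?normr0.
have T0 n x : `|g x - T n x| <= `|g x|.
  rewrite /T; case: (leP `|g x| n%:R) => _; first by rewrite mulr1 subrr normr0.
  by rewrite mulr0 subr0.
have hgT n : L2 (fun x => g x - T n x).
  have m : measurable_fun setT (fun x => g x - T n x) by exact: measurable_funB.
  split => //; apply: (@L1_le _ _ _ _ _ (fun x => g x ^+ 2)) => //.
    exact: measurable_funX.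
  move=> x; rewrite normrX -[leRHS](real_normK (num_real (g x))).
  by rewrite lerXn2r ?nnegrE.
have cT : \int[P]_x ((g x - T n x) ^+ 2) @[n --> \oo] --> (0 : K).
  have [] := @R_dct _ _ _ P (fun n x => (g x - T n x) ^+ 2) (cst 0) (fun x => g x ^+ 2).
  - by move=> n; apply: measurable_funX; exact: measurable_funB.
  - exact: measurable_cst.
  - apply: aeW => x; apply: cvg_near_cst.
    near=> n; rewrite /T (_ : `|g x| <= n%:R); first by rewrite mulr1 subrr expr0n.
    by near: n; exact: nbhs_infty_ger.
  - exact: lg2.
  - apply: aeW => x n; rewrite normrX -[leRHS](real_normK (num_real (g x))).
    by rewrite lerXn2r ?nnegrE.
  by move=> _; rewrite R0.
apply/cvgrPdist_le => /= eps eps0.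
set F := \int[P]_x (f x ^+ 2).
have F0 : 0 <= F by apply: Rintegral_ge0 => x _; exact: sqr_ge0.
have F1 : 0 < F + 1 by rewrite ltr_wpDl.
(* [A] is fixed before [n], so that A F and then G / A are at most eps/6; both remainders and the
   bounded part then cost eps/3 each. The [+ 1] covers F = 0. *)
pose A := eps / 6 / (F + 1).
have A0 : 0 < A by rewrite !divr_gt0.
have AF : A * F <= eps / 6.
  rewrite /A -mulrA ler_piMr ?divr_ge0 ?(ltW eps0)// mulrC ler_pdivrMr//; lra.
have e1 : 0 < eps / 6 * A by rewrite mulr_gt0// divr_gt0.
have /cvgrPdist_le /(_ _ e1) [n _ /(_ n (leqnn n)) /=] := cT.
rewrite sub0r normrN ger0_norm; last by apply: Rintegral_ge0 => x _; exact: sqr_ge0.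
set G := \int[P]_x ((g x - T n x) ^+ 2) => hG.
have AG : A^-1 * G <= eps / 6 by rewrite mulrC ler_pdivrMr.
have e3 : 0 < eps / 3 by rewrite divr_gt0.
have /cvgrPdist_le /(_ _ e3) := smear_cvg (L2_L1 hf) (bT n).
apply: filterS => N hN.
have [l1 h1] := smear_young N A0 hf (hgT n).
have l2 : L1 P (fun x => smear P (tk N) f x * T n x).
  by apply: L1_mul_bdd => //; exact: (smear_L1 (kk N) (L2_L1 hf)).
have l3 : L1 P (fun x => f x * (g x - T n x)) by exact: L2_mul.
have l4 : L1 P (fun x => f x * T n x) by apply: L1_mul_bdd => //; exact: L2_L1.
have h3 : `|\int[P]_x (f x * (g x - T n x))| <= A * F + A^-1 * G.
  have lA : L1 P (fun x => A * f x ^+ 2) by exact: L1Z.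
  have lB : L1 P (fun x => A^-1 * (g x - T n x) ^+ 2) by apply: L1Z; have [] := hgT n.
  apply: le_trans (R_norm l3) _; rewrite /F /G -!RZ//; last by have [] := hgT n.
  rewrite -RD//; apply: R_le_ae; [exact: L1_norm|exact: L1D|].
  by apply: aeW => x; exact: young.
have -> : \int[P]_x (f x * g x) = \int[P]_x (f x * (g x - T n x)) + \int[P]_x (f x * T n x).
  by rewrite -RD//; apply: eqR => x; ring.
have -> : \int[P]_x (smear P (tk N) f x * g x) =
    \int[P]_x (smear P (tk N) f x * (g x - T n x)) + \int[P]_x (smear P (tk N) f x * T n x).
  by rewrite -RD//; apply: eqR => x; ring.
move: h1 h3 hN; set a := \int[P]_x (smear _ _ _ x * (g x - _)).
set b := \int[P]_x (f x * (_ - _)); set c := \int[P]_x (f x * T n x).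
set e := \int[P]_x (smear _ _ _ x * T n x).
rewrite !ler_norml => /andP[a1 a2] /andP[b1 b2] /andP[c1 c2].
by apply/andP; split; rewrite -/F -/G in a1 a2; lra.
Unshelve. all: by end_near. Qed.

(** With [f] unbounded, the product rule [twdM] does not apply. One factor is smeared and absorbed
    in the test function, and the limit is taken by the L^2 convergence; this is used for rho =
    sqrt(rho)^2. *)
Lemma twd_sq i f f' : twd i f f' -> L2 f -> L2 f' ->
  twd i (fun x => f x ^+ 2) (fun x => 2 * f x * f' x).
Proof.
move=> hf f2 f2'; have [lf lf' _] := hf.
have lff : L1 P (fun x => f x ^+ 2) by case: f2.
have lff' : L1 P (fun x => 2 * f x * f' x).
  by apply: eq_L1 (L1Z 2 (L2_mul f2 f2')) => x; rewrite mulrA.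
split=> // e.
have b1 := bdd_xeval e; have b2 := bdd_xeval (xder i e).
have c1 := smear_cvg_L2 f2 (L2_mul_bdd f2 b2).
have c2 := smear_cvg_L2 f2 (L2_mul_bdd f2' b1).
have c3 := smear_cvg_L2 f2' (L2_mul_bdd f2 b1).
have E N : \int[P]_x (smear P (tk N) f x * (f x * xeval (xder i e) x)) =
   - (\int[P]_x (smear P (tk N) f x * (f' x * xeval e x)) +
      \int[P]_x (smear P (tk N) f' x * (f x * xeval e x))).
  have [a [fa da]] := smear_xeval N lf.
  have [_ _ h] := hf; have := h (XMul a e); rewrite /=.
  have l1 : L1 P (fun x => smear P (tk N) f x * (f x * xeval (xder i e) x)).
    by apply: eq_L1 (L1_mul_xeval (XMul a (xder i e)) lf) => x; rewrite fa /=; ring.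
  have l2 : L1 P (fun x => smear P (tk N) f' x * (f x * xeval e x)).
    by apply: eq_L1 (L1_mul_xeval (XMul (xder i a) e) lf) => x; rewrite -(da i f')//=; ring.
  rewrite (_ : (fun x => f x * _) = (fun x => smear P (tk N) f x * (f x * xeval (xder i e) x)
     + smear P (tk N) f' x * (f x * xeval e x))); last first.
    by apply/funext => x; rewrite fa -(da i f')//; ring.
  rewrite (_ : (fun x => f' x * _) = (fun x => smear P (tk N) f x * (f' x * xeval e x))); last first.
    by apply/funext => x; rewrite fa; ring.
  by rewrite RD// => H; rewrite opprD -H addrK.
have c4 := cvgN (cvgD c2 c3).
have c5 : \int[P]_x (smear P (tk N) f x * (f x * xeval (xder i e) x)) @[N --> \oo] -->
    - (\int[P]_x (f x * (f' x * xeval e x)) + \int[P]_x (f' x * (f x * xeval e x))).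
  by under eq_fun do rewrite E; exact: c4.
have H := cvg_unique (@Rhausdorff K) c1 c5.
transitivity (\int[P]_x (f x * (f x * xeval (xder i e) x))).
  by apply: eqR => x; rewrite expr2 mulrA.
rewrite H; congr (- _); rewrite -RD; last 2 first.
- by apply: L2_mul => //; exact: L2_mul_bdd.
- by apply: L2_mul => //; exact: L2_mul_bdd.
by apply: eqR => x; ring.
Qed.

End torus_calculus.

(** * A countable spanning family of tests *)

Section monomials.
Variables (K : realType) (d : nat).
Local Notation pt := 'rV[K]_d.
Local Notation P := (@torus K d).
Local Notation xexpr := (@xexpr K d).
Local Notation idx := (seq (bool * 'I_d)).
Implicit Types (f g h : pt -> K) (e : xexpr) (i j : 'I_d).

(** Monomials in sines and cosines. There are countably many, so statements valid at almost every
    time for each of them hold for all of them outside one null set of times. *)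
Definition mono (m : idx) : xexpr :=
  foldr (fun a acc => XMul (if a.1 then XCos K a.2 else XSin K a.2) acc) (XCst d 1) m.

Lemma mono_cat m1 m2 x : xeval (mono (m1 ++ m2)) x = xeval (mono m1) x * xeval (mono m2) x.
Proof. by elim: m1 => [|a m ih] /=; rewrite ?mul1r// ih mulrA. Qed.

Lemma xder_mono_cat j m1 m2 x : xeval (xder j (mono (m1 ++ m2))) x =
  xeval (mono m1) x * xeval (xder j (mono m2)) x + xeval (xder j (mono m1)) x * xeval (mono m2) x.
Proof.
elim: m1 => [|a m ih] /=; first by rewrite mul1r mul0r addr0.
by rewrite ih mono_cat; ring.
Qed.

(** The second clause is carried along because [xder] acts on syntax: equality of the functions
    alone would not transfer to the symbolic derivatives. *)
Definition spanned e (s : seq (K * idx)) : Prop :=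
  (forall x, xeval e x = \sum_(a <- s) a.1 * xeval (mono a.2) x) /\
  (forall j x, xeval (xder j e) x = \sum_(a <- s) a.1 * xeval (xder j (mono a.2)) x).

Lemma mono_span e : exists s, spanned e s.
Proof.
elim: e => [c|i|i|e1 [s1 [h1 k1]] e2 [s2 [h2 k2]]|e1 [s1 [h1 k1]] e2 [s2 [h2 k2]]].
- by exists [:: (c, [::])]; split=> [x|j x]; rewrite big_seq1/= ?mulr1// mulr0.
- exists [:: (1, [:: (true, i)])]; split=> [x|j x]; rewrite big_seq1/= ?mulr1 ?mul1r//.
  by rewrite mulr0 add0r.
- exists [:: (1, [:: (false, i)])]; split=> [x|j x]; rewrite big_seq1/= ?mulr1 ?mul1r//.
  by rewrite mulr0 add0r.
- by exists (s1 ++ s2); split=> [x|j x]; rewrite big_cat/= -?h1 -?h2 -?k1 -?k2.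
- exists [seq (a.1 * b.1, a.2 ++ b.2) | a <- s1, b <- s2]; split=> [x|j x].
    rewrite big_allpairs_dep/= h1 h2 big_distrl/=; apply: eq_bigr => a _.
    rewrite big_distrr/=; apply: eq_bigr => b _.
    by rewrite mono_cat; ring.
  rewrite big_allpairs_dep/= h1 h2 k1 k2 !big_distrl/= -big_split/=; apply: eq_bigr => a _.
  rewrite !big_distrr/= -big_split/=; apply: eq_bigr => b _.
  by rewrite xder_mono_cat; ring.
Qed.

Lemma spanned_int e s f : spanned e s -> L1 P f ->
  \int[P]_x (f x * xeval e x) = \sum_(a <- s) a.1 * \int[P]_x (f x * xeval (mono a.2) x).
Proof.
move=> [es _] lf.
transitivity (\int[P]_x \sum_(a <- s) a.1 * (f x * xeval (mono a.2) x)).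
  by apply: eqR => x; rewrite es big_distrr/=; apply: eq_bigr => a _; ring.
rewrite Rsum; last by move=> a _; apply: L1Z; exact: L1_mul_xeval.
by apply: eq_bigr => a _; rewrite RZ//; exact: L1_mul_xeval.
Qed.

Lemma spanned_int_xder e s f j : spanned e s -> L1 P f ->
  \int[P]_x (f x * xeval (xder j e) x) =
  \sum_(a <- s) a.1 * \int[P]_x (f x * xeval (xder j (mono a.2)) x).
Proof.
move=> [_ es] lf.
transitivity (\int[P]_x \sum_(a <- s) a.1 * (f x * xeval (xder j (mono a.2)) x)).
  by apply: eqR => x; rewrite es big_distrr/=; apply: eq_bigr => a _; ring.
rewrite Rsum; last by move=> a _; apply: L1Z; exact: L1_mul_xeval.
by apply: eq_bigr => a _; rewrite RZ//; exact: L1_mul_xeval.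
Qed.

Lemma mono_separate h : L1 P h -> (forall m, \int[P]_x (h x * xeval (mono m) x) = 0) ->
  {ae P, forall x, h x = 0}.
Proof.
move=> lh h0; apply: twd_separate => // e.
have [s es] := mono_span e.
by rewrite (spanned_int es)// big1// => a _; rewrite h0 mulr0.
Qed.

Lemma twd_mono i f g : L1 P f -> L1 P g ->
  (forall m, \int[P]_x (f x * xeval (xder i (mono m)) x) = - \int[P]_x (g x * xeval (mono m) x)) ->
  twd i f g.
Proof.
move=> lf lg h; split => // e; have [s es] := mono_span e.
rewrite (spanned_int es)// (spanned_int_xder _ es)// -sumrN.
by apply: eq_bigr => a _; rewrite h mulrN.
Qed.

End monomials.
Arguments mono {K d} m.

Section ae_product_comparison.
Context d1 d2 (X : measurableType d1) (Y : measurableType d2) (K : realType).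
Variables (m1 : {sigma_finite_measure set X -> \bar K})
          (m2 : {sigma_finite_measure set Y -> \bar K}).
Local Notation Q := (m1 \x m2)%E.
Implicit Types F G : X * Y -> K.

Let mle F G : measurable_fun setT F -> measurable_fun setT G ->
  measurable [set p | F p <= G p].
Proof.
move=> mF mG; rewrite -[X in measurable X]setTI.
rewrite (_ : [set p | _] = (fun p => F p <= G p) @^-1` [set true]) //.
exact: (measurable_fun_ler mF mG).
Qed.

Lemma ae_le_prod1 F G : measurable_fun setT F -> measurable_fun setT G ->
  {ae m1, forall x, {ae m2, forall y, F (x, y) <= G (x, y)}} ->
  {ae Q, forall p, F p <= G p}.
Proof. by move=> mF mG h; exact: (@ae_prod1 _ _ _ _ _ m1 m2 _ (mle mF mG) h). Qed.

Lemma ae_le_prod2 F G : measurable_fun setT F -> measurable_fun setT G ->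
  {ae m2, forall y, {ae m1, forall x, F (x, y) <= G (x, y)}} ->
  {ae Q, forall p, F p <= G p}.
Proof. by move=> mF mG h; exact: (@ae_prod2 _ _ _ _ _ m1 m2 _ (mle mF mG) h). Qed.

Lemma ae_eq_prod1 F G : measurable_fun setT F -> measurable_fun setT G ->
  {ae m1, forall x, {ae m2, forall y, F (x, y) = G (x, y)}} ->
  {ae Q, forall p, F p = G p}.
Proof.
move=> mF mG h.
have h1 : {ae Q, forall p, F p <= G p}.
  apply: ae_le_prod1 => //; apply: filterS h => x hx.
  by apply: filterS hx => y ->.
have h2 : {ae Q, forall p, G p <= F p}.
  apply: ae_le_prod1 => //; apply: filterS h => x hx.
  by apply: filterS hx => y ->.
by apply: filterS2 h1 h2 => p p1 p2; apply/eqP; rewrite eq_le p1 p2.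
Qed.

Lemma ae_eq_prod2 F G : measurable_fun setT F -> measurable_fun setT G ->
  {ae m2, forall y, {ae m1, forall x, F (x, y) = G (x, y)}} ->
  {ae Q, forall p, F p = G p}.
Proof.
move=> mF mG h.
have h1 : {ae Q, forall p, F p <= G p}.
  apply: ae_le_prod2 => //; apply: filterS h => x hx.
  by apply: filterS hx => y ->.
have h2 : {ae Q, forall p, G p <= F p}.
  apply: ae_le_prod2 => //; apply: filterS h => x hx.
  by apply: filterS hx => y ->.
by apply: filterS2 h1 h2 => p p1 p2; apply/eqP; rewrite eq_le p1 p2.
Qed.

End ae_product_comparison.

(** * Weak derivatives in space-time *)

Section spacetime.
Variables (K : realType) (d : nat) (T : K).
Local Notation pt := 'rV[K]_d.
Local Notation mT := (measurableTypeR K).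
Local Notation tm := (time T).
Local Notation P := (@torus K d).
Local Notation ST := (tm \x P)%E.
Local Notation xexpr := (@xexpr K d).
Implicit Types (f g h : mT * pt -> K) (e : xexpr) (i j : 'I_d) (chi : K -> K).

Lemma cont_bounded chi : continuous chi -> exists M : K, {ae tm, forall t : mT, `|chi t| <= M}.
Proof.
move=> cchi; have [T0|T0] := ltP 0 T; last first.
  by exists 0; apply: filterS (ae_time_itv T) => t /andP[t0 tT]; have := lt_trans t0 tT; rewrite ltNge T0.
have cn : {within `[0, T], continuous (fun t => `|chi t|)}.
  apply: continuous_subspaceT => t; apply: continuous_comp; [exact: cchi|exact: norm_continuous].
have [c _ cM] := EVT_max (ltW T0) cn.
exists `|chi c|; apply: filterS (ae_time_itv T) => t /andP[t0 tT].
by apply: cM; rewrite in_itv/= (ltW t0) (ltW tT).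
Qed.

Lemma L1_mul_cont (h : mT -> K) chi : L1 tm h -> continuous chi -> L1 tm (fun t => h t * chi t).
Proof.
move=> lh cchi; have [M cM] := cont_bounded cchi.
by apply: L1_mul_bounded cM => //; exact: continuous_measurable_fun.
Qed.

Lemma L1_st_mul f (g : mT -> K) (h : pt -> K) (M N : K) : L1 ST f ->
  measurable_fun setT g -> {ae tm, forall t, `|g t| <= M} ->
  measurable_fun setT h -> {ae P, forall x, `|h x| <= N} ->
  L1 ST (fun p => f p * (g p.1 * h p.2)).
Proof.
move=> lf mg gM mh hN.
have mg1 : measurable_fun setT (fun p : mT * pt => g p.1) by exact: (measurableT_comp mg measurable_fst).
have mh2 : measurable_fun setT (fun p : mT * pt => h p.2) by exact: (measurableT_comp mh measurable_snd).
apply: (@L1_mul_bounded _ _ _ _ (`|M| * `|N|)) => //; first exact: measurable_funM.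
apply: ae_le_prod1 => //; first by apply: measurableT_comp => //; exact: measurable_funM.
apply: filterS gM => t gt; apply: filterS hN => x hx /=.
by rewrite normrM ler_pM// (le_trans _ (ler_norm _)).
Qed.

Lemma L1_st_space f (h : pt -> K) : L1 ST f -> essbdd P h -> L1 ST (fun p => f p * h p.2).
Proof.
move=> lf [mh [N hN]].
apply: eq_L1 (@L1_st_mul f (fun=> 1) h 1 N lf _ _ mh hN) => //.
  by move=> p; rewrite mul1r.
by apply: aeW => t; rewrite normr1.
Qed.

Lemma L1_st_xeval f e : L1 ST f -> L1 ST (fun p => f p * xeval e p.2).
Proof. by move=> lf; apply: L1_st_space => //; exact: bdd_xeval. Qed.

Definition moment f e (t : mT) : K := \int[P]_x (f (t, x) * xeval e x).

Lemma L1_moment f e : L1 ST f -> L1 tm (moment f e).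
Proof. by move=> lf; exact: (L1_int1 (L1_st_xeval e lf)). Qed.

Lemma L1_tprod f chi e : L1 ST f -> continuous chi -> L1 ST (fun p => f p * tprod chi e p).
Proof.
move=> lf cchi; have [M cM] := cont_bounded cchi; have [me [N eN]] := bdd_xeval e.
by apply: L1_st_mul eN => //; [exact: continuous_measurable_fun|exact: cM].
Qed.

Lemma R_tprod f chi e : L1 ST f -> continuous chi ->
  \int[ST]_p (f p * tprod chi e p) = \int[tm]_t (moment f e t * chi t).
Proof.
move=> lf cchi; rewrite R_fubini1; last exact: L1_tprod.
have l1 := L1_tprod e lf cchi.
have l2 := L1_mul_cont (L1_moment e lf) cchi.
apply: R_ae; [exact: L1_meas (L1_int1 l1)|exact: L1_meas l2|].
apply: filterS (L1_slice1 lf) => t lft.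
rewrite /moment -RZr; last exact: L1_mul_xeval.
by apply: eqR => x; rewrite /tprod/=; ring.
Qed.

(** Tests chi(t) m(x), with m a monomial, reduce to the fundamental lemma in time. Countability of
    the monomials leaves a single null set, and they span all tests on the slice. *)
Lemma wderiv_space i f g : is_wderiv T (Some i) f g ->
  {ae tm, forall t : mT, twd i (slice f t) (slice g t)}.
Proof.
move=> [lf lg fg]; have {}lf : L1 ST f := lf; have {}lg : L1 ST g := lg.
have h m : {ae tm, forall t, moment f (xder i (mono m)) t + moment g (mono m) t = 0}.
  have l1 := L1_moment (xder i (mono m)) lf; have l2 := L1_moment (mono m) lg.
  apply: fundamental_time; first exact: L1D.
  move=> chi hchi; have [schi _ _] := hchi; have cchi := smooth1_continuous schi.
  have := fg _ (test_tprod (mono m) hchi).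
  rewrite pd_tprod_space -/ST !R_tprod// => e.
  transitivity (\int[tm]_t (moment f (xder i (mono m)) t * chi t + moment g (mono m) t * chi t)).
    by apply: eqR => t; rewrite mulrDl.
  by rewrite RD ?e ?addNr//; exact: L1_mul_cont.
apply: filterS3 (L1_slice1 lf) (L1_slice1 lg) (ae_foralli h) => t ft gt hm.
apply: twd_mono => // m; apply/eqP; rewrite -subr_eq0 opprK; apply/eqP; exact: hm.
Qed.

(** An interval of positive length meets every set of full measure; this selects good times where
    only almost-sure information is available. *)
Lemma ae_time_ex (a b : K) (Q : mT -> Prop) : 0 <= a -> a < b -> b <= T ->
  {ae tm, forall t, Q t} -> exists2 t : mT, a < t < b & Q t.
Proof.
move=> a0 ab bT /ae_time [A [mA A0 sA]]; apply: contrapT => nex.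
have : (lebesgue_measure `]a, b[%classic <= (0 : \bar K))%E.
  rewrite -A0; apply: le_measure; rewrite ?inE//.
  move=> t /=; rewrite in_itv/= => /andP[ta tb]; apply: sA => /= h; apply: nex.
  by exists t; [rewrite ta tb|apply: h; rewrite (le_lt_trans a0 ta) (lt_le_trans tb bT)].
by rewrite lebesgue_measure_itv/= lte_fin ab -EFinB lee_fin leNgt subr_gt0 ab.
Qed.

Definition sprim g (p : mT * pt) : K := prim T (fun s => g (s, p.2)) p.1.

Lemma meas_sprim g : measurable_fun setT g -> measurable_fun setT (sprim g).
Proof.
move=> mg.
pose F (q : (mT * pt) * mT) := (q.2 < q.1.1)%R%:R * g (q.2, q.1.2).
have mF : measurable_fun setT F.
  have m11 : measurable_fun setT (fun q : (mT * pt) * mT => q.1.1).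
    exact: (measurableT_comp measurable_fst measurable_fst).
  have m12 : measurable_fun setT (fun q : (mT * pt) * mT => q.1.2).
    exact: (measurableT_comp measurable_snd measurable_fst).
  have m2 : measurable_fun setT (fun q : (mT * pt) * mT => q.2) by exact: measurable_snd.
  apply: measurable_funM.
    exact: (measurableT_comp (@meas_lt2 K) (measurable_fun_pair m2 m11)).
  exact: (measurableT_comp mg (measurable_fun_pair m2 m12)).
exact: (meas_int1 tm mF).
Qed.

Lemma sprim_bound g p : L1 tm (fun s => g (s, p.2)) -> `|sprim g p| <= \int[tm]_s `|g (s, p.2)|.
Proof. exact: norm_prim_le. Qed.

Lemma L1_sprim g : L1 ST g -> L1 ST (sprim g).
Proof.
move=> lg.
have lG := L1_int2 (L1_norm lg).
have lGG : L1 ST (fun p => 1 * \int[tm]_s `|g (s, p.2)|) by exact: (L1_prodM (L1_tcst T 1) lG).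
apply: L1_le_ae (lGG); first exact: meas_sprim (L1_meas lg).
apply: ae_le_prod2; [|exact: L1_meas lGG|].
  by apply: measurableT_comp => //; exact: meas_sprim (L1_meas lg).
apply: filterS (L1_slice2 lg) => x lx; apply: aeW => t /=.
by rewrite mul1r; exact: sprim_bound.
Qed.

Lemma int_sprim g (h : pt -> K) (t : mT) : L1 ST g -> essbdd P h ->
  \int[P]_x (sprim g (t, x) * h x) = prim T (fun s => \int[P]_x (g (s, x) * h x)) t.
Proof.
move=> lg bh.
have lgh := L1_st_space lg bh.
have l1 : L1 ST (fun p => (p.1 < t)%R%:R * (g p * h p.2)).
  apply: L1_le_ae (L1_norm lgh).
    apply: measurable_funM (L1_meas lgh).
    by apply: (measurableT_comp (meas_lt t)); exact: measurable_fst.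
  by apply: aeW => p; exact: norm_lt_le.
transitivity (\int[P]_x \int[tm]_s ((s < t)%R%:R * (g (s, x) * h x))).
  apply: R_ae.
  - apply: measurable_funM; last by have [] := bh.
    exact: (meas_slice1 _ (meas_sprim (L1_meas lg))).
  - exact: L1_meas (L1_int2 l1).
  apply: filterS (L1_slice2 lg) => x lx.
  rewrite /sprim /prim -RZr; last exact: L1_lt.
  by apply: eqR => s /=; rewrite mulrA.
rewrite -(R_swap l1) /prim.
apply: R_ae.
- exact: L1_meas (L1_int1 l1).
- by apply: measurable_funM; [exact: meas_lt|exact: L1_meas (L1_int1 lgh)].
apply: filterS (L1_slice1 lgh) => s ls /=.
by rewrite RZ.
Qed.

Lemma moment_sprim g e (t : mT) : L1 ST g -> moment (sprim g) e t = prim T (moment g e) t.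
Proof. by move=> lg; exact: (int_sprim t lg (bdd_xeval e)). Qed.

(** The integrated form of the equation df/dt = g with trace [f0] at time 0. In this form product
    and chain rules can be proved at each fixed [x]. *)
Definition evolves f (f0 : pt -> K) g : Prop :=
  [/\ L1 ST f, L1 P f0, L1 ST g & {ae ST, forall p, f p = f0 p.2 + sprim g p}].

(** By [dubois_reymond], each monomial moment of [f - sprim g] is constant in time. Moments separate
    integrable functions, so this difference is itself independent of time. *)
Lemma wderiv_time f g : 0 < T -> is_wderiv T None f g -> exists f0 : pt -> K, evolves f f0 g.
Proof.
move=> T0 [lf lg fg]; have {}lf : L1 ST f := lf; have {}lg : L1 ST g := lg.
pose k p := f p - sprim g p.
have lk : L1 ST k by apply: L1B => //; exact: L1_sprim.
have hm m : exists c : K, {ae tm, forall t, moment k (mono m) t = c}.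
  have [c hc] : exists c : K,
      {ae tm, forall t, moment f (mono m) t = c + prim T (moment g (mono m)) t}.
    apply: dubois_reymond => //; [exact: L1_moment|exact: L1_moment|].
    move=> chi hchi; have [schi _ _] := hchi; have cchi := smooth1_continuous schi.
    have cchi' : continuous (derive1 chi).
      have s1 : smooth1 (derive1 chi) := smooth1_derive1n (n := 1%N) schi.
      exact: smooth1_continuous.
    have := fg _ (test_tprod (mono m) hchi).
    rewrite pd_tprod_time// -/ST !R_tprod// => e.
    by rewrite RD ?e ?addNr//; apply: L1_mul_cont => //; exact: L1_moment.
  exists c; apply: filterS3 (L1_slice1 lf) (L1_slice1 (L1_sprim lg)) hc => t l1 l2 et.
  rewrite /moment /k; under eqR do rewrite mulrBl.
  rewrite RB; [|exact: L1_mul_xeval|exact: L1_mul_xeval].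
  by rewrite -/(moment (sprim g) _ _) moment_sprim// -/(moment f _ _) et addrK.
have [c hc] := choice hm.
have good := ae_foralli hc.
have lks := L1_slice1 lk.
(* The trace is read off at one good time [t0], at which the slice is integrable and all moments
   have their constant values. *)
have [t0 [lt0 ct0]] : exists t0, L1 P (fun x => k (t0, x)) /\ forall m, moment k (mono m) t0 = c m.
  have : {ae tm, forall t, L1 P (fun x => k (t, x)) /\ forall m, moment k (mono m) t = c m}.
    by apply: filterS2 lks good.
  by move=> /(ae_time_ex (lexx 0) T0 (lexx T)) [t0 _ []]; exists t0.
exists (fun x => k (t0, x)); split => //.
suff : {ae ST, forall p, k p = k (t0, p.2)}.
  by apply: filterS => p kp; rewrite -kp /k subrK.
have mk := L1_meas lk.
apply: ae_eq_prod1 => //.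
  by apply: (measurableT_comp (meas_slice1 t0 mk)); exact: measurable_snd.
apply: filterS2 lks good => t lt ct.
have : {ae P, forall x, k (t, x) - k (t0, x) = 0}.
  apply: (@mono_separate _ _ (fun x => k (t, x) - k (t0, x))); first exact: L1B.
  move=> m; under eqR do rewrite mulrBl.
  rewrite RB; [|exact: L1_mul_xeval|exact: L1_mul_xeval].
  by have := ct m; have := ct0 m; rewrite /moment => -> ->; rewrite subrr.
by apply: filterS => x /eqP; rewrite subr_eq0 => /eqP.
Qed.

End spacetime.

(** * Functions absolutely continuous in time *)

Section evolution.
Variables (K : realType) (d : nat) (T : K).
Hypothesis T0 : 0 < T.
Local Notation pt := 'rV[K]_d.
Local Notation mT := (measurableTypeR K).
Local Notation tm := (time T).
Local Notation P := (@torus K d).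
Local Notation ST := (tm \x P)%E.
Local Notation xexpr := (@xexpr K d).
Implicit Types (f g h : mT * pt -> K) (e : xexpr) (i j : 'I_d).

Lemma ae_seq0 (Q : mT -> Prop) : {ae tm, forall t, Q t} ->
  exists t_ : nat -> mT, forall n, 0 < t_ n < T / n.+1%:R /\ Q (t_ n).
Proof.
move=> hQ; have h n : exists t : mT, 0 < t < T / n.+1%:R /\ Q t.
  have [||t h1 h2] := @ae_time_ex _ _ 0 (T / n.+1%:R) Q (lexx 0) _ _ hQ.
  - by rewrite divr_gt0.
  - by rewrite ler_pdivrMr// ler_peMr ?ler1n// ltW.
  - by exists t.
by have [t_ ht] := choice h; exists t_.
Qed.

Lemma prim_cvg0 (h : mT -> K) (t_ : nat -> mT) : L1 tm h ->
  (forall n, 0 < t_ n < T / n.+1%:R) -> prim T h (t_ n) @[n --> \oo] --> (0 : K).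
Proof.
move=> lh ht.
have [] := @R_dct _ _ _ tm (fun n s => ((s : K) < t_ n)%R%:R * h s) (fun=> 0) (fun s => `|h s|).
- by move=> n; exact: L1_meas (L1_lt _ lh).
- exact: measurable_cst.
- apply: filterS (ae_time_itv T) => s /andP[s0 _]; apply: cvg_near_cst.
  near=> n; rewrite (_ : (s < t_ n) = false) ?mul0r//; apply/negbTE; rewrite -leNgt.
  have /andP[_ /ltW h1] := ht n; apply: le_trans h1 _.
  rewrite ler_pdivrMr// mulrC -ler_pdivrMr// -natr1.
  apply: (@le_trans _ _ (n%:R)); last by rewrite lerDl.
  by near: n; exact: nbhs_infty_ger.
- exact: L1_norm.
- by apply: aeW => s n; exact: norm_lt_le.
by move=> _; rewrite R0.
Unshelve. all: by end_near. Qed.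

Lemma evolves_slice f (f0 : pt -> K) g : evolves T f f0 g ->
  {ae P, forall x, [/\ L1 tm (fun s => g (s, x)), measurable_fun setT (fun s : mT => f (s, x)) &
    {ae tm, forall t, f (t, x) = f0 x + prim T (fun s => g (s, x)) t}]}.
Proof.
move=> [lf _ lg fg]; apply: filterS2 (L1_slice2 lg) (ae_slice2 fg) => x lx fx.
by split => //; exact: (meas_slice2 _ (L1_meas lf)).
Qed.

Lemma evolves_moment f (f0 : pt -> K) g (h : pt -> K) : evolves T f f0 g -> essbdd P h ->
  {ae tm, forall t, \int[P]_x (f (t, x) * h x) =
    \int[P]_x (f0 x * h x) + prim T (fun s => \int[P]_x (g (s, x) * h x)) t}.
Proof.
move=> [lf lf0 lg fg] bh.
apply: filterS3 (L1_slice1 lf) (L1_slice1 (L1_sprim lg)) (ae_slice1 fg) => t l1 l2 e.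
rewrite -(int_sprim t lg bh) -RD; [|exact: L1_mul_bdd|exact: L1_mul_bdd].
apply: R_ae.
- exact: L1_meas (L1_mul_bdd l1 bh).
- by apply: measurable_funD; exact: L1_meas (L1_mul_bdd _ bh).
by apply: filterS e => x ->; rewrite mulrDl.
Qed.

(** Along good times tending to 0, each moment of [f] tends to that of [f0] by continuity of the
    primitive, and stays close to that of [f0'] by the initial condition. *)
Lemma evolves_trace f (f0 f0' : pt -> K) g : evolves T f f0 g -> L1 P f0' -> initial f f0' ->
  {ae P, forall x, f0 x = f0' x}.
Proof.
move=> ev lf0' ini; have [_ lf0 lg _] := ev.
suff : {ae P, forall x, f0 x - f0' x = 0}.
  by apply: filterS => x /eqP; rewrite subr_eq0 => /eqP.
apply: mono_separate; first exact: L1B.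
move=> m; under eqR do rewrite mulrBl.
rewrite RB; [|exact: L1_mul_xeval|exact: L1_mul_xeval].
set a := \int[P]_x (f0 x * _); set b := \int[P]_x (f0' x * _).
apply/eqP; rewrite -normr_eq0; apply: contrapT => /negP ab0.
have eps0 : 0 < `|a - b| by rewrite lt_neqAle eq_sym ab0 normr_ge0.
have e2 : 0 < `|a - b| / 2 by rewrite divr_gt0.
have [del del0 hdel] := ini _ (test_torus_xeval (mono m)) _ e2.
have {}hdel : {ae tm, forall t : mT, t < del -> `|moment f (mono m) t - b| < `|a - b| / 2}.
  apply/ae_time; have fF := ae_filter_ringOfSetsType (@lebesgue_measure K).
  by apply: filterS hdel => t h /andP[t0 _] td; apply: h; rewrite t0 td.
have hm := evolves_moment ev (bdd_xeval (mono m)).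
have hQ : {ae tm, forall t : mT, (t < del -> `|moment f (mono m) t - b| < `|a - b| / 2) /\
    moment f (mono m) t = a + prim T (moment g (mono m)) t}.
  by apply: filterS2 hdel hm.
have [t_ ht] := ae_seq0 hQ.
have lG := L1_moment (mono m) lg.
have /cvgrPdist_le /(_ _ e2) h1 := prim_cvg0 lG (fun n => (ht n).1).
have h2 : \forall n \near \oo, t_ n < del.
  near=> n; have [/andP[_ h] _] := ht n; apply: lt_le_trans h _.
  rewrite ler_pdivrMr// mulrC -ler_pdivrMr// -natr1.
  apply: (@le_trans _ _ (n%:R)); last by rewrite lerDl.
  by near: n; exact: nbhs_infty_ger.
have [n [n1 n2]] : exists n, `|0 - prim T (moment g (mono m)) (t_ n)| <= `|a - b| / 2 /\ t_ n < del.
  by have [N _ h] := filterI h1 h2; exists N; exact: (h N (leqnn N)).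
have [_ [/(_ n2) h3 h4]] := ht n.
rewrite h4 in h3; move: n1 h3; rewrite sub0r normrN.
set u := prim _ _ _ => u1 u2.
have : `|a - b| <= `|a + u - b| + `|u|.
  by rewrite -[`|u|]normrN; apply: le_trans (ler_normD _ _); rewrite addrAC addrK.
by apply/negP; rewrite -ltNge; lra.
Unshelve. all: by end_near. Qed.

(** Zeros of [D] accumulate at almost every [t] from the right, and the difference quotient vanishes
    along them. *)
Lemma ae_derive0 (D del : K -> K) : {ae tm, forall t : mT, is_derive (t : K) (1 : K) D (del t)} ->
  {ae tm, forall t : mT, D t = 0} -> {ae tm, forall t : mT, del t = 0}.
Proof.
move=> hD h0; have h0' := h0; apply: filterS3 hD h0' (ae_time_itv T) => t dt D0 /andP[t0 tT].
have tT' : 0 < T - t by rewrite subr_gt0.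
have h n : exists s : mT, t < s < t + (T - t) / n.+1%:R /\ D s = 0.
  have [|||s h1 h2] := @ae_time_ex _ _ t (t + (T - t) / n.+1%:R) (fun s => D s = 0) _ _ _ h0.
  - exact: ltW.
  - by rewrite ltrDl divr_gt0.
  - by rewrite -lerBrDl ler_pdivrMr// ler_peMr ?ler1n// ltW.
  - by exists s.
have [t_ ht] := choice h.
have [/cvg_ex[/= l hl] dE] := dt.
have el : l = del t by rewrite -dE; apply/esym/cvg_lim.
have c : (t_ n - t) @[n --> \oo] --> (0 : K).
  have c1 : (T - t) / n.+1%:R @[n --> \oo] --> (0 : K).
    by rewrite -[0](mulr0 (T - t)); apply: cvgM; [exact: cvg_cst|exact: cvg_harmonic].
  apply: (squeeze_cvgr _ (cvg_cst 0) c1); near=> n.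
  by have [/andP[h1 h2] _] := ht n; rewrite subr_ge0 (ltW h1) lerBlDl ltW.
have := (cvgr_dnbhsP _ _ _).1 hl (fun n => t_ n - t).
have nz n : t_ n - t != 0 by have [/andP[h1 _] _] := ht n; rewrite subr_eq0 gt_eqF.
move=> /(_ (conj nz c)) /= c2.
rewrite -el; apply: (cvg_unique (@Rhausdorff K) c2).
rewrite (_ : (fun n => _) = fun=> 0); first exact: cvg_cst.
by apply/funext => n; rewrite /= -[_%:A]/(_ * 1) mulr1 subrK (ht n).2 D0 subrr scaler0.
Unshelve. all: by end_near. Qed.

Local Notation bst := (essbdd ST).

Lemma bst_slice f : bst f -> exists2 M : K, 0 <= M & {ae tm, forall t : mT, measurable_fun setT (slice f t) /\
  {ae P, forall x, `|f (t, x)| <= M}}.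
Proof.
move=> [mf [M fM]]; exists `|M| => //; apply: filterS (ae_slice1 fM) => t h; split.
  exact: (meas_slice1 t mf).
by apply: filterS h => x h; apply: le_trans h (ler_norm _).
Qed.

Lemma bst_bdd f : bst f -> {ae tm, forall t : mT, essbdd P (slice f t)}.
Proof.
move=> bf; have [M _ hM] := bst_slice bf.
by apply: filterS hM => t [mf h]; split => //; exists M.
Qed.

(** For almost every [x], one good time expresses the trace through a bounded value of [f] and a
    primitive of a bounded function. *)
Lemma evolves_bdd f (f0 : pt -> K) g : evolves T f f0 g -> bst f -> bst g -> essbdd P f0.
Proof.
move=> ev [_ [M fM]] [_ [N gN]]; have [_ lf0 _ _] := ev; split; first exact: L1_meas lf0.
exists (M + \int[tm]_s N); apply: filterS3 (evolves_slice ev) (ae_slice2 fM) (ae_slice2 gN).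
move=> x [lg _ fE] fx gx.
have h2 : {ae tm, forall t : mT, f (t, x) = f0 x + prim T (fun s => g (s, x)) t /\ `|f (t, x)| <= M}.
  exact: filterS2 fE fx.
have [t _ [e1 e2]] := ae_time_ex (lexx 0) T0 (lexx T) h2.
have -> : f0 x = f (t, x) - prim T (fun s => g (s, x)) t by rewrite e1 addrK.
apply: le_trans (ler_normB _ _) _; apply: lerD => //.
apply: le_trans (norm_prim_le t lg) _; apply: R_le_ae => //; [exact: L1_norm|exact: L1_tcst].
Qed.

Lemma evolves_ae f f' (f0 : pt -> K) g : evolves T f f0 g -> measurable_fun setT f' ->
  {ae ST, forall p, f p = f' p} -> evolves T f' f0 g.
Proof.
move=> [lf lf0 lg h] mf' ff'; split => //; first exact: L1_ae ff' lf.
by apply: filterS2 h ff' => p -> ->.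
Qed.

Lemma evolves0 : @evolves K d T (fun=> 0) (fun=> 0) (fun=> 0).
Proof.
split; [exact: L1_0|exact: L1_0|exact: L1_0|apply: aeW => p].
by rewrite /sprim /prim; under eqR do rewrite mulr0; rewrite R0 addr0.
Qed.

Lemma evolvesD f (f0 : pt -> K) g f' (f0' : pt -> K) g' :
  evolves T f f0 g -> evolves T f' f0' g' ->
  evolves T (fun p => f p + f' p) (fun x => f0 x + f0' x) (fun p => g p + g' p).
Proof.
move=> ev ev'; have [lf lf0 lg _] := ev; have [lf' lf0' lg' _] := ev'.
split; [exact: L1D|exact: L1D|exact: L1D|].
have mg := L1_meas lg; have mg' := L1_meas lg'.
apply: ae_eq_prod2.
- exact: L1_meas (L1D lf lf').
- apply: measurable_funD; last exact: meas_sprim (measurable_funD mg mg').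
  exact: (measurableT_comp (L1_meas (L1D lf0 lf0')) measurable_snd).
apply: filterS2 (evolves_slice ev) (evolves_slice ev') => x [l1 _ e1] [l2 _ e2].
by apply: filterS2 e1 e2 => t -> ->; rewrite /sprim/= primD// addrACA.
Qed.

Lemma evolvesM f (f0 : pt -> K) g f' (f0' : pt -> K) g' :
  evolves T f f0 g -> evolves T f' f0' g' -> bst f -> bst f' -> bst g -> bst g' ->
  evolves T (fun p => f p * f' p) (fun x => f0 x * f0' x) (fun p => g p * f' p + f p * g' p).
Proof.
move=> ev ev' bf bf' bg bg'; have [lf lf0 lg _] := ev; have [lf' lf0' lg' _] := ev'.
have b0 := evolves_bdd ev bf bg; have b0' := evolves_bdd ev' bf' bg'.
have lh : L1 ST (fun p => g p * f' p + f p * g' p) by apply: L1D; exact: L1_mul_bdd.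
split; [exact: L1_mul_bdd|exact: L1_mul_bdd|exact: lh|].
apply: ae_eq_prod2.
- exact: L1_meas (L1_mul_bdd lf bf').
- apply: measurable_funD; last exact: meas_sprim (L1_meas lh).
  exact: (measurableT_comp (L1_meas (L1_mul_bdd lf0 b0')) measurable_snd).
apply: filterS3 (evolves_slice ev) (evolves_slice ev') (L1_slice2 lh).
move=> x [l1 m1 e1] [l2 m2 e2] lhx.
have e1' := e1; have e2' := e2.
apply: filterS2 e1' e2' => t -> ->; rewrite prim_mulD//; congr (_ + _).
rewrite /sprim/=; apply: eq_prim_ae.
- apply: measurable_funD; apply: measurable_funM; try exact: L1_meas l1; try exact: L1_meas l2.
    by apply: measurable_funD => //; exact: meas_prim (L1_meas l2).
  by apply: measurable_funD => //; exact: meas_prim (L1_meas l1).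
- exact: L1_meas lhx.
by apply: filterS2 e1 e2 => s -> ->.
Qed.

Lemma evolvesZ (c : K) f (f0 : pt -> K) g : evolves T f f0 g ->
  evolves T (fun p => c * f p) (fun x => c * f0 x) (fun p => c * g p).
Proof.
move=> ev; have [lf lf0 lg _] := ev.
split; [exact: L1Z|exact: L1Z|exact: L1Z|].
apply: ae_eq_prod2.
- exact: L1_meas (L1Z c lf).
- apply: measurable_funD; last exact: meas_sprim (L1_meas (L1Z c lg)).
  exact: (measurableT_comp (L1_meas (L1Z c lf0)) measurable_snd).
apply: filterS (evolves_slice ev) => x [l1 _ e1].
by apply: filterS e1 => t ->; rewrite /sprim/= primZ// mulrDr.
Qed.

Lemma evolves_sum (I : Type) (s : seq I) (F : I -> mT * pt -> K) (F0 : I -> pt -> K)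
    (G : I -> mT * pt -> K) : (forall a, evolves T (F a) (F0 a) (G a)) ->
  evolves T (fun p => \sum_(a <- s) F a p) (fun x => \sum_(a <- s) F0 a x)
    (fun p => \sum_(a <- s) G a p).
Proof.
move=> h; elim: s => [|a s ih].
  under eq_fun do rewrite big_nil; under [X in evolves _ _ X]eq_fun do rewrite big_nil.
  under [X in evolves _ _ _ X]eq_fun do rewrite big_nil.
  exact: evolves0.
under eq_fun do rewrite big_cons; under [X in evolves _ _ X]eq_fun do rewrite big_cons.
under [X in evolves _ _ _ X]eq_fun do rewrite big_cons.
exact: evolvesD.
Qed.

(** For almost every [x], both primitives are differentiable at almost every time. The difference
    between exp(L) and [R] vanishes almost everywhere, hence so does its derivative; the traces are
    compared along times tending to 0. *)
Lemma evolves_exp L (L0 : pt -> K) l R (R00 : pt -> K) h :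
  evolves T L L0 l -> evolves T R R00 h -> {ae ST, forall p, R p = expR (L p)} ->
  {ae P, forall x, R00 x = expR (L0 x)} /\ {ae ST, forall p, h p = R p * l p}.
Proof.
move=> ev ev' RL; have [_ _ ll _] := ev; have [lR _ lh _] := ev'.
have key : {ae P, forall x, R00 x = expR (L0 x) /\
    {ae tm, forall t, h (t, x) = R (t, x) * l (t, x)}}.
  apply: filterS3 (evolves_slice ev) (evolves_slice ev') (ae_slice2 RL).
  move=> x [l1 _ e1] [l2 _ e2] e3; split.
    have hQ : {ae tm, forall t : mT, R00 x + prim T (fun s => h (s, x)) t =
        expR (L0 x + prim T (fun s => l (s, x)) t)}.
      by apply: filterS3 e1 e2 e3 => t <- <-.
    have [t_ ht] := ae_seq0 hQ.
    have c1 := prim_cvg0 l1 (fun n => (ht n).1).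
    have c2 := prim_cvg0 l2 (fun n => (ht n).1).
    have c3 : R00 x + prim T (fun s => h (s, x)) (t_ n) @[n --> \oo] --> R00 x.
      by rewrite -[X in _ --> X]addr0; apply: cvgD => //; exact: cvg_cst.
    have c4 : expR (L0 x + prim T (fun s => l (s, x)) (t_ n)) @[n --> \oo] --> expR (L0 x).
      apply: continuous_cvg; first exact: continuous_expR.
      by rewrite -[X in _ --> X]addr0; apply: cvgD => //; exact: cvg_cst.
    have ce : (fun n => R00 x + prim T (fun s => h (s, x)) (t_ n)) =
        (fun n => expR (L0 x + prim T (fun s => l (s, x)) (t_ n))).
      by apply/funext => n; exact: (ht n).2.
    by rewrite ce in c3; exact: (cvg_unique (@Rhausdorff K) c3 c4).
  pose D (t : K) := expR (L0 x + prim T (fun s => l (s, x)) t) -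
    (R00 x + prim T (fun s => h (s, x)) t).
  pose del (t : K) := expR (L0 x + prim T (fun s => l (s, x)) t) * l (t, x) - h (t, x).
  have d0 : {ae tm, forall t : mT, is_derive (t : K) (1 : K) D (del t)}.
    apply: filterS2 (prim_derive l1) (prim_derive l2) => t d1 d2.
    rewrite /D /del.
    have d3 : is_derive (t : K) (1 : K) (fun u => L0 x + prim T (fun s => l (s, x)) u) (l (t, x)).
      by rewrite -[l (t, x)]add0r; exact: is_deriveD.
    have d4 : is_derive (t : K) (1 : K) (fun u => R00 x + prim T (fun s => h (s, x)) u) (h (t, x)).
      by rewrite -[h (t, x)]add0r; exact: is_deriveD.
    exact: is_deriveB.
  have D0 : {ae tm, forall t : mT, D t = 0}.
    by apply: filterS3 e1 e2 e3 => t; rewrite /D => <- <- ->; rewrite subrr.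
  apply: filterS3 (ae_derive0 d0 D0) e1 e3 => t dt e1t e3t.
  by move/eqP: dt; rewrite /del -e1t -e3t subr_eq0 => /eqP ->.
split; first by apply: filterS key => x [].
apply: ae_eq_prod2; first exact: L1_meas lh.
  exact: measurable_funM (L1_meas lR) (L1_meas ll).
by apply: filterS key => x [].
Qed.

End evolution.

(** * Conservation laws tested with Lipschitz functions *)

Section kernel_duality.
Variables (K : realType) (d : nat).
Local Notation pt := 'rV[K]_d.
Local Notation P := (@torus K d).
Local Notation xexpr := (@xexpr K d).
Local Notation tk := (@tkern K d).
Implicit Types (f u v : pt -> K) (j : 'I_d).

Let kk N : kern P (tk N) := (approx_id_torus K d).1 N.

Lemma bdd_smear N u : essbdd P u -> essbdd P (smear P (tk N) u).
Proof.
move=> bu; have [mu [M uM]] := bu; split; first exact: L1_meas (smear_L1 (kk N) (bdd_L1 bu)).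
by exists M; apply: aeW => x; exact: (smear_bound (kk N)).
Qed.

Lemma int_smear_cvg f u : L1 P f -> essbdd P u ->
  \int[P]_x (f x * smear P (tk N) u x) @[N --> \oo] --> \int[P]_x (f x * u x).
Proof.
move=> lf bu; have [mu [M uM]] := bu.
under eq_fun do rewrite -(smear_sym (kk _) lf mu uM).
exact: smear_cvg.
Qed.

Lemma int_smear_bound N f u (M : K) : L1 P f -> measurable_fun setT u ->
  {ae P, forall x, `|u x| <= M} ->
  `|\int[P]_x (f x * smear P (tk N) u x)| <= M * \int[P]_x `|f x|.
Proof.
move=> lf mu uM; have bu : essbdd P u by split => //; exists M.
have l1 : L1 P (fun x => f x * smear P (tk N) u x) by apply: L1_mul_bdd => //; exact: bdd_smear.
apply: le_trans (R_norm l1) _; rewrite -RZ; last exact: L1_norm.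
apply: R_le_ae; [exact: L1_norm|by apply: L1Z; exact: L1_norm|apply: aeW => x].
by rewrite normrM mulrC ler_wpM2r//; exact: (smear_bound (kk N)).
Qed.

(** A Parseval-type formula: summing products of moments over the terms of the kernel pairs [f] with
    the smearing of [u]. A derivative on the test of [f] becomes a derivative of [u]. *)
Lemma kernel_duality N : exists s : seq (xexpr * xexpr),
  (forall f u, L1 P f -> essbdd P u ->
    \sum_(a <- s) (\int[P]_x (f x * xeval a.1 x)) * (\int[P]_x (u x * xeval a.2 x)) =
    \int[P]_x (f x * smear P (tk N) u x)) /\
  (forall j f u v, L1 P f -> twd j u v ->
    \sum_(a <- s) (\int[P]_x (f x * xeval (xder j a.1) x)) * (\int[P]_x (u x * xeval a.2 x)) =
    \int[P]_x (f x * smear P (tk N) v x)).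
Proof.
have [s [h1 h2]] := smear_expand K d N; exists s; split=> [f u lf bu|j f u v lf huv].
  transitivity (\int[P]_x \sum_(a <- s) (f x * xeval a.1 x) * (\int[P]_x (u x * xeval a.2 x))).
    rewrite Rsum; last by move=> a _; apply: L1Zr; exact: L1_mul_xeval.
    by apply: eq_bigr => a _; rewrite RZr//; exact: L1_mul_xeval.
  apply: eqR => x; rewrite h1; last exact: bdd_L1.
  by rewrite big_distrr/=; apply: eq_bigr => a _; rewrite mulrA.
transitivity (\int[P]_x \sum_(a <- s) (f x * xeval (xder j a.1) x) * (\int[P]_x (u x * xeval a.2 x))).
  rewrite Rsum; last by move=> a _; apply: L1Zr; exact: L1_mul_xeval.
  by apply: eq_bigr => a _; rewrite RZr//; exact: L1_mul_xeval.
apply: eqR => x; rewrite (h2 _ _ _ huv) big_distrr/=.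
by apply: eq_bigr => a _; rewrite mulrA.
Qed.

End kernel_duality.

Section balance.
Variables (K : realType) (d : nat) (T : K).
Hypothesis T0 : 0 < T.
Local Notation pt := 'rV[K]_d.
Local Notation mT := (measurableTypeR K).
Local Notation tm := (time T).
Local Notation P := (@torus K d).
Local Notation ST := (tm \x P)%E.
Local Notation bst := (essbdd ST).
Local Notation xexpr := (@xexpr K d).
Local Notation tk := (@tkern K d).
Implicit Types (f g h S : mT * pt -> K) (F : 'I_d -> mT * pt -> K) (e : xexpr) (i j : 'I_d).

Definition half_test (chi : K -> K) : Prop :=
  smooth1 chi /\ exists2 T', T' < T & forall t, T' <= t -> chi t = 0.

(* d/dt f + div F = S with initial value c0, tested against tensor products. *)
Definition conservation f F S (c0 : pt -> K) : Prop :=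
  [/\ L1 ST f, forall j, L1 ST (F j), L1 ST S, L1 P c0 &
   forall chi e, half_test chi ->
   \int[ST]_p (f p * tprod (derive1 chi) e p + \sum_j F j p * tprod chi (xder j e) p
      + S p * tprod chi e p) + chi 0 * \int[P]_x (c0 x * xeval e x) = 0].

(** For [b] a bump, the integral of [b] from t to T is a test that does not vanish at t = 0. It
    detects the initial datum, which compactly supported tests cannot see. *)
Lemma half_test_witness : exists2 b : mT -> K, L1 tm b &
  [/\ half_test (fun t => prim T b T - prim T b t), continuous (b : K -> K),
    derive1 (fun t => prim T b T - prim T b t) = (fun t => - b t) &
    prim T b T - prim T b 0 != 0].
Proof.
have a0 : 0 < T / 3 by rewrite divr_gt0.
have ab : T / 3 < 2 * T / 3 by rewrite ltr_pM2r ?invr_gt0// ltr_pMl// ltr1n.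
have bT : 2 * T / 3 < T by rewrite ltr_pdivrMr// mulrC ltr_pM2l// ltr_nat.
pose e := tbump (T / 3) (2 * T / 3) 0.
pose b := teval e.
have cb : continuous (b : K -> K) := smooth1_continuous (smooth1_teval (e := e)).
have b_out t : ~~ (T / 3 < t < 2 * T / 3) -> b t = 0 by exact: bump_out.
have lb : L1 tm b.
  apply: (@L1_cont K T b 1) => // t; rewrite ger0_norm; [exact: bump_le1|exact: bump_ge0].
have db : forall t : K, is_derive t 1 (prim T b) (b t) by exact: is_derive_prim b_out.
exists b => //.
have dchi (t : K) : is_derive t 1 (fun t => prim T b T - prim T b t) (- b t).
  by rewrite -[- b t]add0r; exact: is_deriveB.
have chi0 t : 2 * T / 3 <= t -> prim T b T - prim T b t = 0.
  move=> ht; apply/eqP; rewrite subr_eq0; apply/eqP/eqR => s.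
  have [st|st] := boolP (T / 3 < s < 2 * T / 3); last by rewrite b_out// !mulr0.
  have /andP[_ s2] := st.
  by rewrite (lt_le_trans s2 ht) (lt_trans s2 bT).
split => //.
- split; last by exists (2 * T / 3).
  apply: (smooth1_prim dchi).
  rewrite (_ : (fun t => - b t) = teval (TMul (TCst (-1)) e)); first exact: smooth1_teval.
  by apply/funext => t /=; rewrite mulN1r.
- by apply/funext => t; rewrite derive1E; have [_ ->] := dchi t.
have -> : prim T b 0 = 0.
  rewrite /prim -[RHS](@R0 _ _ _ tm); apply: eqR => s.
  have [st|st] := boolP (T / 3 < s < 2 * T / 3); last by rewrite b_out// mulr0.
  by have /andP[s1 _] := st; rewrite ltNge (ltW (lt_trans a0 s1)) mul0r.
rewrite subr0 primT//; apply/negP => /eqP b0.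
have : {ae tm, forall t, b t = 0}.
  apply: R_norm_eq0 => //; rewrite -[RHS]b0; apply: eqR => t.
  rewrite ger0_norm//; exact: bump_ge0.
move=> /(ae_time_ex (ltW a0) ab (ltW bT))[t ht].
by apply/eqP; rewrite gt_eqF//; exact: bump_gt0.
Qed.

Section fixed.
Variables (f S : mT * pt -> K) (F : 'I_d -> mT * pt -> K) (c0 : pt -> K).
Hypothesis cons : conservation f F S c0.

Definition source e (t : mT) : K := \sum_j moment (F j) (xder j e) t + moment S e t.

Lemma L1_source e : L1 tm (source e).
Proof.
have [_ lF lS _ _] := cons; apply: L1D; last exact: L1_moment.
by apply: L1_sum => j _; exact: L1_moment.
Qed.

(** Tests vanishing near 0 give the ordinary differential equation up to a constant, by
    [dubois_reymond]; the test of [half_test_witness] identifies that constant with the initial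
    moment. *)
Lemma conservation_moment e : {ae tm, forall t,
  moment f e t = \int[P]_x (c0 x * xeval e x) + prim T (source e) t}.
Proof.
have [lf lF lS lc0 h] := cons; have lh := L1_source e; have lm := L1_moment e lf.
have E chi : half_test chi ->
    \int[tm]_t (moment f e t * derive1 chi t + source e t * chi t)
    + chi 0 * \int[P]_x (c0 x * xeval e x) = 0.
  move=> hchi; have [schi _] := hchi; have cchi := smooth1_continuous schi.
  have schi' : smooth1 (derive1 chi) := smooth1_derive1n (n := 1%N) schi.
  have cchi' := smooth1_continuous schi'.
  rewrite -[RHS](h chi e hchi); congr (_ + _).
  have l1 := L1_tprod e lf cchi'; have l2 j := L1_tprod (xder j e) (lF j) cchi.
  have l3 := L1_tprod e lS cchi.
  have l4 : L1 ST (fun p => \sum_j F j p * tprod chi (xder j e) p).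
    by apply: L1_sum => j _; exact: l2.
  rewrite [RHS]RD; [|exact: L1D|by []]; rewrite [X in _ = X + _]RD//.
  rewrite Rsum; last by move=> j _; exact: l2.
  rewrite !R_tprod//; under [in RHS]eq_bigr do rewrite R_tprod//.
  rewrite RD; [|exact: L1_mul_cont|exact: L1_mul_cont].
  rewrite -addrA; congr (_ + _).
  transitivity (\int[tm]_t (\sum_j moment (F j) (xder j e) t * chi t + moment S e t * chi t)).
    by apply: eqR => t; rewrite /source mulrDl big_distrl.
  rewrite RD; last 2 first.
  - by apply: L1_sum => j _; apply: L1_mul_cont => //; exact: L1_moment.
  - by apply: L1_mul_cont => //; exact: L1_moment.
  rewrite Rsum// => j _; apply: L1_mul_cont => //; exact: L1_moment.
have [c hc] : exists c : K, {ae tm, forall t, moment f e t = c + prim T (source e) t}.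
  apply: dubois_reymond => // chi [schi [T' T'T chi0] [t0 t00 chi0']].
  have := E chi (conj schi (ex_intro2 _ _ T' T'T chi0)).
  by rewrite (chi0' 0 (ltW t00)) mul0r addr0.
suff <- : c = \int[P]_x (c0 x * xeval e x) by [].
have [b lb [hb cb db b0]] := half_test_witness.
have := E _ hb; rewrite db; set m := \int[P]_x _; set chi0 := _ - prim T b 0.
have {}b0 : chi0 != 0 := b0.
have p0 : prim T b 0 = 0.
  rewrite /prim -[RHS](@R0 _ _ _ tm); apply: R_ae.
  - exact: L1_meas (L1_lt _ lb).
  - exact: measurable_cst.
  apply: filterS (ae_time_itv T) => s /andP[s0 _].
  by rewrite ltNge (ltW s0) mul0r.
have ec : chi0 = prim T b T by rewrite /chi0 p0 subr0.
have la : L1 tm (fun t => source e t * prim T b t) by exact: L1_mul_prim.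
have lb' : L1 tm (fun t => prim T (source e) t * b t).
  by apply: eq_L1 (L1_mul_prim lb lh) => t; rewrite mulrC.
have -> : \int[tm]_t (moment f e t * - b t + source e t * (prim T b T - prim T b t)) =
    - (c * prim T b T).
  transitivity (\int[tm]_t (prim T b T * source e t - c * b t -
      (source e t * prim T b t + prim T (source e) t * b t))).
    apply: R_ae.
    - apply: measurable_funD; apply: measurable_funM; try exact: L1_meas lm; try exact: L1_meas lh.
        by apply: measurableT_comp => //; exact: L1_meas lb.
      by apply: measurable_funB => //; exact: meas_prim (L1_meas lb).
    - exact: L1_meas (L1B (L1B (L1Z (prim T b T) lh) (L1Z c lb)) (L1D la lb')).
    by apply: filterS hc => t ->; ring.
  rewrite RB; [|by apply: L1B; exact: L1Z|exact: L1D].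
  rewrite RB; [|exact: L1Z|exact: L1Z]; rewrite !RZ//.
  have := prim_mul T lh lb; rewrite !primT//; last exact: L1D.
  by move=> <-; ring.
rewrite -ec mulrC -mulNr [in X in _ + X]mulrC => h0.
have : (m - c) * chi0 = 0 by rewrite -h0; ring.
by move/eqP; rewrite mulf_eq0 (negbTE b0) orbF subr_eq0 => /eqP.
Qed.

Section transported.
Variables (eta g : mT * pt -> K) (eta0 : pt -> K) (deta : 'I_d -> mT * pt -> K).
Hypotheses (ev : evolves T eta eta0 g) (beta : bst eta) (bg : bst g)
  (bdeta : forall j, bst (deta j))
  (heta : forall j, {ae tm, forall t : mT, twd j (slice eta t) (slice (deta j) t)}).

Let b0 : essbdd P eta0 := evolves_bdd T0 ev beta bg.

(** The time derivative of the product of the moments of [f] and [eta] against the two factors of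
    one term of the kernel. *)
Let pairing (a : xexpr * xexpr) (t : mT) : K :=
  source a.1 t * moment eta a.2 t + moment f a.1 t * moment g a.2 t.

Let pairing_prim a : L1 tm (pairing a) /\ {ae tm, forall t,
  moment f a.1 t * moment eta a.2 t =
  (\int[P]_x (c0 x * xeval a.1 x)) * (\int[P]_x (eta0 x * xeval a.2 x)) + prim T (pairing a) t}.
Proof.
have [lf lF lS lc0 _] := cons; have [leta leta0 lg _] := ev.
have ls := L1_source a.1; have lm := L1_moment a.2 lg.
have h1 := conservation_moment a.1; have h2 := evolves_moment ev (bdd_xeval a.2).
set A := \int[P]_x _ in h1 *; set B := \int[P]_x _ in h2 *.
have mpair : measurable_fun setT (pairing a).
  apply: measurable_funD; apply: measurable_funM.
  - exact: L1_meas ls.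
  - exact: L1_meas (L1_moment a.2 leta).
  - exact: L1_meas (L1_moment a.1 lf).
  - exact: L1_meas lm.
pose q (s : mT) := source a.1 s * (B + prim T (moment g a.2) s) +
  (A + prim T (source a.1) s) * moment g a.2 s.
have lq : L1 tm q.
  have l1 := L1D (L1Zr B ls) (L1_mul_prim ls lm).
  have l2 := L1D (L1Z A lm) (L1_mul_prim lm ls).
  by apply: eq_L1 (L1D l1 l2) => s; rewrite /q; ring.
have eq : {ae tm, forall s, q s = pairing a s}.
  by apply: filterS2 h1 h2 => s e1 e2; rewrite /q /pairing e1 /moment e2.
split; first exact: L1_ae eq lq.
apply: filterS2 h1 h2 => t e1 e2.
rewrite e1 /moment e2 -/(moment _ _) prim_mulD//; congr (_ + _).
exact: (eq_prim_ae t (L1_meas lq) mpair eq).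
Qed.

Let pairing_sum (s : seq (xexpr * xexpr)) : {ae tm, forall t,
  \sum_(a <- s) moment f a.1 t * moment eta a.2 t =
  \sum_(a <- s) (\int[P]_x (c0 x * xeval a.1 x)) * (\int[P]_x (eta0 x * xeval a.2 x)) +
  prim T (fun t => \sum_(a <- s) pairing a t) t}.
Proof.
have h : {ae tm, forall t, forall n : nat, let a := nth (XCst d (0 : K), XCst d (0 : K)) s n in
  moment f a.1 t * moment eta a.2 t =
  (\int[P]_x (c0 x * xeval a.1 x)) * (\int[P]_x (eta0 x * xeval a.2 x)) + prim T (pairing a) t}.
  by apply: ae_foralli => n; exact: (pairing_prim _).2.
apply: filterS h => t h; rewrite prim_sum; last by move=> a; exact: (pairing_prim a).1.
rewrite -big_split/= !(big_nth (XCst d (0 : K), XCst d (0 : K))).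
by apply: eq_bigr => n _; exact: h.
Qed.

Definition balance_density (p : mT * pt) : K :=
  f p * g p + \sum_j F j p * deta j p + S p * eta p.

Lemma L1_balance_density : L1 ST balance_density.
Proof.
have [lf lF lS lc0 _] := cons.
apply: L1D; last exact: L1_mul_bdd.
apply: L1D; first exact: L1_mul_bdd.
by apply: L1_sum => j _; exact: L1_mul_bdd.
Qed.

(** Products of moments of [f] and [eta] are differentiated in time and summed over the terms of the
    kernel. By [kernel_duality] each sum is an integral against a smeared field, and smearing tends
    to the identity. This extends the weak equation from tensor tests to Lipschitz ones. *)
Lemma balance : {ae tm, forall t : mT,
  \int[P]_x (f (t, x) * eta (t, x)) = \int[P]_x (c0 x * eta0 x) +
    prim T (fun s => \int[P]_x balance_density (s, x)) t}.
Proof.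
have [lf lF lS lc0 _] := cons; have [leta leta0 lg _] := ev.
have [M1 M10 hM1] := bst_slice beta; have [M2 M20 hM2] := bst_slice bg.
have [sN hsN] := choice (@kernel_duality K d).
pose J N t := \sum_(a <- sN N) pairing a t.
have lJ N : L1 tm (J N) by apply: L1_sum => a _; exact: (pairing_prim a).1.
have hsum : {ae tm, forall t, forall N, \sum_(a <- sN N) moment f a.1 t * moment eta a.2 t =
  \sum_(a <- sN N) (\int[P]_x (c0 x * xeval a.1 x)) * (\int[P]_x (eta0 x * xeval a.2 x)) +
  prim T (J N) t}.
  by apply: ae_foralli => N; exact: pairing_sum.
have lfs := L1_slice1 lf; have lSs := L1_slice1 lS.
have lFs : {ae tm, forall t, forall j, L1 P (fun x => F j (t, x))}.
  by apply: ae_foralli => j; exact: (L1_slice1 (lF j)).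
have hd : {ae tm, forall t : mT, forall j, twd j (slice eta t) (slice (deta j) t)}.
  by apply: ae_foralli => j; exact: heta.
have [Md hMd] := choice (fun j => let: ex_intro2 m m0 hm := bst_slice (bdeta j) in
  ex_intro (fun m => 0 <= m /\ _) m (conj m0 hm)).
have hMd' : {ae tm, forall t : mT, forall j, measurable_fun setT (slice (deta j) t) /\
    {ae P, forall x, `|deta j (t, x)| <= Md j}}.
  by apply: ae_foralli => j; exact: (hMd j).2.
(* The derivatives falling on the tests in the flux terms are moved onto [eta], which produces the
   smeared [deta j]. *)
have JE : {ae tm, forall t, forall N, J N t = \int[P]_x (f (t, x) * smear P (tk N) (slice g t) x) +
    \sum_j \int[P]_x (F j (t, x) * smear P (tk N) (slice (deta j) t) x) +
    \int[P]_x (S (t, x) * smear P (tk N) (slice eta t) x)}.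
  apply: filterS2 (filterI lfs (filterI lSs lFs)) (filterI hM1 (filterI hM2 hd)).
  move=> t [l1 [l2 l3]] [[m1 b1] [[m2 b2] h3]] N.
  have be : essbdd P (slice eta t) by split => //; exists M1.
  have bgt : essbdd P (slice g t) by split => //; exists M2.
  have [k1 k2] := hsN N.
  rewrite -(k1 _ _ l1 bgt) -(k1 _ _ l2 be).
  rewrite (eq_bigr _ (fun j _ => esym (k2 j (fun x => F j (t, x)) _ _ (l3 j) (h3 j)))).
  rewrite exchange_big/= -!big_split/= /J /pairing; apply: eq_bigr => a _.
  by rewrite /source /moment mulrDl big_distrl/= -addrA addrC.
have c1 : (fun N => \int[P]_x (c0 x * smear P (tk N) eta0 x)) @ \oo --> \int[P]_x (c0 x * eta0 x).
  exact: int_smear_cvg.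
(* A bound independent of [N], because smearing does not increase essential bounds. It is integrable
   in time and allows dominated convergence. *)
pose G t := M2 * \int[P]_x `|f (t, x)| + \sum_j Md j * \int[P]_x `|F j (t, x)| +
   M1 * \int[P]_x `|S (t, x)|.
have lG : L1 tm G.
  apply: L1D; last by apply: L1Z; exact: (L1_int1 (L1_norm lS)).
  apply: L1D; first by apply: L1Z; exact: (L1_int1 (L1_norm lf)).
  by apply: L1_sum => j _; apply: L1Z; exact: (L1_int1 (L1_norm (lF j))).
have lB := L1_balance_density; have lB1 := L1_int1 lB.
have Jcvg : {ae tm, forall t, J ^~ t @ \oo --> \int[P]_x balance_density (t, x)}.
  apply: filterS3 (filterI lfs (filterI lSs lFs)) (filterI hM1 (filterI hM2 hMd')) JE.
  move=> t [l1 [l2 l3]] [[m1 b1] [[m2 b2] h3]] e.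
  have be : essbdd P (slice eta t) by split => //; exists M1.
  have bgt : essbdd P (slice g t) by split => //; exists M2.
  have bd j : essbdd P (slice (deta j) t) by have [? ?] := h3 j; split => //; exists (Md j).
  have k1 : L1 P (fun x => f (t, x) * g (t, x)) by exact: L1_mul_bdd.
  have k2 j : L1 P (fun x => F j (t, x) * deta j (t, x)) by apply: L1_mul_bdd => //; exact: bd.
  have k3 : L1 P (fun x => S (t, x) * eta (t, x)) by exact: L1_mul_bdd.
  have k4 : L1 P (fun x => \sum_j F j (t, x) * deta j (t, x)).
    by apply: L1_sum => j _; exact: k2.
  rewrite /balance_density RD; [|exact: L1D|exact: k3]; rewrite RD//.
  rewrite Rsum; last by move=> j _; exact: k2.
  under eq_fun do rewrite e.
  apply: cvgD; last exact: int_smear_cvg.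
  apply: cvgD; first exact: int_smear_cvg.
  by apply: cvg_big => [|j _]; [exact: add_continuous|exact: int_smear_cvg].
have JG : {ae tm, forall t, forall N, `|J N t| <= G t}.
  apply: filterS3 (filterI lfs (filterI lSs lFs)) (filterI hM1 (filterI hM2 hMd')) JE.
  move=> t [l1 [l2 l3]] [[m1 b1] [[m2 b2] h3]] e N; rewrite e.
  apply: le_trans (ler_normD _ _) _; apply: lerD; last exact: int_smear_bound.
  apply: le_trans (ler_normD _ _) _; apply: lerD; first exact: int_smear_bound.
  apply: le_trans (ler_norm_sum _ _ _) _; apply: ler_sum => j _.
  by have [? ?] := h3 j; exact: int_smear_bound.
have c2 (t : mT) : prim T (J N) t @[N --> \oo] --> prim T (fun s => \int[P]_x balance_density (s, x)) t.
  have [] := @R_dct _ _ _ tm (fun N s => ((s : K) < t)%R%:R * J N s)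
    (fun s => ((s : K) < t)%R%:R * \int[P]_x balance_density (s, x)) G.
  - by move=> N; exact: L1_meas (L1_lt _ (lJ N)).
  - exact: L1_meas (L1_lt _ lB1).
  - by apply: filterS Jcvg => s h; apply: cvgM => //; exact: cvg_cst.
  - exact: lG.
  - by apply: filterS JG => s h N; apply: le_trans (norm_lt_le _ _) (h N).
  by [].
apply: filterS3 lfs hM1 hsum => t l1 [m1 b1] h.
have be : essbdd P (slice eta t) by split => //; exists M1.
have c3 : (fun N => \int[P]_x (f (t, x) * smear P (tk N) (slice eta t) x)) @ \oo -->
    \int[P]_x (f (t, x) * eta (t, x)) by exact: int_smear_cvg.
have e : (fun N => \int[P]_x (f (t, x) * smear P (tk N) (slice eta t) x)) =
    (fun N => \int[P]_x (c0 x * smear P (tk N) eta0 x) + prim T (J N) t).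
  apply/funext => N; have [k1 _] := hsN N.
  by rewrite -(k1 _ _ l1 be) -(k1 _ _ lc0 b0) -h.
rewrite e in c3; apply: (cvg_unique (@Rhausdorff K) c3).
by apply: cvgD => //; exact: c2.
Qed.

End transported.

End fixed.

End balance.

(** Each product is split by 2|uv| <= u^2 + v^2. The largest coefficient obtained is M (1 + 2k),
    that of v2^2, which 2 M (1 + k) covers. [g1] to [g4] are entries of grad W and grad Vb and their
    transposes. *)
Lemma quad_bound (K : realType) (k M u1 u2 v1 v2 g1 g2 g3 g4 : K) : 0 <= k -> 0 <= M ->
  `|g1| <= M -> `|g2| <= M -> `|g3| <= M -> `|g4| <= M ->
  - (u1 * g1 * (u2 - k * v2)) - v1 * g2 * (u2 - k * v2) + u1 * g2 * v2
  + k * (u1 * g1 * v2) - v1 * v2 * (g3 - k * g4) <=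
  2 * M * (1 + k) * (u1 ^+ 2 + v1 ^+ 2 + (u2 ^+ 2 + v2 ^+ 2)).
Proof.
move=> k0 M0 h1 h2 h3 h4.
have bd (u v g : K) : `|g| <= M -> u * v * g <= M * u ^+ 2 / 2 + M * v ^+ 2 / 2.
  move=> hg; rewrite -mulrDl -mulrDr; apply: le_trans (ler_norm _) _.
  rewrite normrM mulrC -mulrA ler_pM//.
  rewrite normrM -(real_normK (num_real u)) -(real_normK (num_real v)).
  by have := sqr_ge0 (`|u| - `|v|); nra.
have n1 : `|- g1| <= M by rewrite normrN.
have n2 : `|- g2| <= M by rewrite normrN.
have n3 : `|- g3| <= M by rewrite normrN.
have e1 := bd u1 u2 _ n1; have e2 := bd u1 v2 _ h1; have e3 := bd v1 u2 _ n2.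
have e4 := bd v1 v2 _ h2; have e5 := bd u1 v2 _ h2; have e6 := bd v1 v2 _ n3.
have e7 := bd v1 v2 _ h4.
have f2 := ler_wpM2l k0 e2; have f4 := ler_wpM2l k0 e4; have f7 := ler_wpM2l k0 e7.
have -> : - (u1 * g1 * (u2 - k * v2)) - v1 * g2 * (u2 - k * v2) + u1 * g2 * v2
  + k * (u1 * g1 * v2) - v1 * v2 * (g3 - k * g4) =
  u1 * u2 * - g1 + k * (u1 * v2 * g1) + v1 * u2 * - g2 + k * (v1 * v2 * g2)
  + u1 * v2 * g2 + k * (u1 * v2 * g1) + v1 * v2 * - g3 + k * (v1 * v2 * g4) by ring.
have p (u : K) : 0 <= M * u ^+ 2 by rewrite mulr_ge0// sqr_ge0.
have pk (u : K) : 0 <= k * (M * u ^+ 2) by rewrite mulr_ge0.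
have := p u1; have := p u2; have := p v1; have := p v2.
have := pk u1; have := pk u2; have := pk v1; have := pk v2.
have -> : 2 * M * (1 + k) * (u1 ^+ 2 + v1 ^+ 2 + (u2 ^+ 2 + v2 ^+ 2)) =
   2 * (M * u1 ^+ 2 + M * u2 ^+ 2 + M * v1 ^+ 2 + M * v2 ^+ 2 +
    k * (M * u1 ^+ 2) + k * (M * u2 ^+ 2) + k * (M * v1 ^+ 2) + k * (M * v2 ^+ 2)) by ring.
by move: e1 e2 e3 e4 e5 e6 e7 f2 f4 f7; lra.
Qed.


(** * The spatial estimate *)

Section spatial_identity.
Variables (K : realType) (d : nat).
Local Notation pt := 'rV[K]_d.
Local Notation P := (@torus K d).
Local Notation bdd := (essbdd P).
Local Notation L2 := (sqint P).
Implicit Types (f g : pt -> K) (i j k : 'I_d).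

Variables (hn nu la mu : K).
Hypothesis hn0 : hn != 0.
Local Notation kap := (nu / hn).

Variables (r : pt -> K) (dr a : 'I_d -> pt -> K) (Tw Tb Tu : 'I_d -> 'I_d -> pt -> K).
(** At a fixed time, [r], [a], [b], [q] are sqrt(rho) times 1, w, vbar, u; the formula for [q] is u
    = w - (nu / hbar_nu) vbar. *)
Let b i x := hn * dr i x.
Let q i x := a i x - kap * b i x.
Hypotheses (r2 : L2 r) (dr2 : forall i, L2 (dr i)) (a2 : forall i, L2 (a i)).
Hypothesis hr : forall j, twd j r (dr j).
Hypothesis hTw : forall i j, twd j (fun x => r x * a i x)
  (fun x => r x * Tw i j x + 2 * (a i x * dr j x)).
Hypothesis hTb : forall i j, twd j (fun x => r x * b i x)
  (fun x => r x * Tb i j x + 2 * (b i x * dr j x)).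
Hypothesis hTu : forall i j, twd j (fun x => r x * q i x)
  (fun x => r x * Tu i j x + 2 * (q i x * dr j x)).

Variables (L Lt : pt -> K) (W Vb Wt Vbt : 'I_d -> pt -> K).
Variables (DW DVb : 'I_d -> 'I_d -> pt -> K) (DDW DDVb : 'I_d -> 'I_d -> 'I_d -> pt -> K).
Let V i x := 2 / hn * Vb i x.
Let U i x := W i x - kap * Vb i x.
Let DU i j x := DW i j x - kap * DVb i j x.
Let DDU i j k x := DDW i j k x - kap * DDVb i j k x.
Hypotheses (bW : forall i, bdd (W i)) (bVb : forall i, bdd (Vb i))
  (bDW : forall i j, bdd (DW i j)) (bDVb : forall i j, bdd (DVb i j))
  (bDDW : forall i j k, bdd (DDW i j k)) (bDDVb : forall i j k, bdd (DDVb i j k)).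
Hypotheses (hW : forall i j, twd j (W i) (DW i j)) (hVb : forall i j, twd j (Vb i) (DVb i j))
  (hDW : forall i j k, twd k (DW i j) (DDW i j k))
  (hDVb : forall i j k, twd k (DVb i j) (DDVb i j k))
  (hL : forall j, twd j L (V j)).
(** The three strong equations divided by R. With [V] the gradient of log R, a divergence div(R G)
    becomes R times (V . G + div G). *)
Hypothesis eW : {ae P, forall x i, Wt i x =
  \sum_j (- (U j x * DW i j x) + hn / 2 * (V j x * DVb i j x + DDVb i j j x)
    + nu / 2 * (V j x * DW i j x + DDW i j j x)) - la * V i x - mu * W i x}.
Hypothesis eVb : {ae P, forall x i, Vbt i x =
  \sum_j (- (U j x * DVb i j x) - hn / 2 * (V j x * DU j i x + DDU j i j x))}.
Hypothesis eL : {ae P, forall x, Lt x = - \sum_i (DU i i x + U i x * V i x)}.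

Let rho x := r x ^+ 2.
Let al i x := a i x - r x * W i x.
Let be i x := b i x - r x * Vb i x.

Let b2 i : L2 (b i).
Proof.
have -> : b i = (fun x => dr i x * hn) by apply/funext => x; rewrite /b mulrC.
by apply: L2_mul_bdd; [exact: dr2|exact: bdd_cst].
Qed.

Let al2 i : L2 (al i).
Proof. by apply: L2B; [exact: a2|exact: L2_mul_bdd]. Qed.

Let be2 i : L2 (be i).
Proof. by apply: L2B; [exact: b2|exact: L2_mul_bdd]. Qed.

Let bDU i j : bdd (DU i j).
Proof. by apply: bddB => //; exact: bddZ. Qed.

Let bDDU i j k : bdd (DDU i j k).
Proof. by apply: bddB => //; exact: bddZ. Qed.

Let hDU i j k : twd k (DU i j) (DDU i j k).
Proof. by apply: twdB => //; exact: twdZ. Qed.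

(** [Vb] is a multiple of the gradient of [L], so its gradient is a Hessian. *)
Let DVb_sym : {ae P, forall x i j, DVb i j x = DVb j i x}.
Proof.
apply: ae_foralli => i; apply: ae_foralli => j.
have h u v : twd v (V u) (fun x => 2 / hn * DVb u v x) by exact: twdZ.
apply: filterS (twd_schwarz (hL i) (hL j) (h i j) (h j i)) => x /mulfI; apply.
by rewrite mulf_neq0 ?invr_eq0.
Qed.

Let hrho j : twd j rho (fun x => 2 / hn * (r x * b j x)).
Proof.
have h := twd_sq (hr j) r2 (dr2 j); apply: (twd_eq h) => // x.
by rewrite /b; field.
Qed.

(** The product [r b] is a multiple of the gradient of rho, so its gradient is symmetric, and so is
    the correction since [b] is parallel to [dr]. Only [r Tb] is reached, the values of [Tb] on
    vacuum being free. *)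
Let Tb_sym : {ae P, forall x i j, r x * Tb i j x = r x * Tb j i x}.
Proof.
apply: ae_foralli => i; apply: ae_foralli => j.
have h u v := twdZ (2 / hn) (hTb u v).
apply: filterS (twd_schwarz (hrho i) (hrho j) (h i j) (h j i)) => x /mulfI h0.
have /h0 : 2 / hn != 0 by rewrite mulf_neq0 ?invr_eq0 ?pnatr_eq0.
rewrite /b => e; rewrite -[LHS](addrK (2 * (hn * dr i x * dr j x))) e.
by ring.
Qed.

(** Linearity of u in w and vbar, combined with uniqueness of weak derivatives. *)
Let Tu_split : {ae P, forall x i j, r x * Tu i j x = r x * Tw i j x - kap * (r x * Tb i j x)}.
Proof.
apply: ae_foralli => i; apply: ae_foralli => j.
have h := twdB (hTw i j) (twdZ kap (hTb i j)).
have e : (fun x => r x * a i x - kap * (r x * b i x)) =1 (fun x => r x * q i x).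
  by move=> x; rewrite /q; ring.
apply: filterS (twd_uniq (hTu i j) (twd_eq h e (frefl _))) => x.
by rewrite /q => e'; rewrite -[LHS](addrK (2 * ((a i x - kap * b i x) * dr j x))) e'; ring.
Qed.

(** The density of the relative dissipation minus that of the dissipation in the energy estimate.
    The middle term removes the contribution of rho |vbar|^2, which the relative entropy does not
    contain. *)
Definition dissipated x :=
  nu / 2 * (\sum_i \sum_j (- (2 * (r x * Tb i j x) * DVb i j x) + rho x * DVb i j x ^+ 2
      - 2 * (r x * Tw i j x) * DW i j x + rho x * DW i j x ^+ 2))
  - 2 * nu * la / hn ^+ 2 * (\sum_i b i x ^+ 2)
  + mu * (\sum_i (- (2 * (r x * a i x) * W i x) + rho x * W i x ^+ 2)).

(** This and the next two are the integrands obtained by testing the momentum equation with [W i],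
    the drift equation with [Vb i], and the continuity equation with |W|^2/2 + |Vb|^2/2 - la L. *)
Definition momentum_rate i x := r x * a i x * Wt i x
  + \sum_j (a i x * q j x + la * rho x * (i == j)%:R
      - hn / 2 * (r x * Tb i j x) - nu / 2 * (r x * Tw i j x)) * DW i j x
  - mu * (r x * a i x) * W i x.

Definition drift_rate i x := r x * b i x * Vbt i x
  + \sum_j (b i x * q j x + hn / 2 * (r x * Tu j i x)) * DVb i j x.

Definition mass_rate x := rho x * (\sum_i (W i x * Wt i x + Vb i x * Vbt i x) - la * Lt x)
  + \sum_j r x * q j x * (\sum_i (W i x * DW i j x + Vb i x * DVb i j x) - la * V j x).

Definition quadratic i j x :=
  - (al i x * DW i j x * (al j x - kap * be j x))
  - be i x * DVb i j x * (al j x - kap * be j x)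
  + al i x * DVb i j x * be j x + kap * (al i x * DW i j x * be j x)
  - be i x * be j x * DU j i x.

(** The weak derivative in direction j of the sum of -(hn/2) r a_i DVb_ij, -(nu/2) r a_i DW_ij,
    (hn/2) r b_i DU_ji, (hn/2) rho W_i DVb_ij, (nu/2) rho W_i DW_ij and -(hn/2) rho Vb_i DU_ji; it
    therefore has zero integral. *)
Definition exact_part i j x :=
  - (hn / 2) * ((r x * Tw i j x + 2 * (a i x * dr j x)) * DVb i j x + r x * a i x * DDVb i j j x)
  - nu / 2 * ((r x * Tw i j x + 2 * (a i x * dr j x)) * DW i j x + r x * a i x * DDW i j j x)
  + hn / 2 * ((r x * Tb i j x + 2 * (b i x * dr j x)) * DU j i x + r x * b i x * DDU j i j x)
  + hn / 2 * (2 / hn * (r x * b j x) * (W i x * DVb i j x)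
      + rho x * (DW i j x * DVb i j x + W i x * DDVb i j j x))
  + nu / 2 * (2 / hn * (r x * b j x) * (W i x * DW i j x)
      + rho x * (DW i j x * DW i j x + W i x * DDW i j j x))
  - hn / 2 * (2 / hn * (r x * b j x) * (Vb i x * DU j i x)
      + rho x * (DVb i j x * DU j i x + Vb i x * DDU j i j x)).

(** The weak derivative of rho Vb_i in direction i. *)
Definition exact_diag i x := 2 / hn * (r x * b i x) * Vb i x + rho x * DVb i i x.

(** Summands may be compared up to an antisymmetric term, which the double sum cancels. *)
Let S2E (f g : 'I_d -> 'I_d -> K) (s : 'I_d -> 'I_d -> K) :
  (forall i j, f i j = g i j + (s i j - s j i)) ->
  \sum_i \sum_j f i j = \sum_i \sum_j g i j.
Proof.
move=> h; transitivity (\sum_i \sum_j (g i j + (s i j - s j i))).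
  by apply: eq_bigr => i _; apply: eq_bigr.
under eq_bigr do rewrite big_split/= sumrB.
by rewrite big_split/= sumrB [X in _ - X]exchange_big/= subrr addr0.
Qed.

(** A pointwise identity: once the strong rates are substituted, the terms of higher order form
    spatial derivatives, the pressure terms leave - 2 la nu / hn^2 times |be|^2, and the rest is
    quadratic in the deviations [al], [be]. *)
Lemma rate_decomposition : {ae P, forall x,
  dissipated x - \sum_i momentum_rate i x - \sum_i drift_rate i x + mass_rate x =
  \sum_i \sum_j quadratic i j x - 2 * la * nu / hn ^+ 2 * (\sum_i be i x ^+ 2)
  + (\sum_i \sum_j exact_part i j x - la * kap * \sum_i exact_diag i x)}.
Proof.
apply: filterS3 (filterI eW (filterI eVb eL)) DVb_sym (filterI Tb_sym Tu_split) => x [Wx [Vbx Lx]] sV [sT uT].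
(* The rates of [W] and [Vb] as double-index summands; the terms in la and mu are kept apart, so
   that they are compared under a single sum over i. *)
pose w i j := - (U j x * DW i j x) + hn / 2 * (V j x * DVb i j x + DDVb i j j x)
    + nu / 2 * (V j x * DW i j x + DDW i j j x).
pose v i j := - (U j x * DVb i j x) - hn / 2 * (V j x * DU j i x + DDU j i j x).
have Wx' i : Wt i x = \sum_j w i j + (- la * V i x - mu * W i x) by rewrite Wx; ring.
have Vbx' i : Vbt i x = \sum_j v i j by exact: Vbx.
have eM1 : \sum_i momentum_rate i x =
    \sum_i (r x * a i x * (- la * V i x - mu * W i x) + la * rho x * DW i i x
            - mu * (r x * a i x) * W i x)
    + \sum_i \sum_j (r x * a i x * w i j + (a i x * q j x
      - hn / 2 * (r x * Tb i j x) - nu / 2 * (r x * Tw i j x)) * DW i j x).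
  rewrite -big_split/=; apply: eq_bigr => i _.
  rewrite /momentum_rate Wx' [in RHS]big_split/= -[in RHS]big_distrr/=.
  have -> : \sum_j (a i x * q j x + la * rho x * (i == j)%:R - hn / 2 * (r x * Tb i j x)
       - nu / 2 * (r x * Tw i j x)) * DW i j x =
     \sum_j (a i x * q j x - hn / 2 * (r x * Tb i j x) - nu / 2 * (r x * Tw i j x)) * DW i j x
     + la * rho x * DW i i x.
    rewrite [X in _ + X](_ : _ = \sum_j (i == j)%:R * (la * rho x * DW i j x)); last first.
      rewrite (bigD1 i)//= eqxx mul1r big1 ?addr0// => j ji.
      by rewrite eq_sym (negbTE ji) mul0r.
    by rewrite -big_split/=; apply: eq_bigr => j _; ring.
  by ring.
have eM2 : \sum_i drift_rate i x =
    \sum_i \sum_j (r x * b i x * v i j + (b i x * q j x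
      + hn / 2 * (r x * Tw j i x - kap * (r x * Tb j i x))) * DVb i j x).
  apply: eq_bigr => i _; rewrite /drift_rate Vbx' big_distrr/= -big_split/=.
  by apply: eq_bigr => j _; rewrite uT.
have eM3 : mass_rate x =
    \sum_i (rho x * (W i x * (- la * V i x - mu * W i x) + la * (DU i i x + U i x * V i x))
      - la * (r x * q i x * V i x))
    + \sum_i \sum_j (rho x * (W i x * w i j + Vb i x * v i j)
      + r x * q j x * (W i x * DW i j x + Vb i x * DVb i j x)).
  rewrite /mass_rate Lx.
  have -> : \sum_i (W i x * Wt i x + Vb i x * Vbt i x) =
      \sum_i W i x * (- la * V i x - mu * W i x) +
      \sum_i \sum_j (W i x * w i j + Vb i x * v i j).
    rewrite -big_split/=; apply: eq_bigr => i _.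
    by rewrite [in RHS]big_split/= -!big_distrr/= Wx' Vbx'; ring.
  have -> : \sum_j r x * q j x * (\sum_i (W i x * DW i j x + Vb i x * DVb i j x) - la * V j x) =
      \sum_i \sum_j r x * q j x * (W i x * DW i j x + Vb i x * DVb i j x) -
      \sum_i la * (r x * q i x * V i x).
    rewrite exchange_big/= -sumrB; apply: eq_bigr => j _.
    by rewrite mulrBr big_distrr/= mulrCA mulrA [la * _]mulrC.
  have -> : \sum_i (rho x * (W i x * (- la * V i x - mu * W i x) + la * (DU i i x + U i x * V i x))
      - la * (r x * q i x * V i x)) =
      rho x * (\sum_i W i x * (- la * V i x - mu * W i x)) +
      rho x * (la * \sum_i (DU i i x + U i x * V i x)) - \sum_i la * (r x * q i x * V i x).
    by rewrite sumrB !big_distrr/= -big_split/=; congr (_ - _); apply: eq_bigr => i _; ring.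
  have -> : \sum_i \sum_j (rho x * (W i x * w i j + Vb i x * v i j)
      + r x * q j x * (W i x * DW i j x + Vb i x * DVb i j x)) =
      rho x * (\sum_i \sum_j (W i x * w i j + Vb i x * v i j)) +
      \sum_i \sum_j r x * q j x * (W i x * DW i j x + Vb i x * DVb i j x).
    rewrite big_distrr/= -big_split/=; apply: eq_bigr => i _.
    by rewrite big_distrr/= -big_split.
  by ring.
rewrite eM1 eM2 eM3 /dissipated.
have diag :
  - (2 * nu * la / hn ^+ 2 * (\sum_i b i x ^+ 2))
  + mu * (\sum_i (- (2 * (r x * a i x) * W i x) + rho x * W i x ^+ 2))
  - \sum_i (r x * a i x * (- la * V i x - mu * W i x) + la * rho x * DW i i x
            - mu * (r x * a i x) * W i x)
  + \sum_i (rho x * (W i x * (- la * V i x - mu * W i x) + la * (DU i i x + U i x * V i x))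
      - la * (r x * q i x * V i x)) =
  - (2 * la * nu / hn ^+ 2 * (\sum_i be i x ^+ 2)) - la * kap * \sum_i exact_diag i x.
  rewrite !big_distrr/= -!sumrN -!big_split/=; apply: eq_bigr => i _.
  by rewrite /exact_diag /be /q /U /V /DU /rho; field.
have quad :
  nu / 2 * (\sum_i \sum_j (- (2 * (r x * Tb i j x) * DVb i j x) + rho x * DVb i j x ^+ 2
      - 2 * (r x * Tw i j x) * DW i j x + rho x * DW i j x ^+ 2))
  - \sum_i \sum_j (r x * a i x * w i j + (a i x * q j x
      - hn / 2 * (r x * Tb i j x) - nu / 2 * (r x * Tw i j x)) * DW i j x)
  - \sum_i \sum_j (r x * b i x * v i j + (b i x * q j x
      + hn / 2 * (r x * Tw j i x - kap * (r x * Tb j i x))) * DVb i j x)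
  + \sum_i \sum_j (rho x * (W i x * w i j + Vb i x * v i j)
      + r x * q j x * (W i x * DW i j x + Vb i x * DVb i j x)) =
  \sum_i \sum_j quadratic i j x + \sum_i \sum_j exact_part i j x.
  rewrite big_distrr/= -!sumrN -!big_split/=.
  under eq_bigr do rewrite big_distrr/= -!sumrN -!big_split/=.
  under [in RHS]eq_bigr do rewrite -big_split/=.
  (* For each pair (i, j) the two sides differ by [s i j - s j i] for this [s], once [DVb] and
     [r Tb] are replaced by symmetric expressions. *)
  apply: (S2E (s := fun i j => hn / 2 * (r x * Tw i j x - kap * (r x * Tb i j x)) * DVb i j x
    + hn / 2 * (r x * Tb i j x) * DW i j x - hn / 2 * rho x * DVb i j x * DW i j x)) => i j.
  rewrite /quadratic /exact_part /w /v /be /al /q /U /V /DU /DDU /rho /b (sV j i) (sT j i).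
  move: (r x) (Tw i j x) (Tw j i x) (Tb i j x) (DVb i j x) => rr t1 t2 t3 c1.
  by field.
by move: diag quad; lra.
Qed.

Let exact_part_int i j : L1 P (exact_part i j) /\ \int[P]_x exact_part i j x = 0.
Proof.
have h1 := twdZ (- (hn / 2)) (twdM (hTw i j) (hDVb i j j) (bDVb i j) (bDDVb i j j)).
have h2 := twdZ (nu / 2) (twdM (hTw i j) (hDW i j j) (bDW i j) (bDDW i j j)).
have h3 := twdZ (hn / 2) (twdM (hTb i j) (hDU j i j) (bDU j i) (bDDU j i j)).
have k4 := twdM (hW i j) (hDVb i j j) (bDVb i j) (bDDVb i j j).
have k5 := twdM (hW i j) (hDW i j j) (bDW i j) (bDDW i j j).
have k6 := twdM (hVb i j) (hDU j i j) (bDU j i) (bDDU j i j).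
have prod (f f' g g' : pt -> K) : bdd f -> bdd f' -> bdd g -> bdd g' ->
    bdd (fun x => f x * g x) /\ bdd (fun x => f' x * g x + f x * g' x).
  by move=> *; split; [exact: bddM|apply: bddD; exact: bddM].
have [p4 p4'] := prod _ _ _ _ (bW i) (bDW i j) (bDVb i j) (bDDVb i j j).
have [p5 p5'] := prod _ _ _ _ (bW i) (bDW i j) (bDW i j) (bDDW i j j).
have [p6 p6'] := prod _ _ _ _ (bVb i) (bDVb i j) (bDU j i) (bDDU j i j).
have h4 := twdZ (hn / 2) (twdM (hrho j) k4 p4 p4').
have h5 := twdZ (nu / 2) (twdM (hrho j) k5 p5 p5').
have h6 := twdZ (hn / 2) (twdM (hrho j) k6 p6 p6').
have h := twdB (twdD (twdD (twdD (twdB h1 h2) h3) h4) h5) h6.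
by split; [have [] := h|exact: twd_int0 h].
Qed.

Let exact_diag_int i : L1 P (exact_diag i) /\ \int[P]_x exact_diag i x = 0.
Proof.
have h := twdM (hrho i) (hVb i i) (bVb i) (bDVb i i).
by split; [have [] := h|exact: twd_int0 h].
Qed.

Let L1_quadratic i j : L1 P (quadratic i j).
Proof.
have l (u v G : pt -> K) : L2 u -> L2 v -> bdd G -> L1 P (fun x => u x * G x * v x).
  by move=> hu hv hG; apply: L2_mul => //; exact: L2_mul_bdd.
have hd : L2 (fun x => al j x - kap * be j x) by apply: L2B => //; exact: L2Z.
apply: L1B; last by apply: L1_mul_bdd => //; exact: L2_mul.
apply: L1D; last by apply: L1Z; exact: l.
apply: L1D; last exact: l.
apply: L1B; last exact: (l (be i)).
by apply: L1N; exact: (l (al i)).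
Qed.

(** The derivatives integrate to 0 and the term in |be|^2 has a favourable sign. [quad_bound] gives
    2 M (1 + kap) per pair of indices; summing over pairs doubles it and brings d, and one more
    factor 2 compensates the 1/2 in front of the deviation, whence 8 d M. *)
Lemma rate_bound (M : K) : 0 < hn -> 0 <= nu -> 0 <= la -> 0 <= M ->
  (forall i j, {ae P, forall x, `|DW i j x| <= M}) ->
  (forall i j, {ae P, forall x, `|DVb i j x| <= M}) ->
  L1 P (fun x => dissipated x - \sum_i momentum_rate i x - \sum_i drift_rate i x + mass_rate x) ->
  L1 P (fun x => \sum_i (al i x ^+ 2 + be i x ^+ 2)) /\
  \int[P]_x (dissipated x - \sum_i momentum_rate i x - \sum_i drift_rate i x + mass_rate x)
  <= 8 * d%:R * M * (1 + kap) * (2^-1 * \int[P]_x (\sum_i (al i x ^+ 2 + be i x ^+ 2))).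
Proof.
move=> hn_gt0 nu0 la0 M0 WM VM lZ.
have lq : L1 P (fun x => \sum_i \sum_j quadratic i j x).
  by apply: L1_sum => i _; apply: L1_sum => j _.
have lb : L1 P (fun x => \sum_i be i x ^+ 2).
  by apply: L1_sum => i _; have [] := be2 i.
have ls : L1 P (fun x => \sum_i (al i x ^+ 2 + be i x ^+ 2)).
  by apply: L1_sum => i _; apply: L1D; [have [] := al2 i|have [] := be2 i].
have lex : L1 P (fun x => \sum_i \sum_j exact_part i j x).
  by apply: L1_sum => i _; apply: L1_sum => j _; exact: (exact_part_int i j).1.
have led : L1 P (fun x => \sum_i exact_diag i x).
  by apply: L1_sum => i _; exact: (exact_diag_int i).1.
have ie : \int[P]_x (\sum_i \sum_j exact_part i j x) = 0.
  rewrite Rsum; last by move=> i _; apply: L1_sum => j _; exact: (exact_part_int i j).1.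
  rewrite big1// => i _; rewrite Rsum; last by move=> j _; exact: (exact_part_int i j).1.
  by rewrite big1// => j _; exact: (exact_part_int i j).2.
have id : \int[P]_x (\sum_i exact_diag i x) = 0.
  rewrite Rsum; last by move=> i _; exact: (exact_diag_int i).1.
  by rewrite big1// => i _; exact: (exact_diag_int i).2.
split => //.
have lQ : L1 P (fun x => \sum_i \sum_j quadratic i j x - 2 * la * nu / hn ^+ 2 * (\sum_i be i x ^+ 2)).
  by apply: L1B => //; exact: L1Z.
have lE : L1 P (fun x => \sum_i \sum_j exact_part i j x - la * kap * \sum_i exact_diag i x).
  by apply: L1B => //; exact: L1Z.
rewrite (R_ae (L1_meas lZ) (L1_meas (L1D lQ lE)) rate_decomposition) RD//.
rewrite [X in _ + X]RB//; last exact: L1Z.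
rewrite RZ// ie id mulr0 subr0 addr0 mulrA -RZ//.
have DM : {ae P, forall x i j, `|DW i j x| <= M /\ `|DVb i j x| <= M}.
  apply: ae_foralli => i; apply: ae_foralli => j.
  by apply: filterS2 (WM i j) (VM i j).
apply: R_le_ae => //; first exact: L1Z.
have k0 : 0 <= kap by rewrite divr_ge0// ltW.
apply: filterS DM => x DM.
have dsum (c : K) (s : 'I_d -> K) :
    \sum_i \sum_j c * (s i + s j) = 2 * d%:R * c * \sum_i s i.
  transitivity (\sum_i (c * (d%:R * s i) + c * \sum_j s j)).
    apply: eq_bigr => i _.
    by rewrite -big_distrr/= big_split/= sumr_const card_ord mulr_natl mulrDr.
  by rewrite big_split/= -!big_distrr/= sumr_const card_ord -mulr_natl; ring.
have -> : 8 * d%:R * M * (1 + kap) / 2 * (\sum_i (al i x ^+ 2 + be i x ^+ 2)) =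
    \sum_i \sum_(j < d) 2 * M * (1 + kap) *
      (al i x ^+ 2 + be i x ^+ 2 + (al j x ^+ 2 + be j x ^+ 2)).
  by rewrite (dsum _ (fun i => al i x ^+ 2 + be i x ^+ 2)); field.
have c0 : 0 <= 2 * la * nu / hn ^+ 2 * (\sum_i be i x ^+ 2).
  apply: mulr_ge0; last by apply: sumr_ge0 => i _; exact: sqr_ge0.
  by rewrite mulr_ge0 ?invr_ge0 ?sqr_ge0// !mulr_ge0.
apply: le_trans (_ : _ <= \sum_i \sum_j quadratic i j x) _.
  by rewrite lerBlDr lerDl.
apply: ler_sum => i _; apply: ler_sum => j _.
rewrite /quadratic /DU; apply: quad_bound => //.
- exact: (DM i j).1.
- exact: (DM i j).2.
- exact: (DM j i).1.
- exact: (DM j i).2.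
Qed.

End spatial_identity.

(** * Mixed Lebesgue norms *)

Section lebesgue_spaces.
Variables (K : realType) (d : nat) (T : K).
Hypothesis T0 : 0 < T.
Local Notation pt := 'rV[K]_d.
Local Notation mT := (measurableTypeR K).
Local Notation tm := (time T).
Local Notation P := (@torus K d).
Local Notation ST := (tm \x P)%E.
Implicit Types (f : mT * pt -> K).

Lemma time_gt0 : (0 < tm setT)%E.
Proof.
change (0 < lebesgue_measure ([set: K] `&` [set` `]0%R, T[%R]))%E.
by rewrite setTI lebesgue_measure_itv/= lte_fin T0 oppr0 adde0 lte_fin.
Qed.

Lemma torus_gt0 : (0 < P setT)%E.
Proof. by rewrite probability_setT lte01. Qed.

(** Positivity of the total mass selects the essential-supremum form of the norm; any admissible
    bound below infinity then serves. *)
Lemma Lnorm_oo_ae d' (X : measurableType d') (mu : {measure set X -> \bar K}) (f : X -> \bar K) :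
  (0 < mu setT)%E -> ('N[mu]_+oo[f] < +oo)%E ->
  exists M : K, {ae mu, forall x, (`|f x| <= M%:E)%E}.
Proof.
move=> mu0; rewrite unlock mu0 => /ereal_inf_lt[y hy ylt].
exists (fine y); apply: filterS hy => x /= h; apply: le_trans h _.
by case: y ylt => [y| |] //= _; exact: leNye.
Qed.

Lemma LpLq_oo_oo f : LpLq T +oo +oo f -> essbdd ST f.
Proof.
move=> [mf hf]; split => //.
have [M hM] := Lnorm_oo_ae time_gt0 hf; exists M.
apply: ae_le_prod1; [exact: measurableT_comp|exact: measurable_cst|].
apply: filterS hM => t ht.
have lt : ('N[P]_+oo[EFin \o slice f t] < +oo)%E.
  by apply: le_lt_trans (ltry M); apply: le_trans ht; rewrite lee_abs.
have {}ht : ('N[P]_+oo[EFin \o slice f t] <= M%:E)%E by apply: le_trans ht; rewrite lee_abs.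
(* The essential supremum is an infimum of bounds, so only values above [M] are known to be bounds;
   countably many of them give [M] itself. *)
have hn n : {ae P, forall y, `|f (t, y)| <= M + n.+1%:R^-1}.
  have : ('N[P]_+oo[EFin \o slice f t] < (M + n.+1%:R^-1)%:E)%E.
    by apply: le_lt_trans ht _; rewrite lte_fin ltrDl invr_gt0.
  rewrite unlock torus_gt0 => /ereal_inf_lt[y hy ylt].
  apply: filterS hy => x /= h; rewrite -lee_fin; apply: le_trans h (ltW ylt).
apply: filterS (ae_foralli hn) => x hx.
apply/ler_addgt0Pr => eps eps0.
have [n hnn] : exists n, n.+1%:R^-1 < eps.
  have := near_infty_natSinv_lt (PosNum eps0) => -[N _ h]; exists N; exact: (h N (leqnn N)).
by apply: le_trans (hx n) _; rewrite lerD2l ltW.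
Qed.

(** The squared norms of the slices are bounded at almost every time and the time interval is
    finite, so Tonelli applies. *)
Lemma LpLq_oo_2 f : LpLq T +oo 2%:E f -> sqint ST f.
Proof.
move=> [mf hf]; split => //.
have [M hM] := Lnorm_oo_ae time_gt0 hf.
have mf2 : measurable_fun setT (fun p => f p ^+ 2) by exact: measurable_funX.
have hs : {ae tm, forall t, (\int[P]_x (f (t, x) ^+ 2)%:E <= (`|M| ^+ 2)%:E)%E}.
  apply: filterS hM => t ht.
  have {}ht : ('N[P]_2%:E[EFin \o slice f t] <= M%:E)%E by apply: le_trans ht; rewrite lee_abs.
  have e : ('N[P]_2%:E[EFin \o slice f t] `^ 2 = \int[P]_x (f (t, x) ^+ 2)%:E)%E.
    rewrite unlock /= -poweRrM mulVf// poweRe1; last first.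
      by apply: integral_ge0 => x _; rewrite lee_fin powR_ge0.
    by apply: eq_integral => x _; rewrite /= powR_mulrn// real_normK ?num_real.
  rewrite -e; apply: (@le_trans _ _ ((`|M|%:E) `^ 2)%E).
    have hM0 : ('N[P]_2%:E[EFin \o slice f t] <= `|M|%:E)%E.
      by apply: le_trans ht _; rewrite lee_fin ler_norm.
    by apply: gt0_ler_poweR => //; rewrite in_itv/= leey ?Lnorm_ge0 ?lee_fin ?normr_ge0.
  by rewrite poweR_EFin powR_mulrn.
apply: L1_tonelli => //.
  apply: filterS hs => t ht; apply/integrableP; split.
    by apply/measurable_EFinP; exact: (meas_slice1 t mf2).
  apply: le_lt_trans (ltry (`|M| ^+ 2)); apply: le_trans ht.
  by rewrite le_eqVlt; apply/orP; left; apply/eqP; apply: eq_integral => x _ /=; rewrite ger0_norm ?sqr_ge0.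
apply: (@L1_le_ae _ _ _ _ _ (fun=> `|M| ^+ 2)).
- have mabs : measurable_fun setT (fun p : mT * pt => `|f p ^+ 2|) by exact: measurableT_comp.
  exact: (meas_int1 P mabs).
- apply: filterS hs => t ht; rewrite ger0_norm; last by apply: Rintegral_ge0.
  have fin : (\int[P]_x (f (t, x) ^+ 2)%:E \is a fin_num)%E.
    rewrite ge0_fin_numE ?(le_lt_trans ht) ?ltry//.
    by apply: integral_ge0 => x _; rewrite lee_fin sqr_ge0.
  rewrite -lee_fin; apply: le_trans ht.
  rewrite /Rintegral fineK; last first.
    rewrite (eq_integral (fun x => (f (t, x) ^+ 2)%:E))// => x _.
    by rewrite /= ger0_norm ?sqr_ge0.
  by rewrite (eq_integral (fun x => (f (t, x) ^+ 2)%:E))// => x _; rewrite /= ger0_norm ?sqr_ge0.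
- exact: L1_tcst.
Qed.

Lemma wDP k (f : mT * pt -> K) : wderivable T k f -> is_wderiv T k f (wD T k f).
Proof. by move=> [g hg]; exact: (xgetPex _ (ex_intro _ g hg)). Qed.

(** The bound is available only at almost every time, so an increasing sequence of good times
    tending to [T] is selected before monotone convergence is used. *)
Lemma L1_of_partial (D : mT -> \bar K) (C : K) : measurable_fun setT D -> (forall s, 0 <= D s)%E ->
  {ae tm, forall t : mT, (\int[tm]_s ((s < t)%R%:R%:E * D s) <= C%:E)%E} ->
  (\int[tm]_s D s <= C%:E)%E.
Proof.
move=> mD D0 hC.
(* One good time is taken in each interval between consecutive values of [lo], which makes the
   sequence increasing. *)
pose lo n := T * (1 - n.+1%:R^-1).
have h n : exists t : mT, (lo n < t < lo n.+1) /\ (\int[tm]_s ((s < t)%R%:R%:E * D s) <= C%:E)%E.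
  have lt : lo n < lo n.+1.
    by rewrite /lo ltr_pM2l// ltrD2l ltrN2 ltf_pV2 ?posrE// ltr_nat.
  have [||t h1 h2] := @ae_time_ex _ _ (lo n) (lo n.+1) _ _ lt _ hC.
  - by rewrite /lo mulr_ge0 ?(ltW T0)// subr_ge0 invf_le1// ler1n.
  - by rewrite /lo ler_piMr ?(ltW T0)// gerBl invr_ge0.
  - by exists t.
have [t_ ht] := choice h.
pose g n (s : mT) := ((s < t_ n)%R%:R%:E * D s)%E.
have mg n : measurable_fun setT (g n).
  apply: emeasurable_funM => //; apply/measurable_EFinP; exact: meas_lt.
have tt n : t_ n <= t_ n.+1.
  have [/andP[_ h1] _] := ht n; have [/andP[h2 _] _] := ht n.+1.
  by apply: ltW; exact: lt_trans h1 h2.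
have gc : (fun n => \int[tm]_s g n s)%E @ \oo --> (\int[tm]_s (limn (g ^~ s)))%E.
  apply: cvg_monotone_convergence => //.
  - by move=> n s _; rewrite /g mule_ge0// lee_fin.
  - move=> s _; apply/nondecreasing_seqP => n; rewrite /g lee_wpmul2r// lee_fin.
    by case: (boolP (s < t_ n)) => // h1; rewrite (lt_le_trans h1 (tt n)).
have e : (\int[tm]_s D s = \int[tm]_s (limn (g ^~ s)))%E.
  apply: ae_eq_integral => //.
    apply: (emeasurable_fun_cvg g) => // s _.
    apply: ereal_nondecreasing_is_cvgn; apply/nondecreasing_seqP => n.
    rewrite /g lee_wpmul2r// lee_fin.
    by case: (boolP (s < t_ n)) => // h1; rewrite (lt_le_trans h1 (tt n)).
  apply: filterS (ae_time_itv T) => s /andP[s0 sT] _.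
  apply/esym/cvg_lim => //; apply: cvg_near_cst.
  near=> n; rewrite /g (_ : (s < t_ n) = true) ?mul1e//.
  have [/andP[h1 _] _] := ht n; apply: lt_trans h1.
  rewrite /lo mulrBr mulr1 ltrBrDr -ltrBrDl ltr_pdivrMr//.
  rewrite mulrC -ltr_pdivrMr ?subr_gt0// -natr1.
  apply: (@le_lt_trans _ _ (n%:R)); last by rewrite ltrDl.
  by near: n; exact: nbhs_infty_ger.
rewrite e; apply: (cvge_le _ gc); apply: nearW => n; exact: (ht n).2.
Unshelve. all: by end_near. Qed.

End lebesgue_spaces.

(** * Entropy and energy *)

Section entropy_facts.
Variable K : realType.
Implicit Types x y : K.

Lemma derive_H y : 0 < y -> derive1 (@H K) y = ln y.
Proof.
move=> y0; rewrite derive1E.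
have d1 : is_derive y 1 (@ln K) y^-1 by exact: is_derive1_ln.
have d2 : is_derive y 1 (@H K) (y * y^-1 + ln y * 1 - 1).
  rewrite /H; apply: is_deriveB.
have [_ ->] := d2.
by rewrite divff ?gt_eqF// mulr1 addrAC subrr add0r.
Qed.

(** As [ln] is 0 on nonpositive numbers, H is -x there and its derivative is -1 for x < 0. With the
    logarithm for x > 0 and a single value at 0, the function is piecewise measurable. *)
Lemma meas_derive_H : measurable_fun setT (derive1 (@H K)).
Proof.
have neg y : y < 0 -> derive1 (@H K) y = -1.
  move=> y0; rewrite derive1E.
  have d : is_derive y 1 (-%R : K -> K) (-1) by exact: is_deriveNid.
  have [_ <-] := d; apply: near_eq_derive.
  have h : \forall z \near y, z <= 0 by exact: (@cvgr_le _ _ (nbhs y) _ id y (@cvg_id _ _) 0 y0).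
  by apply: filterS h => z z0; rewrite /H ln0// mulr0 sub0r.
rewrite (_ : derive1 _ = fun y => if 0 < y then ln y else
    if y < 0 then -1 else derive1 (@H K) 0); last first.
  apply/funext => y; case: ltrgtP => [y0|y0|<-//]; [exact: derive_H|exact: neg].
apply: measurable_fun_ifT; [by apply: measurable_fun_ltr|exact: measurable_ln|].
by apply: measurable_fun_ifT => //; apply: measurable_fun_ltr.
Qed.

(** In this form the coupling of the two densities is linear in [x], so that the logarithm of [y]
    can serve as a test function. *)
Lemma relHE x y : 0 < y -> relH x y = H x + y - x * ln y.
Proof. by move=> y0; rewrite /relH derive_H// /H; ring. Qed.

(** For x > 0 this is ln z <= z - 1 at z = y/x, multiplied by x. *)
Lemma relH_ge0 x y : 0 <= x -> 0 < y -> 0 <= relH x y.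
Proof.
move=> x0 y0; rewrite relHE// /H.
have [->|xn0] := eqVneq x 0; first by rewrite !mul0r !subr0 add0r ltW.
have xp : 0 < x by rewrite lt_neqAle eq_sym xn0 x0.
have h : ln (y / x) <= y / x - 1.
  have h1 : -1 < y / x - 1 by rewrite ltrBrDr addNr divr_gt0.
  by have := le_ln1Dx h1; rewrite [1 + _]addrC subrK.
rewrite lnM ?posrE ?invr_gt0// lnV ?posrE// in h.
have := ler_wpM2l x0 h.
have -> : x * (y / x - 1) = y - x by field.
by rewrite mulrBr; lra.
Qed.

Lemma H_ge x : 0 <= x -> -1 <= H x.
Proof. by move=> /relH_ge0 /(_ ltr01); rewrite relHE// ln1 mulr0 subr0; lra. Qed.

End entropy_facts.

Section energy_facts.
Variables (K : realType) (d : nat) (lambda mu nu : K).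
Local Notation pt := 'rV[K]_d.
Local Notation P := (@torus K d).
Local Notation la := (lambda' lambda mu nu).
Hypothesis la0 : 0 < la.

Lemma normsq_rV (v : 'rV[K]_d) : normsq v = \sum_i v 0 i ^+ 2.
Proof. by rewrite /normsq /inner big_ord1; apply: eq_bigr => i _; rewrite expr2. Qed.

Variables (r : pt -> K) (a b : pt -> 'rV[K]_d).
Hypotheses (mr : measurable_fun setT r) (ma : forall i, measurable_fun setT (fun x => a x 0 i))
  (mb : forall i, measurable_fun setT (fun x => b x 0 i)).

Definition energy_density (x : pt) : K :=
  2^-1 * (\sum_i a x 0 i ^+ 2) + 2^-1 * (\sum_i b x 0 i ^+ 2) + la * H (r x ^+ 2).

Lemma meas_H (f : pt -> K) : measurable_fun setT f -> measurable_fun setT (fun x => H (f x)).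
Proof.
move=> mf; rewrite /H; apply: measurable_funB => //; apply: measurable_funM => //.
by apply: measurableT_comp => //; exact: measurable_ln.
Qed.

Lemma energyE : energy lambda mu nu r a b = (\int[P]_x (energy_density x)%:E)%E.
Proof. by rewrite /energy; apply: eq_integral => x _; rewrite !normsq_rV. Qed.

(** The density is bounded below by -la since H >= -1, so its negative part is integrable and
    finiteness of the integral controls the positive part. Each term is then bounded by the density
    plus a constant. *)
Lemma energy_fin : (energy lambda mu nu r a b < +oo)%E ->
  [/\ L1 P energy_density, forall i, sqint P (fun x => a x 0 i),
      forall i, sqint P (fun x => b x 0 i) & L1 P (fun x => H (r x ^+ 2))].
Proof.
rewrite energyE => fin.
have mA : measurable_fun setT (fun x => \sum_i a x 0 i ^+ 2).
  by apply: measurable_sum => i; exact: measurable_funX.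
have mB : measurable_fun setT (fun x => \sum_i b x 0 i ^+ 2).
  by apply: measurable_sum => i; exact: measurable_funX.
have mH : measurable_fun setT (fun x => H (r x ^+ 2)) by apply: meas_H; exact: measurable_funX.
pose S x := 2^-1 * (\sum_i a x 0 i ^+ 2) + 2^-1 * (\sum_i b x 0 i ^+ 2).
have mS : measurable_fun setT S by apply: measurable_funD; exact: measurable_funM.
have md : measurable_fun setT energy_density by apply: measurable_funD => //; exact: measurable_funM.
have A0 x : 0 <= \sum_i a x 0 i ^+ 2 by apply: sumr_ge0 => i _; exact: sqr_ge0.
have B0 x : 0 <= \sum_i b x 0 i ^+ 2 by apply: sumr_ge0 => i _; exact: sqr_ge0.
have S0 x : 0 <= S x by rewrite addr_ge0// mulr_ge0.
have Hm x : - la <= la * H (r x ^+ 2).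
  by rewrite -[leLHS]mulrN1; apply: ler_wpM2l; [exact: ltW|apply: H_ge; exact: sqr_ge0].
have dm x : - la <= energy_density x.
  by rewrite -[leLHS]add0r; exact: (lerD (S0 x) (Hm x)).
pose p x := Num.max (energy_density x) 0; pose n x := Num.max (- energy_density x) 0.
have mp : measurable_fun setT p by exact: measurable_maxr.
have mn : measurable_fun setT n by apply: measurable_maxr => //; exact: measurableT_comp.
have ln : L1 P n.
  apply: (@L1_le _ _ _ _ _ (fun=> la)) => //; last exact: L1_pcst.
  by move=> x; rewrite /n ger0_norm ?le_max ?lexx ?orbT// ge_max (ltW la0) andbT lerNl.
have eE : (\int[P]_x (energy_density x)%:E = \int[P]_x (p x)%:E - \int[P]_x (n x)%:E)%E.
  rewrite integralE; congr (_ - _)%E; apply: eq_integral => x _.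
    by rewrite funeposE EFin_max.
  by rewrite funenegE EFin_max.
have lp : L1 P p.
  apply/integrableP; split; first exact/measurable_EFinP.
  have -> : (\int[P]_x `|(EFin \o p) x| = \int[P]_x (p x)%:E)%E.
    by apply: eq_integral => x _; rewrite /= ger0_norm// /p le_max lexx orbT.
  by move: fin; rewrite eE -(EFinR ln); case: (\int[P]_x (p x)%:E)%E => [u _| |] //; exact: ltry.
have ld : L1 P energy_density.
  apply: eq_L1 (L1B lp ln) => x; rewrite /p /n; case: (lerP (energy_density x) 0) => h.
    by rewrite max_l ?oppr_ge0// sub0r opprK.
  by rewrite max_r ?oppr_le0 ?ltW// subr0.
have lS : L1 P S.
  apply: (@L1_le _ _ _ _ _ (fun x => energy_density x + la)) => //.
    move=> x; rewrite ger0_norm// /energy_density -/(S x) -addrA lerDl.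
    by have := Hm x; lra.
  by apply: L1D => //; exact: L1_pcst.
split => //.
- move=> i; split => //; apply: (@L1_le _ _ _ _ _ (fun x => 2 * S x)).
  + exact: measurable_funX.
  + move=> x; rewrite ger0_norm ?sqr_ge0// /S mulrDr !mulrA divff// !mul1r.
    rewrite (bigD1 i)//= -addrA lerDl addr_ge0//.
    by apply: sumr_ge0 => j _; exact: sqr_ge0.
  + exact: L1Z.
- move=> i; split => //; apply: (@L1_le _ _ _ _ _ (fun x => 2 * S x)).
  + exact: measurable_funX.
  + move=> x; rewrite ger0_norm ?sqr_ge0// /S mulrDr !mulrA divff// !mul1r.
    rewrite [X in _ + X](bigD1 i)//= addrCA lerDl addr_ge0//.
    by apply: sumr_ge0 => j _; exact: sqr_ge0.
  + exact: L1Z.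
- apply: eq_L1 (L1Z la^-1 (L1B ld lS)) => x.
  by rewrite /energy_density -/(S x) addrAC subrr add0r mulKf// gt_eqF.
Qed.

Variables (R : pt -> K) (W Vb : pt -> 'rV[K]_d).

Definition eta_density (x : pt) : K :=
  2^-1 * (\sum_i W x 0 i ^+ 2) + 2^-1 * (\sum_i Vb x 0 i ^+ 2) - la * ln (R x).

(** Expansion of the squares and of [relHE]: the weak energy, the two terms tested with W and Vb,
    the continuity test [eta_density], and the mass of R. The lower bound drops the nonnegative
    relative entropy of the densities. *)
Lemma rel_energyE : (energy lambda mu nu r a b < +oo)%E -> sqint P r ->
  L1 P R -> {ae P, forall x, 0 < R x} -> essbdd P (fun x => ln (R x)) ->
  (forall i, essbdd P (fun x => W x 0 i)) -> (forall i, essbdd P (fun x => Vb x 0 i)) ->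
  rel_energy lambda mu nu r a b R W Vb =
    (\int[P]_x energy_density x - \sum_i \int[P]_x (r x * a x 0 i * W x 0 i)
     - \sum_i \int[P]_x (r x * b x 0 i * Vb x 0 i) + \int[P]_x (r x ^+ 2 * eta_density x)
     + la * \int[P]_x R x)%:E /\
  ((2^-1 * \int[P]_x (\sum_i ((a x 0 i - r x * W x 0 i) ^+ 2 + (b x 0 i - r x * Vb x 0 i) ^+ 2)))%:E
    <= rel_energy lambda mu nu r a b R W Vb)%E.
Proof.
move=> fin r2 lR R0 bL bW bVb.
have [ld a2 b2 lH] := energy_fin fin; have [_ lr2] := r2.
have lR' : L1 P (fun x => relH (r x ^+ 2) (R x)).
  have mR := L1_meas lR; have [ml _] := bL.
  have l : L1 P (fun x => H (r x ^+ 2) + R x - r x ^+ 2 * ln (R x)).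
    by apply: L1B; [exact: L1D|exact: L1_mul_bdd].
  have m : measurable_fun setT (fun x => relH (r x ^+ 2) (R x)).
    rewrite /relH; apply: measurable_funB.
      by apply: measurable_funB; apply: meas_H => //; exact: measurable_funX.
    apply: measurable_funM; last by apply: measurable_funB => //; exact: measurable_funX.
    exact: (measurableT_comp (@meas_derive_H K) mR).
  by apply: (L1_ae m _ l); apply: filterS R0 => x R0; rewrite relHE.
have al2 i : sqint P (fun x => a x 0 i - r x * W x 0 i).
  by apply: L2B => //; exact: (L2_mul_bdd r2).
have be2 i : sqint P (fun x => b x 0 i - r x * Vb x 0 i).
  by apply: L2B => //; exact: (L2_mul_bdd r2).
have lX : L1 P (fun x => \sum_i ((a x 0 i - r x * W x 0 i) ^+ 2 + (b x 0 i - r x * Vb x 0 i) ^+ 2)).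
  by apply: L1_sum => i _; apply: L1D; [have [] := al2 i|have [] := be2 i].
have laW i : L1 P (fun x => r x * a x 0 i * W x 0 i).
  by apply: L1_mul_bdd => //; exact: L2_mul.
have lbV i : L1 P (fun x => r x * b x 0 i * Vb x 0 i).
  by apply: L1_mul_bdd => //; exact: L2_mul.
have bsum (Z : pt -> 'rV[K]_d) : (forall i, essbdd P (fun x => Z x 0 i)) ->
    essbdd P (fun x => 2^-1 * (\sum_i Z x 0 i ^+ 2)).
  move=> bZ; apply: bddZ; apply: bdd_sum => i.
  by rewrite (_ : (fun _ => _) = fun x => Z x 0 i * Z x 0 i)//; exact: bddM.
have beta : essbdd P eta_density.
  by apply: bddB; [apply: bddD; exact: bsum|exact: bddZ].
have leta : L1 P (fun x => r x ^+ 2 * eta_density x) by exact: L1_mul_bdd.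
have e1 : rel_energy lambda mu nu r a b R W Vb =
    (2^-1 * \int[P]_x (\sum_i ((a x 0 i - r x * W x 0 i) ^+ 2 + (b x 0 i - r x * Vb x 0 i) ^+ 2))
     + la * \int[P]_x relH (r x ^+ 2) (R x))%:E.
  rewrite EFinD !EFinM !EFinR// /rel_energy; congr (_ * _ + _)%E.
  apply: eq_integral => x _; rewrite !normsq_rV -big_split/=; congr (_%:E).
  by apply: eq_bigr => i _; rewrite !mxE addrC.
split; last first.
  rewrite e1 lee_fin lerDl mulr_ge0 ?(ltW la0)//.
  apply: R_ge0_ae => //; apply: filterS R0 => x R0.
  by apply: relH_ge0 => //; exact: sqr_ge0.
rewrite e1; congr (_%:E).
have lsW : L1 P (fun x => \sum_i r x * a x 0 i * W x 0 i) by apply: L1_sum => i _.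
have lsV : L1 P (fun x => \sum_i r x * b x 0 i * Vb x 0 i) by apply: L1_sum => i _.
have l1 := L1Z 2^-1 lX; have l2 := L1Z la lR'.
have l3 := L1B ld lsW; have l4 := L1B l3 lsV; have l5 := L1D l4 leta.
have l6 := L1Z la lR; have l7 := L1D l5 l6.
rewrite -(RZ 2^-1 lX) -(RZ la lR') -(RD l1 l2) -!(Rsum _ (fun i _ => laW i)).
rewrite -!(Rsum _ (fun i _ => lbV i)) -(RB ld lsW) -(RB l3 lsV) -(RD l4 leta) -(RZ la lR) -(RD l5 l6).
apply: R_ae; [exact: L1_meas (L1D l1 l2)|exact: L1_meas l7|].
apply: filterS R0 => x R0; rewrite relHE// /energy_density /eta_density.
have -> : 2^-1 * (\sum_i ((a x 0 i - r x * W x 0 i) ^+ 2 + (b x 0 i - r x * Vb x 0 i) ^+ 2)) =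
   2^-1 * (\sum_i a x 0 i ^+ 2) + 2^-1 * (\sum_i b x 0 i ^+ 2)
   - \sum_i r x * a x 0 i * W x 0 i - \sum_i r x * b x 0 i * Vb x 0 i
   + r x ^+ 2 * (2^-1 * (\sum_i W x 0 i ^+ 2) + 2^-1 * (\sum_i Vb x 0 i ^+ 2)).
  rewrite mulrDr !big_distrr/= -!sumrN -!big_split/=; apply: eq_bigr => i _.
  by field.
by ring.
Qed.

End energy_facts.

(** * The weak solution *)

Section weak_conservation.
Variables (K : realType) (d : nat) (T lambda mu nu hbar : K).
Hypothesis T0 : 0 < T.
Local Notation pt := 'rV[K]_d.
Local Notation mT := (measurableTypeR K).
Local Notation tm := (time T).
Local Notation P := (@torus K d).
Local Notation ST := (tm \x P)%E.
Local Notation la := (lambda' lambda mu nu).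
Local Notation hn := (hbar_nu nu hbar).
Variables (r0 : pt -> K) (w0 : pt -> 'rV[K]_d) (r : K * pt -> K) (ru : K * pt -> 'rV[K]_d).
Variables (Tu Tw Tvb : K * pt -> 'M[K]_d).
Hypothesis ws : weak_solution T lambda mu nu hbar r0 w0 r ru Tu Tw Tvb.
Hypotheses (la0 : 0 < la) (d_gt0 : (0 < d)%N) (hn_gt0 : 0 < hn).

Definition dr i : K * pt -> K := wD T (Some i) r.
Local Notation a i := (fun p : mT * pt => rw T nu r ru p 0 i).
Local Notation b i := (fun p : mT * pt => rvb T nu hbar r p 0 i).
Local Notation q i := (fun p : mT * pt => ru p 0 i).

Lemma a_E i (p : K * pt) : rw T nu r ru p 0 i = ru p 0 i + nu * dr i p.
Proof. by rewrite /rw !mxE. Qed.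

Lemma b_E i (p : K * pt) : rvb T nu hbar r p 0 i = hn * dr i p.
Proof. by rewrite /rvb !mxE. Qed.

Lemma sq_r : sqint ST r.
Proof. by have [h _] := weak_r_reg ws; exact: (LpLq_oo_2 T0 h). Qed.

Lemma wderiv_r i : is_wderiv T (Some i) r (dr i).
Proof. by have [_ /(_ i)[h _]] := weak_r_reg ws; exact: wDP. Qed.

Lemma sq_dr i : sqint ST (dr i).
Proof. by have [_ /(_ i)[_ [h _]]] := weak_r_reg ws; exact: (LpLq_oo_2 T0 h). Qed.

Lemma sq_q i : sqint ST (q i).
Proof. exact: (LpLq_oo_2 T0 (weak_ru_reg ws i)). Qed.

Lemma sq_a i : sqint ST (a i).
Proof.
rewrite (_ : a i = fun p => ru p 0 i + nu * dr i p); last by apply/funext => p; rewrite a_E.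
by apply: L2D; [exact: sq_q|apply: L2Z; exact: sq_dr].
Qed.

Lemma sq_b i : sqint ST (b i).
Proof.
rewrite (_ : b i = fun p => hn * dr i p); last by apply/funext => p; rewrite b_E.
by apply: L2Z; exact: sq_dr.
Qed.

Lemma half_test0 chi (e : @xexpr K d) : half_test T chi -> test0 T (tprod chi e).
Proof.
move=> [sc [T' T'T c0]]; split; [exact: smooth_tprod|by move=> t x i; rewrite /tprod/= xeval_periodic|].
by exists T' => // t x /c0 h; rewrite /tprod/= h mul0r.
Qed.

(** The scalar test in component [i]. The Kronecker symbol sits inside the trigonometric polynomial,
    so that every component is again a [tprod]. *)
Definition vtest chi (e : @xexpr K d) (i : 'I_d) : K * pt -> 'rV[K]_d :=
  fun p => \row_k tprod chi (XMul e (XCst d (k == i)%:R)) p.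

Lemma comp_vtest chi e i k : Defs.comp (vtest chi e i) k = tprod chi (XMul e (XCst d (k == i)%:R)).
Proof. by apply/funext => p; rewrite /Defs.comp mxE. Qed.

Lemma vtest_test chi e i k : half_test T chi -> test0 T (Defs.comp (vtest chi e i) k).
Proof. by move=> h; rewrite comp_vtest; exact: half_test0. Qed.

Lemma delta_sum (A : 'I_d -> K) (c : K) i : \sum_k A k * (c * (k == i)%:R) = A i * c.
Proof.
rewrite (bigD1 i)//= eqxx mulr1 big1 ?addr0// => k ki.
by rewrite (negbTE ki) !mulr0.
Qed.

Lemma inner_vtest (v : 'rV[K]_d) chi e i p : inner v (vtest chi e i p) = v 0 i * tprod chi e p.
Proof.
rewrite /inner big_ord1 -(delta_sum (fun k => v 0 k)); apply: eq_bigr => k _.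
by rewrite mxE /tprod/= [_ * (_ * (_ == _)%:R)]mulrA.
Qed.

Lemma inner_dtv (v : 'rV[K]_d) chi e i p : smooth1 chi ->
  inner v (dtv (@pd K d) (vtest chi e i) p) = v 0 i * tprod (derive1 chi) e p.
Proof.
move=> sc; rewrite /inner big_ord1 -(delta_sum (fun k => v 0 k)); apply: eq_bigr => k _.
by rewrite mxE comp_vtest pd_tprod_time// /tprod/= [_ * (_ * (_ == _)%:R)]mulrA.
Qed.

Lemma gradv_vtest chi e i k j p : gradv (@pd K d) (vtest chi e i) p k j =
  tprod chi (xder j e) p * (k == i)%:R.
Proof. by rewrite mxE comp_vtest pd_tprod_space /tprod/= mulr0 add0r mulrA. Qed.

Lemma inner_gradv (M : 'M[K]_d) chi e i p :
  inner M (gradv (@pd K d) (vtest chi e i) p) = \sum_j M i j * tprod chi (xder j e) p.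
Proof.
rewrite /inner exchange_big/=; apply: eq_bigr => j _.
by rewrite -(delta_sum (fun k => M k j)); apply: eq_bigr => k _; rewrite gradv_vtest.
Qed.

Lemma divv_vtest chi e i p : divv (@pd K d) (vtest chi e i) p = tprod chi (xder i e) p.
Proof.
have h k : pd (Some k) (Defs.comp (vtest chi e i) k) p = tprod chi (xder k e) p * (k == i)%:R.
  by rewrite -(gradv_vtest chi e i k k p) mxE.
rewrite /divv (bigD1 i)//= h eqxx mulr1 big1 ?addr0// => k ki.
by rewrite h (negbTE ki) mulr0.
Qed.

Lemma L1_sgrad i : L1 P (fun x => sgrad r0 x 0 i).
Proof.
have [g hg] := weak_r0_diff ws i.
have [_ lg _] := xgetPex (fun=> 0) (ex_intro _ g hg : exists g, [set g | is_sderiv i r0 g] g).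
by apply: eq_L1 lg => x; rewrite /sgrad mxE.
Qed.

Lemma meas_r0 : measurable_fun setT r0 /\ (forall i, measurable_fun setT (fun x => rw0 r0 w0 x 0 i)) /\
  forall i, measurable_fun setT (fun x => rvb0 nu hbar r0 x 0 i).
Proof.
have d0 (i : 'I_d) : measurable_fun setT r0.
  by have [g [lf _ _]] := weak_r0_diff ws i; exact: (L1_meas lf).
have mw i : measurable_fun setT (fun x => rw0 r0 w0 x 0 i).
  rewrite (_ : (fun x => _) = fun x => r0 x * w0 x 0 i); last by apply/funext => x; rewrite !mxE.
  by apply: measurable_funM; [exact: (d0 i)|exact: (weak_w0_meas ws)].
have mv i : measurable_fun setT (fun x => rvb0 nu hbar r0 x 0 i).
  rewrite (_ : (fun x => _) = fun x => hn * sgrad r0 x 0 i); last by apply/funext => x; rewrite !mxE.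
  by apply: measurable_funM => //; exact: L1_meas (L1_sgrad i).
(* Measurability of [r0] is read off a weak derivative in some direction, so at least one direction
   must exist. *)
have md : measurable_fun setT r0 by exact: (d0 (Ordinal d_gt0)).
by [].
Qed.

Lemma init_energy : [/\ L1 P (energy_density lambda mu nu r0 (rw0 r0 w0) (rvb0 nu hbar r0)),
  forall i, sqint P (fun x => rw0 r0 w0 x 0 i),
  forall i, sqint P (fun x => rvb0 nu hbar r0 x 0 i) & sqint P r0].
Proof.
have [m0 [mw mv]] := meas_r0.
have [l1 l2 l3 lH] := energy_fin la0 m0 mw mv (weak_energy0 ws).
split => //; split => //.
apply: (@L1_le _ _ _ _ _ (fun x => H (r0 x ^+ 2) + expR 1)).
- exact: measurable_funX.
- move=> x; have x0 := sqr_ge0 (r0 x); rewrite ger0_norm//.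
  (* Comparison with the constant density e, whose logarithm is 1, gives rho_0 <= H(rho_0) + e. *)
  by have := relH_ge0 x0 (expR_gt0 1); rewrite relHE ?expR_gt0// expRK mulr1; lra.
- by apply: L1D => //; exact: L1_pcst.
Qed.

Lemma mass_conservation :
  conservation T (fun p => r p ^+ 2) (fun j p => r p * q j p) (fun=> 0) (fun x => r0 x ^+ 2).
Proof.
split.
- by have [] := sq_r.
- by move=> j; apply: L2_mul; [exact: sq_r|exact: sq_q].
- exact: L1_0.
- by have [_ _ _ []] := init_energy.
move=> chi e h; have [sc _] := h.
rewrite -[RHS](weak_eq_rho ws (half_test0 e h)); congr (_ + _).
  apply: eqR => p; rewrite /rho mul0r addr0 pd_tprod_time//; congr (_ + _).
  rewrite /inner big_ord1; apply: eq_bigr => j _.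
  by rewrite !mxE pd_tprod_space.
rewrite -RZ; last by have [_ _ _ []] := init_energy => _ l; exact: L1_mul_xeval.
by apply: eqR => x; rewrite /tprod/=; ring.
Qed.

Definition momentum_flux i j (p : mT * pt) : K :=
  a i p * q j p + la * r p ^+ 2 * (i == j)%:R
  - hn / 2 * (r p * Tvb p i j) - nu / 2 * (r p * Tw p i j).

Lemma momentum_conservation i :
  conservation T (fun p => r p * a i p) (momentum_flux i)
    (fun p => - mu * (r p * a i p)) (fun x => r0 x * rw0 r0 w0 x 0 i).
Proof.
have lf : L1 ST (fun p => r p * a i p) by apply: L2_mul; [exact: sq_r|exact: sq_a].
have l0 : L1 P (fun x => r0 x * rw0 r0 w0 x 0 i).
  by have [_ l _ l'] := init_energy; exact: L2_mul.
split => //.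
- move=> j; have [_ lb _] := weak_TN_vb ws i j; have [_ lw _] := weak_TN_w ws i j.
  apply: L1B; last exact: L1Z lw.
  apply: L1B; last exact: L1Z lb.
  apply: L1D; first by apply: L2_mul; [exact: sq_a|exact: sq_q].
  by apply: L1Zr; apply: L1Z; have [] := sq_r.
- exact: L1Z.
move=> chi e h; have [sc _] := h.
rewrite -[RHS](weak_eq_w ws (fun k => vtest_test e i k h)); congr (_ + _).
  apply: eqR => p; rewrite inner_dtv// !inner_gradv divv_vtest inner_vtest.
  rewrite !mxE.
  (* The pressure is written as a diagonal flux, to fit the format of [conservation]. *)
  have -> : la * rho r p * tprod chi (xder i e) p =
      \sum_j la * r p ^+ 2 * (i == j)%:R * tprod chi (xder j e) p.
    rewrite (bigD1 i)//= eqxx mulr1 big1 ?addr0// => j ji.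
    by rewrite eq_sym (negbTE ji) mulr0 mul0r.
  have -> : \sum_j momentum_flux i j p * tprod chi (xder j e) p =
    \sum_j outer (rw T nu r ru p) (ru p) i j * tprod chi (xder j e) p
    + \sum_j la * r p ^+ 2 * (i == j)%:R * tprod chi (xder j e) p
    - hn / 2 * (\sum_j (r p *: Tvb p) i j * tprod chi (xder j e) p)
    - nu / 2 * (\sum_j (r p *: Tw p) i j * tprod chi (xder j e) p).
    rewrite !big_distrr/= -!sumrN -!big_split/=; apply: eq_bigr => j _.
    by rewrite /momentum_flux /outer !mxE big_ord1 !mxE; ring.
  by ring.
rewrite -RZ; last exact: L1_mul_xeval.
by apply: eqR => x; rewrite inner_vtest !mxE /tprod/=; ring.
Qed.

(** As vbar = (hbar_nu / 2) v, the weak drift equation is 2 / hn times this one and the nonzero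
    factor is cancelled. The transpose of T_N(u) accounts for the indices [j i]. *)
Lemma drift_conservation i :
  conservation T (fun p => r p * b i p)
    (fun j p => b i p * q j p + hn / 2 * (r p * Tu p j i))
    (fun=> 0) (fun x => r0 x * rvb0 nu hbar r0 x 0 i).
Proof.
have l0 : L1 P (fun x => r0 x * rvb0 nu hbar r0 x 0 i).
  by have [_ _ l l'] := init_energy; exact: L2_mul.
have lG j : L1 ST (fun p => b i p * q j p + hn / 2 * (r p * Tu p j i)).
  have [_ lu _] := weak_TN_u ws j i.
  by apply: L1D; [apply: L2_mul; [exact: sq_b|exact: sq_q]|exact: L1Z lu].
have lr : L1 ST (fun p => r p * b i p) by apply: L2_mul; [exact: sq_r|exact: sq_b].
have hn0 : hn != 0 by rewrite gt_eqF.
split => //; first exact: L1_0.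
move=> chi e h; have [sc _] := h; have cc := smooth1_continuous sc.
have sc' : smooth1 (derive1 chi) := smooth1_derive1n (n := 1%N) sc.
have cc' := smooth1_continuous sc'.
have l1 : L1 ST (fun p => r p * b i p * tprod (derive1 chi) e p +
    \sum_j (b i p * q j p + hn / 2 * (r p * Tu p j i)) * tprod chi (xder j e) p).
  apply: L1D; first exact: (L1_tprod e lr cc').
  by apply: L1_sum => j _; exact: (L1_tprod (xder j e) (lG j) cc).
have e1 : \int[stm d T]_p (inner (r p *: rv T r p) (dtv (@pd K d) (vtest chi e i) p)
    + inner (outer (rv T r p) (ru p)) (gradv (@pd K d) (vtest chi e i) p)
    + inner (r p *: (Tu p)^T) (gradv (@pd K d) (vtest chi e i) p)) =
  2 / hn * \int[ST]_p (r p * b i p * tprod (derive1 chi) e p +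
    \sum_j (b i p * q j p + hn / 2 * (r p * Tu p j i)) * tprod chi (xder j e) p).
  rewrite -RZ//; apply: eqR => p.
  rewrite inner_dtv// !inner_gradv -addrA -big_split/= mulrDr big_distrr/=.
  congr (_ + _); first by rewrite !mxE; field.
  by apply: eq_bigr => j _; rewrite /outer !mxE big_ord1 !mxE; field.
have e2 : \int[P]_x inner (r0 x *: rv0 r0 x) (vtest chi e i (0, x)) =
    2 / hn * (chi 0 * \int[P]_x (r0 x * rvb0 nu hbar r0 x 0 i * xeval e x)).
  have l2 := L1_mul_xeval e l0.
  rewrite -(RZ _ l2) -(RZ _ (L1Z (chi 0) l2)); apply: eqR => x.
  by rewrite inner_vtest !mxE /tprod/=; field.
have := weak_eq_v ws (fun k => vtest_test e i k h).
rewrite e1 e2 -mulrDr => /eqP; rewrite mulf_eq0 (_ : (2 / hn == 0) = false); last first.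
  by apply/negbTE; rewrite mulf_neq0 ?invr_eq0 ?pnatr_eq0.
rewrite orFb => /eqP h0; rewrite -[RHS]h0; congr (_ + _); apply: eqR => p; by rewrite mul0r addr0.
Qed.

End weak_conservation.

(** * Measurability of continuous functions of time and space *)

Section continuous_measurable.
Variables (K : realType) (d : nat).
Local Notation pt := 'rV[K]_d.
Local Notation mT := (measurableTypeR K).

Let grid n (x : K) : int := Num.floor (n.+1%:R * x).
Let node n (k : int) : K := k%:~R / n.+1%:R.

Let node_dist n x : `|x - node n (grid n x)| <= n.+1%:R^-1.
Proof.
have n0 : 0 < n.+1%:R :> K by [].
have /andP[h1 h2] := Num.Theory.floor_itv (n.+1%:R * x).
have -> : x - node n (grid n x) = (n.+1%:R * x - (grid n x)%:~R) / n.+1%:R.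
  by rewrite /node; field; rewrite gt_eqF.
rewrite normrM [`|_^-1|]ger0_norm ?invr_ge0// ler_piMl ?invr_ge0//.
rewrite ger0_norm ?subr_ge0// lerBlDr; apply: ltW; apply: lt_le_trans h2 _.
by rewrite rmorphD/= addrC.
Qed.

Let node_cvg (x : K) : node n (grid n x) @[n --> \oo] --> x.
Proof.
apply/cvgrPdist_le => e e0; near=> n.
apply: le_trans (node_dist n x) _; apply: ltW.
by near: n; exact: (near_infty_natSinv_lt (PosNum e0)).
Unshelve. all: by end_near. Qed.

Let meas_grid n k d' (X : measurableType d') (c : X -> K) : measurable_fun setT c ->
  measurable [set x | grid n (c x) = k].
Proof.
move=> mc.
rewrite (_ : [set x | _] = c @^-1` `[(k%:~R / n.+1%:R : K), ((k + 1)%:~R / n.+1%:R)[%classic).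
  by rewrite -[X in measurable X]setTI; exact: mc.
have n0 : 0 < n.+1%:R :> K by [].
apply/seteqP; split => x /=; rewrite in_itv/= ler_pdivrMr// ltr_pdivlMr// [c x * _]mulrC.
  by move=> <-; exact: Num.Theory.floor_itv.
by move=> h; apply: Num.Theory.floor_def.
Qed.

(* The sigma-algebra of 'rV is not defined from open sets: a continuous function is shown
   to be the limit of its samples on the grids (1/n)Z^(1+d). *)
Lemma continuous_measurable_prod (f : mT * pt -> K) :
  continuous (f : K * pt -> K) -> measurable_fun setT f.
Proof.
move=> cf.
pose F n (p : mT * pt) := f (node n (grid n p.1), \row_i node n (grid n (p.2 0 i))).
apply: (@measurable_fun_cvg _ _ _ setT F).
  move=> n _ Y mY; rewrite setTI.
  (* The sampled function takes countably many values, one per grid cell; its preimages are unions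
     of the cells whose node is mapped into [Y]. *)
  pose ptk (k : int * {ffun 'I_d -> int}) : mT * pt := (node n k.1, \row_i node n (k.2 i)).
  pose A (k : int * {ffun 'I_d -> int}) : set (mT * pt) :=
    [set p : mT * pt | Y (f (ptk k))] `&` ([set p : mT * pt | grid n p.1 = k.1] `&`
      \bigcap_(i : 'I_d) [set p : mT * pt | grid n (p.2 0 i) = k.2 i]).
  rewrite (_ : F n @^-1` Y = \bigcup_k A k); last first.
    apply/seteqP; split => [p /= hY|p [k _ [/= hY [h1 h2]]]].
      exists (grid n p.1, [ffun i => grid n (p.2 0 i)]) => //; split.
        rewrite /= /ptk/=; move: hY; rewrite /F; congr (Y (f (_, _))).
        by apply/rowP => i; rewrite !mxE ffunE.
      by split => // i _ /=; rewrite ffunE.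
    move: hY; rewrite /= /F /ptk h1; congr (Y (f (_, _))).
    by apply/rowP => i; rewrite !mxE (h2 i).
  apply: countable_bigcupT_measurable => // k; apply: measurableI.
    have [h|h] := pselect (Y (f (ptk k))).
      by rewrite (_ : [set _ : mT * pt | _] = setT)//; apply/seteqP; split.
    by rewrite (_ : [set _ : mT * pt | _] = set0)//; apply/seteqP; split.
  apply: measurableI; first exact: (meas_grid _ _ measurable_fst).
  apply: fin_bigcap_measurable => [|i _]; first exact: finite_finset.
  apply: (@meas_grid n (k.2 i) _ _ (fun p : mT * pt => p.2 0 i)).
  exact: (measurableT_comp (measurable_coord i) measurable_snd).
move=> [t x] _; rewrite /F/=.
have c1 : node n (grid n t) @[n --> \oo] --> (t : K) by exact: node_cvg.
have c2 : (\row_i node n (grid n (x 0 i))) @[n --> \oo] --> (x : pt).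
  apply/cvg_ballP => e e0; near=> n; split => // i j.
  rewrite mxE ord1; apply: le_lt_trans (node_dist n _) _.
  by near: n; exact: (near_infty_natSinv_lt (PosNum e0)).
apply: (@cvg_comp _ _ _ (fun n => (node n (grid n t) : K, \row_i node n (grid n (x 0 i)) : pt)) f
  \oo (nbhs ((t, x) : K * pt)) (nbhs (f (t, x)))); first exact: (cvg_pair c1 c2).
exact: cf.
Unshelve. all: by end_near. Qed.

End continuous_measurable.

(** * The strong solution *)

Section slicewise.
Variables (K : realType) (d : nat) (T : K).
Local Notation pt := 'rV[K]_d.
Local Notation mT := (measurableTypeR K).
Local Notation tm := (time T).
Local Notation P := (@torus K d).
Local Notation ST := (tm \x P)%E.
Local Notation bst := (essbdd ST).
Implicit Types (f g : mT * pt -> K) (j : 'I_d).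

(** The weak derivative in space at almost every time; it is what [wderiv_space] delivers and where
    the torus calculus applies. *)
Definition stwd j f g : Prop := {ae tm, forall t : mT, twd j (slice f t) (slice g t)}.

Lemma stwd_ae j f g f' g' : stwd j f g -> measurable_fun setT f' -> measurable_fun setT g' ->
  {ae ST, forall p, f p = f' p} -> {ae ST, forall p, g p = g' p} -> stwd j f' g'.
Proof.
move=> h mf mg hf hg; rewrite /stwd.
apply: filterS3 h (ae_slice1 hf) (ae_slice1 hg) => t ht ft gt.
by apply: twd_ae ht _ _ ft gt; exact: meas_slice1.
Qed.

Lemma stwd_uniq j f g g' : stwd j f g -> stwd j f g' -> measurable_fun setT g ->
  measurable_fun setT g' -> {ae ST, forall p, g p = g' p}.
Proof.
move=> h h' mg mg'; apply: ae_eq_prod1 => //.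
by apply: filterS2 h h' => t ht ht'; exact: twd_uniq ht ht'.
Qed.

Lemma stwdM j f f' g g' : stwd j f f' -> stwd j g g' -> bst g -> bst g' ->
  stwd j (fun p => f p * g p) (fun p => f' p * g p + f p * g' p).
Proof.
move=> hf hg bg bg'; rewrite /stwd.
by apply: filterS3 hf hg (filterI (bst_bdd bg) (bst_bdd bg')) => t ? ? [? ?]; exact: twdM.
Qed.

Lemma stwdB j f f' g g' : stwd j f f' -> stwd j g g' ->
  stwd j (fun p => f p - g p) (fun p => f' p - g' p).
Proof. by move=> hf hg; rewrite /stwd; apply: filterS2 hf hg => t; exact: twdB. Qed.

Lemma stwdD j f f' g g' : stwd j f f' -> stwd j g g' ->
  stwd j (fun p => f p + g p) (fun p => f' p + g' p).
Proof. by move=> hf hg; rewrite /stwd; apply: filterS2 hf hg => t; exact: twdD. Qed.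

Lemma stwdZ j (c : K) f f' : stwd j f f' -> stwd j (fun p => c * f p) (fun p => c * f' p).
Proof. by move=> hf; rewrite /stwd; apply: filterS hf => t; exact: twdZ. Qed.

Lemma stwd_exp j f f' : stwd j f f' -> bst f -> bst f' ->
  stwd j (fun p => expR (f p)) (fun p => expR (f p) * f' p).
Proof.
move=> hf bf bf'; rewrite /stwd.
by apply: filterS3 hf (bst_bdd bf) (bst_bdd bf') => t; exact: twd_exp.
Qed.

Lemma wD_stwd j f : wderivable T (Some j) f -> stwd j f (wD T (Some j) f).
Proof. by move=> /wDP /wderiv_space. Qed.

Lemma wD_L1 k f : wderivable T k f -> L1 ST (wD T k f).
Proof. by move=> /wDP[]. Qed.

(** The integrals against a test agree as soon as the test and its derivative are measurable, which
    [continuous_measurable_prod] provides. *)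
Lemma is_wderiv_ae k f f' g g' : is_wderiv T k f g ->
  measurable_fun setT f' -> measurable_fun setT g' ->
  {ae ST, forall p, f p = f' p} -> {ae ST, forall p, g p = g' p} -> is_wderiv T k f' g'.
Proof.
move=> [lf lg h] mf' mg' ff' gg'; have {}lf : L1 ST f := lf; have {}lg : L1 ST g := lg.
split; [exact: L1_ae mf' ff' lf|exact: L1_ae mg' gg' lg|move=> phi hphi].
have [[sphi _ _] _] := hphi.
have mphi : measurable_fun setT (phi : mT * pt -> K).
  by apply: continuous_measurable_prod; exact: (sphi [::]).1.
have mdphi : measurable_fun setT (pd k phi : mT * pt -> K).
  by apply: continuous_measurable_prod; exact: (sphi [:: k]).1.
have e1 : \int[ST]_p (f' p * pd k phi p) = \int[ST]_p (f p * pd k phi p).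
  apply: R_ae; [exact: measurable_funM|exact: measurable_funM (L1_meas lf) mdphi|].
  by apply: filterS ff' => p ->.
have e2 : \int[ST]_p (g' p * phi p) = \int[ST]_p (g p * phi p).
  apply: R_ae; [exact: measurable_funM|exact: measurable_funM (L1_meas lg) mphi|].
  by apply: filterS gg' => p ->.
exact: (etrans e1 (etrans (h phi hphi) (congr1 -%R (esym e2)))).
Qed.

End slicewise.

Lemma row_equation (K : realType) d (x y z s t : K) (A u B C D F : 'rV[K]_d) (G : 'M[K]_d) i
    (a b dd ff : K) (u' g' : 'I_d -> K) :
  A 0 i = a -> B 0 i = b -> (forall j, u 0 j = u' j) -> (forall j, G i j = g' j) ->
  D 0 i = dd -> F 0 i = ff ->
  x *: (A + u *m G^T) + y *: B + z *: C = s *: D + t *: F ->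
  x * (a + \sum_j u' j * g' j) + y * b + z * C 0 i = s * dd + t * ff.
Proof.
move=> <- <- hu hg <- <- /rowP /(_ i); rewrite !mxE => <-; congr (_ * (_ + _) + _ + _).
by apply: eq_bigr => j _; rewrite mxE hu hg.
Qed.

(** Every term carries a factor R once div(R G) is expanded and the gradient of R is written as R
    times that of log R; dividing by R > 0 solves for the time derivative. *)
Lemma solve_W_rate (K : realType) d (hn nu la mu R w wt v0 : K) (u dw dv v ddw ddv : 'I_d -> K) :
  0 < R ->
  R * (wt + \sum_j u j * dw j) + la * (R * v0) + mu * R * w =
    hn / 2 * (\sum_j R * (v j * dv j + ddv j)) + nu / 2 * (\sum_j R * (v j * dw j + ddw j)) ->
  wt = \sum_j (- (u j * dw j) + hn / 2 * (v j * dv j + ddv j) + nu / 2 * (v j * dw j + ddw j))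
    - la * v0 - mu * w.
Proof.
move=> R0; rewrite -!big_distrr/= => e; apply: (mulfI (lt0r_neq0 R0)).
rewrite [X in R * (X - _ - _)]big_split/= [X in R * (X + _ - _ - _)]big_split/= sumrN -!big_distrr/=.
move: e; set A := \sum_j u j * _; set B := \sum_j (v j * dv j + _); set C := \sum_j (v j * dw j + _).
move=> e; have -> : R * wt = R * (wt + A) + la * (R * v0) + mu * R * w
  - R * A - la * (R * v0) - mu * R * w by ring.
by rewrite e; ring.
Qed.

Lemma solve_V_rate (K : realType) d (hn R wt : K) (u dv v du ddu : 'I_d -> K) :
  0 < R ->
  R * (wt + \sum_j u j * dv j) + hn / 2 * (\sum_j R * (v j * du j + ddu j)) = 0 ->
  wt = \sum_j (- (u j * dv j) - hn / 2 * (v j * du j + ddu j)).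
Proof.
move=> R0; rewrite -!big_distrr/= => e; apply: (mulfI (lt0r_neq0 R0)).
rewrite sumrB sumrN -!big_distrr/=.
move: e; set A := \sum_j u j * _; set B := \sum_j (v j * du j + _).
move=> e; have -> : R * wt = R * (wt + A) + hn / 2 * (R * B) - R * A - hn / 2 * (R * B) by ring.
by rewrite e; ring.
Qed.

Section strong_facts.
Variables (K : realType) (d : nat) (T lambda mu nu hbar : K).
Hypothesis T0 : 0 < T.
Local Notation pt := 'rV[K]_d.
Local Notation mT := (measurableTypeR K).
Local Notation tm := (time T).
Local Notation P := (@torus K d).
Local Notation ST := (tm \x P)%E.
Local Notation bst := (essbdd ST).
Local Notation la := (lambda' lambda mu nu).
Local Notation hn := (hbar_nu nu hbar).
Local Notation kap := (nu / hn).
Variables (R0 : pt -> K) (W0 : pt -> 'rV[K]_d) (R : mT * pt -> K) (W Vb : mT * pt -> 'rV[K]_d).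
Hypothesis ss : strong_solution T lambda mu nu hbar R0 W0 R W Vb.
Hypotheses (hn_gt0 : 0 < hn) (d_gt0 : (0 < d)%N).

Let hn0 : hn != 0. Proof. by rewrite gt_eqF. Qed.


Definition DW i j : mT * pt -> K := wD T (Some j) (Defs.comp W i).
Definition DVb i j : mT * pt -> K := wD T (Some j) (Defs.comp Vb i).
Definition DDW i j k : mT * pt -> K := wD T (Some k) (DW i j).
Definition DDVb i j k : mT * pt -> K := wD T (Some k) (DVb i j).
Definition Wt i : mT * pt -> K := wD T None (Defs.comp W i).
Definition Vbt i : mT * pt -> K := wD T None (Defs.comp Vb i).
Definition L (p : mT * pt) : K := ln (R p).
Definition Lt : mT * pt -> K := wD T None (H'R R).

Lemma bstW i : bst (Defs.comp W i).
Proof. by have [[h _] _ _] := strong_W_reg ss i; exact: LpLq_oo_oo h. Qed.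

Lemma bstVb i : bst (Defs.comp Vb i).
Proof. by have [[h _] _ _] := strong_Vb_reg ss i; exact: LpLq_oo_oo h. Qed.

Lemma bstDW i j : bst (DW i j) /\ stwd T j (Defs.comp W i) (DW i j).
Proof.
have [[_ /(_ j)[h1 [h2 _]]] _ _] := strong_W_reg ss i.
by split; [exact: LpLq_oo_oo h2|exact: wD_stwd].
Qed.

Lemma bstDVb i j : bst (DVb i j) /\ stwd T j (Defs.comp Vb i) (DVb i j).
Proof.
have [[_ /(_ j)[h1 [h2 _]]] _ _] := strong_Vb_reg ss i.
by split; [exact: LpLq_oo_oo h2|exact: wD_stwd].
Qed.

Lemma bstDDW i j k : bst (DDW i j k) /\ stwd T k (DW i j) (DDW i j k).
Proof.
have [[_ /(_ j)[_ [_ /(_ k)[h1 [h2 _]]]]] _ _] := strong_W_reg ss i.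
by split; [exact: LpLq_oo_oo h2|exact: wD_stwd].
Qed.

Lemma bstDDVb i j k : bst (DDVb i j k) /\ stwd T k (DVb i j) (DDVb i j k).
Proof.
have [[_ /(_ j)[_ [_ /(_ k)[h1 [h2 _]]]]] _ _] := strong_Vb_reg ss i.
by split; [exact: LpLq_oo_oo h2|exact: wD_stwd].
Qed.

Lemma bstWt i : bst (Wt i).
Proof. by have [_ _ h] := strong_W_reg ss i; exact: LpLq_oo_oo h. Qed.

Lemma bstVbt i : bst (Vbt i).
Proof. by have [_ _ h] := strong_Vb_reg ss i; exact: LpLq_oo_oo h. Qed.

Lemma R_bounds : exists2 c : K, 0 < c & exists M : K, {ae ST, forall p : mT * pt, c <= R p <= M}.
Proof.
have /ereal_sup_gt[y hy y0] := strong_R_inf ss.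
have /ereal_inf_lt[z hz zoo] := strong_R_sup ss.
have hy' : {ae ST, forall p : mT * pt, (y <= (R p)%:E)%E} := hy.
have hz' : {ae ST, forall p : mT * pt, ((R p)%:E <= z)%E} := hz.
(* The default 1 serves only [y = +oo], for which the bound on [R p] is contradictory. *)
exists (if y is y'%:E then y' else 1); first by case: y y0 {hy hy'}.
exists (fine z); apply: filterS2 hy' hz' => p.
case: y y0 {hy} => [y| |]//= _; case: z zoo {hz} => [z| |]//= _; rewrite ?lee_fin.
by move=> -> ->.
Qed.

Lemma meas_R : measurable_fun setT (R : mT * pt -> K).
Proof. by have [g [lR _ _]] := strong_dtR ss; exact: (L1_meas lR). Qed.

Lemma meas_L : measurable_fun setT (L : mT * pt -> K).
Proof. by apply: measurableT_comp; [exact: measurable_ln|exact: meas_R]. Qed.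

Lemma R_gt0 : {ae ST, forall p : mT * pt, 0 < R p}.
Proof.
have [c c0 [M h]] := R_bounds.
by apply: filterS h => p /andP[h _]; exact: lt_le_trans h.
Qed.

Lemma R_exp : {ae ST, forall p : mT * pt, expR (L p) = R p}.
Proof. by apply: filterS R_gt0 => p p0; rewrite lnK// posrE. Qed.

Lemma bstL : bst (L : mT * pt -> K).
Proof.
have [c c0 [M h]] := R_bounds; split; first exact: meas_L.
exists (`|ln c| + `|ln M|); apply: filterS h => p /andP[h1 h2].
have Rp : 0 < R p by exact: lt_le_trans h1.
have l1 : ln c <= L p by rewrite ler_ln// posrE.
have l2 : L p <= ln M by rewrite ler_ln// posrE (lt_le_trans Rp h2).
rewrite ler_norml; apply/andP; split.
  by have := ler_norm (- ln c); rewrite normrN; have := normr_ge0 (ln M); lra.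
by have := ler_norm (ln M); have := normr_ge0 (ln c); lra.
Qed.

Lemma bstR : bst (R : mT * pt -> K).
Proof.
have [c c0 [M h]] := R_bounds; split; first exact: meas_R.
exists M; apply: filterS h => p /andP[h1 h2]; rewrite ger0_norm//.
by apply: le_trans h1; exact: ltW.
Qed.

Lemma H'R_L : {ae ST, forall p : mT * pt, H'R R p = L p}.
Proof. by apply: filterS R_gt0 => p p0; rewrite /H'R derive_H. Qed.

Let V j (p : mT * pt) := 2 / hn * Vb p 0 j.
Let U i (p : mT * pt) := W p 0 i - kap * Vb p 0 i.
Let DU i j (p : mT * pt) := DW i j p - kap * DVb i j p.
Let DDU i j k (p : mT * pt) := DDW i j k p - kap * DDVb i j k p.

Lemma bstV j : bst (V j).
Proof. by apply: bddZ; exact: bstVb. Qed.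

Lemma V_E : {ae ST, forall (p : mT * pt) j, wD T (Some j) L p = V j p}.
Proof.
have hV : {ae ST, forall p : mT * pt, Vb p = (hn / 2) *: Defs.V T R p} := strong_Vb ss.
apply: filterS hV => p h j.
rewrite /V h !mxE mulrA (_ : 2 / hn * (hn / 2) = 1) ?mul1r//.
by field.
Qed.

(** The regularity is given for H'(R), which equals log R almost everywhere because R > 0; the
    relation between Vb and the gradient of log R then identifies the derivative. *)
Lemma stwd_L j : stwd T j L (V j).
Proof.
have [h _] := strong_H'R_reg ss (Some j).
have hw := is_wderiv_ae (wDP h) meas_L (L1_meas (wD_L1 h)) H'R_L (aeW _ (fun p => erefl)).
have hL : wderivable T (Some j) L by exists (wD T (Some j) (H'R R)).
apply: stwd_ae (wD_stwd hL) meas_L (bstV j).1 (aeW _ (fun p => erefl)) _.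
by apply: filterS V_E => p.
Qed.

Lemma stwd_R j : stwd T j R (fun p => R p * V j p).
Proof.
have mRV : measurable_fun setT (fun p => R p * V j p).
  exact: measurable_funM meas_R (bstV j).1.
apply: (stwd_ae (stwd_exp (stwd_L j) bstL (bstV j)) meas_R mRV R_exp).
by apply: filterS R_exp => p ->.
Qed.

(** The product rule with grad R = R V, the latter coming from R = exp(L); uniqueness transfers it
    to any function equal to R G almost everywhere. *)
Lemma wD_RM j (G G' X : mT * pt -> K) : stwd T j G G' -> bst G -> bst G' ->
  wderivable T (Some j) X -> {ae ST, forall p : mT * pt, X p = R p * G p} ->
  {ae ST, forall p : mT * pt, wD T (Some j) X p = R p * (V j p * G p + G' p)}.
Proof.
move=> hG bG bG' hX XG; have [lX lX' _] := wDP hX.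
have mRG : measurable_fun setT (fun p => R p * G p) by apply: measurable_funM; [exact: meas_R|exact: bG.1].
have h1 : stwd T j (fun p => R p * G p) (wD T (Some j) X).
  exact: (stwd_ae (wD_stwd hX) mRG (L1_meas lX') XG (aeW _ (fun p => erefl))).
have h2 := stwdM (stwd_R j) hG bG bG'.
have m2 : measurable_fun setT (fun p => R p * V j p * G p + R p * G' p).
  have mV := (bstV j).1; have mR := meas_R; have mG := bG.1; have mG' := bG'.1.
  apply: measurable_funD; last exact: measurable_funM.
  by apply: measurable_funM => //; exact: measurable_funM.
by apply: filterS (stwd_uniq h1 h2 (L1_meas lX') m2) => p ->; ring.
Qed.

Lemma wD_R j : {ae ST, forall p : mT * pt, wD T (Some j) R p = R p * V j p}.
Proof.
have [h _ _] := strong_gradR ss j.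
apply: (stwd_uniq (wD_stwd h) (stwd_R j)); first exact: L1_meas (wD_L1 h).
exact: measurable_funM meas_R (bstV j).1.
Qed.

Lemma U_E : {ae ST, forall (p : mT * pt) i, Defs.U T nu R W p 0 i = U i p}.
Proof.
apply: filterS V_E => p h i; rewrite /Defs.U /U !mxE -/L (h i) /V.
by field.
Qed.

Lemma bstU i : bst (U i).
Proof. exact: (bddB (bstW i) (bddZ kap (bstVb i))). Qed.

Lemma bstDU i j : bst (DU i j) /\ stwd T j (U i) (DU i j).
Proof.
have [b1 h1] := bstDW i j; have [b2 h2] := bstDVb i j.
by split; [exact: (bddB b1 (bddZ kap b2))|exact: (stwdB h1 (stwdZ kap h2))].
Qed.

Lemma bstDDU i j k : bst (DDU i j k) /\ stwd T k (DU i j) (DDU i j k).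
Proof.
have [b1 h1] := bstDDW i j k; have [b2 h2] := bstDDVb i j k.
by split; [exact: (bddB b1 (bddZ kap b2))|exact: (stwdB h1 (stwdZ kap h2))].
Qed.

Lemma gradU_E : {ae ST, forall (p : mT * pt) i j, wD T (Some j) (Defs.comp (Defs.U T nu R W) i) p = DU i j p}.
Proof.
apply: ae_foralli => i; apply: ae_foralli => j.
have h := strong_diff2 ss j i; have [b1 h1] := bstDU i j.
have UE : {ae ST, forall p : mT * pt, Defs.comp (Defs.U T nu R W) i p = U i p}.
  by apply: filterS U_E => p h'; exact: h'.
have h2 := stwd_ae (wD_stwd h) (bstU i).1 (L1_meas (wD_L1 h)) UE (aeW _ (fun p => erefl)).
exact: (stwd_uniq h2 h1 (L1_meas (wD_L1 h)) b1.1).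
Qed.

(** The initial condition is imposed on R. The exponential rule carries it to log R, whose trace is
    therefore log R0, and also relates the two time derivatives. *)
Lemma strong_traces : exists L0 R00 : pt -> K,
  [/\ evolves T L L0 Lt, evolves T R R00 (wD T None R),
      {ae P, forall x, R00 x = expR (L0 x)} & {ae P, forall x, R00 x = R0 x}] /\
  {ae ST, forall p : mT * pt, wD T None R p = R p * Lt p}.
Proof.
have [h _] := strong_H'R_reg ss None.
have [L0 ev] := wderiv_time T0 (wDP h).
have {}ev := evolves_ae ev meas_L H'R_L.
have [R00 ev'] := wderiv_time T0 (wDP (strong_dtR ss)).
have RL : {ae ST, forall p : mT * pt, R p = expR (L p)} by apply: filterS R_exp => p ->.
have [h1 h2] := evolves_exp T0 ev ev' RL.
have h3 := evolves_trace T0 ev' (strong_R0_int ss) (strong_init_R ss).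
by exists L0, R00; split; [split; [exact: ev|exact: ev'|exact: h1|exact: h3]|exact: h2].
Qed.

(** The continuity equation divided by R: its time part becomes the time derivative of log R by
    [strong_traces], its divergence is expanded by [wD_RM]. *)
Lemma Lt_E : {ae ST, forall p : mT * pt, Lt p = - \sum_i (DU i i p + U i p * V i p)}.
Proof.
have [L0 [R00 [_ hR]]] := strong_traces.
have div : {ae ST, forall (p : mT * pt) j, wD T (Some j) (fun p => R p * Defs.U T nu R W p 0 j) p =
    R p * (V j p * U j p + DU j j p)}.
  apply: ae_foralli => j; have [b h] := bstDU j j.
  apply: (wD_RM h (bstU j) b (strong_diff1 ss j)).
  by apply: filterS U_E => p h'; rewrite h'.
have eqR : {ae ST, forall p : mT * pt,
    wD T None R p + divv (wD T) (fun q => R q *: Defs.U T nu R W q) p = 0} := strong_eq_R ss.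
apply: filterS3 (filterI R_gt0 hR) div eqR => p [p0 e1] e2.
rewrite e1 /divv.
have -> : \sum_j wD T (Some j) (Defs.comp (fun q => R q *: Defs.U T nu R W q) j) p =
    R p * \sum_j (DU j j p + U j p * V j p).
  rewrite big_distrr/=; apply: eq_bigr => j _.
  rewrite (_ : Defs.comp _ j = fun p => R p * Defs.U T nu R W p 0 j); last first.
    by apply/funext => q; rewrite /Defs.comp mxE.
  by rewrite e2; ring.
rewrite -mulrDr => /eqP; rewrite mulf_eq0 gt_eqF//= addr_eq0 => /eqP.
by [].
Qed.

Lemma Wt_E : {ae ST, forall (p : mT * pt) i, Wt i p =
  \sum_j (- (U j p * DW i j p) + hn / 2 * (V j p * DVb i j p + DDVb i j j p)
    + nu / 2 * (V j p * DW i j p + DDW i j j p)) - la * V i p - mu * W p 0 i}.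
Proof.
apply: ae_foralli => i.
have d1 : {ae ST, forall (p : mT * pt) j, wD T (Some j) (fun p => R p * gradv (wD T) Vb p i j) p =
    R p * (V j p * DVb i j p + DDVb i j j p)}.
  apply: ae_foralli => j; have [b h] := bstDDVb i j j; have [h1 _ _] := strong_diff3 ss i j.
  apply: (wD_RM h (bstDVb i j).1 b h1).
  by apply: aeW => p; rewrite mxE.
have d2 : {ae ST, forall (p : mT * pt) j, wD T (Some j) (fun p => R p * gradv (wD T) W p i j) p =
    R p * (V j p * DW i j p + DDW i j j p)}.
  apply: ae_foralli => j; have [b h] := bstDDW i j j; have [_ h1 _] := strong_diff3 ss i j.
  apply: (wD_RM h (bstDW i j).1 b h1).
  by apply: aeW => p; rewrite mxE.
have eqW : {ae ST, forall p : mT * pt,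
    R p *: (dtv (wD T) W p + Defs.U T nu R W p *m (gradv (wD T) W p)^T)
    + la *: grad (wD T) R p + (mu * R p) *: W p
    = (hn / 2) *: divm (wD T) (fun q => R q *: gradv (wD T) Vb q) p
      + (nu / 2) *: divm (wD T) (fun q => R q *: gradv (wD T) W q) p} := strong_eq_W ss.
have gW (p : mT * pt) j : gradv (wD T) W p i j = DW i j p by rewrite mxE.
have dVb (p : mT * pt) : divm (wD T) (fun q => R q *: gradv (wD T) Vb q) p 0 i =
    \sum_j wD T (Some j) (fun q => R q * gradv (wD T) Vb q i j) p.
  rewrite mxE; apply: eq_bigr => j _; congr (wD T (Some j) _ p).
  by apply/funext => q; rewrite [LHS]mxE.
have dW (p : mT * pt) : divm (wD T) (fun q => R q *: gradv (wD T) W q) p 0 i =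
    \sum_j wD T (Some j) (fun q => R q * gradv (wD T) W q i j) p.
  rewrite mxE; apply: eq_bigr => j _; congr (wD T (Some j) _ p).
  by apply/funext => q; rewrite [LHS]mxE.
have tW (p : mT * pt) : dtv (wD T) W p 0 i = Wt i p by rewrite mxE.
have rW (p : mT * pt) : grad (wD T) R p 0 i = wD T (Some i) R p by rewrite mxE.
apply: filterS3 (filterI R_gt0 (filterI U_E (wD_R i))) (filterI d1 d2) eqW.
move=> p [p0 [uE rE]] [e1 e2] eq0.
exact: (solve_W_rate p0 (row_equation (tW p) (etrans (rW p) rE) uE (gW p)
  (etrans (dVb p) (eq_bigr _ (fun j _ => e1 j))) (etrans (dW p) (eq_bigr _ (fun j _ => e2 j))) eq0)).
Qed.

Lemma Vbt_E : {ae ST, forall (p : mT * pt) i, Vbt i p =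
  \sum_j (- (U j p * DVb i j p) - hn / 2 * (V j p * DU j i p + DDU j i j p))}.
Proof.
apply: ae_foralli => i.
have d1 : {ae ST, forall (p : mT * pt) j,
    wD T (Some j) (fun p => R p * gradv (wD T) (Defs.U T nu R W) p j i) p =
    R p * (V j p * DU j i p + DDU j i j p)}.
  apply: ae_foralli => j; have [b h] := bstDDU j i j; have [_ _ h1] := strong_diff3 ss i j.
  apply: (wD_RM h (bstDU j i).1 b h1).
  by apply: filterS gradU_E => p hp; rewrite -hp mxE.
have eqV : {ae ST, forall p : mT * pt,
    R p *: (dtv (wD T) Vb p + Defs.U T nu R W p *m (gradv (wD T) Vb p)^T)
    + (hn / 2) *: divm (wD T) (fun q => R q *: (gradv (wD T) (Defs.U T nu R W) q)^T) p = 0}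
  := strong_eq_Vb ss.
have gV (p : mT * pt) j : gradv (wD T) Vb p i j = DVb i j p by rewrite mxE.
have dU (p : mT * pt) : divm (wD T) (fun q => R q *: (gradv (wD T) (Defs.U T nu R W) q)^T) p 0 i =
    \sum_j wD T (Some j) (fun q => R q * gradv (wD T) (Defs.U T nu R W) q j i) p.
  rewrite mxE; apply: eq_bigr => j _; congr (wD T (Some j) _ p).
  by apply/funext => q; rewrite [LHS]mxE [X in _ * X]mxE.
have tV (p : mT * pt) : dtv (wD T) Vb p 0 i = Vbt i p by rewrite mxE.
apply: filterS3 (filterI R_gt0 U_E) d1 eqV => p [p0 uE] e1 h.
(* The equation is padded with zero terms to match the shape expected by [row_equation]. *)
pose Z : 'rV[K]_d := 0; have Z0 : Z 0 i = 0 by rewrite mxE.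
have h' : R p *: (dtv (wD T) Vb p + Defs.U T nu R W p *m (gradv (wD T) Vb p)^T)
    + (hn / 2) *: divm (wD T) (fun q => R q *: (gradv (wD T) (Defs.U T nu R W) q)^T) p
    + 0 *: Z = 0 *: Z + 0 *: Z by rewrite !scale0r !addr0.
have := row_equation (tV p) (etrans (dU p) (eq_bigr _ (fun j _ => e1 j))) uE (gV p) Z0 Z0 h'.
by rewrite !mul0r !addr0; exact: solve_V_rate.
Qed.

Lemma evolvesW i : exists w : pt -> K, evolves T (Defs.comp W i) w (Wt i) /\
  {ae P, forall x, w x = W0 x 0 i}.
Proof.
have [_ h _] := strong_W_reg ss i; have [w ev] := wderiv_time T0 (wDP h).
exists w; split; first exact: ev.
exact: (evolves_trace T0 ev (strong_W0_int ss i) (strong_init_W ss i)).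
Qed.

Lemma evolvesVb i : exists w : pt -> K, evolves T (Defs.comp Vb i) w (Vbt i) /\
  {ae P, forall x, w x = Vb0 nu hbar R0 x 0 i}.
Proof.
have [_ h _] := strong_Vb_reg ss i; have [w ev] := wderiv_time T0 (wDP h).
exists w; split; first exact: ev.
apply: (evolves_trace T0 ev _ (strong_init_Vb ss i)).
have [g hg] := strong_lnR0_diff ss i.
have [_ lg _] := xgetPex (fun=> 0) (ex_intro _ g hg : exists g, [set g | is_sderiv i _ g] g).
by apply: eq_L1 (L1Z (hn / 2) lg) => x; rewrite /Vb0 !mxE.
Qed.

(** The assumed regularity gives this derivative only in L^1(L^infinity); boundedness comes from the
    continuity equation, whose other terms are bounded. *)
Lemma bstLt : bst Lt.
Proof.
have [h _] := strong_H'R_reg ss None.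
have b : bst (fun p => - (\sum_i (DU i i p + U i p * V i p))).
  rewrite (_ : (fun _ => _) = fun p => -1 * \sum_i (DU i i p + U i p * V i p)); last first.
    by apply/funext => p; rewrite mulN1r.
  apply: bddZ; apply: bdd_sum => i.
  exact: (bddD (bstDU i i).1 (bddM (bstU i) (bstV i))).
apply: (bdd_ae (L1_meas (wD_L1 h)) _ b).
by apply: filterS Lt_E => p e; exact: (esym e).
Qed.

(** Divergences have zero integral on the torus, so integrating the continuity equation leaves a
    primitive of zero. *)
Lemma mass_R (R00 : pt -> K) : evolves T R R00 (wD T None R) ->
  {ae tm, forall t : mT, \int[P]_x R (t, x) = \int[P]_x R00 x}.
Proof.
move=> ev.
have b1 : essbdd P (fun=> 1 : K) by exact: bdd_cst.
have lU j : L1 ST (wD T (Some j) (fun p => R p * Defs.U T nu R W p 0 j)) := wD_L1 (strong_diff1 ss j).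
have z : {ae tm, forall s : mT, \int[P]_x (wD T None R (s, x) * 1) = 0}.
  have hj : {ae tm, forall (s : mT) j, L1 P (fun x => wD T (Some j) (fun p => R p * Defs.U T nu R W p 0 j) (s, x)) /\
      \int[P]_x (wD T (Some j) (fun p => R p * Defs.U T nu R W p 0 j) (s, x)) = 0}.
    apply: ae_foralli => j; apply: filterS (wD_stwd (strong_diff1 ss j)) => s h.
    by split; [have [_ l _] := h|exact: twd_int0 h].
  have eqR : {ae ST, forall p : mT * pt,
    wD T None R p + divv (wD T) (fun q => R q *: Defs.U T nu R W q) p = 0} := strong_eq_R ss.
  have lt := L1_slice1 (wD_L1 (strong_dtR ss)).
  apply: filterS3 hj (ae_slice1 eqR) lt => s hs es ls.
  have l2 : L1 P (fun x => \sum_j wD T (Some j) (fun p => R p * Defs.U T nu R W p 0 j) (s, x)).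
    by apply: L1_sum => j _; exact: (hs j).1.
  transitivity (\int[P]_x - (\sum_j wD T (Some j) (fun p => R p * Defs.U T nu R W p 0 j) (s, x))).
    apply: R_ae; [exact: L1_meas (L1_mul_bdd ls b1)|exact: L1_meas (L1N l2)|].
    apply: filterS es => x /eqP; rewrite mulr1 addr_eq0 => /eqP ->; congr (- _).
    apply: eq_bigr => j _; congr (wD T (Some j) _ _); apply/funext => q.
    by rewrite /Defs.comp mxE.
  rewrite RN// Rsum; last by move=> j _; exact: (hs j).1.
  by rewrite big1 ?oppr0// => j _; exact: (hs j).2.
have [_ _ lh _] := ev.
apply: filterS (evolves_moment ev b1) => t.
under eqR do rewrite mulr1; under [X in _ = X + _]eqR do rewrite mulr1.
move=> ->; rewrite (@eq_prim_ae _ _ _ (fun=> 0) t _ _ z).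
- rewrite (_ : (fun=> 0) = (fun s : mT => 0 * 0 : K)); last by apply/funext => s; rewrite mulr0.
  by rewrite primZ ?mul0r ?addr0//; exact: L1_tcst.
- exact: L1_meas (L1_int1 (L1_st_space lh b1)).
- exact: measurable_cst.
Qed.

End strong_facts.

(** * The relative entropy inequality *)

Lemma ae_and d (X : measurableType d) (K : realType) (mu : {measure set X -> \bar K})
    (A B : X -> Prop) : {ae mu, forall x, A x} -> {ae mu, forall x, B x} ->
  {ae mu, forall x, A x /\ B x}.
Proof. exact: filterI. Qed.

Section relative_balance.
Variables (K : realType) (d : nat) (T : K).
Hypothesis T0 : 0 < T.
Local Notation pt := 'rV[K]_d.
Local Notation mT := (measurableTypeR K).
Local Notation tm := (time T).
Local Notation P := (@torus K d).
Local Notation ST := (tm \x P)%E.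
Local Notation bst := (essbdd ST).

Lemma stwd_sum (I : Type) (s : seq I) j (F G : I -> mT * pt -> K) :
  (forall a, stwd T j (F a) (G a)) ->
  stwd T j (fun p => \sum_(a <- s) F a p) (fun p => \sum_(a <- s) G a p).
Proof.
move=> h; elim: s => [|a s ih].
  apply: aeW => t.
  have h0 (a : 'I_0) : twd j (fun=> 0 : K) (fun=> 0 : K) by case: a.
  by apply: (twd_eq (twd_sum [::] h0)) => x; rewrite /slice !big_nil.
have := stwdD (h a) ih; apply: filterS => t ht.
by apply: (twd_eq ht) => x; rewrite /slice big_cons.
Qed.

Variables (hn nu la mu : K).
Hypotheses (hn_gt0 : 0 < hn) (nu0 : 0 <= nu) (la0 : 0 <= la).
Variables (r : mT * pt -> K) (dr a : 'I_d -> mT * pt -> K).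
Variables (Tw Tb Tu : 'I_d -> 'I_d -> mT * pt -> K).
Variables (r0 : pt -> K) (a0 b0 : 'I_d -> pt -> K).
Let b i p := hn * dr i p.
Let q i p := a i p - nu / hn * b i p.
Variables (L Lt : mT * pt -> K) (W Vb Wt Vbt : 'I_d -> mT * pt -> K).
Variables (DW DVb : 'I_d -> 'I_d -> mT * pt -> K).
Variables (L0 : pt -> K) (W0 V0 : 'I_d -> pt -> K).
Let V j p := 2 / hn * Vb j p.

Hypothesis cons_r : conservation T (fun p => r p ^+ 2) (fun j p => r p * q j p) (fun=> 0)
  (fun x => r0 x ^+ 2).
Hypothesis cons_a : forall i, conservation T (fun p => r p * a i p)
  (fun j p => a i p * q j p + la * r p ^+ 2 * (i == j)%:R
    - hn / 2 * (r p * Tb i j p) - nu / 2 * (r p * Tw i j p))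
  (fun p => - mu * (r p * a i p)) (fun x => r0 x * a0 i x).
Hypothesis cons_b : forall i, conservation T (fun p => r p * b i p)
  (fun j p => b i p * q j p + hn / 2 * (r p * Tu j i p)) (fun=> 0) (fun x => r0 x * b0 i x).
Hypotheses (evL : evolves T L L0 Lt) (evW : forall i, evolves T (W i) (W0 i) (Wt i))
  (evV : forall i, evolves T (Vb i) (V0 i) (Vbt i)).
Hypotheses (bL : bst L) (bLt : bst Lt) (bW : forall i, bst (W i)) (bWt : forall i, bst (Wt i))
  (bVb : forall i, bst (Vb i)) (bVbt : forall i, bst (Vbt i))
  (bDW : forall i j, bst (DW i j)) (bDVb : forall i j, bst (DVb i j)).
Hypotheses (dL : forall j, stwd T j L (V j)) (dW : forall i j, stwd T j (W i) (DW i j))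
  (dVb : forall i j, stwd T j (Vb i) (DVb i j)).

Local Notation sl f s := (fun i => slice (f i) s).
Local Notation sl2 f s := (fun i j => slice (f i j) s).
Local Notation sl3 f s := (fun i j k => slice (f i j k) s).

(** The signs are those of the expanded relative energy: the tests with W and Vb are subtracted, the
    test of the continuity equation is added. *)
Definition total_rate (p : mT * pt) : K :=
  mass_rate hn nu la (slice r p.1) (sl dr p.1) (sl a p.1) (slice Lt p.1)
    (sl W p.1) (sl Vb p.1) (sl Wt p.1) (sl Vbt p.1) (sl2 DW p.1) (sl2 DVb p.1) p.2
  - \sum_i momentum_rate hn nu la mu (slice r p.1) (sl dr p.1) (sl a p.1) (sl2 Tw p.1)
      (sl2 Tb p.1) (sl W p.1) (sl Wt p.1) (sl2 DW p.1) i p.2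
  - \sum_i drift_rate hn nu (slice r p.1) (sl dr p.1) (sl a p.1) (sl2 Tu p.1)
      (sl Vbt p.1) (sl2 DVb p.1) i p.2.

Definition total_dissipated (p : mT * pt) : K :=
  dissipated hn nu la mu (slice r p.1) (sl dr p.1) (sl a p.1) (sl2 Tw p.1) (sl2 Tb p.1)
    (sl W p.1) (sl2 DW p.1) (sl2 DVb p.1) p.2.

Let eta p := 2^-1 * (\sum_i W i p * W i p) + 2^-1 * (\sum_i Vb i p * Vb i p) + - la * L p.
Let eta0 x := 2^-1 * (\sum_i W0 i x * W0 i x) + 2^-1 * (\sum_i V0 i x * V0 i x) + - la * L0 x.
Let etat p := 2^-1 * (\sum_i (Wt i p * W i p + W i p * Wt i p))
  + 2^-1 * (\sum_i (Vbt i p * Vb i p + Vb i p * Vbt i p)) + - la * Lt p.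
Let deta j p := 2^-1 * (\sum_i (DW i j p * W i p + W i p * DW i j p))
  + 2^-1 * (\sum_i (DVb i j p * Vb i p + Vb i p * DVb i j p)) + - la * V j p.

Let eta_evolves : evolves T eta eta0 etat.
Proof.
apply: evolvesD; last exact: evolvesZ.
by apply: evolvesD; apply: evolvesZ; apply: evolves_sum => i; apply: evolvesM.
Qed.

Let eta_stwd j : stwd T j eta (deta j).
Proof.
apply: stwdD; last exact: stwdZ.
by apply: stwdD; apply: stwdZ; apply: stwd_sum => i; apply: stwdM.
Qed.

Let bV j : bst (V j). Proof. exact: bddZ. Qed.

Let beta : bst eta.
Proof. by apply: bddD; [apply: bddD; apply: bddZ; apply: bdd_sum => i; apply: bddM|exact: bddZ]. Qed.

Let betat : bst etat.
Proof.
by apply: bddD; [apply: bddD; apply: bddZ; apply: bdd_sum => i; apply: bddD; apply: bddM|exact: bddZ].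
Qed.

Let bdeta j : bst (deta j).
Proof.
by apply: bddD; [apply: bddD; apply: bddZ; apply: bdd_sum => i; apply: bddD; apply: bddM|exact: bddZ].
Qed.

Let Bm := balance_density (fun p => r p ^+ 2) (fun=> 0) (fun j p => r p * q j p) eta etat deta.
Let Ba i := balance_density (fun p => r p * a i p) (fun p => - mu * (r p * a i p))
  (fun j p => a i p * q j p + la * r p ^+ 2 * (i == j)%:R
    - hn / 2 * (r p * Tb i j p) - nu / 2 * (r p * Tw i j p)) (W i) (Wt i) (DW i).
Let Bb i := balance_density (fun p => r p * b i p) (fun=> 0)
  (fun j p => b i p * q j p + hn / 2 * (r p * Tu j i p)) (Vb i) (Vbt i) (DVb i).

Let half_sum (n : nat) (F G : 'I_n -> K) :
  2^-1 * (\sum_i (F i * G i + G i * F i)) = \sum_i G i * F i.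
Proof. by rewrite big_distrr; apply: eq_bigr => i _ /=; field. Qed.

Let total_rateE p : total_rate p = Bm p - \sum_i Ba i p - \sum_i Bb i p.
Proof.
case: p => s x; rewrite /total_rate; congr (_ - _ - _).
- rewrite /mass_rate /Bm /balance_density /etat /deta /= mul0r addr0 /slice; congr (_ + _).
    by rewrite !half_sum// big_split/= mulNr.
  apply: eq_bigr => j _; rewrite !half_sum// big_split/= mulNr; congr (_ * (_ + _ - _)).
- apply: eq_bigr => i _; rewrite /momentum_rate /Ba /balance_density /slice.
  by rewrite mulNr mulNr.
- by apply: eq_bigr => i _; rewrite /drift_rate /Bb /balance_density mul0r addr0.
Qed.

Let LBm : L1 ST Bm. Proof. exact (L1_balance_density cons_r beta betat bdeta). Qed.
Let LBa i : L1 ST (Ba i). Proof. exact (L1_balance_density (cons_a i) (bW i) (bWt i) (bDW i)). Qed.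
Let LBb i : L1 ST (Bb i). Proof. exact (L1_balance_density (cons_b i) (bVb i) (bVbt i) (bDVb i)). Qed.

Lemma L1_total_rate : L1 ST total_rate.
Proof.
apply: (eq_L1 (f := fun p => Bm p - \sum_i Ba i p - \sum_i Bb i p)) => [p|].
  by rewrite total_rateE.
by apply: L1B; [apply: L1B => //|]; apply: L1_sum.
Qed.

(** [balance] is applied to the continuity equation with [eta] and to each component of the other
    two with [W i] and [Vb i], then the results are added with the signs of [total_rate]. *)
Lemma relative_balance : {ae tm, forall t : mT,
  - (\sum_i \int[P]_x (r (t, x) * a i (t, x) * W i (t, x)))
  - (\sum_i \int[P]_x (r (t, x) * b i (t, x) * Vb i (t, x)))
  + \int[P]_x (r (t, x) ^+ 2 * eta (t, x)) =
  - (\sum_i \int[P]_x (r0 x * a0 i x * W0 i x)) - (\sum_i \int[P]_x (r0 x * b0 i x * V0 i x))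
  + \int[P]_x (r0 x ^+ 2 * eta0 x) + prim T (fun s => \int[P]_x total_rate (s, x)) t}.
Proof.
have hm := balance T0 cons_r eta_evolves beta betat bdeta eta_stwd.
have ha := ae_foralli (fun i => balance T0 (cons_a i) (evW i) (bW i) (bWt i) (bDW i) (dW i)).
have hb := ae_foralli (fun i => balance T0 (cons_b i) (evV i) (bVb i) (bVbt i) (bDVb i) (dVb i)).
have lm := L1_int1 LBm; have la' i := L1_int1 (LBa i); have lb i := L1_int1 (LBb i).
have lr := L1_int1 L1_total_rate.
have e t : prim T (fun s => \int[P]_x total_rate (s, x)) t =
    prim T (fun s => \int[P]_x Bm (s, x)) t - \sum_i prim T (fun s => \int[P]_x Ba i (s, x)) t
    - \sum_i prim T (fun s => \int[P]_x Bb i (s, x)) t.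
  have lsa : L1 tm (fun s => \sum_i \int[P]_x Ba i (s, x)) by exact: L1_sum.
  have lsb : L1 tm (fun s => \sum_i \int[P]_x Bb i (s, x)) by exact: L1_sum.
  have lma := L1B lm lsa.
  rewrite -!prim_sum// -primB// -primB//; apply: eq_prim_ae.
  - exact: L1_meas lr.
  - exact: L1_meas (L1B lma lsb).
  apply: filterS3 (L1_slice1 LBm) (ae_foralli (fun i => L1_slice1 (LBa i)))
    (ae_foralli (fun i => L1_slice1 (LBb i))) => s sm sa sb.
  rewrite -!Rsum// -RB//; last exact: L1_sum.
  rewrite -RB//; first by apply: eqR => x; exact: total_rateE.
  - by apply: L1B => //; exact: L1_sum.
  - exact: L1_sum.
apply: filterS3 hm ha hb => t h1 h2 h3; rewrite e h1.
rewrite (eq_bigr _ (fun i _ => h2 i)) (eq_bigr _ (fun i _ => h3 i)) !big_split/=.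
by rewrite -/Bm -/(Ba) -/(Bb); ring.
Qed.

Hypotheses (sq_r : sqint ST r) (sq_dr : forall i, sqint ST (dr i)) (sq_a : forall i, sqint ST (a i)).
Hypotheses (LTw : forall i j, L1 ST (fun p => r p * Tw i j p))
  (LTb : forall i j, L1 ST (fun p => r p * Tb i j p)).

Let sq_b i : sqint ST (b i). Proof. exact: L2Z. Qed.

Lemma L1_total_dissipated : L1 ST total_dissipated.
Proof.
apply: (eq_L1 (f := fun p => nu / 2 * (\sum_i \sum_j (- (2 * (r p * Tb i j p) * DVb i j p)
    + r p ^+ 2 * DVb i j p ^+ 2 - 2 * (r p * Tw i j p) * DW i j p + r p ^+ 2 * DW i j p ^+ 2))
    - 2 * nu * la / hn ^+ 2 * (\sum_i b i p ^+ 2)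
    + mu * (\sum_i (- (2 * (r p * a i p) * W i p) + r p ^+ 2 * W i p ^+ 2)))) => [[s x]|] //.
have [_ lr2] := sq_r.
apply: L1D; [apply: L1B|]; apply: L1Z; apply: L1_sum => i _.
- apply: L1_sum => j _; apply: L1D; first apply: L1B; first apply: L1D.
  + by apply: L1N; apply: L1_mul_bdd => //; exact: L1Z.
  + by apply: L1_mul_bdd => //; apply: bddM.
  + by apply: L1_mul_bdd => //; exact: L1Z.
  + by apply: L1_mul_bdd => //; apply: bddM.
- by have [] := sq_b i.
- apply: L1D; first by apply: L1N; apply: L1_mul_bdd => //; apply: L1Z; exact: L2_mul.
  by apply: L1_mul_bdd => //; apply: bddM.
Qed.

Variables (DDW DDVb : 'I_d -> 'I_d -> 'I_d -> mT * pt -> K).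
Let U i p := W i p - nu / hn * Vb i p.
Let DU i j p := DW i j p - nu / hn * DVb i j p.
Let DDU i j k p := DDW i j k p - nu / hn * DDVb i j k p.
Hypotheses (bDDW : forall i j k, bst (DDW i j k)) (bDDVb : forall i j k, bst (DDVb i j k))
  (dDW : forall i j k, stwd T k (DW i j) (DDW i j k))
  (dDVb : forall i j k, stwd T k (DVb i j) (DDVb i j k)).
Hypothesis eW : {ae ST, forall (p : mT * pt) i, Wt i p =
  \sum_j (- (U j p * DW i j p) + hn / 2 * (V j p * DVb i j p + DDVb i j j p)
    + nu / 2 * (V j p * DW i j p + DDW i j j p)) - la * V i p - mu * W i p}.
Hypothesis eVb : {ae ST, forall (p : mT * pt) i, Vbt i p =
  \sum_j (- (U j p * DVb i j p) - hn / 2 * (V j p * DU j i p + DDU j i j p))}.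
Hypothesis eL : {ae ST, forall p : mT * pt, Lt p = - \sum_i (DU i i p + U i p * V i p)}.
Hypothesis sdr : forall j, stwd T j r (dr j).
Hypothesis sTw : forall i j, stwd T j (fun p => r p * a i p)
  (fun p => r p * Tw i j p + 2 * (a i p * dr j p)).
Hypothesis sTb : forall i j, stwd T j (fun p => r p * b i p)
  (fun p => r p * Tb i j p + 2 * (b i p * dr j p)).
Hypothesis sTu : forall i j, stwd T j (fun p => r p * q i p)
  (fun p => r p * Tu i j p + 2 * (q i p * dr j p)).

Let dev p := \sum_i ((a i p - r p * W i p) ^+ 2 + (b i p - r p * Vb i p) ^+ 2).

Lemma L1_deviation : L1 ST dev.
Proof.
by apply: L1_sum => i _; apply: L1D;
  [have [] : sqint ST (fun p => a i p - r p * W i p)|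
   have [] : sqint ST (fun p => b i p - r p * Vb i p)] => //;
  apply: L2B => //; exact: L2_mul_bdd.
Qed.

Let sq_slice f : sqint ST f -> {ae tm, forall s : mT, sqint P (slice f s)}.
Proof.
move=> [mf /L1_slice1]; apply: filterS => s l; split => //.
exact: meas_slice1.
Qed.

(** Integration in time of [rate_bound]. Its hypotheses concern one slice, so they are first
    collected for all indices outside a single null set of times. *)
Lemma total_rate_le (M : K) (t : mT) : 0 <= M ->
  (forall i j, {ae ST, forall p : mT * pt, `|DW i j p| <= M}) ->
  (forall i j, {ae ST, forall p : mT * pt, `|DVb i j p| <= M}) ->
  prim T (fun s => \int[P]_x (total_dissipated (s, x) + total_rate (s, x))) t <=
  8 * d%:R * M * (1 + nu / hn) * prim T (fun s => 2^-1 * \int[P]_x dev (s, x)) t.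
Proof.
move=> M0 hM hM'; have LZ := L1D L1_total_dissipated L1_total_rate.
have Ld := L1Z 2^-1 (L1_int1 L1_deviation).
rewrite -primZ//; apply: le_prim_ae; [exact: (L1_int1 LZ)|exact: (L1Z _ Ld)|].
have A1 := ae_foralli (fun i => ae_and (sq_slice (sq_dr i)) (sq_slice (sq_a i))).
have A2 := ae_foralli (fun j => sdr j).
have A3 := ae_foralli (fun i => ae_foralli (fun j => sTw i j)).
have A4 := ae_foralli (fun i => ae_foralli (fun j => sTb i j)).
have A5 := ae_foralli (fun i => ae_foralli (fun j => sTu i j)).
have A6 := ae_foralli (fun i => ae_and (bst_bdd (bW i)) (bst_bdd (bVb i))).
have A7 := ae_foralli (fun i => ae_foralli (fun j => ae_and (bst_bdd (bDW i j)) (bst_bdd (bDVb i j)))).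
have A8 := ae_foralli (fun i => ae_foralli (fun j => ae_foralli (fun k =>
  ae_and (bst_bdd (bDDW i j k)) (bst_bdd (bDDVb i j k))))).
have A9 := ae_foralli (fun i => ae_foralli (fun j => ae_and (dW i j) (dVb i j))).
have A10 := ae_foralli (fun i => ae_foralli (fun j => ae_foralli (fun k =>
  ae_and (dDW i j k) (dDVb i j k)))).
have A11 := ae_foralli (fun j => dL j).
have A12 := ae_and (ae_slice1 eW) (ae_and (ae_slice1 eVb) (ae_slice1 eL)).
have A13 := ae_foralli (fun i => ae_foralli (fun j =>
  ae_and (ae_slice1 (hM i j)) (ae_slice1 (hM' i j)))).
have A14 := ae_and (L1_slice1 LZ) (sq_slice sq_r).
apply: filterS2 (ae_and (ae_and (ae_and A1 A2) (ae_and A3 A4)) (ae_and (ae_and A5 A6) (ae_and A7 A8)))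
  (ae_and (ae_and (ae_and A9 A10) (ae_and A11 A12)) (ae_and A13 A14)) => s.
move=> [[[h1 h2] [h3 h4]] [[h5 h6] [h7 h8]]] [[[h9 h10] [h11 [h12 [h12' h12'']]]] [h13 [h14 h14']]].
have eZ x : total_dissipated (s, x) + total_rate (s, x) =
  dissipated hn nu la mu (slice r s) (sl dr s) (sl a s) (sl2 Tw s) (sl2 Tb s)
    (sl W s) (sl2 DW s) (sl2 DVb s) x
  - \sum_i momentum_rate hn nu la mu (slice r s) (sl dr s) (sl a s) (sl2 Tw s)
      (sl2 Tb s) (sl W s) (sl Wt s) (sl2 DW s) i x
  - \sum_i drift_rate hn nu (slice r s) (sl dr s) (sl a s) (sl2 Tu s)
      (sl Vbt s) (sl2 DVb s) i x
  + mass_rate hn nu la (slice r s) (sl dr s) (sl a s) (slice Lt s)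
    (sl W s) (sl Vb s) (sl Wt s) (sl Vbt s) (sl2 DW s) (sl2 DVb s) x.
  by rewrite /total_dissipated /total_rate /=; ring.
rewrite (eqR _ eZ).
have hn0 : hn != 0 by rewrite gt_eqF.
have := @rate_bound K d hn nu la mu hn0 (slice r s) (sl dr s) (sl a s) (sl2 Tw s) (sl2 Tb s)
  (sl2 Tu s) h14' (fun i => (h1 i).1) (fun i => (h1 i).2) h2 h3 h4 h5
  (slice L s) (slice Lt s) (sl W s) (sl Vb s) (sl Wt s) (sl Vbt s) (sl2 DW s) (sl2 DVb s)
  (sl3 DDW s) (sl3 DDVb s)
  (fun i => (h6 i).1) (fun i => (h6 i).2) (fun i j => (h7 i j).1) (fun i j => (h7 i j).2)
  (fun i j k => (h8 i j k).1) (fun i j k => (h8 i j k).2)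
  (fun i j => (h9 i j).1) (fun i j => (h9 i j).2)
  (fun i j k => (h10 i j k).1) (fun i j k => (h10 i j k).2)
  h11 h12 h12' h12'' M hn_gt0 nu0 la0 M0 (fun i j => (h13 i j).1) (fun i j => (h13 i j).2).
by move=> /(_ (eq_L1 eZ h14))[_ ->].
Qed.

End relative_balance.

(** * Lower bounds for integrals and expansion of the dissipation *)

Section lower_integral.
Context d (X : measurableType d) (K : realType) (mu : {measure set X -> \bar K}).
Import HBNNSimple.

(* [E] need not be measurable: its integral is a supremum over simple functions. *)
Lemma integral_ge_ae (D : set X) (g : X -> K) (E : X -> \bar K) : measurable D ->
  measurable_fun setT g -> (forall x, 0 <= g x) ->
  {ae mu, forall x, D x -> ((g x)%:E <= E x)%E} ->
  (\int[mu]_(x in D) (g x)%:E <= \int[mu]_(x in D) E x)%E.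
Proof.
move=> mD mg g0 [N [mN N0 hN]].
have gE x : D x -> ~ N x -> ((g x)%:E <= E x)%E.
  by move=> Dx; apply: contra_notP => h; apply: hN => /(_ Dx).
(* Off the null set [N] the function [E] is nonnegative on [D], so each simple function below its
   negative part vanishes almost everywhere. *)
have neg0 : (\int[mu]_(x in D) (E^\- x) = 0)%E.
  apply/eqP; rewrite eq_le; apply/andP; split; last by apply: integral_ge0.
  rewrite ge0_integralE//; apply: ge_ereal_sup => _ [h hh <-].
  rewrite -integralT_nnsfun (ge0_ae_eq_integral (g := cst 0%E)) ?integral0//.
  - exact/measurable_EFinP.
  - by move=> x _; rewrite lee_fin.
  exists N; split => // x /= hx; apply: contrapT => Nx; apply: hx => _.
  congr EFin; apply/eqP; rewrite eq_le; apply/andP; split; last exact: fun_ge0.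
  rewrite -lee_fin; apply: le_trans (hh x) _; rewrite /patch; case: ifPn => // /set_mem Dx.
  by rewrite funenegE ge_max leeNl oppe0 lexx andbT; apply: le_trans (gE x Dx Nx); rewrite lee_fin.
rewrite [leRHS]integralE neg0 sube0.
(* Setting [g] to 0 outside [D] and on [N] makes the domination hold everywhere, so the suprema over
   simple functions can be compared. *)
pose g' := (fun x => (g x)%:E : \bar K) \_ (D `\` N).
have -> : (\int[mu]_(x in D) (g x)%:E = \int[mu]_x g' x)%E.
  rewrite /g' -integral_mkcond integral_mkcond [RHS]integral_mkcond.
  have m E' : measurable E' -> measurable_fun setT ((fun x => (g x)%:E : \bar K) \_ E').
    by move=> mE; apply/(measurable_restrictT _ mE); apply: measurable_funTS; exact/measurable_EFinP.
  have p E' x : (0 <= ((fun x => (g x)%:E : \bar K) \_ E') x)%E.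
    by rewrite /patch; case: ifP => // _; rewrite lee_fin.
  apply: ge0_ae_eq_integral => //; [exact: m|by apply: m; exact: measurableD|].
  exists N; split => // x /= hx; apply: contrapT => Nx; apply: hx => _.
  by rewrite /patch in_setD; congr (if _ then _ else _); rewrite (memNset Nx) andbT.
rewrite ge0_integralTE; last by move=> x; rewrite /g' /patch; case: ifP => // _; rewrite lee_fin.
rewrite ge0_integralE//; apply: le_ereal_sup => _ [h hh <-]; exists h => // x.
apply: le_trans (hh x) _; rewrite /g' /patch in_setD.
case: (boolP (x \in D)) => Dx //=; case: (boolP (x \in N)) => Nx /=.
  exact: funepos_ge0.
by rewrite funeposE le_max (gE _ (set_mem Dx))// => /mem_set; exact/negP.
Qed.

Lemma combine_integrals (c c' : K) (F G : X -> K) : 0 <= c -> 0 <= c' ->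
  measurable_fun setT F -> measurable_fun setT G -> (forall x, 0 <= F x) -> (forall x, 0 <= G x) ->
  (c%:E * \int[mu]_x (F x)%:E + c'%:E * \int[mu]_x (G x)%:E =
   \int[mu]_x (c * F x + c' * G x)%:E)%E.
Proof.
move=> c0 c0' mF mG F0 G0.
rewrite -!ge0_integralZl//; try (by exact/measurable_EFinP); try (by move=> x _; rewrite lee_fin).
rewrite -ge0_integralD//; try (by move=> x _; rewrite -EFinM lee_fin mulr_ge0).
- by apply/measurable_EFinP; exact: measurable_funM.
- by apply/measurable_EFinP; exact: measurable_funM.
Qed.

End lower_integral.

Section partial_integral.
Variables (K : realType) (T : K).
Local Notation mT := (measurableTypeR K).
Local Notation tm := (time T).

Lemma integral_before (F : mT -> \bar K) (t : K) : t <= T -> measurable_fun setT F ->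
  (forall s, 0 <= F s)%E ->
  (\int[@lebesgue_measure K]_(s in `]0%R, t[) F s = \int[tm]_s ((s < t)%R%:R%:E * F s))%E.
Proof.
move=> tT mF F0; have mlt := meas_lt (t : mT).
have p s : (0 <= (s < t)%R%:R%:E * F s)%E by apply: mule_ge0 => //; rewrite lee_fin ler0n.
rewrite ge0_time//; last by apply: emeasurable_funM => //; exact/measurable_EFinP.
rewrite integral_mkcond [RHS]integral_mkcond; apply: eq_integral => s _.
rewrite /patch !mem_setE !in_itv /=; case: (ltrP 0 s) => s0 //=.
case: (ltrP s t) => st; first by rewrite (lt_le_trans st tT) mul1e.
by rewrite mul0e if_same.
Qed.

Lemma integral_before_prim (F : mT -> \bar K) (g : mT -> K) (t : K) : t <= T ->
  measurable_fun setT F -> (forall s, 0 <= F s)%E -> L1 tm g ->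
  {ae tm, forall s : mT, F s = (g s)%:E} ->
  (\int[@lebesgue_measure K]_(s in `]0%R, t[) F s = (prim T g t)%:E)%E.
Proof.
move=> tT mF F0 lg Fg; rewrite integral_before// /prim EFinR; last exact: L1_lt.
have mlt := meas_lt (t : mT).
apply: ae_eq_integral => //.
- by apply: emeasurable_funM => //; exact/measurable_EFinP.
- by apply/measurable_EFinP; apply: measurable_funM => //; exact: L1_meas lg.
by apply: filterS Fg => s e _; rewrite e EFinM.
Qed.

End partial_integral.

Section square_norms.
Variables (K : realType).

Lemma normsq_ge0 m n (A : 'M[K]_(m, n)) : 0 <= normsq A.
Proof. by apply: sumr_ge0 => i _; apply: sumr_ge0 => j _; rewrite -expr2 sqr_ge0. Qed.

Lemma meas_normsq d (X : measurableType d) m n (f : X -> 'M[K]_(m, n)) :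
  (forall i j, measurable_fun setT (fun x => f x i j)) -> measurable_fun setT (fun x => normsq (f x)).
Proof.
move=> mf; apply: measurable_sum => i; apply: measurable_sum => j.
exact: measurable_funM.
Qed.

Lemma normsq_sub m n (A B : 'M[K]_(m, n)) (c : K) (b : 'I_m -> 'I_n -> K) :
  (forall i j, B i j = b i j) -> normsq (A - c *: B) = normsq A +
    \sum_i \sum_j (- (2 * (c * A i j) * b i j) + c ^+ 2 * b i j ^+ 2).
Proof.
move=> hB; rewrite /normsq /inner -big_split/=; apply: eq_bigr => i _.
by rewrite -big_split/=; apply: eq_bigr => j _; rewrite !mxE hB; ring.
Qed.

(** After the squares are expanded, the term 4 la / hn^2 |z|^2 is added to complete the dissipation
    of the energy estimate and subtracted in the remainder, which is [dissipated]. *)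
Lemma rel_dissipation_expand d (nu hn la mu c : K) (A A' B B' : 'M[K]_d) (u w z : 'rV[K]_d)
    (a' b' : 'I_d -> 'I_d -> K) (b : 'I_d -> K) :
  (forall i j, A' i j = a' i j) -> (forall i j, B' i j = b' i j) -> (forall i, z 0 i = b i) ->
  nu / 2 * (normsq (A - c *: A') + normsq (B - c *: B')) + mu * normsq (u - c *: w) =
  nu / 2 * (normsq B + normsq A + 4 * la / hn ^+ 2 * normsq z) + mu * normsq u
  + (nu / 2 * (\sum_i \sum_j (- (2 * (c * A i j) * a' i j) + c ^+ 2 * a' i j ^+ 2
      - 2 * (c * B i j) * b' i j + c ^+ 2 * b' i j ^+ 2))
    - 2 * nu * la / hn ^+ 2 * (\sum_i b i ^+ 2)
    + mu * (\sum_i (- (2 * (c * u 0 i) * w 0 i) + c ^+ 2 * w 0 i ^+ 2))).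
Proof.
move=> hA hB hz.
rewrite (normsq_sub A c hA) (normsq_sub B c hB) (normsq_sub u c (fun i j => erefl (w i j))).
have -> : normsq z = \sum_i b i ^+ 2.
  by rewrite /normsq /inner big_ord1; apply: eq_bigr => i _; rewrite hz expr2.
have -> : \sum_i \sum_j (- (2 * (c * A i j) * a' i j) + c ^+ 2 * a' i j ^+ 2
      - 2 * (c * B i j) * b' i j + c ^+ 2 * b' i j ^+ 2) =
    \sum_i \sum_j (- (2 * (c * A i j) * a' i j) + c ^+ 2 * a' i j ^+ 2)
    + \sum_i \sum_j (- (2 * (c * B i j) * b' i j) + c ^+ 2 * b' i j ^+ 2).
  rewrite -big_split/=; apply: eq_bigr => i _; rewrite -big_split/=.
  by apply: eq_bigr => j _; ring.
rewrite big_ord1; move: (\sum_i \sum_j _) (\sum_i \sum_j _) => S1 S2.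
move: (\sum_i _) (\sum_i _) (normsq A) (normsq B) (normsq u) (hn ^+ 2)^-1 => S3 S4 x y t h.
by field.
Qed.

End square_norms.

(** * Consequences of the energy inequality *)

Section weak_energy_facts.
Variables (K : realType) (d : nat) (T lambda mu nu hbar : K).
Hypothesis T0 : 0 < T.
Local Notation pt := 'rV[K]_d.
Local Notation mT := (measurableTypeR K).
Local Notation tm := (time T).
Local Notation P := (@torus K d).
Local Notation ST := (tm \x P)%E.
Local Notation la := (lambda' lambda mu nu).
Local Notation hn := (hbar_nu nu hbar).
Variables (r0 : pt -> K) (w0 : pt -> 'rV[K]_d) (r : mT * pt -> K) (ru : mT * pt -> 'rV[K]_d).
Variables (Tu Tw Tvb : mT * pt -> 'M[K]_d).
Hypothesis ws : weak_solution T lambda mu nu hbar r0 w0 r ru Tu Tw Tvb.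
Hypotheses (la0 : 0 < la) (d_gt0 : (0 < d)%N) (nu0 : 0 <= nu) (mu0 : 0 <= mu).
Local Notation a := (rw T nu r ru).
Local Notation b := (rvb T nu hbar r).

Definition dissipation_density (p : mT * pt) : K :=
  nu / 2 * (normsq (Tw p) + normsq (Tvb p) + 4 * la / hn ^+ 2 * normsq (b p)) + mu * normsq (a p).

Lemma meas_a i : measurable_fun setT (fun p : mT * pt => a p 0 i).
Proof. by have [] := sq_a T0 ws i. Qed.

Lemma meas_b i : measurable_fun setT (fun p : mT * pt => b p 0 i).
Proof. by have [] := sq_b T0 ws i. Qed.

Lemma meas_r : measurable_fun setT r.
Proof. by have [] := sq_r T0 ws. Qed.

Let mna : measurable_fun setT (fun p : mT * pt => normsq (a p)).
Proof. by apply: meas_normsq => i j; rewrite (ord1 i); exact: meas_a. Qed.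

Let c0 : 0 <= 4 * la / hn ^+ 2.
Proof. by rewrite divr_ge0 ?sqr_ge0// mulr_ge0// ltW. Qed.

Let Q (p : mT * pt) := normsq (Tw p) + normsq (Tvb p) + 4 * la / hn ^+ 2 * normsq (b p).

Let mQ : measurable_fun setT Q.
Proof.
apply: measurable_funD; first apply: measurable_funD.
- by apply: meas_normsq => i j; have [] := weak_TN_w ws i j.
- by apply: meas_normsq => i j; have [] := weak_TN_vb ws i j.
apply: measurable_funM => //; apply: meas_normsq => i j; rewrite (ord1 i); exact: meas_b.
Qed.

Let Q0 p : 0 <= Q p.
Proof. by apply: addr_ge0; [apply: addr_ge0; exact: normsq_ge0|apply: mulr_ge0 => //; exact: normsq_ge0]. Qed.

Lemma meas_dissipation_density : measurable_fun setT dissipation_density.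
Proof. by apply: measurable_funD; apply: measurable_funM. Qed.

Lemma dissipation_density_ge0 p : 0 <= dissipation_density p.
Proof.
by apply: addr_ge0; [exact: (mulr_ge0 (divr_ge0 nu0 (ler0n _ 2)) (Q0 p))|exact: (mulr_ge0 mu0 (normsq_ge0 _))].
Qed.

Local Notation D := (fun s : mT => \int[P]_x (dissipation_density (s, x))%:E)%E.

Lemma dissipationE s :
  dissipation lambda mu nu hbar (slice a s) (slice b s) (slice Tw s) (slice Tvb s) = D s.
Proof.
exact: (combine_integrals P (divr_ge0 nu0 (ler0n _ 2)) mu0 (meas_slice1 s mQ) (meas_slice1 s mna)
  (fun x => Q0 (s, x)) (fun x => normsq_ge0 (a (s, x)))).
Qed.

Let mD : measurable_fun setT D.
Proof. exact: (meas_eint1 P meas_dissipation_density). Qed.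

Let D0 s : (0 <= D s)%E.
Proof. by apply: integral_ge0 => x _; rewrite lee_fin; exact: dissipation_density_ge0. Qed.

Local Notation ed t := (energy_density lambda mu nu (slice r t) (slice a t) (slice b t)).
Local Notation ed0 := (energy_density lambda mu nu r0 (rw0 r0 w0) (rvb0 nu hbar r0)).

(** The dissipated energy is nonnegative, so finiteness of the initial energy passes to almost every
    slice, whose energy is then the integral of an integrable density. *)
Let energy_slice : {ae tm, forall t : mT,
  (energy lambda mu nu (slice r t) (slice a t) (slice b t) < +oo)%E /\
  ((\int[P]_x ed t x)%:E + \int[@lebesgue_measure K]_(s in `]0%R, t[) D s
    <= (\int[P]_x ed0 x)%:E)%E}.
Proof.
have [le0 _ _ _] := init_energy ws la0 d_gt0.
have h : {ae tm, forall t : mT, (energy lambda mu nu (slice r t) (slice a t) (slice b t) +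
  \int[@lebesgue_measure K]_(s in `]0%R, t[)
    dissipation lambda mu nu hbar (slice a s) (slice b s) (slice Tw s) (slice Tvb s)
  <= energy lambda mu nu r0 (rw0 r0 w0) (rvb0 nu hbar r0))%E} := weak_energy ws.
apply: filterS h => t h.
have e : (\int[@lebesgue_measure K]_(s in `]0%R, t[)
    dissipation lambda mu nu hbar (slice a s) (slice b s) (slice Tw s) (slice Tvb s) =
    \int[@lebesgue_measure K]_(s in `]0%R, t[) D s)%E.
  by apply: eq_integral => s _; exact: dissipationE.
have i0 : (0 <= \int[@lebesgue_measure K]_(s in `]0%R, t[) D s)%E by apply: integral_ge0.
have h' : (energy lambda mu nu (slice r t) (slice a t) (slice b t) +
    \int[@lebesgue_measure K]_(s in `]0%R, t[) D s <= (\int[P]_x ed0 x)%:E)%E.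
  by rewrite -e (EFinR le0) -energyE; exact: h.
have fin : (energy lambda mu nu (slice r t) (slice a t) (slice b t) < +oo)%E.
  by apply: le_lt_trans (leeDl _ i0) _; apply: le_lt_trans h' _; exact: ltry.
split => //; move: h'; rewrite energyE.
have [lt _ _ _] := energy_fin la0 (meas_slice1 t meas_r)
  (fun i => meas_slice1 t (meas_a i)) (fun i => meas_slice1 t (meas_b i)) fin.
by rewrite -(EFinR lt).
Qed.

Lemma energy_slice_fin : {ae tm, forall t : mT,
  (energy lambda mu nu (slice r t) (slice a t) (slice b t) < +oo)%E}.
Proof. by apply: filterS energy_slice => t []. Qed.

(** The energy stays above -la, so the energy inequality bounds the dissipation up to almost every
    time by the initial energy plus la; [L1_of_partial] concludes. *)
Lemma L1_dissipation_density : L1 ST dissipation_density.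
Proof.
have md := meas_dissipation_density.
apply/integrableP; split; first exact/measurable_EFinP.
rewrite (eq_integral (fun p => (dissipation_density p)%:E)); last first.
  by move=> p _; rewrite /= ger0_norm//; exact: dissipation_density_ge0.
rewrite (fubini_tonelli1 (m1 := tm) (m2 := P)); last 2 first.
- exact/measurable_EFinP.
- by move=> p; rewrite lee_fin; exact: dissipation_density_ge0.
apply: le_lt_trans (ltry (\int[P]_x ed0 x + la)).
suff part : {ae tm, forall t : mT,
    (\int[tm]_s ((s < t)%R%:R%:E * D s) <= (\int[P]_x ed0 x + la)%:E)%E}.
  exact: (L1_of_partial T0 mD D0 part).
have ti : {ae tm, forall t : mT, 0 < t < T} := @ae_time_itv K T.
apply: filterS2 ti energy_slice => t /andP[t0 tT] [fin h].
have [lt _ _ _] := energy_fin la0 (meas_slice1 t meas_r)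
  (fun i => meas_slice1 t (meas_a i)) (fun i => meas_slice1 t (meas_b i)) fin.
rewrite -(integral_before (ltW tT) mD D0).
have low : - la <= \int[P]_x ed t x.
  have -> : - la = \int[P]_x (cst (- la) x).
    exact: esym (Rcst P (- la)).
  apply: R_le_ae => //; first exact: (L1_pcst P (- la)).
  apply: aeW => x; rewrite /energy_density /cst -[leLHS]add0r; apply: lerD.
    by apply: addr_ge0; rewrite mulr_ge0//; apply: sumr_ge0 => i _; exact: sqr_ge0.
  by rewrite -mulrN1; apply: ler_wpM2l; [exact: ltW|apply: H_ge; exact: sqr_ge0].
by rewrite EFinD -leeBlDr//; apply: le_trans h; rewrite addeC leeD2r//.
Qed.

Lemma energy_inequality : {ae tm, forall t : mT,
  \int[P]_x ed t x + prim T (fun s => \int[P]_x dissipation_density (s, x)) t <= \int[P]_x ed0 x}.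
Proof.
have ti : {ae tm, forall t : mT, 0 < t < T} := @ae_time_itv K T.
apply: filterS2 ti energy_slice => t /andP[t0 tT] [_].
rewrite (integral_before_prim (g := fun s => \int[P]_x dissipation_density (s, x)) (ltW tT) mD D0).
- by rewrite -EFinD lee_fin.
- exact: (L1_int1 L1_dissipation_density).
by apply: filterS (L1_slice1 L1_dissipation_density) => s l; rewrite (EFinR l).
Qed.

End weak_energy_facts.

Section initial_values.
Variables (K : realType) (d : nat) (T : K).
Local Notation pt := 'rV[K]_d.
Local Notation mT := (measurableTypeR K).
Local Notation tm := (time T).
Local Notation P := (@torus K d).
Local Notation ST := (tm \x P)%E.
Implicit Types f g : mT * pt -> K.

Lemma evolves_init f (f0 f0' : pt -> K) g : evolves T f f0 g -> L1 P f0' ->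
  {ae P, forall x, f0 x = f0' x} -> evolves T f f0' g.
Proof.
move=> [lf l0 lg e] l0' e0; split => //.
have ms := meas_sprim T (L1_meas lg).
have m2 : measurable_fun setT (fun p : mT * pt => f0' p.2 + sprim T g p).
  apply: measurable_funD => //.
  by apply: measurableT_comp measurable_snd; exact: L1_meas l0'.
apply: (ae_eq_prod2 (L1_meas lf) m2).
apply: filterS2 (ae_slice2 e) e0 => x h h0.
by apply: filterS h => s /= ->; rewrite h0.
Qed.

Lemma conservation_ext f f' (F F' : 'I_d -> mT * pt -> K) S c : f =1 f' ->
  (forall j, F j =1 F' j) -> conservation T f F S c -> conservation T f' F' S c.
Proof.
move=> /funext -> hF; have -> // : F = F'.
by apply/funext => j; apply/funext; exact: hF.
Qed.

Lemma prim_intD f g (t : K) : L1 ST f -> L1 ST g ->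
  prim T (fun s => \int[P]_x (f (s, x) + g (s, x))) t =
  prim T (fun s => \int[P]_x f (s, x)) t + prim T (fun s => \int[P]_x g (s, x)) t.
Proof.
move=> lf lg; have l1 := L1_int1 lf; have l2 := L1_int1 lg.
rewrite -primD//; apply: eq_prim_ae.
- exact: L1_meas (L1_int1 (L1D lf lg)).
- exact: L1_meas (L1D l1 l2).
by apply: filterS2 (L1_slice1 lf) (L1_slice1 lg) => s m1 m2; rewrite RD.
Qed.

Lemma sub_scale_entry m n (A B : 'M[K]_(m, n)) c i j b : B i j = b ->
  (A - c *: B) i j = A i j - c * b.
Proof. by move=> <-; rewrite !mxE. Qed.

Lemma gradvE (D : option 'I_d -> (K * pt -> K) -> K * pt -> K) (z : K * pt -> pt) p i j :
  gradv D z p i j = D (Some j) (Defs.comp z i) p.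
Proof. by rewrite /gradv mxE. Qed.

End initial_values.

Section relative_entropy_inequality.
Variables (K : realType) (d : nat) (T lambda mu nu hbar : K).
Hypothesis T0 : 0 < T.
Local Notation pt := 'rV[K]_d.
Local Notation mT := (measurableTypeR K).
Local Notation tm := (time T).
Local Notation P := (@torus K d).
Local Notation ST := (tm \x P)%E.
Local Notation bst := (essbdd ST).
Local Notation la := (lambda' lambda mu nu).
Local Notation hn := (hbar_nu nu hbar).
Hypotheses (hn_gt0 : 0 < hn) (la0 : 0 < la) (d_gt0 : (0 < d)%N) (nu0 : 0 <= nu) (mu0 : 0 <= mu).
Variables (R0 : pt -> K) (W0 : pt -> 'rV[K]_d) (R : mT * pt -> K) (W Vb : mT * pt -> 'rV[K]_d).
Hypothesis ss : strong_solution T lambda mu nu hbar R0 W0 R W Vb.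

Lemma initial_R : [/\ evolves T (L R) (fun x => ln (R0 x)) (Lt T R), {ae P, forall x, 0 < R0 x} &
  {ae tm, forall t : mT, \int[P]_x R (t, x) = \int[P]_x R0 x}].
Proof.
have [L0 [R00 [[evL evR eE e0] _]]] := strong_traces T0 ss.
have eL : {ae P, forall x, L0 x = ln (R0 x)}.
  by apply: filterS2 eE e0 => x e1 e2; rewrite -e2 e1 expRK.
have mR0 := L1_meas (strong_R0_int ss).
split.
- have [_ l0 _ _] := evL; have eL' := eL; apply: evolves_init evL _ eL; apply: L1_ae eL' l0.
  by apply: measurableT_comp => //; exact: measurable_ln.
- by apply: filterS2 eE e0 => x e1 e2; rewrite -e2 e1 expR_gt0.
have [_ l00 _ _] := evR; apply: filterS (mass_R ss evR) => t ->.
by apply: R_ae => //; exact: L1_meas l00.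
Qed.

Lemma initial_W i : evolves T (Defs.comp W i) (fun x => W0 x 0 i) (Wt T W i).
Proof.
have [w [ev e]] := evolvesW T0 ss i.
exact: evolves_init ev (strong_W0_int ss i) e.
Qed.

Lemma initial_Vb i : evolves T (Defs.comp Vb i) (fun x => Vb0 nu hbar R0 x 0 i) (Vbt T Vb i).
Proof.
have [w [ev e]] := evolvesVb T0 ss i; apply: evolves_init ev _ e.
have [g hg] := strong_lnR0_diff ss i.
have [_ lg _] := xgetPex (fun=> 0) (ex_intro _ g hg : exists g, [set g | is_sderiv i _ g] g).
by apply: eq_L1 (L1Z (hn / 2) lg) => x; rewrite /Vb0 !mxE.
Qed.

Variables (r0 : pt -> K) (w0 : pt -> 'rV[K]_d) (r : mT * pt -> K) (ru : mT * pt -> 'rV[K]_d).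
Variables (Tu Tw Tvb : mT * pt -> 'M[K]_d).
Hypothesis ws : weak_solution T lambda mu nu hbar r0 w0 r ru Tu Tw Tvb.

Let dr i : mT * pt -> K := dr T r i.
Let a i (p : mT * pt) : K := rw T nu r ru p 0 i.
Let tw i j (p : mT * pt) : K := Tw p i j.
Let tb i j (p : mT * pt) : K := Tvb p i j.
Let tu i j (p : mT * pt) : K := Tu p i j.
Let a0 i (x : pt) : K := rw0 r0 w0 x 0 i.
Let b0 i (x : pt) : K := rvb0 nu hbar r0 x 0 i.
Let w i : mT * pt -> K := Defs.comp W i.
Let v i : mT * pt -> K := Defs.comp Vb i.

Let bE i p : rvb T nu hbar r p 0 i = hn * dr i p. Proof. exact: b_E. Qed.

Let hn0 : hn != 0. Proof. by rewrite gt_eqF. Qed.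

Let qE i p : ru p 0 i = a i p - nu / hn * (hn * dr i p).
Proof. by rewrite /a a_E -/(dr i); field. Qed.

Let cons_r : conservation T (fun p => r p ^+ 2)
  (fun j p => r p * (a j p - nu / hn * (hn * dr j p))) (fun=> 0) (fun x => r0 x ^+ 2).
Proof.
apply: conservation_ext (mass_conservation T0 ws la0 d_gt0) => // j p.
by rewrite qE.
Qed.

Let cons_a i : conservation T (fun p => r p * a i p)
  (fun j p => a i p * (a j p - nu / hn * (hn * dr j p)) + la * r p ^+ 2 * (i == j)%:R
    - hn / 2 * (r p * tb i j p) - nu / 2 * (r p * tw i j p))
  (fun p => - mu * (r p * a i p)) (fun x => r0 x * a0 i x).
Proof.
apply: conservation_ext (momentum_conservation T0 ws la0 d_gt0 i) => // j p.
by rewrite /momentum_flux qE.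
Qed.

Let cons_b i : conservation T (fun p => r p * (hn * dr i p))
  (fun j p => hn * dr i p * (a j p - nu / hn * (hn * dr j p)) + hn / 2 * (r p * tu j i p))
  (fun=> 0) (fun x => r0 x * b0 i x).
Proof.
apply: conservation_ext (drift_conservation T0 ws la0 d_gt0 hn_gt0 i) => [p|j p].
  by rewrite bE.
by rewrite bE qE.
Qed.

Let bW := bstW T0 ss.
Let bVb := bstVb T0 ss.
Let bWt := bstWt T0 ss.
Let bVbt := bstVbt T0 ss.
Let bDW i j := (bstDW T0 ss i j).1.
Let bDVb i j := (bstDVb T0 ss i j).1.
Let dW i j := (bstDW T0 ss i j).2.
Let dVb i j := (bstDVb T0 ss i j).2.
Let bL := bstL ss.
Let bLt := bstLt T0 ss hn_gt0.
Let dL := stwd_L T0 ss hn_gt0.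
Let r2 := sq_r T0 ws.
Let dr2 := sq_dr T0 ws.
Let a2 := sq_a T0 ws.

Let lTw i j : L1 ST (fun p => r p * tw i j p). Proof. by have [] := weak_TN_w ws i j. Qed.
Let lTb i j : L1 ST (fun p => r p * tb i j p). Proof. by have [] := weak_TN_vb ws i j. Qed.

Let sdr j : stwd T j r (dr j). Proof. exact: (wderiv_space (wderiv_r ws j)). Qed.

Let outerE (u1 u2 : pt) (b' : 'I_d -> K) i j : (forall k, u2 0 k = b' k) ->
  outer u1 u2 i j = u1 0 i * b' j.
Proof. by move=> h; rewrite /outer !mxE big_ord1 !mxE h. Qed.

Let gradE (p : mT * pt) k : grad (wD T) r p 0 k = dr k p.
Proof. by rewrite /grad mxE. Qed.

Let sTN (rz : mT * pt -> pt) (Tz : mT * pt -> 'M[K]_d) (z : 'I_d -> mT * pt -> K) i j :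
  is_TN T r rz Tz -> (forall k p, rz p 0 k = z k p) ->
  stwd T j (fun p => r p * z i p) (fun p => r p * Tz p i j + 2 * (z i p * dr j p)).
Proof.
move=> /(_ i j)[_ _ /wderiv_space h] hz; apply: filterS h => t h.
apply: (twd_eq h) => x; rewrite /slice; first by rewrite hz.
by rewrite (outerE _ _ _ (gradE (t, x))) hz.
Qed.

Local Notation dD := (dissipation_density T lambda mu nu hbar r ru Tw Tvb).
Local Notation dis := (total_dissipated hn nu la mu r dr a tw tb w (DW T W) (DVb T Vb)).
Local Notation rate := (total_rate hn nu la mu r dr a tw tb tu (Lt T R) w v (Wt T W) (Vbt T Vb)
  (DW T W) (DVb T Vb)).
Local Notation dev p := (\sum_i ((a i p - r p * w i p) ^+ 2 + (hn * dr i p - r p * v i p) ^+ 2)).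

Let lD : L1 ST dD. Proof. exact: (L1_dissipation_density T0 ws la0 d_gt0 nu0 mu0). Qed.
Let ldis : L1 ST dis. Proof. exact: (L1_total_dissipated hn nu la mu bW bDW bDVb r2 dr2 a2 lTw lTb). Qed.
Let lrate : L1 ST rate.
Proof. exact: (L1_total_rate cons_r cons_a cons_b bL bLt bW bWt bVb bVbt bDW bDVb). Qed.
Let ldev : L1 ST (fun p => dev p). Proof. exact: (L1_deviation hn bW bVb r2 dr2 a2). Qed.

(** The relative dissipation contains the weak dissipation [dD], which the energy inequality
    absorbs; only the remainder [dis] joins the tested terms. *)
Let rdE (p : mT * pt) :
  nu / 2 * (normsq (Tvb p - r p *: gradv (wD T) Vb p) + normsq (Tw p - r p *: gradv (wD T) W p))
  + mu * normsq (rw T nu r ru p - r p *: W p) = dD p + dis p.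
Proof.
rewrite (@rel_dissipation_expand _ _ nu hn la mu (r p) (Tvb p) (gradv (wD T) Vb p) (Tw p)
  (gradv (wD T) W p) (rw T nu r ru p) (W p) (rvb T nu hbar r p)
  (fun i j => DVb T Vb i j p) (fun i j => DW T W i j p) (fun i => hn * dr i p)).
- by case: p.
- by move=> i j; exact: gradvE.
- by move=> i j; exact: gradvE.
- by move=> i; exact: bE.
Qed.

Let rd0 p : 0 <= dD p + dis p.
Proof.
rewrite -rdE; apply: addr_ge0; apply: mulr_ge0 => //; last exact: normsq_ge0.
  exact: (divr_ge0 nu0 (ler0n _ 2)).
by apply: addr_ge0; exact: normsq_ge0.
Qed.

Let mrd : measurable_fun setT (fun p : mT * pt => dD p + dis p).
Proof. exact: (L1_meas (L1D lD ldis)). Qed.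

Let rel_dissipationE s : rel_dissipation T mu nu r ru Tw Tvb W Vb s =
  (\int[P]_x (dD (s, x) + dis (s, x))%:E)%E.
Proof.
have mm (A B : mT * pt -> 'M[K]_d) (B' : 'I_d -> 'I_d -> mT * pt -> K) :
    (forall i j, measurable_fun setT (fun p => A p i j)) ->
    (forall i j, measurable_fun setT (B' i j)) -> (forall p i j, B p i j = B' i j p) ->
    measurable_fun setT (fun p => normsq (A p - r p *: B p)).
  move=> mA mB hB; apply: meas_normsq => i j.
  rewrite (_ : (fun p => _) = (fun p => A p i j - r p * B' i j p)); last first.
    by apply/funext => p; rewrite (sub_scale_entry _ _ (hB p i j)).
  by apply: measurable_funB => //; apply: measurable_funM => //; exact: (meas_r T0 ws).
have mB : measurable_fun setT (fun p : mT * pt => normsq (Tvb p - r p *: gradv (wD T) Vb p)).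
  apply: (mm _ _ (DVb T Vb)) => [i j|i j|p i j]; last exact: gradvE.
    by have [] := weak_TN_vb ws i j.
  by have [] := bDVb i j.
have mA : measurable_fun setT (fun p : mT * pt => normsq (Tw p - r p *: gradv (wD T) W p)).
  apply: (mm _ _ (DW T W)) => [i j|i j|p i j]; last exact: gradvE.
    by have [] := weak_TN_w ws i j.
  by have [] := bDW i j.
have mC : measurable_fun setT (fun p : mT * pt => normsq (rw T nu r ru p - r p *: W p)).
  apply: meas_normsq => i j; rewrite (ord1 i).
  rewrite (_ : (fun p => _) = (fun p => a j p - r p * w j p)); last first.
    by apply/funext => p; rewrite (sub_scale_entry _ _ (erefl (W p 0 j))).
  apply: measurable_funB; first exact: (meas_a T0 ws).
  by apply: measurable_funM; [exact: (meas_r T0 ws)|have [] := bW j].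
have mAB := measurable_funD mB mA.
have := combine_integrals P (divr_ge0 nu0 (ler0n _ 2)) mu0 (meas_slice1 s mAB) (meas_slice1 s mC)
  (fun x => addr_ge0 (normsq_ge0 (Tvb (s, x) - r (s, x) *: gradv (wD T) Vb (s, x)))
    (normsq_ge0 (Tw (s, x) - r (s, x) *: gradv (wD T) W (s, x))))
  (fun x => normsq_ge0 (rw T nu r ru (s, x) - r (s, x) *: W (s, x))).
move=> e; apply: (etrans e).
by apply: eq_integral => x _; congr EFin; exact: rdE.
Qed.

Local Notation E := (rel_entropy T lambda mu nu hbar r0 w0 r ru Tw Tvb R0 W0 R W Vb).

Let rel_dissipation_int t : t <= T ->
  (\int[@lebesgue_measure K]_(s in `]0%R, t[) rel_dissipation T mu nu r ru Tw Tvb W Vb s =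
   (prim T (fun s => \int[P]_x (dD (s, x) + dis (s, x))) t)%:E)%E.
Proof.
move=> tT; pose F (s : mT) : \bar K := (\int[P]_x (dD (s, x) + dis (s, x))%:E)%E.
have mF : measurable_fun setT F by exact: (meas_eint1 P mrd).
have F0 s : (0 <= F s)%E by apply: integral_ge0 => x _; rewrite lee_fin; exact: rd0.
have lrd := L1D lD ldis.
have eF : {ae tm, forall s : mT, F s = (\int[P]_x (dD (s, x) + dis (s, x)))%:E}.
  by apply: filterS (L1_slice1 lrd) => s l; rewrite /F (EFinR l).
rewrite (eq_integral F); last by move=> s _; exact: rel_dissipationE.
exact: (integral_before_prim tT mF F0 (L1_int1 lrd) eF).
Qed.

Let rel_dissipation_ge0 t : (0 <=
  \int[@lebesgue_measure K]_(s in `]0%R, t[) rel_dissipation T mu nu r ru Tw Tvb W Vb s)%E.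
Proof.
apply: integral_ge0 => s _; rewrite rel_dissipationE.
by apply: integral_ge0 => x _; rewrite lee_fin; exact: rd0.
Qed.

Local Notation ed t := (energy_density lambda mu nu (slice r t)
  (slice (rw T nu r ru) t) (slice (rvb T nu hbar r) t)).
Local Notation ed0 := (energy_density lambda mu nu r0 (rw0 r0 w0) (rvb0 nu hbar r0)).
Local Notation rel_at t := (rel_energy lambda mu nu (slice r t) (slice (rw T nu r ru) t)
  (slice (rvb T nu hbar r) t) (slice R t) (slice W t) (slice Vb t)).

Let bst_slice_bdd f : bst f -> {ae tm, forall t : mT, essbdd P (slice f t)}.
Proof. exact: bst_bdd. Qed.

Let slice_rel_energy : {ae tm, forall t : mT,
  rel_at t = (\int[P]_x ed t x
    - \sum_i \int[P]_x (r (t, x) * a i (t, x) * w i (t, x))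
    - \sum_i \int[P]_x (r (t, x) * (hn * dr i (t, x)) * v i (t, x))
    + \int[P]_x (r (t, x) ^+ 2 * eta_density lambda mu nu (slice R t) (slice W t) (slice Vb t) x)
    + la * \int[P]_x R (t, x))%:E /\
  ((2^-1 * \int[P]_x dev (t, x))%:E <= rel_at t)%E}.
Proof.
have A1 := energy_slice_fin T0 ws la0 d_gt0 nu0 mu0.
have A2 : {ae tm, forall t : mT, sqint P (slice r t)}.
  have [mr /L1_slice1 l] := r2; apply: filterS l => t l; split => //.
  exact: (meas_slice1 t mr).
have A3 := ae_and (bst_slice_bdd (bstR ss)) (bst_slice_bdd bL).
have A4 := ae_foralli (fun i => ae_and (bst_slice_bdd (bW i)) (bst_slice_bdd (bVb i))).
have A5 := ae_slice1 (R_gt0 ss).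
apply: filterS3 (ae_and A1 A2) (ae_and A3 A4) A5 => t [fin sr] [[bR bl] bwv] R0t.
have [e1 e2] := rel_energyE la0 (meas_slice1 t (meas_r T0 ws))
  (fun i => meas_slice1 t (meas_a T0 ws i)) (fun i => meas_slice1 t (meas_b T0 ws i))
  fin sr (bdd_L1 bR) R0t bl (fun i => (bwv i).1) (fun i => (bwv i).2).
have tr (x : \bar K) A S Sb Sb' C D : Sb = Sb' -> x = (A - S - Sb + C + D)%:E ->
  x = (A - S - Sb' + C + D)%:E by move=> ->.
have tr' (x : \bar K) y y' : y = y' -> ((2^-1 * y)%:E <= x)%E -> ((2^-1 * y')%:E <= x)%E.
  by move=> ->.
split.
  apply: tr e1; apply: eq_bigr => i _; apply: eqR => x.
  by congr (_ * _ * _); exact: bE.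
apply: tr' e2; apply: eqR => x; apply: eq_bigr => i _.
by congr (_ + (_ - _) ^+ 2); exact: bE.
Qed.

Let initial_rel_energy :
  rel_energy lambda mu nu r0 (rw0 r0 w0) (rvb0 nu hbar r0) R0 W0 (Vb0 nu hbar R0) =
  (\int[P]_x ed0 x
    - \sum_i \int[P]_x (r0 x * a0 i x * W0 x 0 i)
    - \sum_i \int[P]_x (r0 x * b0 i x * Vb0 nu hbar R0 x 0 i)
    + \int[P]_x (r0 x ^+ 2 * eta_density lambda mu nu R0 W0 (Vb0 nu hbar R0) x)
    + la * \int[P]_x R0 x)%:E.
Proof.
have [evL R0p _] := initial_R; have [mr [mw mv]] := meas_r0 ws d_gt0.
have [_ _ _ sr] := init_energy ws la0 d_gt0.
by have [] := rel_energyE la0 mr mw mv (weak_energy0 ws) sr (strong_R0_int ss) R0p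
  (evolves_bdd T0 evL bL bLt) (fun i => evolves_bdd T0 (initial_W i) (bW i) (bWt i))
  (fun i => evolves_bdd T0 (initial_Vb i) (bVb i) (bVbt i)).
Qed.

Let etaE (F G : 'I_d -> K) (l : K) :
  2^-1 * (\sum_i F i * F i) + 2^-1 * (\sum_i G i * G i) + - la * l =
  2^-1 * (\sum_i F i ^+ 2) + 2^-1 * (\sum_i G i ^+ 2) - la * l.
Proof. by rewrite mulNr. Qed.

Variable M : K.
Hypotheses (M0 : 0 <= M) (hM : forall i j, {ae ST, forall p : mT * pt, `|DW T W i j p| <= M})
  (hM' : forall i j, {ae ST, forall p : mT * pt, `|DVb T Vb i j p| <= M}).

Let rate_le (t : mT) : prim T (fun s => \int[P]_x (dis (s, x) + rate (s, x))) t <=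
  8 * d%:R * M * (1 + nu / hn) * prim T (fun s => 2^-1 * \int[P]_x dev (s, x)) t.
Proof.
exact (total_rate_le hn_gt0 nu0 (ltW la0) cons_r cons_a cons_b bL bLt bW bWt bVb bVbt bDW bDVb
  dL dW dVb r2 dr2 a2 lTw lTb
  (fun i j k => (bstDDW T0 ss i j k).1) (fun i j k => (bstDDVb T0 ss i j k).1)
  (fun i j k => (bstDDW T0 ss i j k).2) (fun i j k => (bstDDVb T0 ss i j k).2)
  (Wt_E T0 ss hn_gt0) (Vbt_E T0 ss hn_gt0) (Lt_E T0 ss hn_gt0) sdr
  (fun i j => sTN i j (weak_TN_w ws) (fun k p => erefl (a k p)))
  (fun i j => sTN i j (weak_TN_vb ws) bE)
  (fun i j => sTN i j (weak_TN_u ws) qE) t M0 hM hM').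
Qed.

(** At almost every time [E] dominates half the deviation, its other contributions being
    nonnegative. The integral of [E] is bounded below through [integral_ge_ae], which does not ask
    for measurability of [E]. *)
Let deviation_le (t : K) : t <= T ->
  ((prim T (fun s => 2^-1 * \int[P]_x dev (s, x)) t)%:E <=
    \int[@lebesgue_measure K]_(s in `]0%R, t[) E s)%E.
Proof.
move=> tT; pose g (s : mT) := 2^-1 * \int[P]_x dev (s, x).
have lg : L1 tm g by exact: (L1Z 2^-1 (L1_int1 ldev)).
have g0 s : 0 <= g s.
  rewrite mulr_ge0 ?invr_ge0//; apply: Rintegral_ge0 => x _.
  by apply: sumr_ge0 => i _; rewrite addr_ge0 ?sqr_ge0.
have mg := L1_meas lg.
have low : {ae tm, forall s : mT, 0 < s < T -> ((g s)%:E <= E s)%E}.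
  apply: filterS slice_rel_energy => s [_ h] /andP[s0 _].
  rewrite /rel_entropy (gt_eqF s0); apply: (le_trans h).
  by apply: leeDl; exact: rel_dissipation_ge0.
move/ae_time: low => low.
have mge : measurable_fun setT (fun s : mT => (g s)%:E) by exact/measurable_EFinP.
rewrite -(integral_before_prim (F := fun s => (g s)%:E) tT mge _ lg); last 2 first.
- by move=> s; rewrite lee_fin.
- exact: aeW.
apply: integral_ge_ae => //.
have fF := ae_filter_ringOfSetsType (@lebesgue_measure K).
apply: filterS low => s h; rewrite /= in_itv /= => /andP[s0 st].
have h1 : 0 < s < T by rewrite s0 (lt_le_trans st tT).
exact (h h1 h1).
Qed.

Lemma rel_entropy_le : {ae tm, forall t : mT,
  (E t - E 0%R <= (8 * d%:R * M * (1 + nu / hn))%:E *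
    \int[@lebesgue_measure K]_(s in `]0%R, t[) E s)%E}.
Proof.
have [evL _ massR] := initial_R.
have bal := relative_balance T0 cons_r cons_a cons_b evL initial_W initial_Vb bL bLt bW bWt
  bVb bVbt bDW bDVb dL dW dVb.
have en := energy_inequality T0 ws la0 d_gt0 nu0 mu0.
have ti : {ae tm, forall t : mT, 0 < t < T} := @ae_time_itv K T.
apply: filterS3 (ae_and ti slice_rel_energy) (ae_and bal en) massR => t.
move=> [/andP[t0 tT] [rE _]] [balt ent] mt.
have E0 : E 0%R = rel_energy lambda mu nu r0 (rw0 r0 w0) (rvb0 nu hbar r0) R0 W0 (Vb0 nu hbar R0).
  by rewrite /rel_entropy eqxx.
have Et : E t = (rel_at t +
    \int[@lebesgue_measure K]_(s in `]0%R, t[) rel_dissipation T mu nu r ru Tw Tvb W Vb s)%E.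
  by rewrite /rel_entropy (gt_eqF t0).
have C0 : 0 <= 8 * d%:R * M * (1 + nu / hn).
  by rewrite mulr_ge0// ?mulr_ge0// addr_ge0// divr_ge0// ltW.
apply: le_trans (lee_wpmul2l _ (deviation_le (ltW tT))); last by rewrite lee_fin.
rewrite -EFinM; apply: (@le_trans _ _ (prim T (fun s => \int[P]_x (dis (s, x) + rate (s, x))) t)%:E); last first.
  by rewrite lee_fin; exact: rate_le.
rewrite Et E0 rE initial_rel_energy (rel_dissipation_int (ltW tT)) mt.
have fe (x p y z : K) : x + p - y <= z -> (x%:E + p%:E - y%:E <= z%:E)%E.
  by move=> h; change ((x + p - y)%:E <= z%:E)%E; rewrite lee_fin.
apply: fe.
rewrite (prim_intD t lD ldis) (prim_intD t ldis lrate).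
have e1 : \int[P]_x (r (t, x) ^+ 2 * eta_density lambda mu nu (slice R t) (slice W t) (slice Vb t) x)
  = \int[P]_x (r (t, x) ^+ 2 * (2^-1 * (\sum_i w i (t, x) * w i (t, x))
      + 2^-1 * (\sum_i v i (t, x) * v i (t, x)) + - la * L R (t, x))).
  by apply: eqR => x; rewrite etaE.
have e2 : \int[P]_x (r0 x ^+ 2 * eta_density lambda mu nu R0 W0 (Vb0 nu hbar R0) x)
  = \int[P]_x (r0 x ^+ 2 * (2^-1 * (\sum_i W0 x 0 i * W0 x 0 i)
      + 2^-1 * (\sum_i Vb0 nu hbar R0 x 0 i * Vb0 nu hbar R0 x 0 i) + - la * ln (R0 x))).
  by apply: eqR => x; rewrite etaE.
(* Here [m] is la times the mass of R, the same at both times. The weak dissipation [d1] is absorbed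
   by the energy inequality; the remainder [d2] and the tested rate [d3] are left. *)
have fin (x1 x2 x3 x4 y1 y2 y3 y4 m d1 d2 d3 : K) :
    - x2 - x3 + x4 = - y2 - y3 + y4 + d3 -> x1 + d1 <= y1 ->
    x1 - x2 - x3 + x4 + m + (d1 + d2) - (y1 - y2 - y3 + y4 + m) <= d2 + d3 by lra.
by apply: fin ent; rewrite e1 e2; exact: balt.
Qed.

End relative_entropy_inequality.

(** None of the four parameters occurs in this property, so a bound can be selected before they are
    introduced. *)
Definition gradients_bounded (K : realType) d (T : K) (W Vb : K * 'rV[K]_d -> 'rV[K]_d) (M : K) :=
  0 <= M /\ forall i j,
  {ae (time T \x torus d)%E, forall p : measurableTypeR K * 'rV[K]_d, `|DW T W i j p| <= M} /\
  {ae (time T \x torus d)%E, forall p : measurableTypeR K * 'rV[K]_d, `|DVb T Vb i j p| <= M}.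

Lemma exists_gradients_bound (K : realType) d (T lambda mu nu hbar : K) (R0 : 'rV[K]_d -> K)
    (W0 : 'rV[K]_d -> 'rV[K]_d) (R : K * 'rV[K]_d -> K) (W Vb : K * 'rV[K]_d -> 'rV[K]_d) :
  0 < T -> strong_solution T lambda mu nu hbar R0 W0 R W Vb ->
  exists M, gradients_bounded T W Vb M.
Proof.
move=> T0 ss.
have [f hf] := choice (fun ij : 'I_d * 'I_d => (bstDW T0 ss ij.1 ij.2).1.2).
have [g hg] := choice (fun ij : 'I_d * 'I_d => (bstDVb T0 ss ij.1 ij.2).1.2).
exists (\sum_ij (`|f ij| + `|g ij|)); split.
  by apply: sumr_ge0 => ij _; rewrite addr_ge0.
have le i j : `|f (i, j)| <= \sum_ij (`|f ij| + `|g ij|) /\ `|g (i, j)| <= \sum_ij (`|f ij| + `|g ij|).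
  rewrite (bigD1 (i, j))//=; set S := \sum_(_ | _) _.
  have S0 : 0 <= S by apply: sumr_ge0 => ij _; rewrite addr_ge0.
  by split; rewrite -addrA; [rewrite lerDl|rewrite addrCA lerDl]; rewrite addr_ge0.
move=> i j; split.
  by apply: filterS (hf (i, j)) => p h; apply: le_trans h _; apply: le_trans (ler_norm _) (le i j).1.
by apply: filterS (hg (i, j)) => p h; apply: le_trans h _; apply: le_trans (ler_norm _) (le i j).2.
Qed.

Theorem theorem3p7 (K : realType) (d : nat) (T : K)
  (R : K * 'rV[K]_d -> K) (W Vb : K * 'rV[K]_d -> 'rV[K]_d) :
  (1 <= d <= 3)%N -> 0 < T ->
  exists C : K, 0 <= C /\
  forall lambda mu nu hbar : K,
    0 < lambda -> 0 < mu -> 0 < hbar -> 0 < nu < hbar ->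
    0 < lambda' lambda mu nu ->
  forall (R0 : 'rV[K]_d -> K) (W0 : 'rV[K]_d -> 'rV[K]_d),
    strong_solution T lambda mu nu hbar R0 W0 R W Vb ->
  forall (r0 : 'rV[K]_d -> K) (w0 : 'rV[K]_d -> 'rV[K]_d)
    (r : K * 'rV[K]_d -> K) (ru : K * 'rV[K]_d -> 'rV[K]_d)
    (Tu Tw Tvb : K * 'rV[K]_d -> 'M[K]_d),
    weak_solution T lambda mu nu hbar r0 w0 r ru Tu Tw Tvb ->
  let E := rel_entropy T lambda mu nu hbar r0 w0 r ru Tw Tvb R0 W0 R W Vb in
  {ae time T, forall t,
    (E t - E 0%R <= (C * (1 + nu / hbar_nu nu hbar))%:E *
                    \int[lebesgue_measure]_(s in `]0%R, t[) E s)%E}.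
Proof.
(* [M] is chosen from [T], [W] and [Vb] alone, ahead of the parameters and of the hypothesis that
   the solution is strong, which makes [C] independent of lambda, mu, nu and hbar. If no bound
   exists, [xget] returns 0 and the claim is vacuous. *)
move=> /andP[d1 _] T0; pose M := xget 0 [set M | gradients_bounded T W Vb M].
have M0 : 0 <= M by rewrite /M; case: xgetP => [y _ []|].
exists (8 * d%:R * M); split; first by rewrite !mulr_ge0.
move=> lambda mu nu hbar l0 m0 h0 /andP[n0 nh] la0 R0 W0 ss r0 w0 r ru Tu Tw Tvb ws E.
have hn0 : 0 < hbar_nu nu hbar.
  by rewrite sqrtr_gt0 subr_sqr mulr_gt0 ?subr_gt0 ?addr_gt0.
have [_ hM] : gradients_bounded T W Vb M := xgetPex 0 (exists_gradients_bound T0 ss).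
exact (rel_entropy_le T0 hn0 la0 d1 (ltW n0) (ltW m0) ss ws M0
  (fun i j => (hM i j).1) (fun i j => (hM i j).2)).
Qed.
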